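(* Let $p\in[1,\infty)$. There exists an extension operator $E_\varepsilon:W^{2,p}(\Omega_\varepsilon)\to W^{2,p}(\Omega)$ such that for all $u_\varepsilon\in W^{2,p}(\Omega_\varepsilon)$ $$\|E_\varepsilon u_\varepsilon\|_{L^p(\Omega)}\le C\big(\|u_\varepsilon\|_{L^p(\Omega_\varepsilon)}+\varepsilon\|\nabla u_\varepsilon\|_{L^p(\Omega_\varepsilon)}\big),$$ $$\|\nabla E_\varepsilon u_\varepsilon\|_{L^p(\Omega)}\le C\|\nabla u_\varepsilon\|_{L^p(\Omega_\varepsilon)},\qquad \|\nabla^2E_\varepsilon u_\varepsilon\|_{L^p(\Omega)}\le C\|\nabla^2u_\varepsilon\|_{L^p(\Omega_\varepsilon)},$$ for a constant $C>0$ independent of $\varepsilon$. Further, $E_\varepsilon$ also acts as an extension operator $E_\varepsilon:W^{1,s}(\Omega_\varepsilon)\to W^{1,s}(\Omega)$ for $s\in[1,\infty)$ such that for all $v_\varepsilon\in W^{1,s}(\Omega_\varepsilon)$ $$\|E_\varepsilon v_\varepsilon\|_{L^s(\Omega)}\le C\|v_\varepsilon\|_{W^{1,s}(\Omega_\varepsilon)},\qquad \|\nabla E_\varepsilon v_\varepsilon\|_{L^s(\Omega)}\le C\|\nabla v_\varepsilon\|_{L^s(\Omega_\varepsilon)},$$ again with $C>0$ independent of $\varepsilon$.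
   Context: Geometry. Let $n\ge 2$, $a,b\in\mathbb{Z}^n$ with $a_i<b_i$ for all $i$, and let $\Omega=\prod_{i=1}^n(a_i,b_i)\subset\mathbb{R}^n$. The parameter $\varepsilon>0$ runs through a sequence tending to $0$ with $\varepsilon^{-1}\in\mathbb{N}$. Let $Y=(0,1)^n$ and let $Y_s\subset Y$ be a connected subdomain whose opposite faces match: $(\partial Y_s\cap\{x_i=0\})+e_i=\partial Y_s\cap\{x_i=1\}$ for $i=1,\dots,n$. Let $\Gamma=\partial Y_s\setminus\partial Y$, assumed to be a Lipschitz boundary. Put $K_\varepsilon=\{k\in\mathbb{Z}^n:\varepsilon(Y+k)\subset\Omega\}$, $\Omega_\varepsilon=\mathrm{int}\big(\bigcup_{k\in K_\varepsilon}\varepsilon(\overline{Y_s}+k)\big)$ and $\Gamma_\varepsilon=\partial\Omega_\varepsilon\setminus\partial\Omega$. It is assumed that $\Omega_\varepsilon$ is connected and $\Gamma_\varepsilon$ is a Lipschitz boundary; hence $|\partial Y_s\cap\{x_i=0\}|>0$ for all $i$. The set $\Omega\setminus\Omega_\varepsilon$ may be connected or disconnected. An extension operator is a linear operator $E$ with $(Eu)|_{\Omega_\varepsilon}=u$.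
   Formalization: ''Lipschitz boundary'' for Γ and Γ_ε is taken uniformly (one radius and one Lipschitz constant for the whole piece, up to ∂Y resp. ∂Ω); with only a local condition at each point the claim fails, e.g. for a disc touching one face of Y tangentially. *)

(* Defs.v *)
From HB Require Import structures.
From mathcomp Require Import all_boot all_order all_algebra.
From mathcomp Require Import all_classical all_reals all_analysis.

Set Implicit Arguments.
Unset Strict Implicit.
Unset Printing Implicit Defensive.

Import Order.TTheory GRing.Theory Num.Theory.
Import numFieldNormedType.Exports.

Local Open Scope classical_set_scope.
Local Open Scope ring_scope.

Definition measure_rV_display : measure_display.
Proof. exact. Qed.

Section measurable_rV.
Context {R : realType} {n : nat}.

Definition rV_coord (i : 'I_n) (x : 'rV[R]_n) : measurableTypeR R := x 0 i.

Let rV_set0 : g_sigma_preimage rV_coord set0.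
Proof. exact: sigma_algebra0. Qed.

Let rV_setC A : g_sigma_preimage rV_coord A -> g_sigma_preimage rV_coord (~` A).
Proof. exact: sigma_algebraC. Qed.

Let rV_bigcup (F : (set 'rV[R]_n)^nat) :
  (forall i, g_sigma_preimage rV_coord (F i)) ->
  g_sigma_preimage rV_coord (\bigcup_i (F i)).
Proof. exact: sigma_algebra_bigcup. Qed.

HB.instance Definition _ := @isMeasurable.Build measure_rV_display
  'rV[R]_n (g_sigma_preimage rV_coord) rV_set0 rV_setC rV_bigcup.

Lemma measurable_rV_coord (i : 'I_n) : measurable_fun setT (rV_coord i).
Proof.
move=> _ Y mY; rewrite setTI; apply: sub_sigma_algebra => /=.
rewrite -bigcup_seq/=; exists i => /=; first by rewrite mem_index_enum.
by exists Y => //; rewrite setTI.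
Qed.

Lemma measurable_fun_rV d (T : measurableType d) (f : T -> 'rV[R]_n) :
  (forall i, measurable_fun setT (rV_coord i \o f)) ->
  measurable_fun setT f.
Proof.
move=> mf.
suff: g_sigma_preimage (fun i => rV_coord i \o f) `<=` measurable.
  rewrite g_sigma_preimage_comp => fS.
  by move=> _ A mA; apply: fS; exists A.
apply: smallest_sub; first exact: sigma_algebra_measurable.
rewrite -bigcup_seq; apply: bigcup_sub => i _.
by move=> A [B mB <-]; exact: mf.
Qed.

Lemma open_measurable_rV (U : set 'rV[R]_n) : open U -> measurable U.
Proof.
move=> oU.
pose B (qk : 'rV[rat]_n * nat) : set 'rV[R]_n := \big[setI/setT]_(i < n)
  (rV_coord i @^-1` ball (ratr (qk.1 0 i) : R) qk.2.+1%:R^-1).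
have BE qk x :
    B qk x <-> forall i, ball (ratr (qk.1 0 i) : R) qk.2.+1%:R^-1 (x 0 i).
  rewrite /B -bigcap_seq; split => [h i|h i _]; last exact: h.
  by apply: h; rewrite /= mem_index_enum.
have mB qk : measurable (B qk).
  apply: bigsetI_measurable => i _.
  rewrite -[X in measurable X]setTI; apply: measurable_rV_coord => //.
  by rewrite ball_itv; exact: measurable_itv.
have -> : U = \bigcup_(qk in [set qk | B qk `<=` U]) B qk.
  apply/seteqP; split => [x Ux|x [qk /= + ]]; last by apply.
  have /nbhs_ballP[e /= e0 xeU] := open_nbhs_nbhs (conj oU Ux).
  have [k ke] : exists k, k.+1%:R^-1 < e / 2.
    exists (Num.truncn (e / 2)^-1).
    by rewrite invf_plt ?posrE ?divr_gt0// truncnS_gt.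
  have k0 : 0 < k.+1%:R^-1 :> R by rewrite invr_gt0.
  have /choice[q qP] :
      forall i : 'I_n, exists q : rat, ball (x 0 i) k.+1%:R^-1 (ratr q).
    move=> i.
    have [q] : exists q : rat, ratr q \in `]x 0 i, x 0 i + k.+1%:R^-1[.
      by apply: rat_in_itvoo; rewrite ltrDl.
    rewrite in_itv/= => /andP[xq qx]; exists q.
    by rewrite /ball/= distrC gtr0_norm ?subr_gt0// ltrBlDl.
  exists (\row_i q i, k) => /=.
    move=> y /BE /= yq; apply: xeU; split => // i j; rewrite !ord1.
    have := yq j; rewrite mxE => /(ball_triangle (qP j)).
    by apply: le_ball; rewrite [leRHS]splitr lerD// ltW.
  by apply/BE => i /=; rewrite mxE; exact/ball_sym.
rewrite bigcup_mkcond; apply: countable_bigcupT_measurable => // qk.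
by case: ifPn.
Qed.

End measurable_rV.

Section lebesgue_rV_step.
Context {R : realType} {n : nat}.
Local Open Scope ereal_scope.

Definition rV_cons (p : measurableTypeR R * 'rV[R]_n) : 'rV[R]_n.+1 :=
  row_mx (p.1)%:M p.2.

Definition rV_uncons (x : 'rV[R]_n.+1) : measurableTypeR R * 'rV[R]_n :=
  (x 0 0, \row_j x 0 (lift 0 j))%R.

Lemma rV_cons0 p : rV_cons p 0%R 0%R = p.1.
Proof.
rewrite /rV_cons.
have -> : (0%R : 'I_n.+1) = lshift n (ord0 : 'I_1) by apply/val_inj.
by apply: (etrans (row_mxEl _ _ _ _)); rewrite mxE.
Qed.

Lemma rV_consS p (i : 'I_n) : rV_cons p 0%R (lift 0%R i) = p.2 0%R i.
Proof.
rewrite /rV_cons.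
have -> : lift 0%R i = rshift 1 i :> 'I_n.+1 by apply/val_inj.
exact: row_mxEr.
Qed.

Lemma rV_consK : cancel rV_cons rV_uncons.
Proof.
move=> p; rewrite /rV_uncons rV_cons0 [RHS]surjective_pairing; congr pair.
by apply/rowP => i; rewrite mxE rV_consS.
Qed.

Lemma measurable_rV_cons : measurable_fun setT rV_cons.
Proof.
apply: measurable_fun_rV => i; have [j ->|->] := unliftP ord0 i.
  rewrite (_ : _ \o _ = rV_coord j \o snd); last first.
    by apply/funext => p; exact: rV_consS.
  by apply: measurableT_comp => //; exact: measurable_rV_coord.
by rewrite (_ : _ \o _ = fst)//; apply/funext => p; exact: rV_cons0.
Qed.

Lemma measurable_rV_uncons : measurable_fun setT rV_uncons.
Proof.
apply: measurable_fun_pair; first exact: (measurable_rV_coord 0%R).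
apply: measurable_fun_rV => i; rewrite (_ : _ \o _ = rV_coord (lift 0%R i)).
  exact: measurable_rV_coord.
by apply/funext => x; rewrite /rV_coord/= mxE.
Qed.

Variable mu : {sigma_finite_measure set 'rV[R]_n -> \bar R}.

Definition lebesgue_rV_step : set 'rV[R]_n.+1 -> \bar R :=
  pushforward (@lebesgue_measure R \x mu) rV_cons.

Let step0 : lebesgue_rV_step set0 = 0.
Proof. by have mf := measurable_rV_cons; exact: measure0. Qed.

Let step_ge0 A : 0 <= lebesgue_rV_step A.
Proof. by have mf := measurable_rV_cons; exact: measure_ge0. Qed.

Let step_sigma_additive : semi_sigma_additive lebesgue_rV_step.
Proof.
by have mf := measurable_rV_cons; exact: measure_semi_sigma_additive.
Qed.

HB.instance Definition _ := isMeasure.Build _ _ _ lebesgue_rV_step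
  step0 step_ge0 step_sigma_additive.

Let step_sigma_finite : sigma_finite setT lebesgue_rV_step.
Proof.
have /sigma_finiteP[F [TF ndF Foo]] := sigma_finiteT (@lebesgue_measure R).
have /sigma_finiteP[G [TG ndG Goo]] := sigma_finiteT mu.
exists (fun k => rV_uncons @^-1` (F k `*` G k)) => [|k].
  rewrite -preimage_bigcup -(preimage_setT rV_uncons); congr (_ @^-1` _).
  rewrite -setXTT TF TG predeqE => -[x y]; split.
    move=> [/= [i _ Fx] [j _ Gy]]; exists (maxn i j) => //; split.
    - by move: x Fx; exact/subsetPset/ndF/leq_maxl.
    - by move: y Gy; exact/subsetPset/ndG/leq_maxr.
  by move=> [i _ []/= ? ?]; split; exists i.
have [mF Fk] := Foo k; have [mG Gk] := Goo k; split.
  rewrite -[X in measurable X]setTI.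
  by apply: measurable_rV_uncons => //; exact: measurableX.
rewrite /= /lebesgue_rV_step /pushforward -comp_preimage.
have -> : rV_uncons \o rV_cons = id by apply/funext => p; exact: rV_consK.
by rewrite preimage_id product_measure1E// lte_mul_pinfty// ge0_fin_numE.
Qed.

HB.instance Definition _ := Measure_isSigmaFinite.Build _ _ _ lebesgue_rV_step
  step_sigma_finite.

End lebesgue_rV_step.

Section lebesgue_rV.
Context {R : realType}.
Local Open Scope ereal_scope.

Fixpoint lebesgue_rV n : {sigma_finite_measure set 'rV[R]_n -> \bar R} :=
  match n with
  | 0 => \d_(0%R : 'rV[R]_0)
  | m.+1 => lebesgue_rV_step (lebesgue_rV m)
  end.

Lemma lebesgue_rV_box n (A : 'I_n -> set R) :
  (forall i, measurable (A i : set (measurableTypeR R))) ->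
  lebesgue_rV n [set x | forall i, A i (x 0%R i)] =
  \prod_(i < n) (@lebesgue_measure R (A i)).
Proof.
elim: n A => [A mA|n IH A mA].
  rewrite big_ord0 /= /dirac indicE mem_set//=.
  by case.
have mB : measurable
    [set x : 'rV[R]_n | forall i, A (lift ord0 i) (x 0%R i)].
  rewrite (_ : mkset _ = \big[setI/setT]_(i < n)
      (rV_coord i @^-1` A (lift ord0 i))).
    apply: bigsetI_measurable => i _.
    by rewrite -[X in measurable X]setTI; exact: measurable_rV_coord.
  rewrite -bigcap_seq; apply/seteqP.
  split => [x /= h i _|x h i]; first exact: h.
  by apply: h; rewrite /= mem_index_enum.
rewrite big_ord_recl -(IH (fun i => A (lift ord0 i)))//.
rewrite -(product_measure1E (@lebesgue_measure R) (lebesgue_rV n))//.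
rewrite /= /lebesgue_rV_step /pushforward; congr (_ _).
apply/seteqP; split => [[x y] /= h|[x y] /= [h0 hS] i].
  by split => [|i]; [have := h 0%R; rewrite rV_cons0|
    have := h (lift 0%R i); rewrite rV_consS].
by have [j ->|->] := unliftP 0%R i; rewrite ?rV_consS ?rV_cons0.
Qed.

End lebesgue_rV.

(* Functions on D are represented by total functions whose values outside D
   are irrelevant, and elements of L^p(D) or W^{k,p}(D) by representatives of
   classes modulo equality a.e. on D. *)
Section sobolev.
Context {R : realType} {n : nat}.
Local Notation mu := (@lebesgue_rV R n).
Implicit Types (D : set 'rV[R]_n) (u v phi : 'rV[R]_n -> R) (p : R).

Definition partial (i : 'I_n) u : 'rV[R]_n -> R :=
  fun x => 'D_(delta_mx 0 i : 'rV[R]_n) u x.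

(* The list s of differentiation directions plays the role of a multi-index of
   order [size s]. *)
Definition partials (s : seq 'I_n) u := foldr partial u s.

Definition smooth u := forall s,
  continuous (partials s u) /\
  forall i x, derivable (partials s u) x (delta_mx 0 i : 'rV[R]_n).

Definition test_function D phi :=
  let K := closure [set x | phi x != 0] in
  [/\ smooth phi, compact K & K `<=` D].

(* [f \_ D] is the extension of f by point = 0. *)
Definition LpD_norm D p (f : 'rV[R]_n -> R) : \bar R :=
  'N[mu]_(p%:E)[EFin \o (f \_ D)]%E.

Definition LpD D p : set ('rV[R]_n -> R) :=
  [set f | f \_ D \in Lfun mu p%:E].

Definition locally_integrable_on D u := measurable_fun D u /\
  forall K, K `<=` D -> compact K -> mu.-integrable K (EFin \o u).

Definition is_weak_derivative D (s : seq 'I_n) u v :=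
  [/\ locally_integrable_on D u, locally_integrable_on D v &
    forall phi, test_function D phi ->
      \int[mu]_(x in D) (u x * partials s phi x) =
      (-1) ^+ size s * \int[mu]_(x in D) (v x * phi x)].

Definition weak_derivative D s u : 'rV[R]_n -> R :=
  xget (cst 0) [set v | is_weak_derivative D s u v].

Definition sobolev (k : nat) p D : set ('rV[R]_n -> R) :=
  [set u | LpD D p u /\ forall s, (size s <= k)%N ->
    exists2 v, LpD D p v & is_weak_derivative D s u v].

Definition frobenius_norm m q (A : 'M[R]_(m, q)) : R :=
  Num.sqrt (\sum_i \sum_j A i j ^+ 2).

Definition gradient D u (x : 'rV[R]_n) : 'rV[R]_n :=
  \row_i weak_derivative D [:: i] u x.

Definition hessian D u (x : 'rV[R]_n) : 'M[R]_n :=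
  \matrix_(i, j) weak_derivative D [:: i; j] u x.

Definition gradient_norm D p u :=
  LpD_norm D p (fun x => frobenius_norm (gradient D u x)).

Definition hessian_norm D p u :=
  LpD_norm D p (fun x => frobenius_norm (hessian D u x)).

Definition sobolev1_norm D p u : \bar R :=
  ((LpD_norm D p u `^ p + gradient_norm D p u `^ p) `^ p^-1)%E.

(* E is a linear extension operator W(D) -> W(D'), where W is a family of
   function spaces, e.g. W = sobolev k p.  The third clause says that E acts on
   classes modulo a.e. equality. *)
Definition extension_operator (W : set 'rV[R]_n -> set ('rV[R]_n -> R)) D D'
    (E : ('rV[R]_n -> R) -> ('rV[R]_n -> R)) :=
  [/\ forall u, W D u -> W D' (E u),
      forall u, W D u -> E u = u %[ae mu in D],
      forall u v, W D u -> W D v ->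
        u = v %[ae mu in D] -> E u = E v %[ae mu in D'] &
      forall (c : R) u v, W D u -> W D v ->
        E (fun x => c * u x + v x) = (fun x => c * E u x + E v x)
          %[ae mu in D']].

End sobolev.

Section geometry.
Context {R : realType} {n : nat}.
Implicit Types (A D G : set 'rV[R]_n).

Definition boundary A := closure A `\` A°.

Definition domain D := [/\ D !=set0, open D & connected D].

(* The part G of the boundary of D is Lipschitz: near every point of G and in
   suitable orthonormal coordinates, D is the subgraph of a Lipschitz function.
   The radius r and the constant L are uniform over G, which need not be closed:
   here G is of the form [boundary D `\` boundary B], and uniformity controls D
   up to the points where G meets [boundary B]. *)
Definition lipschitz_boundary D G := exists r L : R, 0 < r /\
  forall x, G x -> exists (U : 'M[R]_n) (j : 'I_n) (g : 'rV[R]_n.-1 -> R),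
    [/\ U *m U^T = 1%:M, L.-lipschitz g &
      forall y, ball x r y ->
        (D y <-> (y *m U) 0 j < g (col' j (y *m U)))].

Definition open_box (a b : 'rV[int]_n) : set 'rV[R]_n :=
  [set x | forall i, (a 0 i)%:~R < x 0 i < (b 0 i)%:~R].

Definition unit_cube : set 'rV[R]_n := [set x | forall i, 0 < x 0 i < 1].

Definition matching_faces A := forall i : 'I_n,
  [set x + delta_mx 0 i | x in boundary A `&` [set x | x 0 i = 0]] =
  boundary A `&` [set x | x 0 i = 1].

Definition cell (eps : R) (k : 'rV[int]_n) A : set 'rV[R]_n :=
  [set eps *: (y + \row_i (k 0 i)%:~R) | y in A].

Definition perforated (a b : 'rV[int]_n) A (eps : R) : set 'rV[R]_n :=
  (\bigcup_(k in [set k | cell eps k unit_cube `<=` open_box a b])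
     cell eps k (closure A))°.

End geometry.

(* Main.v *)
(** The extension is of Jones type. At scale [h_k = h_0 / 2 ^ k], with [h_0]
    comparable to [eps], a smooth partition of unity with a grid of nodes is
    multiplied by averaged Taylor polynomials of [u], taken over balls in
    [D = Omega_eps] of radius comparable to [h_k] near the nodes. The resulting
    functions are blended into [v_k] so that the scale [h_k] is used within
    distance comparable to [h_k] of [D]; the extension is [u] on [D] and the
    limit of the [v_k] off [D].

    The kernels of two averages differ by a divergence supported in any chain of
    balls joining theirs. So the derivatives of order [m] of [v_k] at [x] are
    bounded, for [m = 0, 1, 2], by the mean of the order [m] derivatives of [u]
    over the part of [D] within distance comparable to [h_k] of [x], and lie in
    L^p by Jensen and Tonelli. On [D] the [v_k] converge weakly to [u], which
    identifies the weak derivatives of the extension on all of [Omega].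

    The constants depend on [D] only through the balls and the chains, which must
    exist uniformly at all scales [h_k]. A Lipschitz boundary yields a uniform
    cone condition, hence balls and chains at small scales; compactness and
    connectedness yield the chains at the other ones. By periodicity, for small
    [eps] the set [Omega_eps] is, within distance [24 * eps] of any point of
    [Omega], similar to part of one fixed [Omega_{eps_0}]; the remaining
    finitely many [eps] are treated one by one. *)
From HB Require Import structures.
From mathcomp Require Import all_boot all_order all_algebra.
From mathcomp Require Import all_classical all_reals all_analysis.
From mathcomp Require Import measurable_realfun zify ring lra.
Require Import Defs.
Set Implicit Arguments.
Unset Strict Implicit.
Unset Printing Implicit Defensive.
Import Order.TTheory GRing.Theory Num.Theory.
Import numFieldNormedType.Exports.
Local Open Scope classical_set_scope.
Local Open Scope ring_scope.

(** One operator has to serve both orders of smoothness and all exponents. So the local polynomials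
    are affine throughout, and their coefficients are integrals of [u] itself against derivatives of
    a kernel: neither [p] nor a weak derivative of [u] enters the construction. The obstacle is that
    derivatives of order m of the partition of unity bring in h_k ^ -m, whereas the bound may
    contain derivatives of [u] of order exactly m only. Since the weights add up to 1, one reference
    polynomial can be subtracted from all local ones near [x]; integrating the differences by parts
    m times gains h_k ^ m. For m = 2 this rests on the reproduction of affine functions. Summability
    over the levels is geometric: a point of [D] influences the values that the extension takes from
    [v_k] off [D] only if its distance to the complement is comparable to h_k, hence for boundedly
    many k. All estimates are invariant under dilation, so that the constants see ratios of lengths
    and not eps. *)

(** * Smooth step functions *)

Section smooth_step.
Context {R : realType}.
Implicit Types (f g : R -> R) (k j : nat).

(** The derivatives are witnesses rather than iterates of [derive1], so that closure under sums,
    products and affine substitution is an induction on [k]. *)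
Fixpoint smo k f : Prop :=
  if k is j.+1 then exists2 g : R -> R, (forall x : R, is_derive x (1 : R) f (g x)) & smo j g
  else True.

Lemma smoW k f : smo k.+1 f -> smo k f.
Proof.
elim: k f => // k IH f [g fg sg]; exists g => //; exact: IH.
Qed.

Lemma smo_cst k (c : R) : smo k (cst c).
Proof. by elim: k c => // k IH c; exists (cst 0) => // x; exact: is_derive_cst. Qed.

Lemma smoD k f g : smo k f -> smo k g -> smo k (f \+ g).
Proof.
elim: k f g => // k IH f g [f' df sf] [g' dg sg].
by exists (f' \+ g'); [move=> x; exact: is_deriveD|exact: IH].
Qed.

Lemma smoM k f g : smo k f -> smo k g -> smo k (f \* g).
Proof.
elim: k f g => // k IH f g sf sg; have sf0 := smoW sf; have sg0 := smoW sg.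
case: sf sg => [f' df sf] [g' dg sg].
exists ((f \* g') \+ (g \* f')); first by move=> x; exact: is_deriveM.
by apply: smoD; apply: IH.
Qed.

Lemma smo_id k : smo k (id : R -> R).
Proof.
case: k => // k; exists (cst 1); last exact: smo_cst.
by move=> x; exact: is_derive_id.
Qed.

Lemma is_derive_affine (a b x : R) : is_derive x (1 : R) (fun x => a * x + b) a.
Proof.
have h1 := is_deriveM (is_derive_cst a x (1 : R)) (is_derive_id x (1 : R)).
have := is_deriveD h1 (is_derive_cst b x (1 : R)).
by move/is_derive_eq; apply; rewrite /= scaler0 !addr0 /GRing.scale /= mulr1.
Qed.

Lemma smo_affine k f (a b : R) : smo k f -> smo k (fun x => f (a * x + b)).
Proof.
elim: k f => // k IH f [f' df sf].
exists ((cst a) \* (fun x => f' (a * x + b))); last first.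
  by apply: smoM; [exact: smo_cst|exact: IH].
move=> x /=; rewrite mulrC; apply: (@is_derive1_comp _ f (fun x => a * x + b)).
exact: is_derive_affine.
Qed.

Lemma smo_inv k f : (forall x, f x != 0) -> smo k f -> smo k (fun x => (f x)^-1).
Proof.
move=> f0; elim: k => // k IH sf; have /IH si := smoW sf.
case: sf => f' df sf.
exists ((cst (-1)) \* (f' \* ((fun x => (f x)^-1) \* (fun x => (f x)^-1)))); last first.
  by do 3 ?[apply: smoM => //]; exact: smo_cst.
move=> x; have := is_deriveV (f0 x) (df x).
move/is_derive_eq; apply => /=.
by rewrite /GRing.scale /= -expr2 exprVn mulN1r mulNr mulrC.
Qed.

(** For [flat] at 0, where no formula holds on both sides but a quadratic bound does. *)
Lemma is_derive0_quadratic f (a c : R) :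
  (forall x, `|f x - f a| <= c * `|x - a| ^+ 2) -> is_derive a (1 : R) f 0.
Proof.
move=> fc.
have H : h^-1 *: (f (h *: (1:R) + a) - f a) @[h --> 0^'] --> (0 : R).
  apply/cvgr0Pnorm_lt => e e0.
  have c1 : 0 < `|c| + 1 by rewrite ltr_wpDl.
  near=> h.
  have h0 : h != 0 by near: h; exact: nbhs_dnbhs_neq.
  have hn : 0 < `|h| by rewrite normr_gt0.
  rewrite normrM normfV ltr_pdivrMl//.
  have := fc (h *: (1:R) + a); rewrite /GRing.scale /= mulr1 addrK.
  move=> /le_lt_trans; apply.
  rewrite expr2 mulrCA ltr_pM2l//.
  apply: (@le_lt_trans _ _ ((`|c| + 1) * `|h|)).
    by rewrite ler_wpM2r// (le_trans (ler_norm _))// lerDl.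
  rewrite -ltr_pdivlMl//.
  near: h; apply: dnbhs0_lt; by rewrite mulr_gt0 ?invr_gt0.
have cH : cvg (h^-1 *: (f (h *: (1:R) + a) - f a) @[h --> 0^']).
  by apply/cvg_ex; exists 0.
apply: DeriveDef => //; exact/cvg_lim.
Unshelve. all: by end_near.
Qed.

(** The functions t^-j exp(-1/t) are treated as one family because the derivative of each is a
    combination of the next two. *)
Definition flat j (t : R) : R := if 0 < t then t^-1 ^+ j * expR (- t^-1) else 0.

(** The term of order j + 2 in the series of exp(1/t) outweighs t^-j with two powers of t to
    spare. *)
Lemma flat_le j (t : R) : 0 <= t -> flat j t <= (j.+2)`!%:R * t ^+ 2.
Proof.
rewrite le_eqVlt => /orP[/eqP<-|t0].
  by rewrite /flat ltxx expr0n mulr0.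
rewrite /flat t0.
have ti0 : 0 < t^-1 by rewrite invr_gt0.
have h : t^-1 ^+ j.+2 / (j.+2)`!%:R <= expR t^-1.
  by apply: le_trans (expR_ge1Dxn j.+1 (ltW ti0)); rewrite lerDr.
rewrite expRN ler_pdivrMr ?expR_gt0//.
apply: (@le_trans _ _ ((j.+2)`!%:R * t ^+ 2 * (t^-1 ^+ j.+2 / (j.+2)`!%:R))); last first.
  by apply: ler_wpM2l => //; rewrite mulr_ge0 ?exprn_ge0 // ltW.
have f0 : (j.+2)`!%:R != 0 :> R by rewrite pnatr_eq0 -lt0n fact_gt0.
rewrite [leRHS](_ : _ = t^-1 ^+ j) ?lexx// [t^-1 ^+ j.+2]exprS [t^-1 ^+ j.+1]exprS.
by set X := _ ^+ j; field; rewrite f0 gt_eqF.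
Qed.

Lemma flat_ge0 j t : 0 <= flat j t.
Proof.
rewrite /flat; case: ifP => // t0; rewrite mulr_ge0 ?expR_ge0// exprn_ge0//.
by rewrite invr_ge0 ltW.
Qed.

Lemma is_derive_flat j (x : R) :
  is_derive x 1 (flat j) (- j%:R * flat j.+1 x + flat j.+2 x).
Proof.
have [x0|x0|->] := ltgtP x 0.
- rewrite /flat !ltNge (ltW x0) /= mulr0 addr0.
  apply: (@near_eq_is_derive _ _ _ (cst 0 : R -> R)).
  near=> y; rewrite /= ltNge; suff -> : y <= 0 by [].
  by apply/ltW; near: y; exact: lt_nbhsl.
- rewrite /flat x0.
  apply: (@near_eq_is_derive _ _ _ (fun t : R => t^-1 ^+ j * expR (- t^-1))).
    near=> y; suff -> : 0 < y by []; near: y; exact: lt_nbhsr.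
  have dV : is_derive x 1 (fun t : R => t^-1) (- x ^- 2).
    have := @is_deriveV R id x _ _ (lt0r_neq0 x0) (is_derive_id x (1:R)).
    by move/is_derive_eq; apply; rewrite /GRing.scale /= mulr1.
  have dX : is_derive x 1 (fun t : R => t^-1 ^+ j)
      ((j%:R * x^-1 ^+ j.-1) *: - x ^- 2).
    have := @is_deriveX _ _ (fun t : R => t^-1) j x 1 _ dV.
    by rewrite (_ : _ ^+ j = fun t : R => t^-1 ^+ j)// exprfctE.
  have dE : is_derive x 1 (fun t : R => expR (- t^-1)) (expR (- x^-1) * x ^- 2).
    apply: (@is_derive1_comp _ expR (fun t => - t^-1)).
    have := is_deriveN dV; move/is_derive_eq; apply; by rewrite opprK.
  have := is_deriveM dX dE; move/is_derive_eq; apply => /=.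
  rewrite /GRing.scale /=.
  case: (j) => [|i]; first by rewrite !expr0 oppr0 !mul0r exprVn; ring.
  by rewrite [i.+1.-1]/= -!exprVn !exprS -mulr_natl; ring.
- have E : - j%:R * flat j.+1 0 + flat j.+2 0 = 0.
    by rewrite /flat ltxx mulr0 addr0.
  rewrite E; apply: (@is_derive0_quadratic _ _ (j.+2)`!%:R) => {}x.
  rewrite {2}/flat ltxx !subr0 (ger0_norm (flat_ge0 _ _)).
  rewrite -normrX ger0_norm ?sqr_ge0//.
  have [x0|x0] := leP 0 x; first exact: flat_le.
  by rewrite /flat ltNge (ltW x0) mulr_ge0 ?sqr_ge0.
Unshelve. all: by end_near.
Qed.

Lemma smo_flat k j : smo k (flat j).
Proof.
elim: k j => // k IH j.
exists ((cst (- (j%:R : R)) \* flat j.+1) \+ flat j.+2).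
  exact: is_derive_flat.
by apply: smoD => //; apply: smoM => //; exact: smo_cst.
Qed.

Definition step0 (t : R) := flat 0 t / (flat 0 t + flat 0 (-1 * t + 1)).

Lemma flat_gt0 t : 0 < t -> 0 < flat 0 t.
Proof. by move=> t0; rewrite /flat t0 expr0 mul1r expR_gt0. Qed.

Lemma flat_eq0 j t : t <= 0 -> flat j t = 0.
Proof. by move=> t0; rewrite /flat ltNge t0. Qed.

Lemma step0_den t : 0 < flat 0 t + flat 0 (-1 * t + 1).
Proof.
have [t0|t0] := ltP 0 t; first by rewrite ltr_wpDr ?flat_ge0 ?flat_gt0.
by rewrite ltr_wpDl ?flat_ge0 ?flat_gt0//; lra.
Qed.

Lemma smo_step0 k : smo k step0.
Proof.
apply: (@smoM _ (flat 0) (fun t => (flat 0 t + flat 0 (-1 * t + 1))^-1)).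
  exact: smo_flat.
apply: smo_inv => [x|]; first by rewrite gt_eqF ?step0_den.
apply: (@smoD _ (flat 0) (fun t => flat 0 (-1 * t + 1))).
  exact: smo_flat.
by apply: smo_affine; exact: smo_flat.
Qed.

Lemma step0_0 t : t <= 0 -> step0 t = 0.
Proof. by move=> t0; rewrite /step0 flat_eq0 ?mul0r. Qed.

Lemma step0_1 t : 1 <= t -> step0 t = 1.
Proof.
move=> t1; have := step0_den t.
rewrite /step0 (@flat_eq0 0 (-1 * t + 1)) ?addr0; last lra.
by move=> h; rewrite divff ?gt_eqF.
Qed.

(* [ramp] is a smooth version of the positive part; [sigma], its first
   difference, is a step and the derivative [tau] of [sigma] generates a
   partition of unity because it is itself a first difference. *)
Definition ramp (t : R) : R := t * step0 t.

Definition sigma (t : R) : R := ramp (t + 1) - ramp t.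

Definition tau : R -> R := (sigma^`())%classic.

Lemma smo_ramp k : smo k ramp.
Proof. by apply: smoM; [exact: smo_id|exact: smo_step0]. Qed.

Lemma ramp_0 t : t <= 0 -> ramp t = 0.
Proof. by move=> t0; rewrite /ramp step0_0// mulr0. Qed.

Lemma ramp_1 t : 1 <= t -> ramp t = t.
Proof. by move=> t0; rewrite /ramp step0_1// mulr1. Qed.

Lemma sigma_0 t : t <= -1 -> sigma t = 0.
Proof. by move=> t0; rewrite /sigma !ramp_0 ?subrr//; lra. Qed.

Lemma sigma_1 t : 1 <= t -> sigma t = 1.
Proof. by move=> t0; rewrite /sigma !ramp_1 //; lra. Qed.

Lemma derive1_smo k f : smo k.+1 f ->
  smo k (f^`())%classic /\ forall x : R, is_derive x (1:R) f ((f^`())%classic x).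
Proof.
move=> [g df sg]; have -> : (f^`())%classic = g.
  by apply/funext => x; rewrite derive1E; apply: derive_val.
by [].
Qed.

Lemma smo_sigma k : smo k sigma.
Proof.
have -> : sigma = (fun t => ramp (1 * t + 1)) \+ (cst (-1) \* ramp).
  by apply/funext => t; rewrite /sigma /= mul1r mulN1r.
apply: smoD; first by apply: smo_affine; exact: smo_ramp.
by apply: smoM; [exact: smo_cst|exact: smo_ramp].
Qed.

Lemma smo_tau k : smo k tau.
Proof. by have [] := derive1_smo (smo_sigma k.+1). Qed.

Lemma is_derive_sigma (x : R) : is_derive x (1:R) sigma (tau x).
Proof. by have [_] := derive1_smo (smo_sigma 1). Qed.

Lemma is_derive_ramp (x : R) : is_derive x (1:R) ramp ((ramp^`())%classic x).
Proof. by have [_] := derive1_smo (smo_ramp 1). Qed.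

Lemma tauE t : tau t = (ramp^`())%classic (t + 1) - (ramp^`())%classic t.
Proof.
rewrite /tau derive1E; apply: derive_val.
apply: is_deriveB.
have : is_derive t 1 (ramp \o (fun x => x + 1)) ((ramp^`())%classic (t + 1) * 1).
  apply: is_derive1_comp; first exact: is_derive_ramp.
  have := is_deriveD (is_derive_id t (1:R)) (is_derive_cst (1:R) t (1:R)).
  by rewrite addr0.
- by rewrite mulr1.
- exact: is_derive_ramp.
Qed.

Lemma smo_continuous f : smo 1 f -> continuous f.
Proof.
by move=> [g df _] x; apply/differentiable_continuous/derivable1_diffP.
Qed.

(** At [a] itself [f] is known to be constant on one side only; there the derivative vanishes by
    continuity, which is what order 2 provides. *)
Lemma derive1_cst_le f (a c : R) : smo 2 f -> (forall x, x <= a -> f x = c) ->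
  forall x, x <= a -> (f^`())%classic x = 0.
Proof.
move=> sf fc.
have [/smo_continuous cf df] := derive1_smo sf.
have lt x : x < a -> (f^`())%classic x = 0.
  move=> xa; rewrite derive1E (@near_eq_derive _ _ _ f (cst c)) ?derive_cst//.
  by near=> y; apply: fc; apply: ltW; near: y; exact: lt_nbhsl.
move=> x; rewrite le_eqVlt => /orP[/eqP->|]; last exact: lt.
apply/eqP/negP => /negP fa.
have fa0 : 0 < `|(f^`())%classic a| by rewrite normr_gt0.
have /nbhs_ballP[e /= e0 He] : \forall y \near a, 0 < `|(f^`())%classic y|.
  exact: (@cvgr_norm_gt _ _ _ _ _ (f^`())%classic _ (cf a) _ fa0).
have /= := He (a - e / 2); rewrite /ball /= opprB addrC subrK gtr0_norm ?divr_gt0//.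
rewrite ltr_pdivrMr// mulr_natr mulr2n ltrDl e0 => /(_ isT).
by rewrite lt ?normr0 ?ltxx// ltrBlDr ltrDl divr_gt0.
Unshelve. all: by end_near.
Qed.

Lemma smoN k f : smo k f -> smo k (fun x => f (- x)).
Proof.
move=> sf; rewrite (_ : (fun x => _) = (fun x => f (-1 * x + 0))).
  exact: smo_affine.
by apply/funext => x; rewrite mulN1r addr0.
Qed.

Lemma derive1_cst_ge f (a c : R) : smo 2 f -> (forall x, a <= x -> f x = c) ->
  forall x, a <= x -> (f^`())%classic x = 0.
Proof.
move=> sf fc x ax.
have [_ df] := derive1_smo sf.
have := @derive1_cst_le (fun x => f (- x)) (- a) c (smoN sf).
move=> /(_ _ (- x)); rewrite lerN2 ax; move=> h.
have {h} : ((fun x => f (- x))^`())%classic (- x) = 0.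
  by apply: h => // y; rewrite lerNr => ay; exact: fc.
rewrite derive1E => E.
have : is_derive (- x) (1:R) (fun x => f (- x)) ((f^`())%classic (- - x) * -1).
  exact: is_derive1_comp.
by move=> /@derive_val; rewrite E opprK mulrN1 => /esym/eqP; rewrite oppr_eq0 => /eqP.
Qed.

Definition supp1 f := forall t, 1 <= `|t| -> f t = 0.

Lemma supp1_tau : supp1 tau.
Proof.
move=> t; rewrite ler_normr => /orP[t1|t1].
  by apply: (@derive1_cst_ge sigma 1 1) => //; [exact: smo_sigma|exact: sigma_1].
apply: (@derive1_cst_le sigma (-1) 0); [exact: smo_sigma|exact: sigma_0|].
by rewrite lerNr.
Qed.

Lemma supp1_derive1 f : smo 2 f -> supp1 f -> supp1 (f^`())%classic.
Proof.
move=> sf f0 t; rewrite ler_normr => /orP[t1|t1].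
  apply: (@derive1_cst_ge f 1 0) => // x x1.
  by apply: f0; rewrite (le_trans x1)// ler_norm.
apply: (@derive1_cst_le f (-1) 0) => // [x x1|]; last by rewrite lerNr.
by apply: f0; rewrite ler_normr lerNr x1 orbT.
Qed.

Lemma supp1_bounded f : smo 1 f -> supp1 f -> exists2 B, 0 < B & forall x, `|f x| <= B.
Proof.
move=> sf f0; have cf := smo_continuous sf.
have [|c _ H] := @EVT_max R (fun x => `|f x|) (-1) 1 ltac:(lra).
  by apply: continuous_subspaceT => x; apply: cvg_norm; exact: cf.
exists (`|f c| + 1) => [|x]; first by rewrite ltr_wpDl.
have [x1|x1] := ltP `|x| 1; last by rewrite f0// normr0 addr_ge0.
rewrite (le_trans (H x _)) ?lerDl// in_itv /=.
by move: x1; rewrite ltr_norml => /andP[/ltW -> /ltW ->].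
Qed.

Lemma sigma_bounded : exists2 B : R, 0 < B & forall x, `|sigma x| <= B.
Proof.
have [|c _ H] := @EVT_max R (fun x => `|sigma x|) (-1) 1 ltac:(lra).
  apply: continuous_subspaceT => x; apply: cvg_norm.
  by apply: smo_continuous; exact: smo_sigma.
exists (`|sigma c| + 1) => [|x]; first by rewrite ltr_wpDl.
have [x1|x1] := leP x (-1); first by rewrite sigma_0// normr0 addr_ge0.
have [x2|x2] := leP 1 x.
  by rewrite sigma_1// normr1 lerDr.
by rewrite (le_trans (H x _)) ?lerDl// in_itv /= !ltW.
Qed.

(** The sum telescopes to ramp'(t + 1) - ramp'(t - N), and ramp' is 0 up to 0 and 1 from 1 on. *)
Lemma sum_tau (t : R) N : 1 <= t -> t <= N%:R ->
  \sum_(j < N.+1) tau (t - j%:R) = 1.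
Proof.
move=> t1 tN.
have [g gE] : exists g : R -> R, g = (ramp^`())%classic by eexists.
have tE u : tau u = g (u + 1) - g u by rewrite gE; exact: tauE.
have E m : \sum_(j < m) tau (t - j%:R) = g (t + 1) - g (t - m%:R + 1).
  elim: m => [|m IH]; first by rewrite big_ord0 subr0 subrr.
  rewrite big_ord_recr [LHS]/= IH tE.
  have -> : t - m.+1%:R + 1 = t - m%:R by rewrite -natr1 opprD addrA subrK.
  by rewrite addrA subrK.
have g0 : g (t - N.+1%:R + 1) = 0.
  have tn : t - N.+1%:R + 1 <= 0 by rewrite -natr1; lra.
  by rewrite gE; exact: (derive1_cst_le (smo_ramp 2) ramp_0 tn).
have g1 : g (t + 1) = 1.
  rewrite gE derive1E; transitivity ('D_(1 : R) (id : R -> R) (t + 1)); last exact: derive_id.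
  apply: (@near_eq_derive _ _ _ ramp id); near=> y; rewrite ramp_1//; apply: ltW; near: y.
  by apply: lt_nbhsr; lra.
by rewrite E g0 g1 subr0.
Unshelve. all: by end_near.
Qed.

End smooth_step.

(** * Smooth functions of several variables *)

Section ck_functions.
Context {R : realType} {n : nat}.
Local Notation V := 'rV[R]_n.
Implicit Types (u v : V -> R) (k : nat) (i : 'I_n) (x : V).
Local Notation e_ i := (delta_mx 0 i : V).

Lemma is_derive_lineP (W : normedModType R) (u : W -> R) (x v : W) (d : R) : is_derive x v u d <->
  is_derive (0 : R) (1 : R) (fun h : R => u (h *: v + x)) d.
Proof.
have E : (fun h : R => h^-1 *: ((u \o shift x) (h *: v) - u x)) =
    (fun h : R => h^-1 *: (((fun h : R => u (h *: v + x)) \o shift 0)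
      (h *: (1 : R)) - u (0 *: v + x))).
  by apply/funext => h /=; rewrite scale0r add0r addr0 [h *: 1]mulr1.
split => -[]; rewrite /derivable /derive.
- by rewrite E => D1 D2; split.
- by rewrite -E => D1 D2; split.
Qed.

Lemma is_derive_line u (g : V -> R) x (v : V) (t : R) :
  (forall y, is_derive y v u (g y)) ->
  is_derive t (1 : R) (fun h : R => u (h *: v + x)) (g (t *: v + x)).
Proof.
move=> ug; apply/(@is_derive_lineP R^o); have /is_derive_lineP := ug (t *: v + x).
congr (is_derive _ _ _ _); apply/funext => h.
by rewrite [h *: 1]mulr1 scalerDl addrA.
Qed.

(** In several variables the existence of partial derivatives does not give continuity, which is
    therefore demanded at every order. *)
Fixpoint ck k u : Prop := continuous u /\
  if k is j.+1 then exists2 g : 'I_n -> V -> R,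
    (forall i x, is_derive x (e_ i) u (g i x)) & forall i, ck j (g i)
  else True.

Lemma ck_continuous k u : ck k u -> continuous u.
Proof. by case: k => [|k] []. Qed.

Lemma ckW k u : ck k.+1 u -> ck k u.
Proof.
elim: k u => [|k IH] u [cu //= [g ug cg]]; split => //.
by exists g => // i; apply: IH; exact: cg.
Qed.

Lemma partialE i u x d : is_derive x (e_ i) u d -> partial i u x = d.
Proof. by move=> /@derive_val. Qed.

Lemma ck_is_derive k u i x : ck k.+1 u -> is_derive x (e_ i) u (partial i u x).
Proof. by move=> [_ [g ug _]]; rewrite (partialE (ug i x)). Qed.

Lemma ck_partial k u i : ck k.+1 u -> ck k (partial i u).
Proof.
move=> [_ [g ug cg]]; rewrite (_ : partial i u = g i); first exact: cg.
by apply/funext => x; apply: partialE.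
Qed.

Lemma ck_partials k (s : seq 'I_n) u : ck (size s + k) u -> ck k (partials s u).
Proof.
elim: s k u => [|i s IH] k u //= cu; apply: ck_partial; apply: IH.
by rewrite addnS.
Qed.

Lemma ck_cst k (c : R) : ck k (cst c).
Proof.
elim: k c => [|k IH] c /=; (split; first exact: cst_continuous) => //.
by exists (fun _ => cst 0) => // i x; exact: is_derive_cst.
Qed.

Lemma ckD k u v : ck k u -> ck k v -> ck k (u \+ v).
Proof.
elim: k u v => [|k IH] u v /=.
  by move=> [cu _] [cv _]; split => // x; exact: (continuousD (cu x) (cv x)).
move=> [cu [g ug cg]] [cv [h vh ch]]; split.
  by move=> x; exact: (continuousD (cu x) (cv x)).
exists (fun i => g i \+ h i) => i; last exact: IH.
by move=> x; exact: is_deriveD.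
Qed.

Lemma ckM k u v : ck k u -> ck k v -> ck k (u \* v).
Proof.
elim: k u v => [|k IH] u v /=.
  by move=> [cu _] [cv _]; split => // x; exact: (continuousM (cu x) (cv x)).
move=> hu hv; have cu := ckW (hu : ck k.+1 u); have cv := ckW (hv : ck k.+1 v).
case: hu hv => [ku [g ug cg]] [kv [h vh ch]]; split.
  by move=> x; exact: (continuousM (ku x) (kv x)).
exists (fun i => (u \* h i) \+ (v \* g i)) => i.
  by move=> x; exact: is_deriveM.
by apply: ckD; apply: IH.
Qed.

Lemma ckZ k (c : R) u : ck k u -> ck k (fun x => c * u x).
Proof. by move=> cu; apply: (@ckM k (cst c)) => //; exact: ck_cst. Qed.

Lemma ckN k u : ck k u -> ck k (fun x => - u x).
Proof.
move=> cu; rewrite (_ : (fun x => _) = fun x => -1 * u x); first exact: ckZ.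
by apply/funext => x; rewrite mulN1r.
Qed.

Lemma ckB k u v : ck k u -> ck k v -> ck k (fun x => u x - v x).
Proof. by move=> cu cv; apply: (@ckD k u (fun x => - v x)) => //; exact: ckN. Qed.

Lemma ck_sum k (I : Type) (r : seq I) (P : pred I) (F : I -> V -> R) :
  (forall a, P a -> ck k (F a)) -> ck k (fun x => \sum_(a <- r | P a) F a x).
Proof.
move=> cF; elim: r => [|a r IH].
  by under eq_fun do rewrite big_nil; exact: ck_cst.
under eq_fun do rewrite big_cons.
case: (boolP (P a)) => // Pa; apply: (@ckD k (F a)) => //; exact: cF.
Qed.

Lemma ck_prod k (I : Type) (r : seq I) (P : pred I) (F : I -> V -> R) :
  (forall a, P a -> ck k (F a)) -> ck k (fun x => \prod_(a <- r | P a) F a x).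
Proof.
move=> cF; elim: r => [|a r IH].
  by under eq_fun do rewrite big_nil; exact: ck_cst.
under eq_fun do rewrite big_cons.
case: (boolP (P a)) => // Pa; apply: (@ckM k (F a)) => //; exact: cF.
Qed.

Lemma is_derive_coord (f g : R -> R) i j x :
  (forall t, is_derive t (1 : R) f (g t)) ->
  is_derive x (e_ j) (fun y : V => f (y 0 i)) ((i == j)%:R * g (x 0 i)).
Proof.
move=> fg; apply/is_derive_lineP.
have -> : (fun h : R => f ((h *: e_ j + x) 0 i)) =
    (fun h : R => f ((i == j)%:R * h + x 0 i)).
  by apply/funext => h; rewrite !mxE eqxx andTb mulrC.
rewrite mulrC; apply: is_derive1_comp.
  by rewrite mulr0 add0r.
exact: is_derive_affine.
Qed.

Lemma ck_coord k f i : smo k.+1 f -> ck k (fun y : V => f (y 0 i)).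
Proof.
have H g : smo 1 g -> continuous (fun y : V => g (y 0 i)).
  move=> /smo_continuous cg y.
  apply: (@continuous_comp _ _ _ (fun y : V => y 0 i) g); last exact: cg.
  exact: coord_continuous.
elim: k f => [|k IH] f sf; first by split => //; exact: H.
split; first by apply: H; case: sf => g fg _; exists g.
case: sf => g fg sg; exists (fun j y => (i == j)%:R * g (y 0 i)) => j.
  by move=> x; exact: is_derive_coord.
by apply: ckZ; exact: IH.
Qed.

(** Equivalent to [smooth] by the next two lemmas, in a form suited to induction on the order. *)
Definition csm u := forall k, ck k u.

Lemma csm_smooth u : csm u -> smooth u.
Proof.
move=> cu s; have c1 : ck 1 (partials s u) by apply: ck_partials; exact: cu.
split; first exact: ck_continuous c1.
by move=> i x; have [] := ck_is_derive i x c1.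
Qed.

Lemma smooth_csm u : smooth u -> csm u.
Proof.
move=> su k; rewrite -[u]/(partials [::] u).
elim: k (Nil _) => [|k IH] s; first by split => //; have [] := su s.
split; first by have [] := su s.
exists (fun i => partial i (partials s u)) => i; last exact: (IH (i :: s)).
by move=> x; apply: DeriveDef => //; have [_] := su s.
Qed.

Lemma csm_partials s u : csm u -> csm (partials s u).
Proof. by move=> cu k; apply: ck_partials; exact: cu. Qed.

Lemma csm_partial i u : csm u -> csm (partial i u).
Proof. by move=> cu k; apply: ck_partial; exact: cu. Qed.

Lemma csmM u v : csm u -> csm v -> csm (u \* v).
Proof. by move=> cu cv k; exact: ckM. Qed.

Lemma partialD i u v : ck 1 u -> ck 1 v ->
  partial i (u \+ v) = partial i u \+ partial i v.
Proof.
move=> cu cv; apply/funext => x; apply: partialE.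
exact: (is_deriveD (ck_is_derive i x cu) (ck_is_derive i x cv)).
Qed.

Lemma partialM i u v : ck 1 u -> ck 1 v ->
  partial i (u \* v) = (u \* partial i v) \+ (v \* partial i u).
Proof.
move=> cu cv; apply/funext => x; apply: partialE.
exact: (is_deriveM (ck_is_derive i x cu) (ck_is_derive i x cv)).
Qed.

Lemma partial_cst i (c : R) : partial i (cst c : V -> R) = cst 0.
Proof. by apply/funext => x; apply: partialE; exact: is_derive_cst. Qed.

Lemma near_partials s u v x : (\forall y \near x, u y = v y) ->
  \forall y \near x, partials s u y = partials s v y.
Proof.
elim: s => //= i s IH /IH /nbhs_interior; apply: filterS => y H.
exact: near_eq_derive.
Qed.

Lemma near_partials_eq s u v x : (\forall y \near x, u y = v y) ->
  partials s u x = partials s v x.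
Proof. by move=> /(near_partials s)/nbhs_singleton. Qed.

(** All bumps, kernels and vector fields below are tensor products, differentiated one factor at a
    time. *)
Definition prodf (f : 'I_n -> R -> R) (x : V) : R := \prod_i f i (x 0 i).

Definition upd (f : 'I_n -> R -> R) i g : 'I_n -> R -> R :=
  fun j => if j == i then g else f j.

Lemma csm_prodf f : (forall i k, smo k (f i)) -> csm (prodf f).
Proof. by move=> sf k; apply: ck_prod => i _; apply: ck_coord; exact: sf. Qed.

Lemma prodfD1 f i x : prodf f x = f i (x 0 i) * \prod_(j | j != i) f j (x 0 j).
Proof. by rewrite /prodf (bigD1 i). Qed.

Lemma prodf_upd f i g x :
  prodf (upd f i g) x = g (x 0 i) * \prod_(j | j != i) f j (x 0 j).
Proof.
rewrite (prodfD1 _ i) /upd eqxx; congr (_ * _).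
by apply: eq_bigr => j /negbTE ->.
Qed.

Lemma partial_prodf f g i :
  (forall t, is_derive t (1 : R) (f i) (g t)) ->
  partial i (prodf f) = prodf (upd f i g).
Proof.
move=> fg; apply/funext => x; apply: partialE; rewrite prodf_upd.
apply/is_derive_lineP.
have -> : (fun h : R => prodf f (h *: e_ i + x)) =
    (fun h : R => (f i (h + x 0 i)) * \prod_(j | j != i) f j (x 0 j)).
  apply/funext => h; rewrite (prodfD1 _ i) !mxE !eqxx mulr1; congr (_ * _).
  by apply: eq_bigr => j /negbTE ji; rewrite !mxE eqxx ji mulr0 add0r.
set c := \prod_(_ | _) _.
have d1 : is_derive (0 : R) (1 : R) (fun h : R => f i (h + x 0 i)) (g (x 0 i) * 1).
  apply: is_derive1_comp; first by rewrite add0r.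
  by have := is_derive_affine 1 (x 0 i) 0; under eq_fun do rewrite mul1r.
have := is_deriveM d1 (is_derive_cst c (0:R) (1:R)).
move/is_derive_eq; apply.
by rewrite scaler0 add0r /GRing.scale /= mulr1 mulrC.
Qed.

End ck_functions.
Arguments prodf {R n}.
Arguments upd {R n}.
Arguments ck {R n}.
Arguments csm {R n}.

(** * Lebesgue measure on row vectors *)

Section rV_norm.
Context {R : realType} {n : nat}.
Local Notation V := 'rV[R]_n.
Implicit Types (x y z : V) (r : R).

Lemma coord_le_norm x i : `|x 0 i| <= `|x|.
Proof.
have /mapP[j Hj ->] : `|x 0 i| \in [seq `|x p.1 p.2| | p : 'I_1 * 'I_n].
  by apply/mapP; exists (ord0, i) => //=; rewrite mem_enum.
by rewrite [leRHS]/Num.Def.normr /= mx_normrE; apply/bigmax_geP; right => /=; exists j.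
Qed.

Lemma rV_norm_le x r : 0 <= r -> (forall i, `|x 0 i| <= r) -> `|x| <= r.
Proof.
move=> r0 xr; rewrite [leLHS]/Num.Def.normr /= mx_normrE; apply/bigmax_leP; split => //.
by move=> [i j] _ /=; rewrite ord1.
Qed.

Lemma rV_norm_lt x r : 0 < r -> (forall i, `|x 0 i| < r) -> `|x| < r.
Proof.
move=> r0 xr; rewrite [ltLHS]/Num.Def.normr /= mx_normrE; apply/bigmax_ltP; split => //.
by move=> [i j] _ /=; rewrite ord1.
Qed.

Lemma rV_ballE x r : ball x r = [set y : V | `|x - y| < r].
Proof. by rewrite -ball_normE. Qed.

Lemma rV_ballP x r y : ball x r y <-> `|x - y| < r.
Proof. by rewrite rV_ballE. Qed.

(** The norm of row vectors is the sup norm, so that balls are cubes. *)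
Lemma rV_ball_box x r : 0 < r ->
  ball x r = [set y : V | forall i, ball (x 0 i) r (y 0 i)].
Proof.
move=> r0; rewrite rV_ballE; apply/seteqP; split => y /= h => [i|].
  by apply: le_lt_trans h; have := coord_le_norm (x - y) i; rewrite !mxE.
by apply: rV_norm_lt => // i; rewrite !mxE; exact: h.
Qed.

Definition ccube x r : set V := [set y | `|y - x| <= r].

Lemma rV_norm_continuous : continuous (fun x : V => `|x|).
Proof. exact: norm_continuous. Qed.

Lemma dist_continuous x : continuous (fun y : V => `|y - x|).
Proof.
move=> y; apply: (@continuous_comp _ _ _ (fun y : V => y - x) (fun z : V => `|z|)).
  by apply: continuousD; [exact: cvg_id|exact: cst_continuous].
exact: norm_continuous.
Qed.

Lemma closed_ccube x r : closed (ccube x r).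
Proof.
exact: ((continuous_closedP _).1 (@dist_continuous x) _ (@closed_le _ r)).
Qed.

Lemma compact_ccube x r : compact (ccube x r).
Proof.
apply: bounded_closed_compact; last exact: closed_ccube.
exists (`|x| + `|r|); split; first exact: num_real.
move=> M xM y /= yx; apply/ltW; apply: le_lt_trans xM.
rewrite -(subrK x y) addrC (le_trans (ler_normD _ _))// lerD2l.
by rewrite (le_trans yx)// ler_norm.
Qed.

End rV_norm.

Section rV_measure.
Context {R : realType}.
Local Notation V n := 'rV[R]_n.
Local Notation mu n := (@lebesgue_rV R n).

Lemma continuous_measurable_rV n (u : V n -> R) (D : set (V n)) :
  continuous u -> measurable_fun D u.
Proof.
move=> cu; apply: measurable_funTS.
apply: (measurability _ (RGenOInfty.measurableE R)) => // _ [_ [a ->] <-].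
rewrite setTI; apply: open_measurable_rV.
have -> : u @^-1` `]a, +oo[ = u @^-1` [set x | a < x].
  by apply/seteqP; split => x /=; rewrite in_itv /= andbT.
by move/continuousP : cu; apply; exact: open_gt.
Qed.

Lemma lebesgue_shift1 (t : R) (A : set (measurableTypeR R)) : measurable A ->
  lebesgue_measure [set x : R | A (x + t)] = lebesgue_measure A.
Proof.
have mf : measurable_fun setT (fun x : measurableTypeR R => (x + t : measurableTypeR R)).
  by apply: measurable_funD => //; exact: measurable_cst.
move=> mA.
pose nu :=
  [the measure _ _ of pushforward (@lebesgue_measure R) (fun x : measurableTypeR R => (x + t : measurableTypeR R))].
rewrite (@lebesgue_measure_unique R (nu mf) _ A mA)//.
move=> X [[a b] /= _ <-].
rewrite /nu /pushforward /=.
rewrite [X in _ = lebesgue_measure X](_ : _ = `]a - t, b - t]%classic).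
  rewrite !lebesgue_measure_itv /= !lte_fin ltrD2r.
  by case: ifP => // _; rewrite -!EFinB opprB addrA subrK.
by apply/seteqP; split => x /=; rewrite !in_itv/= ltrBlDr lerBrDr.
Qed.

Definition boxes n : set (set (V n)) := [set B | exists2 F : 'I_n -> set R,
  (forall i, measurable (F i : set (measurableTypeR R))) &
  B = [set x : V n | forall i, F i (x 0 i)]].

Lemma measurable_boxes n B : boxes B -> measurable (B : set (V n)).
Proof.
move=> [F mF ->].
rewrite (_ : mkset _ = \big[setI/setT]_(i < n) (rV_coord i @^-1` F i)).
  apply: bigsetI_measurable => i _.
  by rewrite -[X in measurable X]setTI; exact: measurable_rV_coord.
rewrite -bigcap_seq; apply/seteqP.
split => [x /= h i _|x h i]; first exact: h.
by apply: h; rewrite /= mem_index_enum.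
Qed.

Lemma measurable_boxesE n : @measurable _ (V n) = <<s @boxes n >>.
Proof.
apply/seteqP; split; last first.
  by apply: smallest_sub; [exact: sigma_algebra_measurable|exact: measurable_boxes].
apply: smallest_sub; first exact: smallest_sigma_algebra.
rewrite -bigcup_seq => A [i _ [B mB <-]]; rewrite setTI.
apply: sub_sigma_algebra; exists (fun j => if j == i then B else setT).
  by move=> j; case: ifP.
apply/seteqP; split => x /= => [Bx j|/(_ i)]; last by rewrite eqxx.
by case: ifP => // /eqP ->.
Qed.

Lemma setI_closed_boxes n : setI_closed (@boxes n).
Proof.
move=> _ _ [F mF ->] [G mG ->]; exists (fun i => F i `&` G i).
  by move=> i; exact: measurableI.
by apply/seteqP; split => x /= => [[h1 h2] i|h]; split => // i; have [] := h i.
Qed.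

Lemma ball_boxes n (x : V n) r : 0 < r -> boxes (ball x r).
Proof.
move=> r0; exists (fun i => ball (x 0 i) r); last exact: rV_ball_box.
by move=> i; exact: measurable_ball.
Qed.

Lemma lebesgue_rV_ball n (x : V n) r : 0 < r -> mu n (ball x r) = ((2 * r) ^+ n)%:E.
Proof.
move=> r0; rewrite rV_ball_box// (@lebesgue_rV_box _ _ (fun i => ball (x 0 i) r)); last first.
  by move=> i; exact: measurable_ball.
under eq_bigr do rewrite lebesgue_measure_ball ?(ltW r0)//.
rewrite prodEFin; congr EFin.
by rewrite prodr_const card_ord mulr_natl.
Qed.

Lemma bigcup_balls n (x : V n) : \bigcup_k ball x k.+1%:R = setT.
Proof.
apply/seteqP; split => // y _; exists (Num.truncn `|x - y|) => //.
by rewrite rV_ballE /=; exact: truncnS_gt.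
Qed.

Lemma rV_measure_unique n (m1 m2 : {measure set (V n) -> \bar R}) :
  (forall A, boxes A -> m1 A = m2 A) -> (forall k, m1 (ball (0 : V n)%R (k.+1%:R : R)%R) < +oo)%E ->
  forall A, measurable A -> m1 A = m2 A.
Proof.
move=> m12 fm A mA.
apply: (@measure_unique _ R _ (@boxes n) (fun k => ball (0 : V n) k.+1%:R)) => //.
- exact: measurable_boxesE.
- exact: setI_closed_boxes.
- by move=> k; exact: ball_boxes.
- exact: bigcup_balls.
Qed.

Lemma measurable_shift_rV n (t : V n) : measurable_fun setT (fun x : V n => x + t).
Proof.
apply: measurable_fun_rV => i.
rewrite (_ : _ \o _ = fun x : V n => x 0 i + t 0 i).
  by apply: measurable_funD => //; exact: measurable_rV_coord.
by apply/funext => x; rewrite /rV_coord /= mxE.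
Qed.

Lemma lebesgue_rV_shift n (t : V n) A : measurable A ->
  mu n [set x | A (x + t)] = mu n A.
Proof.
move=> mA; have mf := measurable_shift_rV t.
pose nu := [the measure _ _ of pushforward (mu n) (fun x : V n => x + t)].
apply/esym; apply: (@rV_measure_unique n (mu n) (nu mf)) => // [_ [F mF ->]|k]; last first.
  apply: (@le_lt_trans _ _ ((2 * k.+1%:R) ^+ n)%:E); last exact: ltry.
  by rewrite -(lebesgue_rV_ball (0 : V n)).
transitivity (\prod_(i < n) @lebesgue_measure R (F i))%E.
  exact: lebesgue_rV_box.
transitivity (\prod_(i < n) @lebesgue_measure R [set s : R | F i (s + t 0 i)%R])%E.
  by apply: eq_bigr => i _; rewrite lebesgue_shift1.
rewrite -(@lebesgue_rV_box R n (fun i => [set s : R | F i (s + t 0 i)])).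
  rewrite /nu /= /pushforward; congr (_ _).
  by apply/seteqP; split => x /= h i; have := h i; rewrite mxE.
move=> i; rewrite -[X in measurable X]setTI.
have : measurable_fun setT (fun x : measurableTypeR R => (x + t 0 i : measurableTypeR R)).
  by apply: measurable_funD => //; exact: measurable_cst.
exact.
Qed.

Lemma ge0_integral_shift n (t : V n) (f : V n -> \bar R) :
  measurable_fun setT f -> (forall x, 0 <= f x)%E ->
  (\int[mu n]_x f (x + t)%R = \int[mu n]_x f x)%E.
Proof.
move=> mf f0; have mt := measurable_shift_rV t.
rewrite -(@ge0_integral_pushforward _ _ _ _ _ _ mt (mu n) setT)//.
apply: eq_measure_integral => A mA _.
by rewrite /= /pushforward; exact: lebesgue_rV_shift.
Qed.

Lemma integral_shift n (t : V n) (f : V n -> \bar R) :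
  (mu n).-integrable setT f ->
  (\int[mu n]_x f (x + t)%R = \int[mu n]_x f x)%E.
Proof.
move=> /integrableP[mf _].
rewrite integralE [RHS]integralE; congr (_ - _)%E.
  by rewrite -(ge0_integral_shift t (measurable_funepos mf))//; apply: eq_integral => x _; rewrite unlock.
by rewrite -(ge0_integral_shift t (measurable_funeneg mf))//; apply: eq_integral => x _; rewrite unlock.
Qed.

End rV_measure.

(** * Integrability of real-valued functions *)

Section real_integrable.
Context d (T : measurableType d) {R : realType} (mu : {measure set T -> \bar R}).
Variables (D : set T) (mD : measurable D).
Implicit Types f g : T -> R.

Lemma rint_measurable f : mu.-integrable D (EFin \o f) -> measurable_fun D f.
Proof. by move=> /integrableP[/measurable_EFinP]. Qed.

Lemma eq_rint f g : (forall x, D x -> f x = g x) ->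
  mu.-integrable D (EFin \o f) -> mu.-integrable D (EFin \o g).
Proof. by move=> fg; apply: eq_integrable => // x; rewrite inE /= => /fg ->. Qed.

Lemma rintD f g : mu.-integrable D (EFin \o f) -> mu.-integrable D (EFin \o g) ->
  mu.-integrable D (EFin \o (fun x => f x + g x)).
Proof. by move=> If Ig; apply: eq_integrable (integrableD mD If Ig). Qed.

Lemma rintB f g : mu.-integrable D (EFin \o f) -> mu.-integrable D (EFin \o g) ->
  mu.-integrable D (EFin \o (fun x => f x - g x)).
Proof. by move=> If Ig; apply: eq_integrable (integrableB mD If Ig). Qed.

Lemma rintZ (c : R) f : mu.-integrable D (EFin \o f) ->
  mu.-integrable D (EFin \o (fun x => c * f x)).
Proof. by move=> If; apply: eq_integrable (integrableZl mD c If). Qed.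

Lemma rintM f g (B : R) : mu.-integrable D (EFin \o f) -> measurable_fun D g ->
  (forall x, D x -> `|g x| <= B) -> mu.-integrable D (EFin \o (fun x => f x * g x)).
Proof.
move=> If mg gB; have mf := rint_measurable If.
apply: (@le_integrable _ _ _ mu D mD _ (EFin \o (fun x => B * f x))).
- by apply/measurable_EFinP; exact: measurable_funM.
- move=> x Dx /=; rewrite lee_fin !normrM mulrC ler_wpM2r//.
  by rewrite (le_trans (gB x Dx))// ler_norm.
- exact: rintZ.
Qed.

Lemma rint_norm f : mu.-integrable D (EFin \o f) ->
  mu.-integrable D (EFin \o (fun x => `|f x|)).
Proof. by move=> If; apply: eq_integrable (integrable_abse If). Qed.

Lemma rint_le f g : measurable_fun D f -> (forall x, D x -> `|f x| <= g x) ->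
  mu.-integrable D (EFin \o g) -> mu.-integrable D (EFin \o f).
Proof.
move=> mf fg Ig; apply: (le_integrable mD _ _ Ig).
  exact/measurable_EFinP.
by move=> x Dx /=; rewrite lee_fin (le_trans (fg x Dx))// ler_norm.
Qed.

Lemma rint_sum (I : Type) (r : seq I) (P : pred I) (F : I -> T -> R) :
  (forall i, P i -> mu.-integrable D (EFin \o F i)) ->
  mu.-integrable D (EFin \o (fun x => \sum_(i <- r | P i) F i x)).
Proof.
move=> IF; elim: r => [|a r IH].
  by apply: (@eq_rint (cst 0)) => [x _|]; [rewrite big_nil|exact: integrable0].
case: (boolP (P a)) => Pa.
  apply: (@eq_rint (fun x => F a x + \sum_(i <- r | P i) F i x)).
    by move=> x _; rewrite big_cons Pa.
  by apply: rintD => //; exact: IF.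
by apply: eq_rint IH => x _; rewrite big_cons (negbTE Pa).
Qed.

Lemma Rintegral_sum (I : Type) (r : seq I) (P : pred I) (F : I -> T -> R) :
  (forall i, P i -> mu.-integrable D (EFin \o F i)) ->
  \int[mu]_(x in D) (\sum_(i <- r | P i) F i x) =
  \sum_(i <- r | P i) \int[mu]_(x in D) F i x.
Proof.
move=> IF; elim: r => [|a r IH].
  rewrite big_nil (@eq_Rintegral _ _ _ _ _ (cst 0)); last by move=> x _; rewrite big_nil.
  by rewrite Rintegral_cst// mul0r.
rewrite big_cons -IH; case: (boolP (P a)) => Pa.
  rewrite -RintegralD//; [|exact: IF|exact: rint_sum].
  by apply: eq_Rintegral => x _; rewrite big_cons Pa.
by apply: eq_Rintegral => x _; rewrite big_cons (negbTE Pa).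
Qed.

End real_integrable.

(** * Integration by parts *)

Section integration_by_parts.
Context {R : realType} {n : nat}.
Local Notation V := 'rV[R]_n.
Local Notation mu := (@lebesgue_rV R n).
Local Notation e_ i := (delta_mx 0 i : V).
Implicit Types (u v phi : V -> R) (x y : V) (D : set V).

Lemma measurable_ccube x r : measurable (ccube x r : set V).
Proof.
rewrite -[ccube x r]setCK; apply: measurableC; apply: open_measurable_rV.
by apply: closed_openC; exact: closed_ccube.
Qed.

Lemma lebesgue_ccube_lty x r : (mu (ccube x r) < +oo)%E.
Proof.
have r1 : 0 < `|r| + 1 by rewrite ltr_wpDl.
apply: (@le_lt_trans _ _ (mu (ball x (`|r| + 1)))); last first.
  by rewrite lebesgue_rV_ball// ltry.
apply: le_measure; rewrite ?inE.
- exact: measurable_ccube.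
- by apply: measurable_boxes; exact: ball_boxes.
- move=> y /= yx; apply/rV_ballP; rewrite distrC (le_lt_trans yx)//.
  by rewrite (le_lt_trans (ler_norm _))// ltrDl.
Qed.

Lemma bounded_on_ccube u x r : continuous u ->
  exists2 B, 0 < B & forall y, ccube x r y -> `|u y| <= B.
Proof.
move=> cu.
have cc : compact (u @` ccube x r).
  apply: continuous_compact; last exact: compact_ccube.
  exact: continuous_subspaceT.
have [M [_ HM]] := compact_bounded cc.
exists (`|M| + 1); first by rewrite ltr_wpDl.
move=> y yc; apply: (HM (`|M| + 1)); last by exists y.
by rewrite (le_lt_trans (ler_norm _))// ltrDl.
Qed.

Lemma integrable_bsupp u (r : R) : continuous u ->
  (forall x, r < `|x| -> u x = 0) -> mu.-integrable setT (EFin \o u).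
Proof.
move=> cu ur.
have [B B0 HB] := bounded_on_ccube 0 r cu.
have -> : EFin \o u = (EFin \o u) \_ (ccube 0 r).
  apply/funext => x /=; rewrite patchE; case: ifPn => // /negP; rewrite inE /ccube /= subr0.
  by move/negP; rewrite -ltNge => /ur ->.
rewrite -integrable_mkcond; last exact: measurable_ccube.
apply: measurable_bounded_integrable.
- exact: measurable_ccube.
- exact: lebesgue_ccube_lty.
- exact: continuous_measurable_rV.
- exists B; split; first exact: num_real.
  by move=> M BM y yc /=; rewrite (le_trans (HB _ yc))// ltW.
Qed.

Lemma contM u v : continuous u -> continuous v -> continuous (fun x => u x * v x).
Proof. by move=> cu cv; apply: (@ck_continuous _ _ 0); apply: (@ckM _ _ 0 u v). Qed.

Lemma line_norm (i : 'I_n) (t : R) : `|t *: e_ i| <= `|t|.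
Proof.
apply: rV_norm_le => // j; rewrite !mxE eqxx /= normrM.
by case: (j == i); rewrite /= ?normr1 ?normr0 ?mulr1 ?mulr0.
Qed.

Lemma line_MVT u i x (t : R) : ck 1 u -> 0 < t ->
  exists2 y, `|y - x| <= t & u (t *: e_ i + x) - u x = t * partial i u y.
Proof.
move=> cu t0.
have du (s : R) : is_derive s (1:R) (fun h : R => u (h *: e_ i + x))
    (partial i u (s *: e_ i + x)).
  by apply: is_derive_line => y; exact: (ck_is_derive i y cu).
have cf : continuous (fun h : R => u (h *: e_ i + x)).
  by move=> s; apply/differentiable_continuous/derivable1_diffP; have [] := du s.
have [c] := @MVT R _ _ 0 t t0 (fun s _ => du s) (continuous_subspaceT cf).
rewrite in_itv /= => /andP[c0 ct] E.
exists (c *: e_ i + x).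
  rewrite addrK (le_trans (line_norm _ _))// ger0_norm; exact: ltW.
by move: E; rewrite scale0r add0r subr0 mulrC.
Qed.

Lemma partial_bsupp u (r : R) i : (forall x, r < `|x| -> u x = 0) ->
  forall x, r < `|x| -> partial i u x = 0.
Proof.
move=> ur x rx.
transitivity (partial i (cst 0 : V -> R) x); last by rewrite partial_cst.
apply: (@near_partials_eq _ _ [:: i] u (cst 0)).
near=> y; apply: ur; near: y.
exact: (@cvgr_gt _ _ _ _ (fun z : V => `|z|) _ (@rV_norm_continuous R n x) r rx).
Unshelve. all: by end_near.
Qed.

(** The difference quotients have integral 0 by translation invariance. They converge to the partial
    derivative and are dominated by the mean value theorem; steps of length at most 1 keep their
    supports in the cube of radius r + 1. *)
Lemma integral_partial_eq0 u (r : R) i : ck 1 u ->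
  (forall x, r < `|x| -> u x = 0) -> \int[mu]_x partial i u x = 0.
Proof.
move=> cu ur; have cpu := ck_continuous (ck_partial i cu).
have pur := partial_bsupp i ur.
pose t (k : nat) : R := k.+1%:R^-1.
have t0 k : 0 < t k by rewrite invr_gt0.
have t1 k : t k <= 1 by rewrite invf_le1 ?ler1n.
pose f k x := (t k)^-1 * (u (x + t k *: e_ i) - u x).
have cus k : continuous (fun x => u (x + t k *: e_ i)).
  move=> x; apply: (@continuous_comp _ _ _ (fun x : V => x + t k *: e_ i) u).
    by apply: continuousD; [exact: cvg_id|exact: cst_continuous].
  exact: (ck_continuous cu).
have cf k : continuous (f k).
  apply: (@ck_continuous _ _ 0); apply: ckZ; apply: (@ckB _ _ 0 _ u).
    by split => //; exact: cus.
  by split => //; exact: (ck_continuous cu).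
have iu : mu.-integrable setT (EFin \o u).
  by apply: (@integrable_bsupp _ r) => //; exact: ck_continuous cu.
have usr k x : r + 1 < `|x| -> u (x + t k *: e_ i) = 0.
  move=> rx; apply: ur; have := lerB_normD x (t k *: e_ i).
  have := line_norm i (t k); rewrite (ger0_norm (ltW (t0 k))) => h1 h2.
  by have := t1 k; lra.
have ius k : mu.-integrable setT (EFin \o (fun x => u (x + t k *: e_ i))).
  by apply: (@integrable_bsupp _ (r + 1)); [exact: cus|exact: usr].
have If k : \int[mu]_x f k x = 0.
  rewrite RintegralZl//; last first.
    exact: rintB.
  rewrite RintegralB// [X in X - _](_ : _ = \int[mu]_x u x) ?subrr ?mulr0//.
  by rewrite /Rintegral -(integral_shift (t k *: e_ i) iu).
have [B B0 HB] := bounded_on_ccube 0 (r + 1) cpu.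
have HB' y : `|partial i u y| <= B.
  have [yr|yr] := leP `|y| (r + 1); first by apply: HB; rewrite /ccube /= subr0.
  by rewrite pur ?normr0 ?(ltW B0)//; lra.
have [] := @dominated_convergence _ _ _ mu setT measurableT
    (fun k => EFin \o f k) (EFin \o partial i u) (EFin \o (cst B \_ (ccube 0 (r + 1)))).
- by move=> k; apply/measurable_EFinP; exact: continuous_measurable_rV.
- by apply/measurable_EFinP; exact: continuous_measurable_rV.
- apply: aeW => x _; apply: cvg_EFin; first by apply: nearW.
  have [] := ck_is_derive i x cu; rewrite /derivable => cvx Ex.
  pose q (h : R) := h^-1 *: ((u \o shift x) (h *: e_ i) - u x).
  have cq : q h @[h --> (0:R)^'] --> (partial i u x : R) by rewrite -Ex; exact: cvx.
  have h : t k @[k --> \oo] --> (0 : R)^'.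
    move=> A [d /= d0 HA]; have := @cvg_harmonic R => /cvgr0Pnorm_lt.
    move=> /(_ d d0) [N _ HN]; exists N => // k /= Nk; apply: HA; last by rewrite gt_eqF.
    by rewrite /= sub0r normrN; exact: HN.
  have := cvg_comp t q h cq; apply: cvg_trans; apply: near_eq_cvg; near=> k.
  by rewrite /= /f /q /= [x + _]addrC.
- have -> : EFin \o cst B \_ (ccube 0 (r + 1)) = (EFin \o cst B) \_ (ccube (0:V) (r + 1)).
    by apply/funext => x; rewrite /= !patchE; case: ifP.
  rewrite -integrable_mkcond; last exact: measurable_ccube.
  apply: measurable_bounded_integrable.
  + exact: measurable_ccube.
  + exact: lebesgue_ccube_lty.
  + exact: measurable_cst.
  + exists B; split; first exact: num_real.
    by move=> M BM y yc /=; rewrite ger0_norm ltW.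
- apply: aeW => x k _ /=; rewrite lee_fin patchE; case: ifPn => [_|].
    have [y _ E] := line_MVT i x cu (t0 k).
    by rewrite /f [x + _]addrC E mulKf ?gt_eqF.
  move=> /negP; rewrite inE /ccube /= subr0 => /negP; rewrite -ltNge => rx.
  by rewrite /f usr// ur ?subrr ?mulr0 ?normr0//; lra.
move=> ip _ /= cvI.
rewrite /Rintegral; have -> : (\int[mu]_x (partial i u x)%:E = 0)%E; last by [].
have : (\int[mu]_x (f k x)%:E)%E @[k --> \oo] --> (0 : \bar R)%E.
  rewrite (_ : (fun k => _) = cst 0%E); first exact: cvg_cst.
  apply/funext => k; transitivity (\int[mu]_x f k x)%:E; last by rewrite If.
  rewrite /Rintegral fineK//; apply: integrable_fin_num => //; apply: (@integrable_bsupp _ (r + 1)) => // x rx.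
  by rewrite /f usr// ur ?subrr ?mulr0//; lra.
by move/(cvg_unique _ cvI); apply.
Unshelve. all: by end_near.
Qed.

Lemma ibp u phi (r : R) i : ck 1 u -> ck 1 phi ->
  (forall x, r < `|x| -> phi x = 0) ->
  \int[mu]_x (u x * partial i phi x) = - \int[mu]_x (partial i u x * phi x).
Proof.
move=> cu cphi pr.
have H := @integral_partial_eq0 (u \* phi) r i (ckM cu cphi).
have cpu := ck_continuous (ck_partial i cu).
have cpp := ck_continuous (ck_partial i cphi).
have ppr := partial_bsupp i pr.
have I1 : mu.-integrable setT (EFin \o (fun x => u x * partial i phi x)).
  apply: (@integrable_bsupp _ r) => [|x rx]; last by rewrite ppr// mulr0.
  exact: (contM (ck_continuous cu) cpp).
have I2 : mu.-integrable setT (EFin \o (fun x => partial i u x * phi x)).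
  apply: (@integrable_bsupp _ r) => [|x rx]; last by rewrite pr// mulr0.
  exact: (contM cpu (ck_continuous cphi)).
apply/eqP; rewrite -subr_eq0 opprK -RintegralD//; apply/eqP.
rewrite -[RHS]H => [|x rx]; last by rewrite /= pr// mulr0.
by apply: eq_Rintegral => x _; rewrite partialM//= [phi x * _]mulrC.
Qed.

End integration_by_parts.

(** * Smooth approximation of half-open boxes *)

Section half_open_boxes.
Context {R : realType} {n : nat}.
Local Notation V := 'rV[R]_n.
Local Notation mu := (@lebesgue_rV R n).
Implicit Types (a b x z : V).

(** Half-open boxes are stable under intersection, generate the sigma-algebra, and their indicators
    are limits of the smooth [hbump] at every point: all that the fundamental lemma asks of them. *)
Definition hbox a b : set V := [set x | forall i, a 0 i < x 0 i <= b 0 i].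

Definition hboxes : set (set V) := [set A | exists a b, A = hbox a b].

Lemma setI_closed_hboxes : setI_closed hboxes.
Proof.
move=> _ _ [a [b ->]] [c [d ->]].
exists (\row_i Num.max (a 0 i) (c 0 i)), (\row_i Num.min (b 0 i) (d 0 i)).
apply/seteqP; split => x /= => [[h1 h2] i|h]; last split => i.
- by rewrite !mxE gt_max le_min; move: (h1 i) (h2 i) => /andP[-> ->] /andP[-> ->].
- by have := h i; rewrite !mxE gt_max le_min => /andP[/andP[-> _] /andP[-> _]].
- by have := h i; rewrite !mxE gt_max le_min => /andP[/andP[_ ->] /andP[_ ->]].
Qed.

Lemma hbox_boxes a b : boxes (hbox a b).
Proof.
exists (fun i => `]a 0 i, b 0 i]%classic) => [i|]; first exact: measurable_itv.
by apply/seteqP; split => x /= h i; have := h i; rewrite in_itv.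
Qed.

Lemma measurable_hbox a b : measurable (hbox a b : set V).
Proof. by apply: measurable_boxes; exact: hbox_boxes. Qed.

Lemma measurable_hboxesE : @measurable _ V = <<s hboxes >>.
Proof.
apply/seteqP; split; last first.
  apply: smallest_sub; first exact: sigma_algebra_measurable.
  by move=> _ [a [b ->]]; exact: measurable_hbox.
apply: smallest_sub; first exact: smallest_sigma_algebra.
rewrite -bigcup_seq => A [i _ [B mB <-]]; rewrite setTI.
have [S0 SC SU] := @smallest_sigma_algebra V setT hboxes.
suff : @measurable _ (measurableTypeR R) `<=`
    [set B | <<s hboxes >> (@rV_coord R n i @^-1` B)] by apply.
apply: smallest_sub.
  split => /= [|C HC|F HF].
  - by rewrite preimage_set0.
  - exact: (SC _ HC).
  - by rewrite preimage_bigcup; exact: SU.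
move=> _ [[c d] /= _ <-].
have -> : @rV_coord R n i @^-1` `]c, d]%classic =
    \bigcup_k hbox (\row_j if j == i then c else - k%:R)
                   (\row_j if j == i then d else k%:R).
  apply/seteqP; split => [x /=|x [k _ /= /(_ i)]].
    rewrite in_itv /= => xcd; have [k Hk] : exists k : nat, `|x| < k%:R.
      by exists (Num.truncn `|x|).+1; exact: truncnS_gt.
    exists k => // j; rewrite !mxE; case: eqP => [->//|_].
    have := le_lt_trans (coord_le_norm x j) Hk; rewrite ltr_norml => /andP[-> /ltW ->].
    by [].
  by rewrite !mxE eqxx in_itv.
by apply: SU => k; apply: sub_sigma_algebra; eexists; eexists.
Qed.

(** The shift by 1 puts the two transitions into [a, a + 2/k] and [b, b + 2/k], to the right of the
    endpoints, so that the limit is the indicator of []a, b]] at the endpoints too. *)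
Definition bump1 (a b : R) (k : nat) (t : R) : R :=
  sigma (k%:R * t + (- k%:R * a - 1)) - sigma (k%:R * t + (- k%:R * b - 1)).

Definition hbump a b k : V -> R := prodf (fun i => bump1 (a 0 i) (b 0 i) k).

Lemma csm_hbump a b k : csm (hbump a b k).
Proof.
apply: csm_prodf => i j.
have -> : bump1 (a 0 i) (b 0 i) k =
    (fun t => sigma (k%:R * t + (- k%:R * a 0 i - 1))) \+
    ((cst (-1)) \* (fun t => sigma (k%:R * t + (- k%:R * b 0 i - 1)))).
  by apply/funext => t; rewrite /bump1 /= mulN1r.
apply: smoD; first by apply: (@smo_affine _ j sigma); exact: smo_sigma.
by apply: smoM; [exact: smo_cst|apply: (@smo_affine _ j sigma); exact: smo_sigma].
Qed.

Lemma bump1_out (a b t : R) k : a <= b -> (0 < k)%N ->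
  t <= a \/ b + 2 / k%:R <= t -> bump1 a b k t = 0.
Proof.
move=> ab k0; have kp : (0 : R) < k%:R by rewrite ltr0n.
have E c : k%:R * t + (- k%:R * c - 1) = k%:R * (t - c) - 1 by ring.
move=> [ta|bt]; rewrite /bump1 !E.
  rewrite !sigma_0 ?subrr//.
    have : k%:R * (t - b) <= 0 by rewrite mulr_ge0_le0 ?(ltW kp) ?subr_le0 ?(le_trans ta).
    by lra.
  have : k%:R * (t - a) <= 0 by rewrite mulr_ge0_le0 ?(ltW kp) ?subr_le0.
  by lra.
have h : 2 <= k%:R * (t - b) by rewrite mulrC -ler_pdivrMr//; lra.
rewrite !sigma_1 ?subrr//; first by lra.
have : k%:R * (t - b) <= k%:R * (t - a) by rewrite ler_wpM2l ?(ltW kp)//; lra.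
by lra.
Qed.

Lemma bump1_cvg (a b t : R) : a <= b ->
  \forall k \near \oo, bump1 a b k t = (a < t <= b)%R%:R.
Proof.
move=> ab.
have E k c : (k : R) * t + (- k * c - 1) = k * (t - c) - 1 by ring.
have S c : \forall k \near \oo, sigma (k%:R * (t - c) - 1) = (c < t)%R%:R :> R.
  have [tc|ct] := leP t c.
    near=> k; apply: sigma_0; rewrite lerBlDr addNr.
    by rewrite mulr_ge0_le0 ?subr_le0.
  near=> k; apply: sigma_1; rewrite lerBrDr -ler_pdivrMr ?subr_gt0//.
  by near: k; exact: nbhs_infty_ger.
near=> k; rewrite /bump1 !E.
have -> : sigma (k%:R * (t - a) - 1) = (a < t)%R%:R by near: k; exact: S.
have -> : sigma (k%:R * (t - b) - 1) = (b < t)%R%:R by near: k; exact: S.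
have [bt|tb] := ltP b t; last by rewrite subr0 andbT.
by rewrite (le_lt_trans ab bt) subrr.
Unshelve. all: by end_near.
Qed.

Lemma bump1_bounded : exists2 B : R, 0 < B & forall (a b : R) k t, `|bump1 a b k t| <= B.
Proof.
have [B B0 HB] := @sigma_bounded R.
exists (B + B) => [|a b k t]; first exact: addr_gt0.
by rewrite (le_trans (ler_normB _ _))// lerD.
Qed.

Lemma hbump_out a b k x : (forall i, a 0 i <= b 0 i) -> (0 < k)%N ->
  hbump a b k x != 0 -> forall i, a 0 i < x 0 i < b 0 i + 2 / k%:R.
Proof.
move=> ab k0 h i; apply: contraNT h; rewrite negb_and -!leNgt => h.
rewrite /hbump (prodfD1 _ i) bump1_out ?mul0r//.
by case/orP: h; [left|right].
Qed.

Lemma hbump_cvg a b x : (forall i, a 0 i <= b 0 i) ->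
  \forall k \near \oo, hbump a b k x = \1_(hbox a b) x.
Proof.
move=> ab.
have [xab|/existsNP[i xab]] := pselect (hbox a b x).
  rewrite indicE mem_set//.
  have : \forall k \near \oo, forall i, bump1 (a 0 i) (b 0 i) k (x 0 i) = 1.
    apply: filter_forall => i.
    by have := bump1_cvg (x 0 i) (ab i); rewrite (xab i).
  apply: filterS => k h; rewrite /hbump /prodf big1//.
rewrite indicE memNset; last by move/(_ i).
have := bump1_cvg (x 0 i) (ab i); move/negP/negbTE : xab => ->.
by apply: filterS => k h; rewrite /hbump (prodfD1 _ i) h mul0r.
Qed.

Lemma hbump_bounded : exists2 B : R, 0 < B & forall a b k x, `|hbump a b k x| <= B.
Proof.
have [B B0 HB] := bump1_bounded.
exists (B ^+ n) => [|a b k x]; first exact: exprn_gt0.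
rewrite /hbump /prodf normr_prod.
rewrite -[X in _ <= _ ^+ X](card_ord n) -prodr_const; apply: ler_prod => i _.
by rewrite normr_ge0 HB.
Qed.

End half_open_boxes.

(** * Test functions and weak derivatives *)

Section fundamental_lemma.
Context {R : realType} {n : nat}.
Local Notation V := 'rV[R]_n.
Local Notation mu := (@lebesgue_rV R n).
Implicit Types (D K : set V) (u v w phi : V -> R) (x z : V) (s : seq 'I_n).

Lemma test_functionI D K phi : csm phi -> compact K -> K `<=` D ->
  (forall x, phi x != 0 -> K x) -> test_function D phi.
Proof.
move=> cphi cK KD phiK; have clK : closed K.
  by apply: compact_closed => //; exact: norm_hausdorff.
have sK : closure [set x | phi x != 0] `<=` K.
  by rewrite [X in _ `<=` X](closure_id K).1//; apply: closure_subset => x; exact: phiK.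
split; first exact: csm_smooth.
  by apply: (subclosed_compact _ cK sK); exact: closed_closure.
exact: subset_trans sK KD.
Qed.

Lemma test_function_csm D phi : test_function D phi -> csm phi.
Proof. by case=> sphi _ _; exact: smooth_csm. Qed.

Lemma partials_out phi s x : ~ closure [set x | phi x != 0] x -> partials s phi x = 0.
Proof.
move=> nx; have : \forall y \near x, phi y = (cst 0 : V -> R) y.
  have /open_nbhs_nbhs : open_nbhs x (~` closure [set x | phi x != 0]).
    by split => //; apply: closed_openC; exact: closed_closure.
  apply: filterS => y ny; apply/eqP/negPn/negP => h; apply: ny.
  exact: subset_closure.
move=> /(near_partials_eq s) ->.
elim: s x {nx} => [//|i s IH] x /=.
have -> : partials s (cst 0 : V -> R) = cst 0 by apply/funext => y; exact: IH.
by rewrite partial_cst.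
Qed.

Lemma test_function_out D phi s x : test_function D phi -> ~ D x -> partials s phi x = 0.
Proof. by case=> _ _ KD Dx; apply: partials_out => /KD. Qed.

Lemma test_function_partials D phi s : test_function D phi -> test_function D (partials s phi).
Proof.
move=> tphi; have [_ cK KD] := tphi.
apply: (test_functionI _ cK KD); first by apply: csm_partials; exact: test_function_csm tphi.
by move=> x; apply: contraNP => /partials_out ->.
Qed.

Lemma test_function_partial D phi i : test_function D phi -> test_function D (partial i phi).
Proof. exact: (@test_function_partials D phi [:: i]). Qed.

Lemma test_functionMr D chi phi : csm chi -> test_function D phi ->
  test_function D (fun x => chi x * phi x).
Proof.
move=> cchi tphi; have [_ cK KD] := tphi.
apply: (test_functionI _ cK KD).
  by apply: csmM => //; exact: test_function_csm tphi.
move=> x; apply: contraNP => /(@partials_out phi [::] x) /= ->.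
by rewrite mulr0.
Qed.

Lemma test_functionS D D' phi : D `<=` D' -> test_function D phi -> test_function D' phi.
Proof. by move=> DD [? ? KD]; split => //; exact: subset_trans KD DD. Qed.

Lemma test_function_continuous D phi s : test_function D phi -> continuous (partials s phi).
Proof. by move=> /test_function_csm/(csm_partials s) c; exact: (ck_continuous (c 0%N)). Qed.

Lemma test_function_bsupp D phi : test_function D phi ->
  exists r : R, forall s x, r < `|x| -> partials s phi x = 0.
Proof.
case=> _ /compact_bounded [M [_ HM]] _.
exists (`|M| + 1) => s x rx; apply: partials_out => /(HM (`|M| + 1)).
rewrite (le_lt_trans (ler_norm _)) ?ltrDl// => /(_ isT).
by move=> /=; rewrite leNgt rx.
Qed.

Lemma test_function_bounded D phi s : test_function D phi ->
  exists2 B, 0 < B & forall x, `|partials s phi x| <= B.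
Proof.
move=> tphi; have [r pr] := test_function_bsupp tphi.
have [B B0 HB] := bounded_on_ccube 0 r (test_function_continuous (s:=s) tphi).
exists B => // x; have [xr|xr] := leP `|x| r; first by apply: HB; rewrite /ccube /= subr0.
by rewrite pr// normr0 ltW.
Qed.

Lemma negligible_countable (I : countType) (F : I -> set V) :
  (forall i, mu.-negligible (F i)) -> mu.-negligible (\bigcup_i F i).
Proof.
move=> nF; pose G k := if @unpickle I k is Some i then F i else set0.
apply: (@negligibleS _ _ _ _ (\bigcup_k G k)).
  by move=> x [i _ Fx]; exists (pickle i) => //; rewrite /G pickleK.
apply: negligible_bigcup => k; rewrite /G; case: unpickle => [i|]; first exact: nF.
exact: negligible_set0.
Qed.

(** Countably many balls cover [D], each with a concentric closed cube of twice its radius inside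
    [D], as [fundamental_local] requires. *)
Lemma rational_cover D x : open D -> D x -> exists q : 'rV[rat]_n, exists k : nat,
  let z : V := \row_i ratr (q 0 i) in
  ccube z (2 / k.+1%:R) `<=` D /\ ball z k.+1%:R^-1 x.
Proof.
move=> oD Dx.
have /nbhs_ballP[e /= e0 xeD] := open_nbhs_nbhs (conj oD Dx).
have [k ke] : exists k, k.+1%:R^-1 < e / 3.
  exists (Num.truncn (e / 3)^-1).
  by rewrite invf_plt ?posrE ?divr_gt0// truncnS_gt.
have k0 : 0 < k.+1%:R^-1 :> R by rewrite invr_gt0.
have /choice[q qP] :
    forall i : 'I_n, exists q : rat, ball (x 0 i) k.+1%:R^-1 (ratr q).
  move=> i.
  have [q] : exists q : rat, ratr q \in `]x 0 i, x 0 i + k.+1%:R^-1[.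
    by apply: rat_in_itvoo; rewrite ltrDl.
  rewrite in_itv/= => /andP[xq qx]; exists q.
  by rewrite /ball/= distrC gtr0_norm ?subr_gt0// ltrBlDl.
exists (\row_i q i), k => /=.
set z := \row_i _.
have zx : ball z k.+1%:R^-1 x.
  rewrite rV_ball_box// => i; rewrite !mxE; exact/ball_sym.
split => // y; rewrite /ccube /= => yz; apply: xeD; apply/rV_ballP.
move/rV_ballP : zx => zx; rewrite distrC -(subrKA z).
rewrite (le_lt_trans (ler_normD _ _))//.
by move: yz zx ke; set t := _^-1 => *; lra.
Qed.

(** Testing with [hbump] gives integral 0 over all half-open boxes close to [z]; the pi-lambda
    theorem passes to all measurable sets, and a function with vanishing integrals is null. *)
Lemma fundamental_local D w z rho : 0 < rho -> ccube z rho `<=` D -> open D ->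
  locally_integrable_on D w ->
  (forall phi, test_function D phi -> \int[mu]_(x in D) (w x * phi x) = 0) ->
  mu.-negligible [set x | ball z (rho / 2) x /\ w x != 0].
Proof.
move=> rho0 CD oD [mw lw] H.
set C := ccube z rho; have mC : measurable (C : set V) by exact: measurable_ccube.
have iw : mu.-integrable C (EFin \o w) by apply: lw => //; exact: compact_ccube.
(* [Q] has half the width of [C], which leaves room for the overhang 2/k of the bumps. *)
pose q a : V := z + const_mx a; pose Q := hbox (q (- (rho / 2))) (q (rho / 2)).
have mQ : measurable (Q : set V) by exact: measurable_hbox.
have QC : Q `<=` C.
  move=> x Qx; rewrite /C /ccube /=; apply: rV_norm_le; first exact: ltW.
  by move=> i; have := Qx i; rewrite !mxE ler_norml => /andP[? ?]; apply/andP; lra.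
pose W := w \_ Q.
have iW : mu.-integrable setT (EFin \o W).
  have : mu.-integrable Q (EFin \o w) by apply: integrableS iw.
  rewrite integrable_mkcond//; apply: eq_integrable => // x _ /=.
  by rewrite /W !patchE; case: ifP.
have box0 (a b : V) : (forall i, z 0 i - rho / 2 <= a 0 i) ->
    (forall i, b 0 i <= z 0 i + rho / 2) ->
    (\int[mu]_(x in hbox a b) (w x)%:E = 0)%E.
  move=> za bz.
  have [ab|/existsNP[i /negP]] := pselect (forall i, a 0 i <= b 0 i); last first.
    rewrite -ltNge => ba; rewrite (_ : hbox a b = set0) ?integral_set0//.
    by apply/seteqP; split => // x /(_ i) /andP[ax xb]; have := lt_le_trans ax xb; rewrite ltNge (ltW ba).
  have BC : hbox a b `<=` C.
    move=> x ab'; apply: QC => i; have := ab' i; have := za i; have := bz i; rewrite !mxE.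
    by move=> h1 h2 /andP[h3 h4]; apply/andP; split; lra.
  have [B B0 HB] := @hbump_bounded R n.
  have mB k : measurable_fun C (hbump a b k).
    by apply: continuous_measurable_rV; exact: (ck_continuous (csm_hbump a b k 0%N)).
  have [] := @dominated_convergence _ _ _ mu C mC
     (fun k x => (w x * hbump a b k x)%:E) (fun x => (w x * \1_(hbox a b) x)%:E)
     (fun x => (B * `|w x|)%:E).
  - move=> k; apply/measurable_EFinP; apply: measurable_funM => //.
    exact: rint_measurable iw.
  - apply/measurable_EFinP; apply: measurable_funM; first exact: rint_measurable iw.
    by apply: measurable_indic; exact: measurable_hbox.
  - apply: aeW => x _; apply: cvg_near_cst.
    by have := hbump_cvg x ab; apply: filterS => k ->.
  - by apply: rintZ => //; exact: rint_norm.
  - apply: aeW => x k _; rewrite lee_fin normrM mulrC ler_wpM2r//; exact: HB.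
  move=> _ _ cv.
  have E1 : (\int[mu]_(x in C) (w x * \1_(hbox a b) x)%:E = \int[mu]_(x in hbox a b) (w x)%:E)%E.
    rewrite -[in RHS](setIidr BC) integral_mkcondr; apply: eq_integral => x _.
    by rewrite patchE indicE; case: ifP; rewrite ?mulr1 ?mulr0.
  rewrite -E1; apply: (cvg_unique _ cv) => //.
  apply: cvg_near_cst; near=> k.
  have k0 : (0 < k)%N by near: k; exists 1%N.
  have k4 : 4 / rho <= k%:R by near: k; exact: nbhs_infty_ger.
  have kp : (0:R) < k%:R by rewrite ltr0n.
  have h2 : 2 / k%:R <= rho / 2.
    rewrite ler_pdivrMr// mulrAC ler_pdivlMr//; move: k4; rewrite ler_pdivrMr// => k4.
    by lra.
  have supp x : hbump a b k x != 0 -> C x.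
    move=> /(hbump_out ab k0) h; rewrite /C /ccube /=; apply: rV_norm_le; first exact: ltW.
    move=> i; have := h i; have := za i; have := bz i; rewrite !mxE ler_norml.
    by move=> ? ? /andP[? ?]; apply/andP; lra.
  have tb : test_function D (hbump a b k).
    apply: (@test_functionI _ C) => //; first exact: csm_hbump.
    exact: compact_ccube.
  have := H _ tb; rewrite /Rintegral.
  have -> : (\int[mu]_(x in D) (w x * hbump a b k x)%:E =
            \int[mu]_(x in C) (w x * hbump a b k x)%:E)%E.
    rewrite -[C](setIidr CD) integral_mkcondr; apply: eq_integral => x _.
    rewrite patchE; case: ifPn => // /negP; rewrite inE => Cx.
    by have [->|/supp//] := eqVneq (hbump a b k x) 0; rewrite mulr0.
  have iwb : mu.-integrable C (fun x => (w x * hbump a b k x)%:E).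
    by apply: (@rintM _ _ _ mu C mC w (hbump a b k) B).
  by move=> h; rewrite -[LHS]fineK ?h// integrable_fin_num.
have Q0 : (\int[mu]_x (W x)%:E = 0)%E.
  rewrite -(box0 (q (- (rho / 2))) (q (rho / 2))); last 2 first.
  - by move=> i; rewrite !mxE.
  - by move=> i; rewrite !mxE.
  rewrite [RHS]integral_mkcond; apply: eq_integral => x _.
  by rewrite /W !patchE; case: ifP.
have all0 : forall A : set V, measurable A -> (\int[mu]_(x in A) (W x)%:E = 0)%E.
  move=> A; rewrite measurable_hboxesE.
  pose L := [set A : set V | measurable A /\ (\int[mu]_(x in A) (W x)%:E = 0)%E].
  move=> sA; suff: L A by case.
  move: A sA; apply: (@lambda_system_subset _ _ setI_closed_hboxes setT L) => //.
    apply/dynkin_lambda_system; rewrite /L; split => /=.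
    - by split.
    - move=> B [mB B0]; split; first exact: measurableC.
      have := Q0; rewrite -(setUv B) integral_setU//=.
      + by rewrite B0 add0e.
      + exact: measurableC.
      + by rewrite setUv; have /integrableP[] := iW.
      + by apply/disj_setPCl.
    - move=> F tF HF; split; first by apply: bigcup_measurable => k _; have [] := HF k.
      rewrite integral_bigcup//.
      + by apply: eseries0 => k _ _; have [] := HF k.
      + by move=> k; have [] := HF k.
      + by apply: integrableS iW => //; apply: bigcup_measurable => k _; have [] := HF k.
  move=> _ [a [b ->]]; rewrite /L; split; first exact: measurable_hbox.
  have [c [d E]] := setI_closed_hboxes (ex_intro _ a (ex_intro _ b erefl))
    (ex_intro _ (q (- (rho / 2))) (ex_intro _ (q (rho / 2)) erefl)).
  have -> : (\int[mu]_(x in hbox a b) (W x)%:E = \int[mu]_(x in hbox a b `&` Q) (w x)%:E)%E.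
    rewrite integral_mkcondr; apply: eq_integral => x _.
    by rewrite /W !patchE; case: ifP.
  rewrite (_ : hbox a b `&` Q = hbox (\row_i Num.max (a 0 i) (z 0 i - rho / 2))
      (\row_i Num.min (b 0 i) (z 0 i + rho / 2))).
    by apply: box0 => i; rewrite !mxE ?le_max ?ge_min lexx orbT.
  apply/seteqP; split => x /= => [[h1 h2] i|h]; last split => i.
  - by rewrite !mxE gt_max le_min; move: (h1 i) (h2 i); rewrite !mxE => /andP[-> ->] /andP[-> ->].
  - by have := h i; rewrite !mxE gt_max le_min => /andP[/andP[-> _] /andP[-> _]].
  - by have := h i; rewrite !mxE gt_max le_min => /andP[/andP[_ ->] /andP[_ ->]].
have [N [mN N0 HN]] : ae_eq mu setT (EFin \o W) (cst 0%E).
  apply: integral_ae_eq => // A _ mA; rewrite all0// integral0//.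
exists N; split => // x /= [zx wx]; apply: HN => /= /(_ I).
rewrite /W patchE; case: ifPn => [_ [wx0]|/negP]; first by rewrite wx0 eqxx in wx.
rewrite inE => Qx; exfalso; apply: Qx => i; rewrite !mxE.
have : ball z (rho / 2) x by [].
rewrite rV_ball_box ?divr_gt0// => /(_ i); rewrite /ball /= ltr_norml => /andP[? ?].
by apply/andP; split; lra.
Unshelve. all: by end_near.
Qed.

Lemma fundamental_lemma D w : open D -> locally_integrable_on D w ->
  (forall phi, test_function D phi -> \int[mu]_(x in D) (w x * phi x) = 0) ->
  {ae mu, forall x, D x -> w x = 0}.
Proof.
move=> oD lw H.
pose F (p : 'rV[rat]_n * nat) : set V :=
  let z : V := \row_i ratr (p.1 0 i) in
  [set x | ccube z (2 / p.2.+1%:R) `<=` D /\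
    (ball z (2 / p.2.+1%:R / 2) x /\ w x != 0)].
apply: (@negligibleS _ _ _ _ (\bigcup_p F p)).
  move=> x /= /not_implyP[Dx wx].
  have [q [k [qD qx]]] := rational_cover oD Dx.
  exists (q, k) => //; rewrite /F /=; split => //; split; last exact/eqP.
  by rewrite mulrAC divff// mul1r.
apply: negligible_countable => p; set z : V := \row_i ratr (p.1 0 i).
have [pD|npD] := pselect (ccube z (2 / p.2.+1%:R) `<=` D).
  apply: (@negligibleS _ _ _ _ [set x | ball z (2 / p.2.+1%:R / 2) x /\ w x != 0]).
    by move=> x [].
  by apply: (fundamental_local _ pD) => //; rewrite divr_gt0.
rewrite (_ : F p = set0); first exact: negligible_set0.
by apply/seteqP; split => // x [].
Qed.

Lemma measurable_closed K : closed K -> measurable (K : set V).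
Proof.
move=> cK; rewrite -[K]setCK; apply: measurableC; apply: open_measurable_rV.
exact: closed_openC.
Qed.

Lemma measurable_compact K : compact K -> measurable (K : set V).
Proof.
by move=> cK; apply: measurable_closed; apply: compact_closed.
Qed.

Lemma locally_integrableM D s f phi : open D -> locally_integrable_on D f ->
  test_function D phi -> mu.-integrable D (EFin \o (fun x => f x * partials s phi x)).
Proof.
move=> oD [mf lf] tphi; have [_ cK KD] := tphi; set K := closure _ in cK KD.
have mD := open_measurable_rV oD; have mK := measurable_compact cK.
have [B B0 HB] := test_function_bounded s tphi.
have IK : mu.-integrable K (EFin \o (fun x => f x * partials s phi x)).
  apply: (@rintM _ _ _ mu K mK f _ B) => //; first exact: lf.
  by apply: continuous_measurable_rV; exact: (@test_function_continuous D phi s tphi).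
rewrite integrable_mkcond// in IK.
have := integrableS measurableT mD (@subsetT _ D) IK.
apply: eq_integrable => // x _; rewrite patchE /=; case: ifPn => // /negP.
by rewrite inE => /(partials_out s) ->; rewrite mulr0.
Qed.

Lemma weak_derivative_unique D s u v w : open D ->
  is_weak_derivative D s u v -> is_weak_derivative D s u w ->
  {ae mu, forall x, D x -> v x = w x}.
Proof.
move=> oD [_ lv Hv] [_ lw Hw]; have mD := open_measurable_rV oD.
have lvw : locally_integrable_on D (fun x => v x - w x).
  split; first by apply: measurable_funB; [exact: lv.1|exact: lw.1].
  move=> K KD cK; apply: rintB; [|exact: lv.2|exact: lw.2].
  exact: measurable_compact.
have := fundamental_lemma oD lvw; move=> /(_ _)/= h.
have {h} : {ae mu, forall x, D x -> v x - w x = 0}.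
  apply: h => phi tphi.
  have Il f : locally_integrable_on D f -> mu.-integrable D (EFin \o (fun x => f x * phi x)).
    by move=> lf; exact: (locally_integrableM [::] oD lf tphi).
  rewrite (@eq_Rintegral _ _ _ _ _ (fun x => v x * phi x - w x * phi x)); last first.
    by move=> x _; rewrite mulrBl.
  rewrite RintegralB//; [|exact: Il|exact: Il].
  have := Hv _ tphi; rewrite (Hw _ tphi) => /eqP.
  rewrite -subr_eq0 -mulrBr mulf_eq0 signr_eq0 /= => /eqP E.
  by apply/eqP; rewrite -oppr_eq0 opprB; apply/eqP.
apply: filterS => x h Dx; apply/eqP; rewrite -subr_eq0; apply/eqP; exact: h.
Qed.

End fundamental_lemma.

(** * Averaging kernels *)

Section kernel_bound.
Context {R : realType}.

(** One constant for everything built from [tau]. The bound on [sigma] is halved because [thet]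
    contains a difference of two copies of it. *)
Lemma kernel_bound_exists : exists B : R, 1 <= B /\ forall t : R,
  [/\ `|tau t| <= B, `|(tau^`())%classic t| <= B, `|((tau^`())^`())%classic t| <= B & `|sigma t| <= B / 2].
Proof.
have [B1 B10 H1] := supp1_bounded (@smo_tau R 1) (@supp1_tau R).
have [s1 _] := derive1_smo (@smo_tau R 3).
have [s2 _] := derive1_smo s1.
have p1 := supp1_derive1 (@smo_tau R 2) (@supp1_tau R).
have [B2 B20 H2] := supp1_bounded (smoW s1) p1.
have [B3 B30 H3] := supp1_bounded s2 (supp1_derive1 s1 p1).
have [B4 B40 H4] := @sigma_bounded R.
exists (1 + B1 + B2 + B3 + 2 * B4); split; first lra.
by move=> t; split; [move: (H1 t)|move: (H2 t)|move: (H3 t)|move: (H4 t)] => h; lra.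
Qed.

Definition kB : R := sval (cid kernel_bound_exists).

Lemma kB_ge1 : 1 <= kB.
Proof. by rewrite /kB; case: cid => B /= []. Qed.

Lemma kB_gt0 : 0 < kB.
Proof. exact: lt_le_trans kB_ge1. Qed.

Lemma kB_tau t : `|tau t| <= kB.
Proof. by rewrite /kB; case: cid => B /= [_ /(_ t)[]]. Qed.

Lemma kB_dtau t : `|(tau^`())%classic t| <= kB.
Proof. by rewrite /kB; case: cid => B /= [_ /(_ t)[]]. Qed.

Lemma kB_ddtau t : `|((tau^`())^`())%classic t| <= kB.
Proof. by rewrite /kB; case: cid => B /= [_ /(_ t)[]]. Qed.

Lemma kB_sigma t : `|sigma t| <= kB / 2.
Proof. by rewrite /kB; case: cid => B /= [_ /(_ t)[]]. Qed.

(** Written as an affine substitution for the sake of [smo_affine]; [scE] gives the usual form. *)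
Definition sc (g : R -> R) (a r t : R) : R := g (r^-1 * t + - (r^-1 * a)).

Lemma scE g a r t : sc g a r t = g ((t - a) / r).
Proof. by rewrite /sc; congr g; ring. Qed.

Lemma smo_sc k g a r : smo k g -> smo k (sc g a r).
Proof. exact: smo_affine. Qed.

Lemma is_derive_sc g g' a r t : (forall t, is_derive t (1 : R) g (g' t)) ->
  is_derive t (1 : R) (sc g a r) (r^-1 * sc g' a r t).
Proof.
move=> gg; rewrite mulrC; apply: is_derive1_comp; exact: is_derive_affine.
Qed.

Definition dtau : R -> R := (tau^`())%classic.
Definition ddtau : R -> R := (dtau^`())%classic.

Lemma is_derive_tau (t : R) : is_derive t (1 : R) tau (dtau t).
Proof. by have [_] := derive1_smo (@smo_tau R 1). Qed.

Lemma smo_dtau k : smo k dtau.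
Proof. by have [] := derive1_smo (@smo_tau R k.+1). Qed.

Lemma is_derive_dtau (t : R) : is_derive t (1 : R) dtau (ddtau t).
Proof. by have [_] := derive1_smo (smo_dtau 1). Qed.

Lemma supp1_dtau : supp1 dtau.
Proof. exact: supp1_derive1 (@smo_tau R 2) (@supp1_tau R). Qed.

Lemma supp1_ddtau : supp1 ddtau.
Proof. exact: supp1_derive1 (smo_dtau 2) supp1_dtau. Qed.

Lemma sc_supp g a r t : 0 < r -> supp1 g -> r <= `|t - a| -> sc g a r t = 0.
Proof.
move=> r0 g0 h; rewrite scE; apply: g0.
by rewrite normrM normfV (gtr0_norm r0) ler_pdivlMr// mul1r.
Qed.

End kernel_bound.

Section kernels.
Context {R : realType} {n : nat}.
Local Notation V := 'rV[R]_n.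
Local Notation mu := (@lebesgue_rV R n).
Implicit Types (x y z w : V) (r d rho : R) (i j : 'I_n).

Definition krn1 (a r t : R) : R := r^-1 * sc tau a r t.

(** The factors 1/r give the kernel mass 1, which follows from [krn_bphi] and [int_bphi]. *)
Definition krn z r : V -> R := prodf (fun i => krn1 (z 0 i) r).

Lemma smo_krn1 k a r : smo k (krn1 a r).
Proof.
apply: (@smoM _ k (cst r^-1)); first exact: smo_cst.
by apply: smo_sc; exact: smo_tau.
Qed.

Lemma csm_krn z r : csm (krn z r).
Proof. by apply: csm_prodf => i k; exact: smo_krn1. Qed.

Lemma krn1_le a r rho t : 0 < rho -> rho <= r -> `|krn1 a r t| <= rho^-1 * kB.
Proof.
move=> rho0 rr; have r0 := lt_le_trans rho0 rr.
rewrite /krn1 normrM gtr0_norm ?invr_gt0//.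
by apply: ler_pM => //; [rewrite invr_ge0 ltW|rewrite lef_pV2|exact: kB_tau].
Qed.

Lemma krn1_supp a r t : 0 < r -> r <= `|t - a| -> krn1 a r t = 0.
Proof. by move=> r0 h; rewrite /krn1 sc_supp ?mulr0//; exact: supp1_tau. Qed.

Lemma prodf_le (f : 'I_n -> R -> R) (c : R) y :
  (forall i t, `|f i t| <= c) -> `|prodf f y| <= c ^+ n.
Proof.
move=> fc; rewrite /prodf normr_prod.
rewrite -[X in _ <= _ ^+ X](card_ord n) -prodr_const; apply: ler_prod => i _.
by rewrite normr_ge0 fc.
Qed.

Lemma krn_le z r rho y : 0 < rho -> rho <= r ->
  `|krn z r y| <= (rho^-1 * kB) ^+ n.
Proof. by move=> rho0 rr; apply: prodf_le => i t; exact: krn1_le. Qed.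

Lemma prodf_neq0 (f : 'I_n -> R -> R) y : prodf f y != 0 -> forall i, f i (y 0 i) != 0.
Proof. by move=> fy i; apply: contraNneq fy => h; rewrite (prodfD1 _ i) h mul0r. Qed.

Lemma krn_supp z r y : 0 < r -> krn z r y != 0 -> `|y - z| < r.
Proof.
move=> r0 /prodf_neq0 h; apply: rV_norm_lt => // i; rewrite !mxE ltNge.
by apply: contraNN (h i) => /(krn1_supp r0) ->.
Qed.

Definition dkrn1 (a r t : R) : R := r^-1 * (r^-1 * sc dtau a r t).

Lemma is_derive_krn1 a r t : is_derive t (1 : R) (krn1 a r) (dkrn1 a r t).
Proof.
have d := is_derive_sc a r t (@is_derive_tau R).
have := is_deriveZ (r^-1) d; exact.
Qed.

Lemma partial_krn z r j :
  partial j (krn z r) = prodf (upd (fun i => krn1 (z 0 i) r) j (dkrn1 (z 0 j) r)).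
Proof. by apply: partial_prodf => t; exact: is_derive_krn1. Qed.

Lemma partial_krn_le z r rho j y : 0 < rho -> rho <= r ->
  `|partial j (krn z r) y| <= rho^-1 * (rho^-1 * kB) ^+ n.
Proof.
move=> rho0 rr; have r0 := lt_le_trans rho0 rr.
have -> : partial j (krn z r) y =
    r^-1 * prodf (upd (fun i => krn1 (z 0 i) r) j (fun t => r^-1 * sc dtau (z 0 j) r t)) y.
  by rewrite partial_krn !prodf_upd /dkrn1 -[LHS]mulrA.
rewrite normrM gtr0_norm ?invr_gt0//; apply: ler_pM => //.
- by rewrite invr_ge0 ltW.
- by rewrite lef_pV2.
- apply: prodf_le => i t; rewrite /upd; case: eqP => _; last exact: krn1_le.
  rewrite normrM gtr0_norm ?invr_gt0//.
  by apply: ler_pM => //; [rewrite invr_ge0 ltW|rewrite lef_pV2|exact: kB_dtau].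
Qed.

Lemma partial_krn_supp z r j y : 0 < r -> partial j (krn z r) y != 0 -> `|y - z| < r.
Proof.
move=> r0; rewrite partial_krn => /prodf_neq0 h; apply: rV_norm_lt => // i.
rewrite !mxE ltNge; apply: contraNN (h i) => hi; rewrite /upd; case: (i =P j) => [<-|_].
  by rewrite /dkrn1 sc_supp ?mulr0//; exact: supp1_dtau.
by rewrite krn1_supp.
Qed.

(* The vector field [(thet z r z' r' i)_i] has divergence [krn z r - krn z' r'];
   it changes one factor of the product at a time. *)
Definition thet z r z' r' i : V -> R := prodf (fun j =>
  if (j < i)%N then krn1 (z' 0 j) r' else
  if j == i then (fun t => sc sigma (z 0 j) r t - sc sigma (z' 0 j) r' t)
  else krn1 (z 0 j) r).

Lemma csm_thet z r z' r' i : csm (thet z r z' r' i).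
Proof.
apply: csm_prodf => j k; case: ifP => _; first exact: smo_krn1.
case: ifP => _; last exact: smo_krn1.
have -> : (fun t => sc sigma (z 0 j) r t - sc sigma (z' 0 j) r' t) =
    sc sigma (z 0 j) r \+ (cst (-1) \* sc sigma (z' 0 j) r').
  by apply/funext => t /=; rewrite mulN1r.
apply: smoD; first by apply: smo_sc; exact: smo_sigma.
by apply: smoM; [exact: smo_cst|apply: smo_sc; exact: smo_sigma].
Qed.

Lemma partial_thet z r z' r' y :
  \sum_i partial i (thet z r z' r' i) y = krn z r y - krn z' r' y.
Proof.
(* [M] interpolates between the kernels, with the first [m] factors already exchanged; the i-th term
   of the divergence is one step of this interpolation. *)
pose M m := prodf (fun j : 'I_n => if (j < m)%N then krn1 (z' 0 j) r' else krn1 (z 0 j) r) y.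
have E (i : 'I_n) : partial i (thet z r z' r' i) y = M i - M i.+1.
  have -> : partial i (thet z r z' r' i) = prodf (upd (fun j => if (j < i)%N
      then krn1 (z' 0 j) r' else
      if j == i then (fun t => sc sigma (z 0 j) r t - sc sigma (z' 0 j) r' t)
      else krn1 (z 0 j) r) i (fun t => krn1 (z 0 i) r t - krn1 (z' 0 i) r' t)).
    apply: partial_prodf => t; rewrite ltnn eqxx.
    exact: (is_deriveB (is_derive_sc (z 0 i) r t (@is_derive_sigma R))
      (is_derive_sc (z' 0 i) r' t (@is_derive_sigma R))).
  pose P := \prod_(j | j != i)
    (if (j < i)%N then krn1 (z' 0 j) r' else krn1 (z 0 j) r) (y 0 j).
  have M1 : M i = krn1 (z 0 i) r (y 0 i) * P by rewrite /M (prodfD1 _ i) ltnn.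
  have M2 : M i.+1 = krn1 (z' 0 i) r' (y 0 i) * P.
    rewrite /M (prodfD1 _ i) ltnSn; congr (_ * _); apply: eq_bigr => j ji.
    have /negbTE jin : (j : nat) != i by [].
    by rewrite ltnS leq_eqVlt jin.
  rewrite M1 M2 -mulrBl prodf_upd.
  apply: (congr1 (fun q => (krn1 (z 0 i) r (y 0 i) - krn1 (z' 0 i) r' (y 0 i)) * q)).
  by apply: eq_bigr => j ji; rewrite (negbTE ji).
rewrite (eq_bigr (fun i : 'I_n => M i - M i.+1)) => [|i _]; last exact: E.
rewrite -(big_mkord xpredT (fun i : nat => M i - M i.+1)).
under eq_bigr do rewrite -opprB.
rewrite sumrN telescope_sumr// opprB /M /krn; congr (_ - _).
by rewrite /prodf; apply: eq_bigr => i _; rewrite ltn_ord.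
Qed.

Lemma thet_le z r z' r' i rho y : 0 < rho -> rho <= r -> rho <= r' ->
  `|thet z r z' r' i y| <= rho * (rho^-1 * kB) ^+ n.
Proof.
move=> rho0 rr rr'.
have -> : thet z r z' r' i y = rho * prodf (fun j =>
  if (j < i)%N then krn1 (z' 0 j) r' else
  if j == i then (fun t => rho^-1 * (sc sigma (z 0 j) r t - sc sigma (z' 0 j) r' t))
  else krn1 (z 0 j) r) y.
  rewrite /thet (prodfD1 _ i) [in RHS](prodfD1 _ i) ltnn eqxx.
  rewrite [in RHS]mulrA [in RHS]mulrA divff ?gt_eqF// mul1r.
  by congr (_ * _); apply: eq_bigr => j ji; rewrite (negbTE ji).
rewrite normrM gtr0_norm// ler_pM2l//; apply: prodf_le => j t.
case: ifP => _; first exact: krn1_le.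
case: ifP => _; last exact: krn1_le.
rewrite normrM gtr0_norm ?invr_gt0// ler_pM2l ?invr_gt0//.
rewrite (le_trans (ler_normB _ _))//.
by rewrite (le_trans (lerD (kB_sigma _) (kB_sigma _)))// -splitr.
Qed.

(** In the coordinate being exchanged both primitives are 1 to the right of the two supports and 0
    to the left, so that their difference vanishes outside any cube containing both. *)
Lemma thet_supp z r z' r' i w d y : 0 < r -> 0 < r' ->
  `|z - w| + r <= d -> `|z' - w| + r' <= d ->
  thet z r z' r' i y != 0 -> `|y - w| < d.
Proof.
move=> r0 r'0 zd zd' /prodf_neq0 h.
apply: rV_norm_lt => [|j]; first by rewrite (lt_le_trans _ zd)// ltr_wpDl.
have H x s : 0 < s -> `|x - w| + s <= d -> `|(y - w) 0 j| < d \/ s <= `|y 0 j - x 0 j|.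
  move=> s0 xs; have [?|dy] := ltP `|(y - w) 0 j| d; [by left|right].
  have := coord_le_norm (x - w) j; move: dy; rewrite !mxE => dy xw.
  have := ler_normB (y 0 j - x 0 j) (x 0 j - w 0 j); have := ler_normD (y 0 j - x 0 j) (x 0 j - w 0 j).
  by rewrite subrKA; lra.
have := h j; case: ifP => _ .
  have [//|/(krn1_supp r'0) ->] := H z' r' r'0 zd'.
  by rewrite eqxx.
case: ifP => [ji|_]; last first.
  have [//|/(krn1_supp r0) ->] := H z r r0 zd; by rewrite eqxx.
rewrite ltNge; apply: contraNN => dy.
have zw := coord_le_norm (z - w) j; have zw' := coord_le_norm (z' - w) j.
move: dy zw zw'; rewrite !mxE !scE ler_normr => /orP[dy|dy] zw zw'.
  rewrite !sigma_1 ?subrr//.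
    by rewrite ler_pdivlMr// mul1r; have := ler_norm (z' 0 j - w 0 j); lra.
  by rewrite ler_pdivlMr// mul1r; have := ler_norm (z 0 j - w 0 j); lra.
rewrite !sigma_0 ?subrr//.
  by rewrite ler_pdivrMr// mulN1r; have := ler_norm (- (z' 0 j - w 0 j)); rewrite normrN; lra.
by rewrite ler_pdivrMr// mulN1r; have := ler_norm (- (z 0 j - w 0 j)); rewrite normrN; lra.
Qed.

End kernels.

(** * Averaged Taylor polynomials *)

Section taylor.
Context {R : realType} {n : nat}.
Local Notation V := 'rV[R]_n.
Local Notation mu := (@lebesgue_rV R n).
Implicit Types (x y z w : V) (r d rho M : R) (i j : 'I_n) (u phi psi : V -> R) (D S : set V).

Definition lin j (c : R) : V -> R := fun y => y 0 j - c.

Lemma csm_lin j c : csm (lin j c).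
Proof.
move=> k; apply: (@ck_coord _ _ k (fun t => t - c)).
rewrite (_ : (fun t => _) = id \+ cst (- c)); last by apply/funext.
by apply: smoD; [exact: smo_id|exact: smo_cst].
Qed.

Lemma partial_lin i j c : partial i (lin j c) = cst (j == i)%:R.
Proof.
apply/funext => y; apply: partialE.
have := @is_derive_coord R n (fun t => 1 * t + - c) (cst 1) j i y (is_derive_affine 1 (- c)).
rewrite /= mulr1; congr (is_derive _ _ _ _).
by apply/funext => z; rewrite mul1r.
Qed.

(** By parts, the average of the j-th derivative of [u]: see [betaE1]. *)
Definition beta D u z r j : R := - \int[mu]_(y in D) (u y * partial j (krn z r) y).

(** By parts, the average of u y - grad u y . y; of the factor n + 1, the n is the divergence of the
    identity field. *)
Definition alpha D u z r : R := \int[mu]_(y in D)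
  (u y * (n.+1%:R * krn z r y + \sum_j y 0 j * partial j (krn z r) y)).

(* For [u] weakly differentiable this is the average of the Taylor polynomials
   [x |-> u y + grad u y . (x - y)] against the kernel at [z]; written without
   derivatives of [u], it makes sense for integrable [u]. *)
Definition Ptl D u z r x : R := alpha D u z r + \sum_j beta D u z r j * x 0 j.

Definition lkrn x z r j : V -> R := fun y => lin j (x 0 j) y * krn z r y.

Lemma partial_lkrn x z r j y :
  partial j (lkrn x z r j) y = krn z r y + (y 0 j - x 0 j) * partial j (krn z r) y.
Proof.
rewrite /lkrn (@partialM _ _ j (lin j (x 0 j)) (krn z r)); last 2 first.
- exact: csm_lin.
- exact: csm_krn.
by rewrite /= partial_lin /= eqxx mulr1 addrC.
Qed.

Lemma csm_bounded_supp psi K : csm psi -> compact K -> (forall y, psi y != 0 -> K y) ->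
  exists2 B, 0 < B & forall y, `|psi y| <= B.
Proof.
move=> cpsi cK psiK.
have [r _] : exists r : R, True by exists 0.
have tp : test_function setT psi by apply: (test_functionI cpsi cK) => //.
exact: (test_function_bounded [::] tp).
Qed.

Lemma rint_csm D u psi K : open D -> mu.-integrable D (EFin \o u) -> csm psi ->
  compact K -> (forall y, psi y != 0 -> K y) ->
  mu.-integrable D (EFin \o (fun y => u y * psi y)).
Proof.
move=> oD iu cpsi cK psiK; have [B B0 HB] := csm_bounded_supp cpsi cK psiK.
have mD := open_measurable_rV oD.
apply: (@rintM _ _ _ mu D mD u psi B) => //.
by apply: continuous_measurable_rV; exact: (ck_continuous (cpsi 0%N)).
Qed.

Lemma le_int_supp D S u psi (B : R) : open D -> measurable S -> S `<=` D ->
  mu.-integrable D (EFin \o u) -> measurable_fun D psi ->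
  (forall y, `|psi y| <= B) -> (forall y, psi y != 0 -> S y) ->
  `|\int[mu]_(y in D) (u y * psi y)| <= B * \int[mu]_(y in S) `|u y|.
Proof.
move=> oD mS SD iu cpsi pB pS; have mD := open_measurable_rV oD.
have iup : mu.-integrable D (EFin \o (fun y => u y * psi y)).
  exact: (@rintM _ _ _ mu D mD u psi B).
have iuS : mu.-integrable S (EFin \o (fun y => `|u y|)).
  by apply: rint_norm => //; exact: (integrableS mD mS SD iu).
apply: (le_trans (le_normr_Rintegral mD iup)).
rewrite -RintegralZl//.
have -> : \int[mu]_(y in D) `|u y * psi y| = \int[mu]_(y in S) `|u y * psi y|.
  rewrite -[in RHS](setIidr SD) Rintegral_mkcondr; apply: eq_Rintegral => y _.
  rewrite patchE; case: ifPn => // /negP; rewrite inE => Sy.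
  have [->|/pS//] := eqVneq (psi y) 0; by rewrite mulr0 normr0.
apply: le_Rintegral => //.
- by apply: rint_norm => //; exact: (integrableS mD mS SD iup).
- exact: rintZ.
- by move=> y _; rewrite normrM mulrC ler_wpM2r.
Qed.

Lemma lkrn_partial_supp x z r j y : 0 < r ->
  partial j (lkrn x z r j) y != 0 -> `|y - z| < r.
Proof.
move=> r0; rewrite partial_lkrn => h.
have [k0|] := eqVneq (krn z r y) 0; last exact: krn_supp.
apply: (@partial_krn_supp _ _ _ _ j) => //; apply: contraNneq h => ->.
by rewrite k0 mulr0 addr0.
Qed.

Lemma csm_lkrn x z r j : csm (lkrn x z r j).
Proof. by apply: csmM; [exact: csm_lin|exact: csm_krn]. Qed.

Lemma lkrn_supp x z r j y : 0 < r -> lkrn x z r j y != 0 -> `|y - z| < r.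
Proof.
move=> r0; rewrite /lkrn mulf_eq0 negb_or => /andP[_]; exact: krn_supp.
Qed.

Lemma rint_krnlike D u psi z r : open D -> mu.-integrable D (EFin \o u) -> csm psi ->
  (forall y, psi y != 0 -> `|y - z| < r) ->
  mu.-integrable D (EFin \o (fun y => u y * psi y)).
Proof.
move=> oD iu cpsi h; apply: (rint_csm oD iu cpsi (@compact_ccube R n z r)).
by move=> y /h /ltW.
Qed.

(** Recentring at [x]: the moments y_j in [alpha] and the x_j of the linear part combine to y_j -
    x_j, which is of the order of the scale where the kernel lives. *)
Lemma PtlE D u z r x : open D -> mu.-integrable D (EFin \o u) -> 0 < r ->
  Ptl D u z r x = \int[mu]_(y in D) (u y * krn z r y) +
    \sum_j \int[mu]_(y in D) (u y * partial j (lkrn x z r j) y).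
Proof.
move=> oD iu r0; have mD := open_measurable_rV oD.
have ik : mu.-integrable D (EFin \o (fun y => u y * krn z r y)).
  by apply: (@rint_krnlike _ _ _ z r) => //; [exact: csm_krn|move=> y; exact: krn_supp].
have ipk j : mu.-integrable D (EFin \o (fun y => u y * partial j (krn z r) y)).
  apply: (@rint_krnlike _ _ _ z r) => //; first by apply: csm_partial; exact: csm_krn.
  by move=> y; exact: partial_krn_supp.
have ilk j : mu.-integrable D (EFin \o (fun y => u y * partial j (lkrn x z r j) y)).
  apply: (@rint_krnlike _ _ _ z r) => //; first by apply: csm_partial; exact: csm_lkrn.
  by move=> y; exact: lkrn_partial_supp.
have ixk j : mu.-integrable D (EFin \o (fun y => - x 0 j * (u y * partial j (krn z r) y))).
  exact: rintZ.
rewrite -(Rintegral_sum mD) => [|j _]; last exact: ilk.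
rewrite -RintegralD//; last by apply: (rint_sum mD) => j _; exact: ilk.
rewrite /Ptl (eq_bigr (fun j => \int[mu]_(y in D) (- x 0 j * (u y * partial j (krn z r) y)))); last first.
  by move=> j _; rewrite /beta RintegralZl// mulNr mulrC -mulNr mulrC.
rewrite -(Rintegral_sum mD) => [|j _]; last exact: ixk.
have E y : u y * (n.+1%:R * krn z r y + \sum_j y 0 j * partial j (krn z r) y) =
   (u y * krn z r y + \sum_j u y * partial j (lkrn x z r j) y) -
   \sum_j (- x 0 j * (u y * partial j (krn z r) y)).
  have S1 : \sum_j u y * partial j (lkrn x z r j) y -
      \sum_j (- x 0 j * (u y * partial j (krn z r) y)) =
      u y * (n%:R * krn z r y + \sum_j y 0 j * partial j (krn z r) y).
    rewrite -sumrB mulrDr [u y * (n%:R * _)](_ : _ = \sum_(j < n) u y * krn z r y); last first.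
      by rewrite sumr_const card_ord mulrCA mulr_natl.
    rewrite mulr_sumr -big_split; apply: eq_bigr => j _.
    by rewrite partial_lkrn /=; ring.
  by rewrite -[RHS]addrA S1 -natr1; ring.
rewrite /alpha -RintegralD//; last 2 first.
- have is1 : mu.-integrable D (EFin \o (fun y => \sum_j u y * partial j (lkrn x z r j) y)).
    by apply: (rint_sum mD) => j _; exact: ilk.
  have is2 : mu.-integrable D (EFin \o
      (fun y => \sum_j (- x 0 j * (u y * partial j (krn z r) y)))).
    by apply: (rint_sum mD) => j _; exact: ixk.
  by apply: eq_rint (rintB mD (rintD mD ik is1) is2) => // y _; rewrite E.
- by apply: (rint_sum mD) => j _; exact: ixk.
by apply: eq_Rintegral => y _; rewrite E subrK.
Qed.

(** The derivatives are data, so that second order is just [wk1] for each [u1 j]; integrability on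
    the whole of [D] allows kernels to be paired with [u] directly. *)
Definition wk1 D u (u1 : 'I_n -> V -> R) :=
  [/\ mu.-integrable D (EFin \o u), forall j, mu.-integrable D (EFin \o u1 j) &
   forall j phi, test_function D phi ->
    \int[mu]_(y in D) (u y * partial j phi y) = - \int[mu]_(y in D) (u1 j y * phi y)].

Lemma krn_test D z r : 0 < r -> ccube z r `<=` D -> test_function D (krn z r).
Proof.
move=> r0 zD; apply: (test_functionI _ (@compact_ccube R n z r)) => //; first exact: csm_krn.
by move=> y /(krn_supp r0) /ltW.
Qed.

Lemma lkrn_test D x z r j : 0 < r -> ccube z r `<=` D -> test_function D (lkrn x z r j).
Proof. by move=> r0 zD; apply: test_functionMr; [exact: csm_lin|exact: krn_test]. Qed.

(** The strict inequalities leave room for a closed cube between the two small balls and the large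
    one, which makes [thet] a test function in [S]. *)
Definition link S (a b : V * R) := exists w d,
  [/\ `|a.1 - w| + a.2 < d, `|b.1 - w| + b.2 < d & ball w d `<=` S].

Lemma link_sym S a b : link S a b -> link S b a.
Proof. by move=> [w [d [? ? ?]]]; exists w, d. Qed.

Lemma link_ccube S a b : link S a b -> ccube a.1 a.2 `<=` S.
Proof.
move=> [w [d [h _ wS]]] y /= yz; apply: wS; apply/rV_ballP.
rewrite distrC -(subrKA a.1) (le_lt_trans (ler_normD _ _))//.
by move: yz h; rewrite /ccube /=; lra.
Qed.

Lemma thet_link_supp S z r z' r' i y : 0 < r -> 0 < r' -> link S (z, r) (z', r') ->
  thet z r z' r' i y != 0 -> S y.
Proof.
move=> r0 r'0 [w [d /= [/ltW h1 /ltW h2 wS]]] /(thet_supp r0 r'0 h1 h2) h.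
by apply: wS; apply/rV_ballP; rewrite distrC.
Qed.

Lemma thet_test S z r z' r' i : 0 < r -> 0 < r' -> link S (z, r) (z', r') ->
  test_function S (thet z r z' r' i).
Proof.
move=> r0 r'0 [w [d /= [h1 h2 wS]]].
pose m := Num.max (`|z - w| + r) (`|z' - w| + r').
have md : m < d by rewrite /m gt_max h1.
apply: (test_functionI _ (@compact_ccube R n w m)); first exact: csm_thet.
  by move=> y /= yw; apply: wS; apply/rV_ballP; rewrite distrC (le_lt_trans yw).
move=> y /(@thet_supp _ _ _ _ _ _ _ w m _ r0 r'0) h; apply/ltW/h.
  by rewrite /m le_max lexx.
by rewrite /m le_max lexx orbT.
Qed.

End taylor.

(** * Differences of averaged polynomials along links *)

Section link_estimates.
Context {R : realType} {n : nat}.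
Local Notation V := 'rV[R]_n.
Local Notation mu := (@lebesgue_rV R n).
Implicit Types (x y z w : V) (r d rho M : R) (i j : 'I_n) (u phi psi : V -> R) (D S : set V) (a b c : V * R).

Lemma rint_test D u phi s : open D -> mu.-integrable D (EFin \o u) ->
  test_function D phi -> mu.-integrable D (EFin \o (fun y => u y * partials s phi y)).
Proof.
move=> oD iu tphi; have mD := open_measurable_rV oD.
have [B B0 HB] := test_function_bounded s tphi.
apply: (@rintM _ _ _ mu D mD u _ B) => //.
by apply: continuous_measurable_rV; exact: (@test_function_continuous _ _ D phi s tphi).
Qed.

Lemma eq_le_refl (p q : R) : p = q -> p <= q.
Proof. by move=> ->. Qed.

Lemma sumr_ord (c : R) : \sum_(j < n) c = n%:R * c.
Proof. by rewrite sumr_const card_ord mulr_natl. Qed.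

Definition Kc rho : R := (rho^-1 * kB) ^+ n.

Lemma Kc_ge0 rho : 0 < rho -> 0 <= Kc rho.
Proof.
by move=> r0; rewrite exprn_ge0// mulr_ge0 ?invr_ge0 ?(ltW r0)// ltW// kB_gt0.
Qed.

(** The jet seminorm [jetn] at [x] of the affine difference, by [jet_Pd]. *)
Definition Pd D u a b x rho : R :=
  `|Ptl D u a.1 a.2 x - Ptl D u b.1 b.2 x| +
  rho * \sum_j `|beta D u a.1 a.2 j - beta D u b.1 b.2 j|.

Fixpoint chain S rho N a b : Prop := a = b \/
  if N is m.+1 then exists c, [/\ rho <= c.2, link S a c & chain S rho m c b]
  else False.

Section fixed_data.
Variables (D S : set V) (M rho : R) (x : V).
Hypotheses (oD : open D) (mS : measurable S) (SD : S `<=` D).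
Hypotheses (rho0 : 0 < rho) (M0 : 0 <= M).
Hypothesis Sx : forall y, S y -> `|y - x| <= M * rho.

Local Notation "'IS' f" := (\int[mu]_(y in S) `|f y|) (at level 10).

Let Kc0 : 0 <= Kc rho. Proof. exact: Kc_ge0. Qed.

Let krn_bound u z r : mu.-integrable D (EFin \o u) -> rho <= r -> ccube z r `<=` S ->
  `|\int[mu]_(y in D) (u y * krn z r y)| <= Kc rho * IS u.
Proof.
move=> iu rr zS; apply: le_int_supp => //.
- by apply: continuous_measurable_rV; exact: (ck_continuous (csm_krn z r 0%N)).
- by move=> y; exact: krn_le.
- by move=> y /(krn_supp (lt_le_trans rho0 rr)) /ltW; exact: zS.
Qed.

Let lkrn_bound u z r j : mu.-integrable D (EFin \o u) -> rho <= r -> ccube z r `<=` S ->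
  `|\int[mu]_(y in D) (u y * lkrn x z r j y)| <= M * rho * Kc rho * IS u.
Proof.
move=> iu rr zS; have r0 := lt_le_trans rho0 rr.
have sS y : lkrn x z r j y != 0 -> S y by move=> /(lkrn_supp r0) /ltW; exact: zS.
apply: le_int_supp => //.
- by apply: continuous_measurable_rV; exact: (ck_continuous (csm_lkrn x z r j 0%N)).
- move=> y; have [->|/sS Sy] := eqVneq (lkrn x z r j y) 0.
    by rewrite normr0 !mulr_ge0// ltW.
  rewrite /lkrn normrM; apply: ler_pM => //; last exact: krn_le.
  by apply: le_trans (Sx Sy); have := coord_le_norm (y - x) j; rewrite !mxE.
Qed.

Let thet_bound u z r z' r' i : mu.-integrable D (EFin \o u) -> rho <= r -> rho <= r' ->
  link S (z, r) (z', r') ->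
  `|\int[mu]_(y in D) (u y * thet z r z' r' i y)| <= rho * Kc rho * IS u.
Proof.
move=> iu rr rr' l; apply: le_int_supp => //.
- by apply: continuous_measurable_rV; exact: (ck_continuous (csm_thet z r z' r' i 0%N)).
- by move=> y; exact: thet_le.
- by move=> y; apply: thet_link_supp l; exact: lt_le_trans rho0 _.
Qed.

(** At order 0 the derivatives stay on the kernel and cost a factor 1/rho each, made up for by |y -
    x| <= M * rho in [Ptl] and by the weight rho of the [beta]. *)
Lemma lev0 u z r : mu.-integrable D (EFin \o u) -> rho <= r -> ccube z r `<=` S ->
  `|Ptl D u z r x| + rho * \sum_j `|beta D u z r j| <=
  (1 + n%:R * (2 + M)) * Kc rho * IS u.
Proof.
move=> iu rr zS; have r0 := lt_le_trans rho0 rr.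
have kS y : krn z r y != 0 -> S y by move=> /(krn_supp r0) /ltW; exact: zS.
have pS j y : partial j (krn z r) y != 0 -> S y.
  by move=> /(partial_krn_supp r0) /ltW; exact: zS.
have lS j y : partial j (lkrn x z r j) y != 0 -> S y.
  by move=> /(lkrn_partial_supp r0) /ltW; exact: zS.
have H1 : `|Ptl D u z r x| <= Kc rho * IS u + n%:R * ((1 + M) * Kc rho * IS u).
  rewrite -sumr_ord PtlE// (le_trans (ler_normD _ _))// lerD//; first exact: krn_bound.
  rewrite (le_trans (ler_norm_sum _ _ _))//; apply: ler_sum => j _.
  apply: le_int_supp => //; last exact: lS.
    apply: continuous_measurable_rV.
    exact: (ck_continuous (csm_partial j (csm_lkrn x z r j) 0%N)).
  move=> y; have [->|/lS Sy] := eqVneq (partial j (lkrn x z r j) y) 0.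
    by rewrite normr0 mulr_ge0// addr_ge0.
  rewrite partial_lkrn (le_trans (ler_normD _ _))// [leRHS]mulrDl mul1r lerD ?krn_le//.
  rewrite normrM (_ : M * Kc rho = (M * rho) * (rho^-1 * Kc rho)); last first.
    by rewrite mulrA mulfK ?gt_eqF.
  apply: ler_pM => //; last exact: partial_krn_le.
  by apply: le_trans (Sx Sy); have := coord_le_norm (y - x) j; rewrite !mxE.
have H2 : rho * \sum_j `|beta D u z r j| <= n%:R * (Kc rho * IS u).
  rewrite -sumr_ord mulr_sumr; apply: ler_sum => j _.
  rewrite /beta normrN -ler_pdivlMl// mulrA.
  apply: le_int_supp => //; [|by move=> y; exact: partial_krn_le|exact: pS].
  apply: continuous_measurable_rV.
  exact: (ck_continuous (csm_partial j (csm_krn z r) 0%N)).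
apply: (le_trans (lerD H1 H2)).
set I := \int[mu]_(y in S) _.
by apply: eq_le_refl; ring.
Qed.

Lemma lev1 u (u1 : 'I_n -> V -> R) z r : wk1 D u u1 -> rho <= r -> ccube z r `<=` S ->
  \sum_j `|beta D u z r j| <= Kc rho * \sum_j IS (u1 j).
Proof.
move=> [iu iu1 H] rr zS; rewrite mulr_sumr; apply: ler_sum => j _.
have r0 := lt_le_trans rho0 rr.
rewrite /beta H ?opprK; last by apply: krn_test => //; exact: subset_trans SD.
exact: krn_bound.
Qed.

Lemma PtlE1 u (u1 : 'I_n -> V -> R) z r : wk1 D u u1 -> 0 < r -> ccube z r `<=` D ->
  Ptl D u z r x = \int[mu]_(y in D) (u y * krn z r y) -
    \sum_j \int[mu]_(y in D) (u1 j y * lkrn x z r j y).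
Proof.
move=> [iu iu1 H] r0 zD; rewrite PtlE//; congr (_ + _); rewrite -sumrN.
by apply: eq_bigr => j _; rewrite H//; exact: lkrn_test.
Qed.

Lemma betaE1 u (u1 : 'I_n -> V -> R) z r j : wk1 D u u1 -> 0 < r -> ccube z r `<=` D ->
  beta D u z r j = \int[mu]_(y in D) (u1 j y * krn z r y).
Proof. by move=> [_ _ H] r0 zD; rewrite /beta H ?opprK//; exact: krn_test. Qed.

Lemma Ptl_diff u (u1 : 'I_n -> V -> R) z r z' r' : wk1 D u u1 -> rho <= r -> rho <= r' ->
  link S (z, r) (z', r') ->
  Ptl D u z r x - Ptl D u z' r' x =
  - \sum_i \int[mu]_(y in D) (u1 i y * thet z r z' r' i y) -
  \sum_j (\int[mu]_(y in D) (u1 j y * lkrn x z r j y) -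
          \int[mu]_(y in D) (u1 j y * lkrn x z' r' j y)).
Proof.
move=> W rr rr' l; have [iu iu1 H] := W; have mD := open_measurable_rV oD.
have r0 := lt_le_trans rho0 rr; have r'0 := lt_le_trans rho0 rr'.
have zS := link_ccube l; have z'S := link_ccube (link_sym l).
have cD : ccube z r `<=` D by apply: subset_trans SD.
have c'D : ccube z' r' `<=` D by apply: subset_trans SD.
have E : \int[mu]_(y in D) (u y * krn z r y) - \int[mu]_(y in D) (u y * krn z' r' y) =
    - \sum_i \int[mu]_(y in D) (u1 i y * thet z r z' r' i y).
  have tt i : test_function D (thet z r z' r' i).
    by apply: (test_functionS SD); exact: thet_test.
  rewrite -sumrN; under eq_bigr do rewrite -H//.
  rewrite -(Rintegral_sum mD) => [|i _]; last first.
    exact: (rint_test [:: i] oD iu (tt i)).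
  rewrite -RintegralB//; last 2 first.
  - apply: (@rint_krnlike _ _ _ _ _ z r) => //; first exact: csm_krn.
    by move=> y; exact: krn_supp.
  - apply: (@rint_krnlike _ _ _ _ _ z' r') => //; first exact: csm_krn.
    by move=> y; exact: krn_supp.
  apply: eq_Rintegral => y _; rewrite -mulrBr -mulr_sumr; congr (_ * _).
  by rewrite partial_thet.
have alg (p q p' q' : R) : (p - q) - (p' - q') = (p - p') - (q - q') by ring.
by rewrite (PtlE1 W r0 cD) (PtlE1 W r'0 c'D) alg E sumrB.
Qed.

Let lkrn_bound2 u z r z' r' j : mu.-integrable D (EFin \o u) -> rho <= r -> rho <= r' ->
  link S (z, r) (z', r') ->
  `|\int[mu]_(y in D) (u y * lkrn x z r j y) - \int[mu]_(y in D) (u y * lkrn x z' r' j y)| <=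
  2 * M * rho * Kc rho * IS u.
Proof.
move=> iu rr rr' l; rewrite (le_trans (ler_normB _ _))//.
have h1 := lkrn_bound j iu rr (link_ccube l).
have h2 := lkrn_bound j iu rr' (link_ccube (link_sym l)).
by rewrite (le_trans (lerD h1 h2))// le_eqVlt; apply/orP; left; apply/eqP; ring.
Qed.

(** The difference of the two averages of [u] is its integral against the divergence of [thet]; by
    parts only [u1] remains, with a gain of one factor rho. *)
Lemma link1 u (u1 : 'I_n -> V -> R) a b : wk1 D u u1 -> rho <= a.2 -> rho <= b.2 -> link S a b ->
  Pd D u a b x rho <= (3 + 2 * M) * rho * Kc rho * \sum_j IS (u1 j).
Proof.
case: a b => [z r] [z' r'] W /= rr rr' l; have [iu iu1 H] := W.
rewrite /Pd /= (Ptl_diff W rr rr' l).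
have H1 : `|- \sum_i \int[mu]_(y in D) (u1 i y * thet z r z' r' i y)| <=
    rho * Kc rho * \sum_j IS (u1 j).
  rewrite normrN (le_trans (ler_norm_sum _ _ _))// mulr_sumr; apply: ler_sum => i _.
  exact: thet_bound.
have H2 : `|\sum_j (\int[mu]_(y in D) (u1 j y * lkrn x z r j y) -
          \int[mu]_(y in D) (u1 j y * lkrn x z' r' j y))| <=
    2 * M * rho * Kc rho * \sum_j IS (u1 j).
  rewrite (le_trans (ler_norm_sum _ _ _))// mulr_sumr; apply: ler_sum => i _.
  exact: lkrn_bound2.
have H3 : rho * \sum_j `|beta D u z r j - beta D u z' r' j| <=
    2 * rho * Kc rho * \sum_j IS (u1 j).
  have h1 := lev1 W rr (link_ccube l); have h2 := lev1 W rr' (link_ccube (link_sym l)).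
  have alg (A : R) : 2 * rho * Kc rho * A = rho * (Kc rho * A + Kc rho * A) by ring.
  rewrite alg ler_pM2l//; apply: le_trans (lerD h1 h2); rewrite -big_split; apply: ler_sum => j _.
  exact: ler_normB.
apply: (le_trans (lerD (le_trans (ler_normB _ _) (lerD H1 H2)) H3)).
by apply: eq_le_refl; ring.
Qed.

(** A second integration by parts turns the first moments of [u1] into terms in [u2], plus integrals
    of [u1 j] against [thet] that cancel those in [Ptl_diff]. The cancellation expresses that affine
    functions are reproduced. *)
Lemma link2 u (u1 : 'I_n -> V -> R) (u2 : 'I_n -> 'I_n -> V -> R) a b : wk1 D u u1 -> (forall j, wk1 D (u1 j) (u2 j)) ->
  rho <= a.2 -> rho <= b.2 -> link S a b ->
  Pd D u a b x rho <= (1 + M) * rho ^+ 2 * Kc rho * \sum_j \sum_i IS (u2 j i).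
Proof.
case: a b => [z r] [z' r'] W W2 /= rr rr' l; have [iu iu1 H] := W.
have mD := open_measurable_rV oD.
have r0 := lt_le_trans rho0 rr; have r'0 := lt_le_trans rho0 rr'.
have zS := link_ccube l; have z'S := link_ccube (link_sym l).
have tS i := thet_test i r0 r'0 l.
have tt i : test_function D (thet z r z' r' i) by exact: test_functionS (tS i).
have iu2 j i : mu.-integrable D (EFin \o u2 j i) by have [_] := W2 j.
have krnD j : \int[mu]_(y in D) (u1 j y * krn z r y) -
    \int[mu]_(y in D) (u1 j y * krn z' r' y) =
    - \sum_i \int[mu]_(y in D) (u2 j i y * thet z r z' r' i y).
  have [_ _ H2] := W2 j.
  rewrite -sumrN; under eq_bigr do rewrite -H2//.
  rewrite -(Rintegral_sum mD) => [|i _]; last exact: (rint_test [:: i] oD (iu1 j) (tt i)).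
  rewrite -RintegralB//.
  - apply: eq_Rintegral => y _; rewrite -mulrBr -mulr_sumr; congr (_ * _).
    by rewrite partial_thet.
  - apply: (@rint_krnlike _ _ _ _ _ z r) => //; first exact: csm_krn.
    by move=> y; exact: krn_supp.
  - apply: (@rint_krnlike _ _ _ _ _ z' r') => //; first exact: csm_krn.
    by move=> y; exact: krn_supp.
have cD : ccube z r `<=` D by apply: subset_trans SD.
have c'D : ccube z' r' `<=` D by apply: subset_trans SD.
have H3 : rho * \sum_j `|beta D u z r j - beta D u z' r' j| <=
    rho ^+ 2 * Kc rho * \sum_j \sum_i IS (u2 j i).
  have alg (A : R) : rho ^+ 2 * Kc rho * A = rho * (rho * Kc rho * A) by ring.
  rewrite alg ler_pM2l// mulr_sumr; apply: ler_sum => j _.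
  rewrite (betaE1 j W r0 cD) (betaE1 j W r'0 c'D) krnD normrN (le_trans (ler_norm_sum _ _ _))// mulr_sumr.
  by apply: ler_sum => i _; exact: thet_bound.
have ilt j i : mu.-integrable D (EFin \o (fun y => u2 j i y * (lin j (x 0 j) y * thet z r z' r' i y))).
  apply: (rint_test [::] oD (iu2 j i)).
  by apply: test_functionMr => //; exact: csm_lin.
have lkD j : \int[mu]_(y in D) (u1 j y * lkrn x z r j y) -
    \int[mu]_(y in D) (u1 j y * lkrn x z' r' j y) =
    - \sum_i \int[mu]_(y in D) (u2 j i y * (lin j (x 0 j) y * thet z r z' r' i y)) -
    \int[mu]_(y in D) (u1 j y * thet z r z' r' j y).
  have [_ _ H2] := W2 j.
  have tl i : test_function D (fun y => lin j (x 0 j) y * thet z r z' r' i y).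
    by apply: test_functionMr => //; exact: csm_lin.
  have ip i := rint_test [:: i] oD (iu1 j) (tl i).
  have it := rint_test [::] oD (iu1 j) (tt j).
  rewrite -sumrN; under eq_bigr do rewrite -H2//.
  rewrite -(Rintegral_sum mD) => [|i _]; last exact: ip.
  rewrite -!RintegralB//.
  - apply: eq_Rintegral => y _; rewrite -mulr_sumr -!mulrBr; congr (_ * _).
    rewrite -partial_thet mulr_sumr.
    rewrite [X in X - _](_ : _ = \sum_i (lin j (x 0 j) y * partial i (thet z r z' r' i) y +
      (j == i)%:R * thet z r z' r' i y)).
      rewrite big_split /= -[LHS]addr0 -addrA; congr (_ + _).
      rewrite (bigD1 j)//= eqxx mul1r big1 ?addr0 ?subrr// => i ij.
      by rewrite eq_sym (negbTE ij) mul0r.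
    apply: eq_bigr => i _.
    rewrite (@partialM _ _ i (lin j (x 0 j)) (thet z r z' r' i)); last 2 first.
    - exact: csm_lin.
    - exact: csm_thet.
    by rewrite partial_lin /= [thet _ _ _ _ _ _ * _]mulrC.
  - by apply: (rint_sum mD) => i _; exact: ip.
  - apply: (@rint_krnlike _ _ _ _ _ z r) => //; first exact: csm_lkrn.
    by move=> y; exact: lkrn_supp.
  - apply: (@rint_krnlike _ _ _ _ _ z' r') => //; first exact: csm_lkrn.
    by move=> y; exact: lkrn_supp.
have H1 : `|Ptl D u z r x - Ptl D u z' r' x| <=
    M * rho ^+ 2 * Kc rho * \sum_j \sum_i IS (u2 j i).
  rewrite (Ptl_diff W rr rr' l); under [X in _ - X]eq_bigr do rewrite lkD.
  (* Here the integrals of [u1] cancel and those of [u2] are left. *)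
  rewrite sumrB opprB addKr sumrN opprK.
  rewrite (le_trans (ler_norm_sum _ _ _))// mulr_sumr; apply: ler_sum => j _.
  rewrite (le_trans (ler_norm_sum _ _ _))// mulr_sumr; apply: ler_sum => i _.
  apply: le_int_supp => //.
  - apply: continuous_measurable_rV.
    exact: (ck_continuous (csmM (csm_lin j (x 0 j)) (csm_thet z r z' r' i) 0%N)).
  - move=> y; have [->|t0] := eqVneq (thet z r z' r' i y) 0.
      by rewrite mulr0 normr0 !mulr_ge0// ltW.
    have Sy := thet_link_supp r0 r'0 l t0.
    rewrite normrM expr2 mulrA -mulrA; apply: ler_pM => //; last exact: thet_le.
    by apply: le_trans (Sx Sy); have := coord_le_norm (y - x) j; rewrite !mxE.
  - by move=> y; rewrite mulf_eq0 negb_or => /andP[_]; exact: thet_link_supp.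
rewrite /Pd /= (le_trans (lerD H1 H3))//.
by apply: eq_le_refl; ring.
Qed.

Lemma Pd_triangle u a b c : Pd D u a c x rho <= Pd D u a b x rho + Pd D u b c x rho.
Proof.
rewrite /Pd addrACA -mulrDr -big_split; apply: lerD.
  by rewrite (le_trans _ (ler_normD _ _))// subrKA.
rewrite ler_pM2l//; apply: ler_sum => j _.
by rewrite (le_trans _ (ler_normD _ _))// subrKA.
Qed.

Lemma chain_Pd u (G : R) (N : nat) a b : 0 <= G ->
  (forall a' b', rho <= a'.2 -> rho <= b'.2 -> link S a' b' -> Pd D u a' b' x rho <= G) ->
  rho <= a.2 -> chain S rho N a b -> Pd D u a b x rho <= N%:R * G.
Proof.
move=> G0 HG; have P0 c : Pd D u c c x rho = 0.
  by rewrite /Pd subrr normr0 big1 ?mulr0 ?addr0// => j _; rewrite subrr normr0.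
elim: N a => [|N IH] a ra /=; first by case=> // ->; rewrite P0 mul0r.
case=> [->|[c [rc l ch]]]; first by rewrite P0 mulr_ge0.
rewrite (le_trans (Pd_triangle u a c b))// -natr1 mulrDl mul1r addrC lerD//.
  exact: IH.
exact: HG.
Qed.

End fixed_data.
End link_estimates.

(** * Jets *)

Opaque partial kB tau sigma dtau ddtau.

Section jets.
Context {R : realType} {n : nat}.
Local Notation V := 'rV[R]_n.
Implicit Types (x y z : V) (h : R) (i j : 'I_n) (f g : V -> R).

Definition D1n f x : R := \sum_i `|partial i f x|.
Definition D2n f x : R := \sum_i \sum_j `|partial i (partial j f) x|.

(* The powers of [h] make this seminorm submultiplicative up to a factor 2. *)
Definition jetn h f x : R := `|f x| + h * D1n f x + h ^+ 2 * D2n f x.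

Lemma ler_sum_term (F : 'I_n -> R) i : (forall j, 0 <= F j) -> F i <= \sum_j F j.
Proof. by move=> F0; rewrite (bigD1 i)//= lerDl sumr_ge0. Qed.

Lemma D1n_ge0 f x : 0 <= D1n f x.
Proof. exact: sumr_ge0. Qed.

Lemma D2n_ge0 f x : 0 <= D2n f x.
Proof. by apply: sumr_ge0 => i _; exact: sumr_ge0. Qed.

Lemma D1n_term i f x : `|partial i f x| <= D1n f x.
Proof. by apply: (@ler_sum_term (fun i => `|partial i f x|)). Qed.

Lemma D2n_term i j f x : `|partial i (partial j f) x| <= D2n f x.
Proof.
apply: le_trans (@ler_sum_term (fun i => \sum_j `|partial i (partial j f) x|) i _).
  by apply: (@ler_sum_term (fun j => `|partial i (partial j f) x|)).
by move=> k; exact: sumr_ge0.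
Qed.

Lemma D1n_near f g x : (\forall y \near x, f y = g y) -> D1n f x = D1n g x.
Proof.
by move=> fg; apply: eq_bigr => i _; have := near_partials_eq [:: i] fg => /= ->.
Qed.

Lemma D2n_near f g x : (\forall y \near x, f y = g y) -> D2n f x = D2n g x.
Proof.
move=> fg; apply: eq_bigr => i _; apply: eq_bigr => j _.
by have := near_partials_eq [:: i; j] fg => /= ->.
Qed.

Lemma D1nD f g x : ck 1 f -> ck 1 g -> D1n (f \+ g) x <= D1n f x + D1n g x.
Proof.
move=> cf cg; rewrite /D1n -big_split; apply: ler_sum => i _.
by rewrite partialD//= ler_normD.
Qed.

Lemma D2nD f g x : ck 2 f -> ck 2 g -> D2n (f \+ g) x <= D2n f x + D2n g x.
Proof.
move=> cf cg; rewrite /D2n -big_split; apply: ler_sum => i _.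
rewrite -big_split; apply: ler_sum => j _.
rewrite partialD; [|exact: ckW|exact: ckW].
by rewrite partialD ?ler_normD//; exact: ck_partial.
Qed.

Lemma D1nM f g x : ck 1 f -> ck 1 g ->
  D1n (f \* g) x <= `|f x| * D1n g x + `|g x| * D1n f x.
Proof.
move=> cf cg; rewrite /D1n !mulr_sumr -big_split; apply: ler_sum => i _.
by rewrite partialM//= (le_trans (ler_normD _ _))// !normrM.
Qed.

Lemma D2nM_sum (A B C : 'I_n -> 'I_n -> R) (a b : 'I_n -> R) (c d : R) :
  (forall i j, C i j <= c * B i j + a i * b j + (d * A i j + b i * a j)) ->
  \sum_i \sum_j C i j <= c * (\sum_i \sum_j B i j) + (\sum_i a i) * (\sum_i b i) +
    (d * (\sum_i \sum_j A i j) + (\sum_i b i) * (\sum_i a i)).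
Proof.
move=> H.
have E1 (e : R) (F : 'I_n -> 'I_n -> R) :
    e * (\sum_i \sum_j F i j) = \sum_i \sum_j e * F i j.
  by rewrite mulr_sumr; apply: eq_bigr => i _; rewrite mulr_sumr.
have E2 (e f : 'I_n -> R) : (\sum_i e i) * (\sum_i f i) = \sum_i \sum_j e i * f j.
  by rewrite mulr_suml; apply: eq_bigr => i _; rewrite mulr_sumr.
have E3 (F G : 'I_n -> 'I_n -> R) : \sum_i \sum_j F i j + \sum_i \sum_j G i j =
    \sum_i \sum_j (F i j + G i j).
  by rewrite -big_split; apply: eq_bigr => i _; rewrite big_split.
rewrite (E1 c) (E1 d) (E2 a) (E2 b) E3 E3 E3.
by apply: ler_sum => i _; apply: ler_sum => j _; exact: H.
Qed.

Lemma D2nM f g x : ck 2 f -> ck 2 g -> D2n (f \* g) x <=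
  `|f x| * D2n g x + D1n f x * D1n g x + (`|g x| * D2n f x + D1n g x * D1n f x).
Proof.
move=> cf cg; have c1f := ckW cf; have c1g := ckW cg.
have cpf i := ck_partial i cf; have cpg i := ck_partial i cg.
have E2 i j : partial i (partial j (f \* g)) x =
    (f x * partial i (partial j g) x + partial j g x * partial i f x) +
    (g x * partial i (partial j f) x + partial j f x * partial i g x).
  by rewrite partialM// partialD ?partialM//; apply: ckM.
have T i j : `|partial i (partial j (f \* g)) x| <=
    `|f x| * `|partial i (partial j g) x| + `|partial i f x| * `|partial j g x| +
    (`|g x| * `|partial i (partial j f) x| + `|partial i g x| * `|partial j f x|).
  rewrite (E2 i j); apply: le_trans (ler_normD _ _) _; apply: lerD.
    by apply: le_trans (ler_normD _ _) _; rewrite 2!normrM [X in _ + X <= _]mulrC.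
  by apply: le_trans (ler_normD _ _) _; rewrite 2!normrM [X in _ + X <= _]mulrC.
exact: (D2nM_sum T).
Qed.

Lemma jet_arithD (h a b c A1 B1 C1 A2 B2 C2 : R) : 0 < h ->
  c <= a + b -> C1 <= A1 + B1 -> C2 <= A2 + B2 ->
  c + h * C1 + h ^+ 2 * C2 <= a + h * A1 + h ^+ 2 * A2 + (b + h * B1 + h ^+ 2 * B2).
Proof.
move=> h0 H H1 H2.
have := ler_wpM2l (ltW h0) H1; have := ler_wpM2l (ltW (exprn_gt0 2 h0)) H2.
by rewrite !mulrDr; lra.
Qed.

Lemma jet_arithM (h F0 G0 F1 G1 F2 G2 A B : R) : 0 < h -> 0 <= F0 -> 0 <= G0 ->
  0 <= F1 -> 0 <= G1 -> 0 <= F2 -> 0 <= G2 ->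
  A <= F0 * G1 + G0 * F1 -> B <= F0 * G2 + F1 * G1 + (G0 * F2 + G1 * F1) ->
  F0 * G0 + h * A + h ^+ 2 * B <=
  2 * ((F0 + h * F1 + h ^+ 2 * F2) * (G0 + h * G1 + h ^+ 2 * G2)).
Proof.
move=> h0 F00 G00 F10 G10 F20 G20 /(ler_wpM2l (ltW h0)) h1.
move=> /(ler_wpM2l (ltW (exprn_gt0 2 h0))) h2.
have hF1 : 0 <= h * F1 by rewrite mulr_ge0// ltW.
have hG1 : 0 <= h * G1 by rewrite mulr_ge0// ltW.
have hF2 : 0 <= h ^+ 2 * F2 by rewrite mulr_ge0// exprn_ge0// ltW.
have hG2 : 0 <= h ^+ 2 * G2 by rewrite mulr_ge0// exprn_ge0// ltW.
apply: (@le_trans _ _ (F0 * G0 + h * (F0 * G1 + G0 * F1) +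
  h ^+ 2 * (F0 * G2 + F1 * G1 + (G0 * F2 + G1 * F1)))); first lra.
rewrite -subr_ge0.
rewrite [leRHS](_ : _ = F0 * G0 + F0 * (h * G1) + G0 * (h * F1) + F0 * (h^+2 * G2)
  + G0 * (h ^+2 * F2) + 2 * (h * F1) * (h ^+ 2 * G2) + 2 * (h ^+ 2 * F2) * (h * G1)
  + 2 * (h ^+ 2 * F2) * (h ^+ 2 * G2)); last by ring.
repeat apply: addr_ge0; repeat apply: mulr_ge0 => //.
Qed.

Section fixed_scale.
Variables (h : R) (h0 : 0 < h).

Lemma jetn_ge0 f x : 0 <= jetn h f x.
Proof.
by rewrite /jetn !addr_ge0// mulr_ge0 ?D1n_ge0 ?D2n_ge0// ?exprn_ge0// ltW.
Qed.

Lemma jetn_val f x : `|f x| <= jetn h f x.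
Proof.
rewrite /jetn -addrA lerDl addr_ge0// mulr_ge0 ?D1n_ge0 ?D2n_ge0// ?exprn_ge0//; exact: ltW.
Qed.

Lemma jetn_partial i f x : h * `|partial i f x| <= jetn h f x.
Proof.
rewrite /jetn; apply: (@le_trans _ _ (h * D1n f x)).
  by rewrite ler_pM2l// D1n_term.
rewrite -addrA addrCA lerDl addr_ge0// mulr_ge0 ?D2n_ge0// exprn_ge0//; exact: ltW.
Qed.

Lemma jetn_partial2 i j f x : h ^+ 2 * `|partial i (partial j f) x| <= jetn h f x.
Proof.
rewrite /jetn; apply: (@le_trans _ _ (h ^+ 2 * D2n f x)).
  by rewrite ler_pM2l ?exprn_gt0// D2n_term.
by rewrite lerDr addr_ge0// mulr_ge0 ?D1n_ge0// ltW.
Qed.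

Lemma jetn_near f g x : (\forall y \near x, f y = g y) -> jetn h f x = jetn h g x.
Proof.
by move=> fg; rewrite /jetn (D1n_near fg) (D2n_near fg) (nbhs_singleton fg).
Qed.

Lemma jetnD f g x : ck 2 f -> ck 2 g -> jetn h (f \+ g) x <= jetn h f x + jetn h g x.
Proof.
move=> cf cg; apply: (jet_arithD h0); first exact: ler_normD.
  by apply: D1nD; exact: ckW.
exact: D2nD.
Qed.

(** The factor 2 pays for the products of first derivatives, which the second derivative contains
    twice and the product of the jets once. *)
Lemma jetnM f g x : ck 2 f -> ck 2 g ->
  jetn h (f \* g) x <= 2 * (jetn h f x * jetn h g x).
Proof.
move=> cf cg; rewrite /jetn normrM.
apply: (jet_arithM h0); rewrite ?D1n_ge0 ?D2n_ge0//; last exact: D2nM.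
by apply: D1nM; exact: ckW.
Qed.

Lemma jetn_sum (I : finType) (P : pred I) (F : I -> V -> R) x :
  (forall a, P a -> ck 2 (F a)) ->
  jetn h (fun y => \sum_(a | P a) F a y) x <= \sum_(a | P a) jetn h (F a) x.
Proof.
move=> cF; elim: (index_enum I) => [|a r IH].
  rewrite (_ : (fun y => _) = cst 0); last by apply/funext => y; rewrite big_nil.
  rewrite big_nil /jetn /D1n /D2n normr0 add0r big1 => [|i _]; last first.
    by rewrite partial_cst normr0.
  rewrite big1 ?mulr0 ?addr0// => i _; rewrite big1// => j _.
  by rewrite !partial_cst normr0.
case: (boolP (P a)) => Pa; last first.
  rewrite big_cons (negbTE Pa) (_ : (fun y => _) = (fun y => \sum_(b <- r | P b) F b y))//.
  by apply/funext => y; rewrite big_cons (negbTE Pa).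
rewrite big_cons Pa (_ : (fun y => _) = (F a \+ (fun y => \sum_(b <- r | P b) F b y))); last first.
  by apply/funext => y; rewrite big_cons Pa.
apply: le_trans (jetnD x (cF _ Pa) _) _; last by rewrite lerD2l.
by apply: ck_sum => b; exact: cF.
Qed.

End fixed_scale.

Definition aff (a : R) (b : 'I_n -> R) : V -> R := fun x => a + \sum_j b j * x 0 j.

Lemma csm_aff a b : csm (aff a b).
Proof.
move=> k; apply: (@ckD _ _ k (cst a)); first exact: ck_cst.
by apply: ck_sum => j _; apply: ckZ; apply: (@ck_coord _ _ k id); exact: smo_id.
Qed.

Lemma partial_aff a b i : partial i (aff a b) = cst (b i).
Proof.
apply/funext => x; apply: partialE; apply/is_derive_lineP.
have -> : (fun t : R => aff a b (t *: (delta_mx 0 i : V) + x)) =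
    (fun t : R => b i * t + aff a b x).
  apply/funext => t; rewrite /aff addrCA; congr (_ + _).
  rewrite (bigD1 i)//= [in RHS](bigD1 i)//= !mxE !eqxx mulr1 mulrDr -addrA; congr (_ + (_ + _)).
  by apply: eq_bigr => j /negbTE ji; rewrite !mxE eqxx ji mulr0 add0r.
exact: is_derive_affine.
Qed.

Lemma jetn_aff h a b x : jetn h (aff a b) x = `|aff a b x| + h * \sum_i `|b i|.
Proof.
have E2 : D2n (aff a b) x = 0.
  rewrite /D2n big1// => i _; rewrite big1// => j _.
  by rewrite partial_aff partial_cst normr0.
have E1 : D1n (aff a b) x = \sum_i `|b i|.
  by apply: eq_bigr => i _; rewrite partial_aff.
by rewrite /jetn E2 E1 mulr0 addr0.
Qed.

(** The kernel without its normalisation: on the grid of mesh h such bumps add up to 1. *)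
Definition bphi (nu : V) (h : R) : V -> R := prodf (fun i => sc tau (nu 0 i) h).

Lemma csm_bphi nu h : csm (bphi nu h).
Proof. by apply: csm_prodf => i k; apply: smo_sc; exact: smo_tau. Qed.

Lemma prodf_supp0 (F : 'I_n -> R -> R) (nu : V) h x : 0 < h ->
  (forall i t, h <= `|t - nu 0 i| -> F i t = 0) -> h <= `|x - nu| -> prodf F x = 0.
Proof.
move=> h0 F0; apply: contraTeq; rewrite -ltNge => /prodf_neq0 Fx.
apply: rV_norm_lt => // i; rewrite !mxE ltNge; apply: contraNN (Fx i) => /F0 ->.
by rewrite eqxx.
Qed.

Definition Cphi : R := kB ^+ n * (1 + n%:R + n%:R * n%:R).

(** A derivative costs 1/h', which the weight h absorbs as h <= h'. The indicator of the support is
    kept in order to count nodes later. *)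
Lemma jetn_bphi nu h h' x : 0 < h -> h <= h' ->
  jetn h (bphi nu h') x <= (`|x - nu| < h')%R%:R * Cphi.
Proof.
move=> h0 hh; have h'0 := lt_le_trans h0 hh.
pose F1 i := upd (fun j => sc tau (nu 0 j) h') i (fun t => h'^-1 * sc dtau (nu 0 i) h' t).
have E1 i : partial i (bphi nu h') = prodf (F1 i).
  apply: partial_prodf => t; exact: (is_derive_sc _ _ t (@is_derive_tau R)).
pose F2 i j := upd (F1 j) i (if i == j then
    fun t => h'^-1 * (h'^-1 * sc ddtau (nu 0 i) h' t)
  else fun t => h'^-1 * sc dtau (nu 0 i) h' t).
have E2 i j : partial i (partial j (bphi nu h')) = prodf (F2 i j).
  rewrite E1; apply: partial_prodf => t; rewrite /F1 /upd; case: (i =P j) => [->|_].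
    exact: (is_deriveZ (h'^-1) (is_derive_sc _ _ t (@is_derive_dtau R))).
  exact: (is_derive_sc _ _ t (@is_derive_tau R)).
have [xn|xn] := ltP `|x - nu| h'; last first.
  have Z1 i : prodf (F1 i) x = 0.
    apply: (prodf_supp0 h'0 _ xn) => j t ht; rewrite /F1 /upd; case: (j =P i) => [ji|_].
      by rewrite sc_supp ?mulr0 -?ji//; exact: supp1_dtau.
    by rewrite sc_supp//; exact: supp1_tau.
  have Z2 i j : prodf (F2 i j) x = 0.
    apply: (prodf_supp0 h'0 _ xn) => k t ht; rewrite /F2 /F1 /upd; case: (k =P i) => [ki|_].
      by case: ifP => _; rewrite sc_supp ?mulr0 -?ki//; [exact: supp1_ddtau|exact: supp1_dtau].
    case: (k =P j) => [kj|_]; first by rewrite sc_supp ?mulr0 -?kj//; exact: supp1_dtau.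
    by rewrite sc_supp//; exact: supp1_tau.
  have Z0 : bphi nu h' x = 0.
    by apply: (prodf_supp0 h'0 _ xn) => i t; apply: sc_supp => //; exact: supp1_tau.
  have D1 : D1n (bphi nu h') x = 0.
    by rewrite /D1n big1// => i _; rewrite E1 Z1 normr0.
  have D2 : D2n (bphi nu h') x = 0.
    by rewrite /D2n big1// => i _; rewrite big1// => j _; rewrite E2 Z2 normr0.
  by rewrite mul0r /jetn D1 D2 Z0 normr0 !mulr0 !addr0.
have hi1 : h * h'^-1 <= 1 by rewrite ler_pdivrMr// mul1r.
have hi0 : 0 <= h * h'^-1 by rewrite mulr_ge0 ?invr_ge0 ?(ltW h0) ?(ltW h'0).
have kB0 : 0 <= kB ^+ n :> R by rewrite exprn_ge0// ltW// kB_gt0.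
have B0 : `|bphi nu h' x| <= kB ^+ n by apply: prodf_le => i t; exact: kB_tau.
have B1 i : h * `|partial i (bphi nu h') x| <= kB ^+ n.
  have -> : partial i (bphi nu h') x = h'^-1 *
      prodf (upd (fun j => sc tau (nu 0 j) h') i (sc dtau (nu 0 i) h')) x.
    by rewrite E1 /F1 !prodf_upd mulrA.
  rewrite normrM gtr0_norm ?invr_gt0// mulrA -[leRHS]mul1r; apply: ler_pM => //.
  by apply: prodf_le => j t; rewrite /upd; case: eqP => _; [exact: kB_dtau|exact: kB_tau].
have alg4 (c a b P : R) : c * a * (c * b * P) = c * c * (a * (b * P)) by ring.
have B2 i j : h ^+ 2 * `|partial i (partial j (bphi nu h')) x| <= kB ^+ n.
  have -> : partial i (partial j (bphi nu h')) x = h'^-1 * h'^-1 *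
      prodf (upd (upd (fun j => sc tau (nu 0 j) h') j (sc dtau (nu 0 j) h')) i
       (if i == j then sc ddtau (nu 0 i) h' else sc dtau (nu 0 i) h')) x.
    rewrite E2 /F2 !prodf_upd; case: (i =P j) => [->|ij].
      rewrite -!mulrA; congr (_ * (_ * (_ * _))); apply: eq_bigr => k /negbTE kj.
      by rewrite /F1 /upd kj.
    have ji : j != i by apply/eqP => /esym.
    rewrite (bigD1 j)//= [in RHS](bigD1 j)//= /F1 /upd eqxx.
    rewrite (_ : \prod_(k | (k != i) && (k != j)) _ =
      \prod_(k | (k != i) && (k != j)) sc tau (nu 0 k) h' (x 0 k)); last first.
      by apply: eq_bigr => k /andP[_ /negbTE ->].
    rewrite [X in _ = _ * (_ * (_ * X))](_ : _ =
      \prod_(k | (k != i) && (k != j)) sc tau (nu 0 k) h' (x 0 k)); last first.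
      by apply: eq_bigr => k /andP[_ /negbTE ->].
    exact: alg4.
  rewrite normrM [`|h'^-1 * _|]ger0_norm; last by rewrite mulr_ge0 ?invr_ge0 ?(ltW h'0).
  rewrite expr2 mulrA [h * h * _]mulrACA -[leRHS]mul1r; apply: ler_pM => //.
  - exact: mulr_ge0.
  - exact: mulr_ile1.
  - apply: prodf_le => k t; rewrite /upd; case: (k =P i) => _.
      by case: ifP => _; [exact: kB_ddtau|exact: kB_dtau].
    by case: eqP => _; [exact: kB_dtau|exact: kB_tau].
have D1 : h * D1n (bphi nu h') x <= n%:R * kB ^+ n.
  by rewrite /D1n mulr_sumr -sumr_ord; apply: ler_sum => i _; exact: B1.
have D2 : h ^+ 2 * D2n (bphi nu h') x <= n%:R * (n%:R * kB ^+ n).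
  rewrite /D2n mulr_sumr -sumr_ord; apply: ler_sum => i _.
  by rewrite mulr_sumr -sumr_ord; apply: ler_sum => j _; exact: B2.
rewrite mul1r; apply: (le_trans (lerD (lerD B0 D1) D2)).
by apply: eq_le_refl; rewrite /Cphi; ring.
Qed.

End jets.

(** * Dyadic grids and blending *)

Opaque partial kB tau sigma dtau ddtau.

Section grid.
Context {R : realType} {n : nat}.
Local Notation V := 'rV[R]_n.
Implicit Types (x y : V) (k : nat).
Variables (h0 : R) (A0 : nat).
Hypothesis h00 : 0 < h0.

Definition hh k : R := h0 / 2 ^+ k.

Lemma hhE k : hh k = h0 / 2 ^+ k. Proof. by []. Qed.

Lemma hh_gt0 k : 0 < hh k. Proof. by rewrite divr_gt0// exprn_gt0. Qed.

Lemma hhS k : hh k = 2 * hh k.+1.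
Proof. by rewrite /hh exprS invfM mulrCA (mulrA 2) divff ?mul1r// pnatr_eq0. Qed.

Lemma hh_le k l : (k <= l)%N -> hh l <= hh k.
Proof.
move=> kl; rewrite /hh ler_pM2l// lef_pV2 ?posrE ?exprn_gt0//.
by rewrite ler_eXn2l// ltr1n.
Qed.

(** The number of nodes on a half-axis doubles with the level, so that all grids fill the same cube,
    of half-width [h0 * A0]. *)
Definition gA k : nat := (A0 * 2 ^ k)%N.

Lemma hh_gA k : hh k * (gA k)%:R = h0 * A0%:R.
Proof. by rewrite /hh /gA natrM natrX mulrACA mulrA -mulrA mulVf ?mulr1// expf_neq0// pnatr_eq0. Qed.

Lemma hh_le0 k : hh k <= h0.
Proof. by have := hh_le (leq0n k); rewrite {2}/hh expr0 divr1. Qed.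

Definition grid k := {ffun 'I_n -> 'I_(2 * gA k).+1}.

Definition node k (q : grid k) : V := \row_i (hh k * ((q i)%:R - (gA k)%:R)).

Definition phi k (q : grid k) : V -> R := bphi (node q) (hh k).

Lemma csm_phi k (q : grid k) : csm (phi q).
Proof. exact: csm_bphi. Qed.

Lemma phi_supp k (q : grid k) x : phi q x != 0 -> `|x - node q| < hh k.
Proof.
apply: contraNT; rewrite -leNgt => h; apply/eqP.
apply: (prodf_supp0 (hh_gt0 k) _ h) => i t; apply: sc_supp; first exact: hh_gt0.
exact: supp1_tau.
Qed.

Lemma grid_arith (h t q A : R) : h != 0 ->
  h^-1 * t + - (h^-1 * (h * (q - A))) = h^-1 * t + A - q.
Proof. by move=> h_neq0; field. Qed.

Lemma grid_lo (h t A L : R) : 0 < h -> h <= h0 -> h * A = L -> - (L - h0) <= t ->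
  1 <= h^-1 * t + A.
Proof.
move=> hp hl hA ht; rewrite -(ler_pM2l hp) mulrDr mulVKf ?gt_eqF// mulr1 hA.
by move: hl ht; lra.
Qed.

Lemma grid_hi (h t A L : R) : 0 < h -> h <= h0 -> h * A = L -> t <= L - h0 ->
  h^-1 * t + A <= 2 * A.
Proof.
move=> hp hl hA ht; rewrite -(ler_pM2l hp) mulrDr mulVKf ?gt_eqF// mulrCA hA.
by move: hl ht hp; lra.
Qed.

(** The sum over the grid is a product over the coordinates of the sums in [sum_tau]. The margin
    [h0] keeps [x] away from the rim of the grid, where translates are missing. *)
Lemma sum_phi k x : `|x| <= h0 * A0%:R - h0 -> \sum_(q : grid k) phi q x = 1.
Proof.
move=> xA; have hk := hh_gt0 k; have hk0 : hh k != 0 by rewrite gt_eqF.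
pose F (i : 'I_n) (j : 'I_(2 * gA k).+1) : R :=
  tau ((hh k)^-1 * x 0 i + (gA k)%:R - j%:R).
have E (q : grid k) : phi q x = \prod_i F i (q i).
  by apply: eq_bigr => i _; rewrite /sc /F mxE (grid_arith _ _ _ hk0).
rewrite (eq_bigr _ (fun q _ => E q)) -(bigA_distr_bigA F) big1// => i _.
have := le_trans (coord_le_norm x i) xA; rewrite ler_norml => /andP[lo hi].
apply: sum_tau; first exact: (grid_lo hk (hh_le0 k) (hh_gA k) lo).
by rewrite natrM; exact: (grid_hi hk (hh_le0 k) (hh_gA k) hi).
Qed.

Lemma sum_ord_eq1 (a N : nat) : \sum_(j < N) (nat_of_ord j == a)%:R <= 1 :> R.
Proof.
have [aN|Na] := ltnP a N.
  rewrite (bigD1 (Ordinal aN))//= eqxx big1 ?addr0// => j /negbTE.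
  by rewrite -val_eqE /= => ->.
by rewrite big1 ?ler01// => j _; rewrite ltn_eqF// (leq_trans (ltn_ord j)).
Qed.

(** Two integers within distance 1 of t differ by less than 2, so that all of them lie among one of
    them and its two neighbours. *)
Lemma count1 (t : R) N : \sum_(j < N) (`|t - j%:R| < 1)%R%:R <= 3 :> R.
Proof.
have [[j0 hj0]|no] := pselect (exists j : 'I_N, `|t - j%:R| < 1); last first.
  rewrite big1 ?ler0n// => j _; case: ltP => // h; case: no; by exists j.
apply: (@le_trans _ _ (\sum_(j < N) ((nat_of_ord j == j0.-1)%:R +
    (nat_of_ord j == j0)%:R + (nat_of_ord j == j0.+1)%:R))); last first.
  rewrite big_split big_split /=.
  have := lerD (lerD (sum_ord_eq1 j0.-1 N) (sum_ord_eq1 j0 N)) (sum_ord_eq1 j0.+1 N).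
  by move=> h; apply: le_trans h _; lra.
apply: ler_sum => j _; case: (ltP `|t - j%:R| 1) => hj /=; last by rewrite -!natrD ler0n.
have hjj : `|(nat_of_ord j)%:R - (nat_of_ord j0)%:R : R| < 2.
  rewrite -(subrKA t) (le_lt_trans (ler_normD _ _))// distrC.
  by move: hj0 hj; set p := `|_|; set q := `|_|; lra.
rewrite -!natrD (ler_nat _ 1); move: hjj; rewrite ltr_norml => /andP[].
move=> h1 h2.
have h1' : (j0 < j + 2)%N by rewrite -(ltr_nat R) natrD; move: h1; lra.
have h2' : (j < j0 + 2)%N by rewrite -(ltr_nat R) natrD; move: h2; lra.
have : [|| nat_of_ord j == j0.-1, nat_of_ord j == j0 | nat_of_ord j == j0.+1].
  rewrite addn2 ltnS in h1'; rewrite addn2 ltnS in h2'.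
  have [jl|jg|_] := ltngtP j j0; last by rewrite orbT.
    by rewrite -[X in _ == X.-1](_ : j.+1 = j0) ?eqxx//; apply/eqP; rewrite eqn_leq h1' jl.
  by rewrite [X in _ || (X == _)](_ : _ = j0.+1) ?eqxx ?orbT//; apply/eqP; rewrite eqn_leq h2' jg.
by case/or3P => ->; rewrite ?addn1 ?addnS ?addSn.
Qed.

Lemma node_count k x : \sum_(q : grid k) (`|x - node q| < hh k)%R%:R <= 3 ^+ n :> R.
Proof.
have hk := hh_gt0 k; have hk0 : hh k != 0 by rewrite gt_eqF.
pose F (i : 'I_n) (j : 'I_(2 * gA k).+1) : R :=
  (`|(hh k)^-1 * x 0 i + (gA k)%:R - j%:R| < 1)%R%:R.
apply: (@le_trans _ _ (\sum_(q : grid k) \prod_i F i (q i))).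
  apply: ler_sum => q _; case: ltP => [h|_] /=; last by apply: prodr_ge0 => i _; exact: ler0n.
  rewrite big1// => i _; rewrite /F -(grid_arith _ _ _ hk0) -mulrBr normrM normfV (gtr0_norm hk).
  rewrite ltr_pdivrMl// mulr1 (_ : _ < _ = true)//; apply: le_lt_trans h.
  by have := coord_le_norm (x - node q) i; rewrite !mxE.
rewrite -(bigA_distr_bigA F) -[leRHS](_ : \prod_(i < n) 3 = _); last first.
  by rewrite prodr_const card_ord.
apply: ler_prod => i _; rewrite count1 andbT; apply: sumr_ge0 => j _; exact: ler0n.
Qed.

Local Notation Cn := (@Cphi R n).

Definition Cpart : R := 2 * 3 ^+ n * Cn.

Lemma Cphi_ge0 : 0 <= Cn.
Proof. by rewrite /Cphi mulr_ge0 ?addr_ge0 ?mulr_ge0// exprn_ge0// ltW// kB_gt0. Qed.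

Lemma Cpart_ge0 : 0 <= Cpart.
Proof. by apply: mulr_ge0; [apply: mulr_ge0 => //; exact: exprn_ge0|exact: Cphi_ge0]. Qed.

Section parts.
Variables (k : nat) (rho : R).
Hypotheses (rho0 : 0 < rho) (rhok : rho <= hh k).

Lemma part_arith (p : bool) (J W C G : R) : J <= p%:R * C -> 0 <= J -> 0 <= W ->
  (p -> W <= G) -> 2 * (J * W) <= p%:R * (2 * C * G).
Proof.
case: p => /= J1 J0 W0 H; last first.
  rewrite mul0r in J1; rewrite (_ : J = 0) ?mul0r ?mulr0//.
  by apply/eqP; rewrite eq_le J1.
rewrite mul1r in J1; rewrite mul1r -mulrA ler_pM2l//; apply: ler_pM => //; exact: H.
Qed.

Lemma jetn_part (S : pred (grid k)) (W : grid k -> V -> R) x (G : R) : 0 <= G ->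
  (forall q, ck 2 (W q)) -> (forall q, S q -> `|x - node q| < hh k -> jetn rho (W q) x <= G) ->
  jetn rho (fun y => \sum_(q | S q) phi q y * W q y) x <= Cpart * G.
Proof.
move=> G0 cW HG.
have C0 := Cphi_ge0.
have CG0 : 0 <= 2 * Cn * G by apply: mulr_ge0 => //; exact: mulr_ge0.
apply: le_trans (jetn_sum rho0 _ _) _ => [q _|].
  by apply: (@ckM _ _ _ (phi q) (W q)) => //; exact: csm_phi.
apply: (@le_trans _ _ (\sum_(q : grid k) (`|x - node q| < hh k)%R%:R * (2 * Cn * G))).
  rewrite [leRHS](bigID S) /= -[leLHS]addr0; apply: lerD; last first.
    by apply: sumr_ge0 => q _; apply: mulr_ge0 => //; exact: ler0n.
  apply: ler_sum => q Sq; apply: le_trans (jetnM rho0 x _ (cW q)) _; first exact: csm_phi.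
  have J1 := jetn_bphi (node q) x rho0 rhok.
  have J0 := jetn_ge0 rho0 (phi q) x; have W0 := jetn_ge0 rho0 (W q) x.
  exact: (part_arith J1 J0 W0 (HG q Sq)).
rewrite -mulr_suml (_ : Cpart * G = 3 ^+ n * (2 * Cn * G)); last by rewrite /Cpart; ring.
by rewrite ler_wpM2r// node_count.
Qed.

End parts.

Section multiresolution.
Variables (D : set V) (P : forall k, grid k -> V -> R).
Hypothesis csmP : forall k (q : grid k), csm (@P k q).

Definition near r : set V := [set x | exists2 y, D y & `|y - x| < r].

(** At level 0 all nodes are active, so that the blend has a value everywhere. At the other levels
    the radii are nested: every node whose bump meets the 5 h_k neighbourhood of [D] is active with
    6, active bumps vanish beyond 7, and with 8 they vanish near the point as well. *)
Definition active k (q : grid k) : bool := (k == 0)%N || `[< near (6 * hh k) (node q) >].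

Definition vA k x : R := \sum_(q : grid k | active q) phi q x * P q x.

Definition vE k x : R := \sum_(q : grid k | active q) phi q x.

(** Where [vE] is 1 the new level replaces all coarser ones, where it is 0 it leaves them
    untouched. *)
Fixpoint vv k : V -> R :=
  if k is l.+1 then (fun x => vA k x + (1 - vE k x) * vv l x) else vA 0.

Lemma csm_vA k : csm (vA k).
Proof. by move=> j; apply: ck_sum => q _; apply: (ckM (csm_phi q j) (csmP q j)). Qed.

Lemma csm_vE k : csm (fun x => 1 - vE k x).
Proof.
move=> j; apply: (@ckD _ _ j (cst 1) (fun x => - vE k x)); first exact: ck_cst.
rewrite (_ : (fun x => _) = (fun x => -1 * vE k x)); last by apply/funext => x; rewrite mulN1r.
by apply: ckZ; apply: ck_sum => q _; exact: csm_phi.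
Qed.

Lemma csm_vv k : csm (vv k).
Proof.
elim: k => [|k IH]; first exact: csm_vA.
by move=> j; apply: (@ckD _ _ j (vA k.+1)); [exact: csm_vA|exact: csmM (csm_vE k.+1) IH j].
Qed.

Lemma near_lt r s x y : near r x -> `|y - x| < s -> near (r + s) y.
Proof.
move=> [z Dz zx] yx; exists z => //; rewrite -(subrKA x) (le_lt_trans (ler_normD _ _))//.
by rewrite ltrD// distrC.
Qed.

Lemma near_le r s x : r <= s -> near r x -> near s x.
Proof. by move=> rs [y Dy h]; exists y => //; exact: lt_le_trans rs. Qed.

Lemma active_near k (q : grid k) x : near (5 * hh k) x -> `|x - node q| < hh k -> active q.
Proof.
move=> nx xq; apply/orP; right; apply/asboolP.
rewrite (_ : 6 = 5 + 1); last by rewrite -natr1.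
by rewrite mulrDl mul1r; apply: near_lt nx _; rewrite distrC.
Qed.

Lemma vE1 k x : `|x| <= h0 * A0%:R - h0 -> (k == 0)%N || `[< near (5 * hh k) x >] -> vE k x = 1.
Proof.
move=> xA kx; rewrite -(sum_phi k xA) /vE [RHS](bigID (@active k)) /= [X in _ = _ + X]big1 ?addr0// => q nq.
apply/eqP; apply: contraNT nq => /phi_supp xq.
by case/orP: kx => [k0|/asboolP nx]; [rewrite /active k0|exact: active_near nx xq].
Qed.

Lemma not_active k x : (0 < k)%N -> ~ near (7 * hh k) x ->
  forall q : grid k, active q -> phi q x = 0.
Proof.
move=> k0 nx q; rewrite /active -[_ == _]negbK -lt0n k0 /= => /asboolP nq.
apply/eqP; apply/negPn/negP => /phi_supp xq; apply: nx.
rewrite (_ : 7 = 6 + 1); last by rewrite -natr1.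
by rewrite mulrDl mul1r; apply: near_lt nq _.
Qed.

Lemma near_nbhs_ball (Q : V -> Prop) x e : 0 < e -> (forall y, `|y - x| < e -> Q y) ->
  \forall y \near x, Q y.
Proof.
move=> e0 h; apply/nbhs_ballP; exists e => // y /rV_ballP yx; apply: h.
by rewrite distrC.
Qed.

(** Equality on a neighbourhood, so that all derivatives agree too. *)
Lemma vv_far k x : ~ near (8 * hh k.+1) x -> \forall y \near x, vv k.+1 y = vv k y.
Proof.
move=> nx; apply: (near_nbhs_ball (hh_gt0 k.+1)) => y yx.
have ny : ~ near (7 * hh k.+1) y.
  move=> ny; apply: nx; rewrite (_ : 8 = 7 + 1); last by rewrite -natr1.
  by rewrite mulrDl mul1r; apply: near_lt ny _; rewrite distrC.
have na := not_active (ltn0Sn k) ny.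
by rewrite /= /vA /vE !big1 ?subr0 ?mul1r ?add0r// => q aq; rewrite na ?mul0r.
Qed.

Lemma nbhs_lt_norm x L : `|x| < L -> exists2 e, 0 < e & forall y, `|y - x| < e -> `|y| <= L.
Proof.
move=> xL; exists (L - `|x|); rewrite ?subr_gt0// => y yx.
rewrite -(subrK x y) (le_trans (ler_normD _ _))//; move: yx; set p := `|_ - _|.
by move: p => p; lra.
Qed.

(** As 8 h_(k+1) = 4 h_k, the level k has full weight around [x] and has erased everything coarser:
    only two consecutive levels meet there. *)
Lemma vv_near k x : `|x| < h0 * A0%:R - h0 -> near (8 * hh k.+1) x ->
  \forall y \near x, vv k.+1 y = vA k.+1 y + (1 - vE k.+1 y) * vA k y.
Proof.
move=> /nbhs_lt_norm[e e0 xe] nx; pose d := Num.min e (hh k).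
have d0 : 0 < d by rewrite lt_min e0 hh_gt0.
apply: (near_nbhs_ball d0) => y; rewrite lt_min => /andP[ye yk].
rewrite /=; congr (_ + _ * _).
have E1 : vE k y = 1.
  apply: vE1; first exact: xe.
  apply/orP; right; apply/asboolP; rewrite (_ : 5 = 4 + 1); last by rewrite -natr1.
  rewrite mulrDl mul1r; apply: near_lt yk; move: nx; rewrite (hhS k) mulrA.
  by rewrite (_ : 4 * 2 = 8)// -natrM.
by case: k {nx d d0 yk} E1 => [|k] E1 //; rewrite /= E1 subrr mul0r addr0.
Qed.

Lemma level_arith (N G a b c e : R) : a <= N * G -> b <= 1 + N -> c <= N * G ->
  0 <= b -> 0 <= c -> e <= 2 * (b * c) -> a + e <= (N + 2 * (1 + N) * N) * G.
Proof.
move=> ha hb hc b0 c0 he; rewrite mulrDl lerD// (le_trans he)// -!mulrA ler_pM2l//.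
exact: ler_pM.
Qed.

Section jet_bound.
Variables (rho G : R) (x : V) (P0 : V -> R).
Hypotheses (rho0 : 0 < rho) (G0 : 0 <= G) (csmP0 : csm P0) (xA : `|x| < h0 * A0%:R - h0).

Local Notation N := (Cpart).
Let Pm k (q : grid k) : V -> R := fun y => P q y - P0 y.

Let csmPm k (q : grid k) : csm (Pm q).
Proof.
move=> j; apply: (@ckD _ _ j (P q) (fun y => - P0 y)); first exact: csmP.
rewrite (_ : (fun y => _) = (fun y => -1 * P0 y)); last by apply/funext => y; rewrite mulN1r.
by apply: ckZ; exact: csmP0.
Qed.

Let Am k y : R := \sum_(q : grid k | active q) phi q y * Pm q y.

Let csm_Am k : csm (Am k).
Proof. by move=> j; apply: ck_sum => q _; apply: (ckM (csm_phi q j) (csmPm q j)). Qed.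

Let AmE k y : vA k y = Am k y + vE k y * P0 y.
Proof.
rewrite /vA /Am /vE mulr_suml -big_split; apply: eq_bigr => q _.
by rewrite /Pm /= -mulrDr subrK.
Qed.

Let jetn_Am k : rho <= hh k ->
  (forall q : grid k, active q -> `|x - node q| < hh k -> jetn rho (Pm q) x <= G) ->
  jetn rho (Am k) x <= N * G.
Proof.
move=> rk HG; apply: (@jetn_part k rho rho0 rk (@active k) (@Pm k) x G G0) => // q.
exact: csmPm.
Qed.

Lemma jetn_vv0 : rho <= h0 ->
  (forall q : grid 0, `|x - node q| < h0 -> jetn rho (fun y => P q y - P0 y) x <= G) ->
  jetn rho (fun y => vv 0 y - P0 y) x <= N * G.
Proof.
move=> r0 HG; have h00E : hh 0 = h0 by rewrite /hh expr0 divr1.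
rewrite (@jetn_near _ _ rho _ (Am 0) x); last first.
  have [e e0 xe] := nbhs_lt_norm xA.
  by apply: (near_nbhs_ball e0) => y ye; rewrite /= AmE vE1 ?xe// mul1r addrK.
by apply: jetn_Am; rewrite h00E// => q _; exact: HG.
Qed.

Lemma jetn_vvS k : rho <= hh k.+1 -> near (8 * hh k.+1) x ->
  (forall q : grid k.+1, active q -> `|x - node q| < hh k.+1 ->
     jetn rho (fun y => P q y - P0 y) x <= G) ->
  (forall q : grid k, active q -> `|x - node q| < hh k ->
     jetn rho (fun y => P q y - P0 y) x <= G) ->
  jetn rho (fun y => vv k.+1 y - P0 y) x <= (N + 2 * (1 + N) * N) * G.
Proof.
move=> r0 nx HG1 HG.
have rk : rho <= hh k by apply: le_trans r0 _; exact: hh_le.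
have c1 := @csm_Am k.+1; have c2 := csm_vE k.+1; have c3 := @csm_Am k.
have VE : \forall y \near x, vE k y = 1.
  have [e e0 xe] := nbhs_lt_norm xA; pose d := Num.min e (hh k).
  have d0 : 0 < d by rewrite lt_min e0 hh_gt0.
  apply: (near_nbhs_ball d0) => y; rewrite lt_min => /andP[ye yk].
  apply: vE1; first exact: xe.
  apply/orP; right; apply/asboolP; rewrite (_ : 5 = 4 + 1); last by rewrite -natr1.
  rewrite mulrDl mul1r; apply: near_lt yk; move: nx; rewrite (hhS k) mulrA.
  by rewrite (_ : 4 * 2 = 8)// -natrM.
rewrite (@jetn_near _ _ rho _ (Am k.+1 \+ ((fun y => 1 - vE k.+1 y) \* Am k)) x); last first.
  have vn := vv_near xA nx.
  near=> y.
  have -> : vv k.+1 y = vA k.+1 y + (1 - vE k.+1 y) * vA k y by near: y.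
  have E1 : vE k y = 1 by near: y.
  rewrite (AmE k.+1) (AmE k) E1 /=; set a := Am _ _; set b := vE _ _; set c := Am _ _.
  by ring.
apply: le_trans (jetnD rho0 x (c1 2%N) (csmM c2 c3 2%N)) _.
have H1 : jetn rho (Am k.+1) x <= N * G by apply: jetn_Am.
have H2 : jetn rho (Am k) x <= N * G by apply: jetn_Am.
have H3 : jetn rho (fun y => 1 - vE k.+1 y) x <= 1 + N.
  apply: le_trans (jetnD rho0 x (@ck_cst _ _ 2 1) _) _.
  - rewrite (_ : (fun y => _) = (fun y => -1 * vE k.+1 y)); last by apply/funext => y; rewrite mulN1r.
    by apply: ckZ; apply: ck_sum => q _; exact: csm_phi.
  apply: lerD.
    rewrite /jetn /D1n /D2n normr1 big1 => [|i _]; last by rewrite partial_cst normr0.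
    rewrite big1 ?mulr0 ?addr0// => i _; rewrite big1// => j _.
    by rewrite !partial_cst normr0.
  rewrite (_ : (fun y => _) = (fun y => \sum_(q : grid k.+1 | active q) phi q y * -1)).
    rewrite -[leRHS]mulr1; apply: (@jetn_part k.+1 rho rho0 r0 (@active k.+1) (fun _ => cst (-1)) x 1) => //.
      by move=> q; exact: ck_cst.
    move=> q _ _; rewrite /jetn /D1n /D2n normrN1 big1 => [|i _]; last by rewrite partial_cst normr0.
    rewrite big1 ?mulr0 ?addr0// => i _; rewrite big1// => j _.
    by rewrite !partial_cst normr0.
  by apply/funext => y; rewrite /vE -mulr_suml mulrN1.
have J1 := jetn_ge0 rho0 (fun y => 1 - vE k.+1 y) x.
have J2 := jetn_ge0 rho0 (Am k) x.
have J3 := jetnM rho0 x (c2 2%N) (c3 2%N).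
exact: (level_arith H1 H3 H2 J1 J2 J3).
Unshelve. all: by end_near.
Qed.

End jet_bound.
End multiresolution.

End grid.

Opaque partial kB tau sigma dtau ddtau.

(** * Composition and comparison of chains *)

Section chains.
Context {R : realType} {n : nat}.
Local Notation V := 'rV[R]_n.
Implicit Types (S : set V) (rho : R) (N : nat) (a b c : V * R).

Lemma chain_rcons S rho N a b c : chain S rho N a b -> rho <= c.2 -> link S b c ->
  chain S rho N.+1 a c.
Proof.
elim: N a => [|N IH] a /=.
  by case=> // -> rc l; right; exists c; split => //; left.
case=> [->|[d [rd ad db]]] rc l; first by right; exists c; split => //; left.
by right; exists d; split => //; exact: IH.
Qed.

Lemma chainW S rho N a b : chain S rho N a b -> chain S rho N.+1 a b.
Proof.
elim: N a => [|N IH] a /=; first by case=> // ->; left.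
by case=> [->|[d [rd ad db]]]; [left|right; exists d; split => //; exact: IH].
Qed.

Lemma chain_cat S rho N M a b c : chain S rho N a b -> chain S rho M b c ->
  chain S rho (N + M) a c.
Proof.
elim: N a => [|N IH] a /=; first by case=> // ->.
case=> [->|[d [rd ad db]]] bc; last by right; exists d; split => //; exact: IH.
have H m : chain S rho (m + M) b c by elim: m => // m IHm; exact: chainW.
exact: (H N.+1).
Qed.

Lemma chain_mono S rho N M a b : (N <= M)%N -> chain S rho N a b -> chain S rho M a b.
Proof. by move=> /subnKC <- h; apply: chain_cat h _; case: (M - N)%N => [|m]; left. Qed.

Lemma chain_rev S rho N a b : rho <= a.2 -> chain S rho N a b -> chain S rho N b a.
Proof.
elim: N a b => [|N IH] a b ra /=; first by case=> // ->; left.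
case=> [->|[d [rd ad db]]]; first by left.
have := chain_rcons (IH _ _ rd db) ra (link_sym ad); exact.
Qed.

Lemma chainS S S' rho rho' N a b : S `<=` S' -> rho' <= rho -> chain S rho N a b ->
  chain S' rho' N a b.
Proof.
move=> SS rr; elim: N a => [|N IH] a /=; first by case=> // ->; left.
case=> [->|[d [rd [w [e [h1 h2 h3]]] db]]]; first by left.
right; exists d; split; [exact: le_trans rd| |exact: IH].
by exists w, e; split => //; exact: subset_trans SS.
Qed.

End chains.

(** * Depth inside the domain *)

Section deep_sets.
Context {R : realType} {n : nat}.
Local Notation V := 'rV[R]_n.
Implicit Types (D : set V) (x y z : V) (r e : R).

(** Depth is phrased with open balls, which makes this set closed for every [D]. *)
Definition deep D e : set V := [set y | ball y e `<=` D].

Lemma closed_deep D e : closed (deep D e).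
Proof.
rewrite -openC openE => y /= ny.
have [w [yw nw]] : exists w, ball y e w /\ ~ D w.
  by apply: contrapT => h; apply: ny => w yw; apply: contrapT => nw; apply: h; exists w.
move: yw => /rV_ballP yw.
apply/nbhs_ballP; exists (e - `|y - w|); rewrite /= ?subr_gt0//.
move=> z /rV_ballP yz /=; rewrite /deep /= => zD; apply: nw; apply: zD; apply/rV_ballP.
rewrite -(subrKA y) (le_lt_trans (ler_normD _ _))//; rewrite distrC in yz.
by rewrite -ltrBrDr.
Qed.

Lemma deep_sub D e : 0 < e -> deep D e `<=` D.
Proof. by move=> e0 y; apply; exact: ballxx. Qed.

Lemma deep_le D e e' : e' <= e -> deep D e `<=` deep D e'.
Proof. by move=> ee y yD z h; apply: yD; exact: le_ball h. Qed.

Lemma deep_shift D e z y : deep D e z -> deep D (e - `|y - z|) y.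
Proof.
move=> zD w /rV_ballP h; apply: zD; apply/rV_ballP.
by rewrite -(subrKA y) (le_lt_trans (ler_normD _ _))// distrC; move: h; rewrite ltrBrDl.
Qed.

(** The part of [D] seen from [x] at scale [h]. Everything integrated at [x] is supported there. *)
Definition Rset D kap M x h : set V := deep D (kap * h) `&` ccube x (M * h).

Lemma measurable_Rset D kap M x h : measurable (Rset D kap M x h).
Proof.
apply: measurableI; apply: measurable_closed; first exact: closed_deep.
exact: (@closed_ccube R n x (M * h)).
Qed.

End deep_sets.

(** * Pointwise bounds on the approximations *)

Section extension_jets.
Context {R : realType} {n : nat}.
Local Notation V := 'rV[R]_n.
Local Notation mu := (@lebesgue_rV R n).
Variables (D Om : set V) (h0 c kap M M3 : R) (A0 N : nat).

Local Notation hh := (hh h0).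

(* [D] is a domain in which every point of [Om] sees, at each scale [hh k] (for
   [k > 0] only at points near [D]), a ball of radius comparable to the scale;
   any two such balls are joined inside [D] by a chain of boundedly many
   overlapping balls of comparable size, staying at comparable distance. *)
Definition chained := [/\ open D, [/\ 0 < h0, 0 < kap, kap <= 1, 4 * kap <= c & 2 * M + 5 <= M3],
  0 < M,
  forall k nu x, Om x -> `|x - nu| < hh k -> (k == 0)%N || `[< near D (6 * hh k) nu >] ->
    exists z, deep D (c * hh k) z /\ `|z - nu| < M * hh k &
  forall k x z z', Om x -> (k == 0)%N || `[< near D (8 * hh k) x >] ->
    deep D (c * hh k) z -> `|z - x| < (2 * M + 2) * hh k ->
    deep D (c * hh k) z' -> `|z' - x| < (2 * M + 2) * hh k ->
    chain (Rset D kap M3 x (hh k)) (kap * hh k) N (z, kap * hh k) (z', kap * hh k)].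

Definition in_grid := forall x, Om x -> `|x| < h0 * A0%:R - h0.

Hypotheses (HC : chained) (HG : in_grid).

Let oD : open D. Proof. by case: HC. Qed.
Let h00 : 0 < h0. Proof. by case: HC => _ []. Qed.
Let kap0 : 0 < kap. Proof. by case: HC => _ []. Qed.
Let kap1 : kap <= 1. Proof. by case: HC => _ []. Qed.
Let kapc : 4 * kap <= c. Proof. by case: HC => _ []. Qed.
Let M30 : 2 * M + 5 <= M3. Proof. by case: HC => _ []. Qed.
Let M0 : 0 < M. Proof. by case: HC. Qed.

Local Notation grid := (@grid n A0).
Local Notation node k q := (@node R n h0 A0 k q).
Local Notation act k q := (@active R n h0 A0 D k q).

(** The choice depends on the domain and the node but not on the function to be extended, which
    makes the operator linear. *)
Definition zz k (q : grid k) : V :=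
  xget 0 [set z | deep D (c * hh k) z /\ `|z - node k q| < M * hh k].

Definition PP (u : V -> R) k (q : grid k) : V -> R := Ptl D u (zz q) (kap * hh k).

Definition ext_k (u : V -> R) k : V -> R := @vv R n h0 A0 D (PP u) k.

Lemma ext_kS u k x : ext_k u k.+1 x =
  @vA R n h0 A0 D (PP u) k.+1 x + (1 - @vE R n h0 A0 D k.+1 x) * ext_k u k x.
Proof. by []. Qed.

Lemma csm_PP u k (q : grid k) : csm (PP u q).
Proof. exact: csm_aff. Qed.

Let hk k : 0 < hh k. Proof. exact: hh_gt0. Qed.
Let rho k := kap * hh k.
Let rho0 k : 0 < rho k. Proof. exact: mulr_gt0. Qed.
Let rhok k : rho k <= hh k. Proof. by rewrite ler_piMl// ltW. Qed.

Lemma zzP k (q : grid k) x : Om x -> `|x - node k q| < hh k -> act k q ->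
  deep D (c * hh k) (zz q) /\ `|zz q - x| < (M + 1) * hh k.
Proof.
move=> Ox xq aq; have [_ _ _ I1 _] := HC.
have := I1 k (node k q) x Ox xq aq.
move=> /(xgetPex 0)[h1 h2]; split => //.
rewrite -(subrKA (node k q)) (le_lt_trans (ler_normD _ _))//.
by rewrite distrC in xq; rewrite mulrDl mul1r ltrD.
Qed.

Let RR x k := Rset D kap M3 x (hh k).

Let ball_RR x k z : deep D (4 * rho k) z -> `|z - x| < (2 * M + 2) * hh k ->
  ball z (3 * rho k) `<=` RR x k.
Proof.
move=> zD zx y /rV_ballP zy; split.
  apply: (@deep_le _ _ D (4 * rho k - `|y - z|)); last exact: deep_shift.
  by rewrite distrC in zy; move: zy; rewrite -/(rho k); set p := `|_ - _|; lra.
rewrite /ccube /= -(subrKA z) (le_trans (ler_normD _ _))//.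
rewrite distrC in zy.
apply: (@le_trans _ _ (3 * hh k + (2 * M + 2) * hh k)).
  apply: lerD; last exact: ltW.
  by apply: ltW (lt_le_trans zy _); rewrite ler_pM2l.
rewrite -mulrDl ler_pM2r//.
by move: M30; lra.
Qed.

(* The radius [2 * rho k] is that of the sample balls of level [k - 1]. *)
Let good x k (a : V * R) := [/\ deep D (c * hh k) a.1,
  `|a.1 - x| < (2 * M + 2) * hh k & a.2 = rho k \/ a.2 = 2 * rho k].

Let good_ccube x k a : good x k a -> ccube a.1 a.2 `<=` RR x k.
Proof.
move=> [aD ax ar] y /= ya; apply: (ball_RR _ ax).
  by apply: deep_le aD; rewrite mulrA ler_pM2r.
rewrite /ccube /= in ya; apply/rV_ballP; rewrite distrC (le_lt_trans ya)//.
by have := rho0 k; case: ar => ->; lra.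
Qed.

Let good_le x k a : good x k a -> rho k <= a.2.
Proof. by move=> [_ _ [->//|->]]; have := rho0 k; lra. Qed.

Let good_chain x k a b : Om x -> (k == 0)%N || `[< near D (8 * hh k) x >] ->
  good x k a -> good x k b -> chain (RR x k) (rho k) (N + 2) a b.
Proof.
move=> Ox kx ga gb; have [_ _ _ _ I2] := HC.
have [aD ax ar] := ga; have [bD bx br] := gb.
have H := I2 k x a.1 b.1 Ox kx aD ax bD bx.
have step e : good x k e -> link (RR x k) (e.1, rho k) e.
  move=> [eD ex er]; exists e.1, (3 * rho k); have := rho0 k => r0.
  split; rewrite /= ?subrr ?normr0 ?add0r; [lra|by case: er => ->; lra|].
  by apply: ball_RR => //; apply: deep_le eD; rewrite mulrA ler_pM2r.
rewrite (_ : (N + 2 = 1 + (N + 1))%N); last by rewrite addnA [(1 + N)%N]addnC -addnA.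
apply: chain_cat (chain_cat H _).
  by right; exists (a.1, rho k); split => //; [exact: link_sym (step _ ga)|left].
by right; exists b; split => //; [exact: good_le gb|exact: step|left].
Qed.

Let good_q x k (q : grid k) : Om x -> `|x - node k q| < hh k -> act k q ->
  good x k (zz q, rho k).
Proof.
move=> Ox xq aq; have [h1 h2] := zzP Ox xq aq; split => //=; last by left.
apply: lt_le_trans h2 _; rewrite ler_pM2r//.
by move: M0; lra.
Qed.

Let good_qS x k (q : grid k) : Om x -> `|x - node k q| < hh k -> act k q ->
  good x k.+1 (zz q, rho k).
Proof.
move=> Ox xq aq; have [h1 h2] := zzP Ox xq aq.
have e := hhS h0 k; split => /=.
- by apply: deep_le h1; rewrite ler_wpM2l ?hh_le// (le_trans _ kapc)// mulr_ge0// ltW.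
- by apply: lt_le_trans h2 _; rewrite e mulrA [_ * 2]mulrC mulrDr mulr1.
- by right; rewrite /rho e mulrCA.
Qed.

Let jet_Pd u a b x r : 0 < r ->
  jetn r (fun y => Ptl D u a.1 a.2 y - Ptl D u b.1 b.2 y) x = Pd D u a b x r.
Proof.
move=> r0; have E : (fun y => Ptl D u a.1 a.2 y - Ptl D u b.1 b.2 y) =
  aff (alpha D u a.1 a.2 - alpha D u b.1 b.2) (fun j => beta D u a.1 a.2 j - beta D u b.1 b.2 j).
  apply/funext => y; rewrite /Ptl /aff opprD addrACA; congr (_ + _).
  by rewrite -sumrB; apply: eq_bigr => j _; rewrite mulrBl.
have Ex := congr1 (fun f : V -> R => f x) E.
by rewrite E jetn_aff -Ex.
Qed.

Definition Cjet : R := @Cpart R n + 2 * (1 + @Cpart R n) * @Cpart R n.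

Lemma Cjet_ge0 : 0 <= Cjet.
Proof.
have C0 := @Cpart_ge0 R n.
by apply: addr_ge0 => //; apply: mulr_ge0 => //; apply: mulr_ge0 => //; apply: addr_ge0.
Qed.

(** Common to the three orders: a bound [G] on differences of chained polynomials bounds the jet of
    the deviation from one reference polynomial. The reference ball is that of a node near [x], of
    level k - 1 if k > 0; its radius is then [2 * rho k]. *)
Lemma jet_ext k x : Om x -> (k == 0)%N || `[< near D (8 * hh k) x >] ->
  exists a, [/\ rho k <= a.2, ccube a.1 a.2 `<=` RR x k &
    forall u G, 0 <= G ->
     (forall b b', rho k <= b.2 -> rho k <= b'.2 -> ccube b.1 b.2 `<=` RR x k ->
        ccube b'.1 b'.2 `<=` RR x k -> chain (RR x k) (rho k) (N + 2) b b' ->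
        Pd D u b b' x (rho k) <= G) ->
     jetn (rho k) (fun y => ext_k u k y - Ptl D u a.1 a.2 y) x <= Cjet * G].
Proof.
move=> Ox kx; have xA := HG Ox; have C0 := @Cpart_ge0 R n.
have ex l : exists q : grid l, `|x - node l q| < hh l.
  apply: contrapT => no; have := @sum_phi R n h0 A0 h00 l x (ltW xA).
  rewrite big1 => [/esym/eqP|q _]; first by rewrite oner_eq0.
  by apply/eqP/negPn/negP => /phi_supp xq; apply: no; exists q; exact: xq.
case: k kx => [|k] kx.
  have [q xq] := ex 0%N; have aq : act 0 q by rewrite /active.
  have gq := good_q Ox xq aq.
  exists (zz q, rho 0); split; [exact: good_le gq|exact: good_ccube gq|].
  move=> u G G0 HGG.
  apply: (@le_trans _ _ (@Cpart R n * G)); last first.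
    by rewrite ler_wpM2r// /Cjet lerDl mulr_ge0// mulr_ge0// addr_ge0.
  have hh00 : hh 0 = h0 by rewrite hhE expr0 divr1.
  apply: (@jetn_vv0 R n h0 A0 h00 D (PP u) (csm_PP u) (rho 0) G x (Ptl D u (zz q) (rho 0))
    (rho0 0) G0 (csm_aff _ _) xA).
    by apply: le_trans (rhok 0) _; rewrite hh00.
  move=> q' xq0; have xq' : `|x - node 0 q'| < hh 0 by apply: lt_le_trans xq0 _; rewrite hh00.
  have aq' : act 0 q' by rewrite /active.
  have gq' := good_q Ox xq' aq'.
  rewrite (@jet_Pd u (zz q', rho 0) (zz q, rho 0) x (rho 0) (rho0 0)).
  apply: HGG; [exact: good_le gq'|exact: good_le gq|exact: good_ccube gq'|exact: good_ccube gq|].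
  exact: good_chain.
have nx : near D (8 * hh k.+1) x by apply/asboolP.
have a5 : near D (5 * hh k) x.
  apply: near_le nx; rewrite (hhS h0 k) mulrA ler_pM2r//; lra.
have [q xq] := ex k; have aq : act k q by apply: active_near xq.
have gq := good_qS Ox xq aq.
exists (zz q, rho k); split; [exact: good_le gq|exact: good_ccube gq|].
move=> u G G0 HGG.
apply: (@jetn_vvS R n h0 A0 h00 D (PP u) (csm_PP u) (rho k.+1) G x (Ptl D u (zz q) (rho k))
    (rho0 k.+1) G0 (csm_aff _ _) xA k (rhok k.+1) nx).
- move=> q' aq' xq'; have gq' := good_q Ox xq' aq'.
  rewrite (@jet_Pd u (zz q', rho k.+1) (zz q, rho k) x (rho k.+1) (rho0 k.+1)).
  apply: HGG; [exact: good_le gq'|exact: good_le gq|exact: good_ccube gq'|exact: good_ccube gq|].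
  exact: good_chain.
- move=> q' aq' xq'; have gq' := good_qS Ox xq' aq'.
  rewrite (@jet_Pd u (zz q', rho k) (zz q, rho k) x (rho k.+1) (rho0 k.+1)).
  apply: HGG; [exact: good_le gq'|exact: good_le gq|exact: good_ccube gq'|exact: good_ccube gq|].
  exact: good_chain.
Qed.

Lemma diff_arith (p q r : R) (f g : 'I_n -> R) : 0 <= r ->
  `|p - q| + r * \sum_j `|f j - g j| <=
  (`|p| + r * \sum_j `|f j|) + (`|q| + r * \sum_j `|g j|).
Proof.
move=> r0; rewrite addrACA -mulrDr lerD ?ler_normB// ler_wpM2l// -big_split.
by apply: ler_sum => j _; exact: ler_normB.
Qed.

Let mm := M3 / kap.

Let mm0 : 0 <= mm.
Proof. by rewrite divr_ge0 ?(ltW kap0)//; move: M30 M0; lra. Qed.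

Let RRx x k y : RR x k y -> `|y - x| <= mm * rho k.
Proof. by move=> [_]; rewrite /ccube /= /mm /rho mulrA divfK// gt_eqF. Qed.

Let RRD x k : RR x k `<=` D.
Proof. by move=> y [h _]; apply: deep_sub h; exact: mulr_gt0. Qed.

Let mRR x k : measurable (RR x k).
Proof. exact: measurable_Rset. Qed.

Local Notation avg k x f := (@Kc R n (kap * hh k) * \int[mu]_(y in Rset D kap M3 x (hh k)) f y).

Let split_ext u a k : ext_k u k =
  (fun y => ext_k u k y - Ptl D u a.1 a.2 y) \+ aff (alpha D u a.1 a.2) (beta D u a.1 a.2).
Proof. by apply/funext => y /=; rewrite subrK. Qed.

Let csm_ext u k : csm (ext_k u k).
Proof. by apply: csm_vv => // *; exact: csm_PP. Qed.

Let csm_diff u a k : csm (fun y => ext_k u k y - Ptl D u a.1 a.2 y).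
Proof.
move=> j; apply: (@ckD _ _ j (ext_k u k) (fun y => - Ptl D u a.1 a.2 y)); first exact: csm_ext.
rewrite (_ : (fun y => _) = (fun y => -1 * Ptl D u a.1 a.2 y)); last first.
  by apply/funext => y; rewrite mulN1r.
by apply: ckZ; exact: csm_aff.
Qed.

(** The deviation from the reference polynomial plus that polynomial: its value at order 0, its
    gradient at order 1, and nothing at order 2 as it is affine. N + 2 counts the links of a chain
    with an adjustment of the radius at either end. *)
Definition C0ext : R := (2 * Cjet + 1) * (1 + n%:R * (2 + M3 / kap)).
Definition C1ext : R := Cjet * (N + 2)%:R * (3 + 2 * (M3 / kap)) + 1.
Definition C2ext : R := Cjet * (N + 2)%:R * (1 + M3 / kap).

(** At order 0 there is no derivative to spend on a chain; the two polynomials of a difference are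
    bounded separately. *)
Lemma ext_bound0 u k x : mu.-integrable D (EFin \o u) ->
  Om x -> (k == 0)%N || `[< near D (8 * hh k) x >] ->
  `|ext_k u k x| <= C0ext * avg k x (fun y => `|u y|).
Proof.
move=> iu Ox kx; have [a [ra aR H]] := jet_ext Ox kx.
have L0 b : rho k <= b.2 -> ccube b.1 b.2 `<=` RR x k -> _ :=
  @lev0 R n D (RR x k) mm (rho k) x oD (mRR x k) (@RRD x k) (rho0 k) mm0 (@RRx x k) u b.1 b.2 iu.
set I := \int[mu]_(y in _) _ in L0 *.
have I0 : 0 <= I by apply: Rintegral_ge0.
pose L := (1 + n%:R * (2 + mm)) * @Kc R n (rho k) * I.
have L00 : 0 <= L.
  by rewrite /L !mulr_ge0// ?addr_ge0 ?mulr_ge0 ?Kc_ge0// addr_ge0.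
have L20 : 0 <= 2 * L by rewrite mulr_ge0.
have J := H u (2 * L) L20 _.
have {}J : jetn (rho k) (fun y => ext_k u k y - Ptl D u a.1 a.2 y) x <= Cjet * (2 * L).
  apply: J.
  move=> b b' rb rb' bR b'R _.
  have h1 := L0 b rb bR; have h2 := L0 b' rb' b'R.
  apply: le_trans (_ : _ <= L + L) _; last by rewrite mulr_natl mulr2n.
  apply: le_trans (lerD h1 h2); exact: (diff_arith _ _ _ _ (ltW (rho0 k))).
have J1 := le_trans (jetn_val (rho0 k) _ x) J.
have J2 : `|Ptl D u a.1 a.2 x| <= L.
  apply: le_trans (L0 a ra aR); rewrite lerDl mulr_ge0 ?(ltW (rho0 k))//; exact: sumr_ge0.
have -> : C0ext * (@Kc R n (rho k) * I) = Cjet * (2 * L) + L by rewrite /C0ext /L /mm; ring.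
rewrite -(subrK (Ptl D u a.1 a.2 x) (ext_k u k x)).
by apply: le_trans (ler_normD _ _) _; exact: lerD.
Qed.

(** The factor rho gained by [link1] cancels the weight of first derivatives in the jet; for second
    derivatives rho ^ 2 and [link2] do the same. *)
Lemma ext_bound1 u (u1 : 'I_n -> V -> R) k x i : wk1 D u u1 ->
  Om x -> (k == 0)%N || `[< near D (8 * hh k) x >] ->
  `|partial i (ext_k u k) x| <= C1ext * (@Kc R n (kap * hh k) * \sum_j \int[mu]_(y in Rset D kap M3 x (hh k)) `|u1 j y|).
Proof.
move=> W Ox kx; have [a [ra aR H]] := jet_ext Ox kx.
have L1 b b' : rho k <= b.2 -> rho k <= b'.2 -> link (RR x k) b b' -> _ :=
  @link1 R n D (RR x k) mm (rho k) x oD (mRR x k) (@RRD x k) (rho0 k) mm0 (@RRx x k) u u1 b b' W.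
have B1 := @lev1 R n D (RR x k) (rho k) oD (mRR x k) (@RRD x k) (rho0 k) u u1 a.1 a.2 W ra aR.
move: L1 B1; set I := \sum_j \int[mu]_(y in _) _ => L1 B1.
have I0 : 0 <= I by apply: sumr_ge0 => j _; apply: Rintegral_ge0.
pose L := (3 + 2 * mm) * rho k * @Kc R n (rho k) * I.
have K0 := @Kc_ge0 R n _ (rho0 k); have r0 := ltW (rho0 k).
have L0 : 0 <= L.
  by apply: mulr_ge0 => //; apply: mulr_ge0 => //; apply: mulr_ge0 => //; move: mm0; lra.
have G0 : 0 <= (N + 2)%:R * L by rewrite mulr_ge0.
have J := H u ((N + 2)%:R * L) G0 _.
have {}J : jetn (rho k) (fun y => ext_k u k y - Ptl D u a.1 a.2 y) x <= Cjet * ((N + 2)%:R * L).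
  apply: J.
  move=> b b' rb rb' _ _ ch.
  exact: (@chain_Pd R n D (RR x k) (rho k) x (rho0 k) u L (N + 2) b b' L0 L1 rb ch).
have J1 := le_trans (jetn_partial (rho0 k) i _ x) J.
rewrite (split_ext u a k) partialD; [|exact: csm_diff|exact: csm_aff].
rewrite partial_aff /= -(ler_pM2l (rho0 k)).
have J2 : `|beta D u a.1 a.2 i| <= @Kc R n (rho k) * I.
  by apply: le_trans (ler_sum_term i _) B1 => j.
have := lerD J1 (ler_wpM2l r0 J2); rewrite -mulrDr => J3.
apply: le_trans (ler_wpM2l r0 (ler_normD _ _)) _; apply: le_trans J3 _.
by apply: eq_le_refl; rewrite /C1ext /L /mm; ring.
Qed.

Lemma ext_bound2 u (u1 : 'I_n -> V -> R) (u2 : 'I_n -> 'I_n -> V -> R) k x i j :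
  wk1 D u u1 -> (forall j, wk1 D (u1 j) (u2 j)) ->
  Om x -> (k == 0)%N || `[< near D (8 * hh k) x >] ->
  `|partial i (partial j (ext_k u k)) x| <=
  C2ext * (@Kc R n (kap * hh k) * \sum_j \sum_i \int[mu]_(y in Rset D kap M3 x (hh k)) `|u2 j i y|).
Proof.
move=> W W2 Ox kx; have [a [ra aR H]] := jet_ext Ox kx.
have L1 b b' : rho k <= b.2 -> rho k <= b'.2 -> link (RR x k) b b' -> _ :=
  @link2 R n D (RR x k) mm (rho k) x oD (mRR x k) (@RRD x k) (rho0 k) mm0 (@RRx x k) u u1 u2 b b' W W2.
move: L1; set I := \sum_j \sum_i \int[mu]_(y in _) _ => L1.
have I0 : 0 <= I.
  by apply: sumr_ge0 => j' _; apply: sumr_ge0 => i' _; apply: Rintegral_ge0.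
pose L := (1 + mm) * rho k ^+ 2 * @Kc R n (rho k) * I.
have K0 := @Kc_ge0 R n _ (rho0 k); have r0 := ltW (rho0 k).
have L0 : 0 <= L.
  apply: mulr_ge0 => //; apply: mulr_ge0 => //; apply: mulr_ge0; last exact: exprn_ge0.
  by move: mm0; lra.
have G0 : 0 <= (N + 2)%:R * L by rewrite mulr_ge0.
have J := H u ((N + 2)%:R * L) G0 _.
have {}J : jetn (rho k) (fun y => ext_k u k y - Ptl D u a.1 a.2 y) x <= Cjet * ((N + 2)%:R * L).
  apply: J.
  move=> b b' rb rb' _ _ ch.
  exact: (@chain_Pd R n D (RR x k) (rho k) x (rho0 k) u L (N + 2) b b' L0 L1 rb ch).
have J1 := le_trans (jetn_partial2 (rho0 k) i j _ x) J.
have cd := csm_diff u a k.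
rewrite (split_ext u a k) partialD; [|exact: cd|exact: csm_aff].
rewrite partial_aff partialD; [|exact: csm_partial cd 1%N|exact: ck_cst].
rewrite partial_cst /= addr0 -(ler_pM2l (exprn_gt0 2 (rho0 k))).
apply: le_trans J1 _.
by apply: eq_le_refl; rewrite /C2ext /L /mm; ring.
Qed.

End extension_jets.

(** * Averages over cubes *)

Opaque partial kB tau sigma dtau ddtau.

Section averages.
Context {R : realType} {n : nat}.
Local Notation V := 'rV[R]_n.
Local Notation mu := (@lebesgue_rV R n).
Implicit Types (x y z : V) (r : R) (A X W : set V) (f : V -> R).

(** By comparison with the open ball of radius 2 r, whose measure is known. *)
Lemma mu_ccube_le x r : 0 < r -> (mu (ccube x r) <= ((4 * r) ^+ n)%:E)%E.
Proof.
move=> r0; rewrite (_ : 4 * r = 2 * (2 * r)); last by rewrite mulrA -natrM.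
rewrite -(@lebesgue_rV_ball R n x); last by rewrite mulr_gt0.
apply: le_measure; rewrite ?inE.
- by apply: measurable_closed; exact: (@closed_ccube R n x r).
- by apply: open_measurable_rV; apply: (@ball_open R V); rewrite mulr_gt0.
move=> y /= h; apply/rV_ballP; rewrite distrC (le_lt_trans h)// ltr_pMl// (ltr_nat R 1 2)//.
Qed.

Lemma measurable_close_pairs r : measurable [set p : V * V | `|p.2 - p.1| <= r].
Proof.
have [r0|r0] := leP 0 r; last first.
  rewrite (_ : mkset _ = set0)//; apply/seteqP; split => // -[x y] /= h.
  by have := le_lt_trans (le_trans (normr_ge0 _) h) r0; rewrite ltxx.
rewrite (_ : mkset _ = \big[setI/setT]_(i < n)
   [set p : V * V | `|rV_coord i p.2 - rV_coord i p.1| <= r]).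
  apply: bigsetI_measurable => i _.
  rewrite -[X in measurable X]setTI.
  pose g (p : V * V) : R := `|rV_coord i p.2 - rV_coord i p.1|.
  have mg : measurable_fun setT g.
    apply: (measurableT_comp (@normr_measurable R setT)); apply: measurable_funB.
      by apply: (measurableT_comp (measurable_rV_coord i)); exact: measurable_snd.
    by apply: (measurableT_comp (measurable_rV_coord i)); exact: measurable_fst.
  have := mg measurableT `]-oo, r]%classic (measurable_itv _).
  by congr (measurable (_ `&` _)); apply/seteqP; split => p /=; rewrite in_itv.
rewrite -bigcap_seq; apply/seteqP; split => [[x y] /= h i _ /=|[x y] h /=].
  by apply: le_trans h; have := coord_le_norm (y - x) i; rewrite !mxE.
apply: rV_norm_le => // i; rewrite !mxE; apply: (h i); by rewrite /= mem_index_enum.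
Qed.

(* Tonelli: a point [y] contributes to the integrals over the cubes around the
   points [x] with [|y - x| <= r] only. *)
Lemma schur A X W r f : measurable A -> measurable X -> measurable W -> 0 < r ->
  measurable_fun W f -> (forall y, 0 <= f y) ->
  (forall x y, X x -> A y -> `|y - x| <= r -> W y) ->
  (\int[mu]_(x in X) \int[mu]_(y in A `&` ccube x r) (f y)%:E <=
   ((4 * r) ^+ n)%:E * \int[mu]_(y in W) (f y)%:E)%E.
Proof.
move=> mA mX mW r0 mf f0 XAW.
pose S : set (V * V) := (X `*` A) `&` [set p | `|p.2 - p.1| <= r].
have mS : measurable S.
  by apply: measurableI; [exact: measurableX|exact: measurable_close_pairs].
pose g : V -> R := f \_ W.
have g0 y : 0 <= g y by rewrite /g patchE; case: ifP.
have mg : measurable_fun setT g by apply/(measurable_restrictT _ mW).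
pose H (p : V * V) : \bar R := (g p.2 * \1_S p)%:E.
have H0 p : (0 <= H p)%E by rewrite lee_fin mulr_ge0.
have mH : measurable_fun setT H.
  apply/measurable_EFinP; apply: measurable_funM; last exact: measurable_indic.
  by apply: (measurableT_comp mg); exact: measurable_snd.
have mcc x : measurable (ccube x r).
  by apply: measurable_closed; exact: (@closed_ccube R n x r).
have E1 : (\int[mu]_(x in X) \int[mu]_(y in A `&` ccube x r) (f y)%:E =
    \int[mu]_x \int[mu]_y H (x, y))%E.
  rewrite integral_mkcond; apply: eq_integral => x _; rewrite patchE.
  case: ifPn => [|/negP]; rewrite inE => Xx; last first.
    rewrite integral0_eq// => y _; rewrite /H /= indicE memNset ?mulr0//.
    by move=> [[]].
  rewrite integral_mkcond; apply: eq_integral => y _; rewrite patchE /H /= indicE.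
  case: ifPn => [|/negP]; rewrite inE => Ay; last first.
    by rewrite memNset ?mulr0// => -[[_ ?] ?]; apply: Ay.
  have [Aa ya] := Ay; rewrite mem_set ?mulr1; last by split.
  by rewrite /g patchE mem_set//; exact: XAW ya.
rewrite E1 fubini_tonelli//.
rewrite [X in (_ * X)%E]integral_mkcond.
have -> : ((\int[mu]_y ((fun y => (f y)%:E) \_ W) y) = \int[mu]_y (g y)%:E)%E.
  by apply: eq_integral => y _; rewrite /g !patchE; case: ifP.
have r4 : 0 <= (4 * r) ^+ n by rewrite exprn_ge0// mulr_ge0// ltW.
rewrite -ge0_integralZl_EFin//; last exact/measurable_EFinP.
apply: ge0_le_integral => //.
- by move=> y _; apply: integral_ge0 => x _; exact: H0.
- exact: measurable_fun_fubini_tonelli_G.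
- by apply: measurable_funeM; exact/measurable_EFinP.
move=> y _; apply: (@le_trans _ _ (\int[mu]_x ((g y)%:E * (\1_(ccube y r) x)%:E))%E).
  apply: ge0_le_integral => //.
  - by apply: (measurableT_comp mH); exact: pair2_measurable.
  - by apply: measurable_funeM; apply/measurable_EFinP; exact: measurable_indic.
  move=> x _; rewrite -EFinM lee_fin ler_wpM2l//= !indicE.
  case: (boolP ((x, y) \in S)) => // /set_mem[_ /= h].
  by rewrite mem_set// /ccube /= distrC.
rewrite ge0_integralZl_EFin//; last by apply/measurable_EFinP; exact: measurable_indic.
rewrite integral_indic// setIT muleC lee_wpmul2r ?lee_fin//.
exact: mu_ccube_le.
by move=> y _; rewrite lee_fin.
Qed.

End averages.

Lemma powR_pred {R : realType} (p a : R) : 0 < a -> a `^ p = a `^ (p - 1) * a.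
Proof.
move=> a0; have := @powRD R a (p - 1) 1; rewrite subrK (powRr1 (ltW a0)); apply.
by rewrite (gt_eqF a0) implybT.
Qed.

Lemma young_arith {R : realType} (p q v a F : R) : 0 < p -> p^-1 + q^-1 = 1 ->
  v * a <= p^-1 * F + v * (a / q) -> v * a <= F.
Proof.
move=> p0 pq; have -> : a / q = a - a * p^-1.
  by rewrite (_ : q^-1 = 1 - p^-1) ?mulrBr ?mulr1// -pq addrC addKr.
rewrite mulrBr mulrA -{1}[v * a]addr0 [X in _ <= X]addrCA lerD2l.
by rewrite subr_ge0 mulrC ler_pM2l ?invr_gt0.
Qed.

Section jensen.
Context d (T : measurableType d) {R : realType} (mu : {measure set T -> \bar R}).
Variables (S : set T) (mS : measurable S).

(* Jensen's inequality, from Young's inequality with parameter [I / v]. *)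
Lemma powR_Rintegral_le (f : T -> R) (v p : R) : 0 < v -> (mu S <= v%:E)%E -> 1 <= p ->
  (forall x, 0 <= f x) ->
  mu.-integrable S (EFin \o f) -> mu.-integrable S (EFin \o (fun x => f x `^ p)) ->
  (\int[mu]_(x in S) f x) `^ p <= v `^ (p - 1) * \int[mu]_(x in S) (f x `^ p).
Proof.
move=> v0 Sv; rewrite le_eqVlt => /orP[/eqP <- f0 If _|p1 f0 If Ip].
  rewrite subrr powRr0 mul1r powRr1; last exact: Rintegral_ge0.
  by apply: eq_le_refl; apply: eq_Rintegral => x _; rewrite powRr1.
have p0 : 0 < p by apply: lt_trans p1.
set I := \int[mu]_(x in S) f x; set F := \int[mu]_(x in S) _.
have F0 : 0 <= F by apply: Rintegral_ge0 => x _; exact: powR_ge0.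
have : 0 <= I by exact: Rintegral_ge0.
rewrite le_eqVlt => /orP[/eqP <-|I0].
  by rewrite powR0 ?gt_eqF// mulr_ge0 ?powR_ge0.
pose l := I / v; have l0 : 0 < l by rewrite divr_gt0.
pose q := p / (p - 1); have p10 : 0 < p - 1 by rewrite subr_gt0.
have q0 : 0 < q by rewrite divr_gt0.
have pq : p^-1 + q^-1 = 1.
  by rewrite /q invf_div -{1}[p^-1]mul1r -mulrDl addrC subrK divff// gt_eqF.
have lq : (l `^ (p - 1)) `^ q = l `^ p.
  by rewrite -powRrM /q mulrC divfK// gt_eqF.
have fS : (mu S < +oo)%E by apply: le_lt_trans Sv _; rewrite ltry.
have Ic (c : R) : mu.-integrable S (EFin \o cst c).
  apply/integrableP; split; first exact/measurable_EFinP.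
  rewrite (_ : (fun x => _) = cst `|c|%:E)// integral_cst//.
  by rewrite lte_mul_pinfty ?lee_fin.
have Sf : fine (mu S) <= v by rewrite -lee_fin fineK// ge0_fin_numE.
have Y : l `^ (p - 1) * I <= p^-1 * F + v * (l `^ p / q).
  rewrite -RintegralZl// -RintegralZl//.
  apply: (@le_trans _ _ (\int[mu]_(x in S) (p^-1 * (f x `^ p) + l `^ p / q))).
    apply: le_Rintegral => //; first exact: rintZ.
    by apply: rintD => //; [exact: rintZ|exact: Ic].
    move=> x _; rewrite mulrC [_^-1 * _]mulrC -lq.
    by apply: conjugate_powR => //; exact: powR_ge0.
  rewrite RintegralD//; [|exact: rintZ|exact: Ic].
  rewrite lerD2l Rintegral_cst// mulrC ler_wpM2r//.
  by rewrite divr_ge0 ?powR_ge0// ltW.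
have I1 : I = v * l by rewrite /l mulrCA divff ?mulr1// gt_eqF.
have lp := powR_pred p l0.
have Q : v * l `^ p <= F.
  have E : l `^ (p - 1) * I = v * l `^ p by rewrite lp I1; ring.
  by rewrite E in Y; exact: (young_arith p0 pq Y).
rewrite {1}I1 powRM ?(ltW v0) ?(ltW l0)//.
by rewrite (powR_pred p v0) -mulrA ler_wpM2l// powR_ge0.
Qed.

End jensen.

(** * Gluing along the boundary of the domain *)

Opaque partial kB tau sigma dtau ddtau.

Section measurable_averages.
Context {R : realType} {n : nat}.
Local Notation V := 'rV[R]_n.
Local Notation mu := (@lebesgue_rV R n).

Lemma measurable_local_integral (A : set V) r (f : V -> R) : measurable A ->
  measurable_fun A f -> (forall y, 0 <= f y) ->
  measurable_fun setT (fun x => \int[mu]_(y in A `&` ccube x r) (f y)%:E)%E.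
Proof.
move=> mA mf f0.
pose S : set (V * V) := (setT `*` A) `&` [set p | `|p.2 - p.1| <= r].
have mS : measurable S.
  by apply: measurableI; [exact: measurableX|exact: measurable_close_pairs].
pose g : V -> R := f \_ A.
have g0 y : 0 <= g y by rewrite /g patchE; case: ifP.
have mg : measurable_fun setT g by apply/(measurable_restrictT _ mA).
pose H (p : V * V) : \bar R := (g p.2 * \1_S p)%:E.
have H0 p : (0 <= H p)%E by rewrite lee_fin mulr_ge0.
have mH : measurable_fun setT H.
  apply/measurable_EFinP; apply: measurable_funM; last exact: measurable_indic.
  by apply: (measurableT_comp mg); exact: measurable_snd.
rewrite (_ : (fun x => _) = (fun x => \int[mu]_y H (x, y))%E).
  exact: (@measurable_fun_fubini_tonelli_F _ _ _ _ R mu H mH H0).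
apply/funext => x; rewrite integral_mkcond; apply: eq_integral => y _.
rewrite patchE /H /= indicE; case: ifPn => [|/negP]; rewrite inE => Ay; last first.
  by rewrite memNset ?mulr0// => -[[_ ?] ?]; apply: Ay.
have [Aa ya] := Ay; rewrite mem_set ?mulr1; last by split.
by rewrite /g patchE mem_set.
Qed.

End measurable_averages.

(** The layers [w k] fit between [a (k - J)] and [a k], so that their sum telescopes in steps of J
    and only the last J values of [a] survive. This is bounded overlap, with masses in place of
    sets. *)
Lemma sum_telescope {R : realType} (J : nat) (w a : nat -> R) (A : R) K :
  (forall k, 0 <= a k <= A) ->
  (forall k, w k + (if (k < J)%N then 0 else a (k - J)%N) <= a k) ->
  \sum_(k < K) w k <= J%:R * A.
Proof.
move=> aA wa; pose F i := if (i < J)%N then 0 else a (i - J)%N.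
have A0 : 0 <= A by case/andP: (aA 0%N) => h /(le_trans h).
have H : \sum_(k < K) w k <= \sum_(j < J) F (K + j)%N.
  elim: K => [|K IH]; first by rewrite big_ord0 sumr_ge0// => j _; rewrite /F; case: ifP => // _; case/andP: (aA (0 + j - J)%N).
  have E : \sum_(j < J) F (K + j)%N + F (K + J)%N = F K + \sum_(j < J) F (K.+1 + j)%N.
    have := big_ord_recr J (fun j => F (K + j)%N) : \sum_(j < J.+1) _ = _ => /= <-.
    rewrite big_ord_recl /= addn0; congr (_ + _); apply: eq_bigr => j _.
    by rewrite /bump /= add1n addnS addSn.
  have FKJ : F (K + J)%N = a K by rewrite /F ltnNge leq_addl /= addnK.
  rewrite FKJ in E; rewrite big_ord_recr /=.
  have := wa K; rewrite -/(F K); move: IH E.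
  move: (\sum_(k < K) w k) (\sum_(j < J) F (K + j)%N) (\sum_(j < J) F (K.+1 + j)%N).
  by move=> p q r; lra.
apply: le_trans H _; rewrite -sumr_ord.
apply: ler_sum => j _; rewrite /F; case: ifP => // _; by case/andP: (aA (K + j - J)%N).
Qed.

Lemma glue_arith {R : realType} (eps c B q dl : R) : 0 <= B -> 0 <= q -> 0 <= dl ->
  (c + 2) * B * (q + 1) * dl = eps / 2 ->
  eps / 2 + c * B * ((q + 1) * dl) + B * (q * dl + dl) <= eps.
Proof.
move=> B0 q0 dl0 H; have X0 : 0 <= B * ((q + 1) * dl).
  by apply: mulr_ge0 => //; apply: mulr_ge0 => //; apply: addr_ge0.
have -> : c * B * ((q + 1) * dl) = eps / 2 - 2 * (B * ((q + 1) * dl)) by rewrite -H; ring.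
have -> : B * (q * dl + dl) = B * ((q + 1) * dl) by ring.
by move: X0; set X := B * _; lra.
Qed.

(** * Abstract gluing, to be applied to the v_k and to each of their derivatives *)

Section gluing.
Context {R : realType} {n : nat}.
Local Notation V := 'rV[R]_n.
Local Notation mu := (@lebesgue_rV R n).
Variables (D Om : set V) (h0 kap M3 C : R) (w_ : nat -> V -> R) (w f : V -> R).
Local Notation hh := (hh h0).
Hypotheses (oD : open D) (oOm : open Om) (DOm : D `<=` Om) (h00 : 0 < h0) (kap0 : 0 < kap)
  (M30 : 0 < M3) (C0 : 0 <= C).
Hypotheses (f0 : forall y, 0 <= f y) (If : mu.-integrable D (EFin \o f)).
Hypotheses (mw : measurable_fun D w) (wf : forall y, D y -> `|w y| <= f y).
Hypothesis cw_ : forall k, continuous (w_ k).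
Hypothesis w_le : forall k x, Om x -> (k == 0)%N || `[< near D (8 * hh k) x >] ->
  `|w_ k x| <= C * (@Kc R n (kap * hh k) * \int[mu]_(y in Rset D kap M3 x (hh k)) f y).
Hypothesis w_far : forall k x, ~ near D (8 * hh k.+1) x -> w_ k.+1 x = w_ k x.

Let mD : measurable D. Proof. exact: open_measurable_rV. Qed.
Let mOm : measurable Om. Proof. exact: open_measurable_rV. Qed.
Let hk k : 0 < hh k. Proof. exact: hh_gt0. Qed.
Let mdeep e : measurable (deep D e).
Proof. by apply: measurable_closed; exact: closed_deep. Qed.
Let mR x k : measurable (Rset D kap M3 x (hh k)). Proof. exact: measurable_Rset. Qed.
Let RD x k : Rset D kap M3 x (hh k) `<=` D.
Proof. by move=> y [h _]; apply: deep_sub h; exact: mulr_gt0. Qed.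
Let mw_ k : measurable_fun setT (w_ k). Proof. exact: continuous_measurable_rV. Qed.

(** The kernel bound [Kc] times the volume (4 M3 h_k)^n of the window; the scale cancels. *)
Definition Qavg : R := (4 * M3 * kB / kap) ^+ n.

Lemma Qavg_ge0 : 0 <= Qavg.
Proof. by apply: exprn_ge0; rewrite divr_ge0 ?mulr_ge0 ?(ltW kap0) ?(ltW M30)// ltW// kB_gt0. Qed.

(** Jensen for the local average and then [schur] turn the pointwise bound into one in L^p; the
    powers p - 1 and 1 of the volume combine with the kernel bound to [Qavg]. *)
Lemma local_average p k X W : 1 <= p -> mu.-integrable D (EFin \o (fun y => f y `^ p)) ->
  measurable X -> measurable W -> W `<=` D ->
  (forall x, X x -> Om x /\ ((k == 0)%N || `[< near D (8 * hh k) x >])) ->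
  (forall x y, X x -> deep D (kap * hh k) y -> `|y - x| <= M3 * hh k -> W y) ->
  (\int[mu]_(x in X) (`|w_ k x| `^ p)%:E <=
   ((C * Qavg) `^ p)%:E * \int[mu]_(y in W) (f y `^ p)%:E)%E.
Proof.
move=> p1 Ip mX mW WD XOm XW.
have mfp : measurable_fun D (fun y => f y `^ p) by exact: rint_measurable Ip.
set v := (4 * (M3 * hh k)) ^+ n; set K := @Kc R n (kap * hh k).
have r0 : 0 < M3 * hh k by rewrite mulr_gt0.
have v0 : 0 < v by rewrite exprn_gt0// mulr_gt0.
have K0 : 0 <= K by apply: Kc_ge0; exact: mulr_gt0.
have p0 : 0 <= p by apply: le_trans p1.
have Kv : K * v = Qavg.
  rewrite /K /Kc /v /Qavg -exprMn; congr (_ ^+ _); field.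
  by rewrite !gt_eqF.
have AD : deep D (kap * hh k) `<=` D by apply: deep_sub; exact: mulr_gt0.
have mI := @measurable_local_integral R n (deep D (kap * hh k)) (M3 * hh k) (fun y => f y `^ p)
  (mdeep _) (measurable_funS mD AD mfp) (fun y => powR_ge0 _ _).
have CK0 : 0 <= (C * K) `^ p * v `^ (p - 1) by rewrite mulr_ge0 ?powR_ge0.
apply: (@le_trans _ _ (\int[mu]_(x in X) (((C * K) `^ p * v `^ (p - 1))%:E *
   \int[mu]_(y in deep D (kap * hh k) `&` ccube x (M3 * hh k)) (f y `^ p)%:E))%E).
  apply: ge0_le_integral => //.
  - apply: measurable_funS (measurableT) (@subsetT _ _) _.
    apply/measurable_EFinP; apply: (measurableT_comp (measurable_powR p)).
    by apply: (measurableT_comp (@normr_measurable R setT)); exact: mw_.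
  - by apply: measurable_funeM; apply: measurable_funS mI.
  move=> x Xx; have [Ox kx] := XOm x Xx.
  have IfR : mu.-integrable (Rset D kap M3 x (hh k)) (EFin \o f).
    exact: (integrableS mD (mR x k) (@RD x k) If).
  have IpR : mu.-integrable (Rset D kap M3 x (hh k)) (EFin \o (fun y => f y `^ p)).
    exact: (integrableS mD (mR x k) (@RD x k) Ip).
  rewrite -[X in (_ * X)%E]fineK; last exact: (integrable_fin_num (mR x k) IpR).
  rewrite -EFinM lee_fin.
  have vR : (mu (Rset D kap M3 x (hh k)) <= v%:E)%E.
    apply: le_trans (mu_ccube_le x r0); apply: le_measure; rewrite ?inE//.
      by apply: measurable_closed; exact: (@closed_ccube R n x _).
    by move=> y [].
  have J := powR_Rintegral_le (mR x k) v0 vR p1 f0 IfR IpR.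
  rewrite -mulrA; apply: le_trans (ler_wpM2l (powR_ge0 _ _) J).
  have I0 : 0 <= \int[mu]_(y in Rset D kap M3 x (hh k)) f y by exact: Rintegral_ge0.
  rewrite -powRM// ?mulr_ge0//; apply: ge0_ler_powR; rewrite ?nnegrE ?normr_ge0//.
    by rewrite !mulr_ge0.
  by rewrite -mulrA; exact: w_le.
rewrite ge0_integralZl_EFin//; last 2 first.
- by move=> x _; apply: integral_ge0 => y _; rewrite lee_fin powR_ge0.
- exact: measurable_funS mI.
have S := @schur R n (deep D (kap * hh k)) X W (M3 * hh k) (fun y => f y `^ p)
  (mdeep _) mX mW r0 (measurable_funS mD WD mfp) (fun y => powR_ge0 _ _) XW.
apply: le_trans (lee_wpmul2l _ S) _; first by rewrite lee_fin.
rewrite muleA -EFinM; apply: lee_wpmul2r.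
  by apply: integral_ge0 => y _; rewrite lee_fin powR_ge0.
rewrite lee_fin -/v -mulrA -(powR_pred p v0) -powRM ?mulr_ge0 ?(ltW v0)//.
by rewrite -mulrA Kv.
Qed.

Lemma open_near r : open (near D r).
Proof.
rewrite openE => x [y Dy yx]; apply: (@near_nbhs_ball _ _ _ x (r - `|y - x|)).
  by rewrite subr_gt0.
move=> z zx; exists y => //; rewrite -(subrKA x) (le_lt_trans (ler_normD _ _))//.
by rewrite distrC in zx; move: zx; rewrite ltrBrDl.
Qed.

Let mnear r : measurable (near D r).
Proof. by apply: open_measurable_rV; exact: open_near. Qed.

(* Off the closure of [D] the sequence is eventually constant. The value [0] on
   the rest of the boundary makes the nullity of the boundary irrelevant. *)
Definition glue (x : V) : R := if `[< D x >] then w x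
  else if `[< forall k, near D (8 * hh k) x >] then 0 else lim (w_ ^~ x @ \oo).

(** The points off [D] where the sequence is constant from index k on and not known to be so
    earlier. Zone 0 extends away from [D] without limit inside [Om]. *)
Definition zone k : set V := [set x | [/\ Om x, ~ D x,
  (k == 0)%N || `[< near D (8 * hh k) x >] & ~ near D (8 * hh k.+1) x]].

Lemma nearS k l x : (k <= l)%N -> near D (8 * hh l) x -> near D (8 * hh k) x.
Proof. by move=> kl; apply: near_le; rewrite ler_pM2l// hh_le. Qed.

Lemma w_stable k l x : ~ near D (8 * hh k.+1) x -> (k <= l)%N -> w_ l x = w_ k x.
Proof.
move=> nx; elim: l => [|l IH]; first by rewrite leqn0 => /eqP ->.
rewrite leq_eqVlt => /orP[/eqP ->//|]; rewrite ltnS => kl.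
by rewrite w_far ?IH// => h; apply: nx; apply: nearS h.
Qed.

Lemma glue_far k x : ~ D x -> ~ near D (8 * hh k.+1) x -> glue x = w_ k x.
Proof.
move=> nDx nx; have nA : ~ forall l, near D (8 * hh l) x by move=> h; exact: nx (h k.+1).
rewrite /glue asboolF// asboolF//.
apply: cvg_lim => //; apply: cvg_near_cst.
by exists k => // l /= kl; exact: w_stable.
Qed.

Lemma measurable_zone k : measurable (zone k).
Proof.
rewrite (_ : zone k = Om `&` ~` D `&` (if k is 0 then setT else near D (8 * hh k)) `&`
   ~` near D (8 * hh k.+1)).
  apply: measurableI; last exact: measurableC.
  apply: measurableI; last by case: (k).
  by apply: measurableI => //; exact: measurableC.
by apply/seteqP; split => x; case: (k) => [|k'] /=;
  [case=> ? ? _ ?|case=> ? ? /asboolP ? ?|case=> [[[? ?] _]] ?|case=> [[[? ?] ?]] ?]; do ?split => //; exact/asboolP.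
Qed.

Lemma trivIset_zone : trivIset setT zone.
Proof.
apply/trivIsetP => i j _ _.
wlog ij : i j / (i < j)%N.
  move=> h ij; have := ij; rewrite neq_ltn => /orP[l|l]; first exact: h.
  by rewrite setIC; apply: h => //; rewrite eq_sym.
move=> _; apply/seteqP; split => // x [[_ _ _ nx] [_ _ jx _]]; exfalso; apply: nx.
by case: j ij jx => // j ij /= /asboolP; exact: nearS.
Qed.

(** The points of [Om] on the boundary of [D]. *)
Definition limbo : set V := [set x | [/\ Om x, ~ D x & forall k, near D (8 * hh k) x]].

Lemma measurable_limbo : measurable limbo.
Proof.
rewrite (_ : limbo = Om `&` ~` D `&` \bigcap_k near D (8 * hh k)).
  apply: measurableI; first by apply: measurableI => //; exact: measurableC.
  exact: bigcap_measurableType.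
apply/seteqP; split => x; first by case=> Ox nD h; split => // k _; exact: h.
by case=> [[Ox nD] h]; split => // k; exact: h.
Qed.

Lemma outside_zones : Om `\` D = limbo `|` \bigcup_k zone k.
Proof.
apply/seteqP; split => [x [Ox nD]|x [[? ? _]|[k _ [? ? _ _]]]]; try by split.
have [h|/existsNP[k nk]] := pselect (forall k, near D (8 * hh k) x); first by left.
right; elim: k nk => [|k IH] nk.
  exists 0%N => //; split => // h; apply: nk; exact: nearS h.
have [kx|/IH//] := pselect (near D (8 * hh k) x).
by exists k => //; split => //; apply/orP; right; apply/asboolP.
Qed.

Lemma glue_limbo x : limbo x -> glue x = 0.
Proof. by move=> [_ nD h]; rewrite /glue asboolF// asboolT. Qed.

Lemma glue_zone k x : zone k x -> glue x = w_ k x.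
Proof. by move=> [_ nD _ nx]; exact: glue_far. Qed.

Lemma glue_in x : D x -> glue x = w x.
Proof. by move=> Dx; rewrite /glue asboolT. Qed.

Lemma measurable_glue : measurable_fun Om glue.
Proof.
rewrite (_ : Om = D `|` (limbo `|` \bigcup_k zone k)); last first.
  by rewrite -outside_zones setDUK.
have mz : measurable (\bigcup_k zone k).
  by apply: bigcup_measurable => k _; exact: measurable_zone.
apply/measurable_funU => //; first by apply: measurableU => //; exact: measurable_limbo.
split; first by apply: eq_measurable_fun mw => x; rewrite inE => /glue_in.
apply/measurable_funU => //; first exact: measurable_limbo.
split.
  apply: (eq_measurable_fun (cst (0 : R))); last exact: measurable_cst.
  by move=> x; rewrite inE => /glue_limbo.
apply/measurable_fun_bigcup => k; first exact: measurable_zone.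
apply: (eq_measurable_fun (w_ k)); last exact: measurable_funS (mw_ k).
by move=> x; rewrite inE => /glue_zone.
Qed.

(** The points of [D] that feed [zone k]: being within [M3 * hh k] of a point off [D], they cannot
    have depth [2 * M3 * hh k]. *)
Definition band k : set V := deep D (kap * hh k) `\` deep D (2 * M3 * hh k).

(** J levels earlier the depth [kap * hh] has grown to at least [2 * M3 * hh k]. So [band k] is
    disjoint from the points of that depth, and [sum_telescope] applies to the masses of the sets
    [deep D (kap * hh k)]. *)
Lemma band_sum p J K : 0 <= p -> 2 * M3 <= kap * 2 ^+ J ->
  mu.-integrable D (EFin \o (fun y => f y `^ p)) ->
  (\sum_(0 <= k < K) \int[mu]_(y in band k) (f y `^ p)%:E <=
   J%:R%:E * \int[mu]_(y in D) (f y `^ p)%:E)%E.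
Proof.
move=> p0 hJ Ip; pose g y := (f y `^ p)%:E.
have mg : measurable_fun D g by apply/measurable_EFinP; exact: rint_measurable Ip.
have g0 y : (0 <= g y)%E by rewrite lee_fin powR_ge0.
have dD k : deep D (kap * hh k) `<=` D by apply: deep_sub; exact: mulr_gt0.
have mb k : measurable (band k) by exact: measurableD.
have bD k : band k `<=` D by move=> y [/dD].
have fi A : measurable A -> A `<=` D -> (\int[mu]_(y in A) g y)%E \is a fin_num.
  by move=> mA AD; apply: (integrable_fin_num mA (integrableS mD mA AD Ip)).
have le A B : measurable A -> measurable B -> A `<=` B -> B `<=` D ->
    fine (\int[mu]_(y in A) g y)%E <= fine (\int[mu]_(y in B) g y)%E.
  move=> mA mB AB BD; rewrite fine_le ?fi//; first exact: subset_trans BD.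
  by apply: ge0_subset_integral => //; exact: measurable_funS mg.
rewrite big_mkord -(fineK (fi _ mD (@subset_refl _ D))).
rewrite (eq_bigr (fun k : 'I_K => (fine (\int[mu]_(y in band k) g y)%E)%:E)); last first.
  by move=> k _; rewrite fineK// fi.
rewrite sumEFin -EFinM lee_fin.
apply: (@sum_telescope R J (fun k => fine (\int[mu]_(y in band k) g y)%E)
  (fun k => fine (\int[mu]_(y in deep D (kap * hh k)) g y)%E) _ K).
  move=> k; rewrite fine_ge0 ?le//; exact: integral_ge0.
move=> k; case: ifPn => [_|].
  by rewrite addr0 le// => y [].
rewrite -leqNgt => Jk.
have sub : deep D (kap * hh (k - J)) `<=` deep D (2 * M3 * hh k).
  apply: deep_le; apply: (@le_trans _ _ (kap * 2 ^+ J * hh k)).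
    by rewrite ler_pM2r.
  rewrite -mulrA ler_pM2l// (_ : hh (k - J) = 2 ^+ J * hh k)//.
  have E2 : 2 ^+ k = 2 ^+ (k - J) * 2 ^+ J :> R by rewrite -exprD subnK.
  by rewrite !hhE E2; field; rewrite !expf_neq0// pnatr_eq0.
have sub2 : deep D (kap * hh (k - J)) `<=` deep D (kap * hh k).
  by apply: deep_le; rewrite ler_pM2l// hh_le// leq_subr.
rewrite -fineD ?fi// -ge0_integral_setU//.
- apply: le => //; first exact: measurableU.
  by move=> y [[]|/sub2].
- by apply: measurable_funS mg => // y [/bD|/dD].
- by apply/disj_setPS => y [[_ h] /sub].
Qed.

Definition glue_const J p : R := 1 + (C * Qavg) `^ p * J%:R.

(** [D] contributes the 1 in the constant, [limbo] nothing, and each zone the mass on its band, of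
    which at most J overlap. *)
Lemma glue_Lp J p : 1 <= p -> 2 * M3 <= kap * 2 ^+ J ->
  mu.-integrable D (EFin \o (fun y => f y `^ p)) ->
  (\int[mu]_(x in Om) (`|glue x| `^ p)%:E <=
   (glue_const J p)%:E * \int[mu]_(y in D) (f y `^ p)%:E)%E.
Proof.
move=> p1 hJ Ip; have p0 : 0 <= p by apply: le_trans p1.
have mz : measurable (\bigcup_k zone k).
  by apply: bigcup_measurable => k _; exact: measurable_zone.
pose G x := (`|glue x| `^ p)%:E.
have mG : measurable_fun Om G.
  apply/measurable_EFinP; apply: (measurableT_comp (measurable_powR p)).
  by apply: (measurableT_comp (@normr_measurable R setT)); exact: measurable_glue.
have G0 x : (0 <= G x)%E by rewrite lee_fin powR_ge0.
have OmE : Om = D `|` (limbo `|` \bigcup_k zone k) by rewrite -outside_zones setDUK.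
have lzO : limbo `|` \bigcup_k zone k `<=` Om by rewrite -outside_zones; exact: subDsetl.
have mlz : measurable (limbo `|` \bigcup_k zone k).
  by apply: measurableU => //; exact: measurable_limbo.
have HD : (\int[mu]_(x in D) G x <= \int[mu]_(y in D) (f y `^ p)%:E)%E.
  apply: ge0_le_integral => //.
  - exact: measurable_funS mG.
  - by apply/measurable_EFinP; exact: rint_measurable Ip.
  move=> x Dx; rewrite lee_fin glue_in//; apply: ge0_ler_powR; rewrite ?nnegrE//.
  exact: wf.
have HZ k : (\int[mu]_(x in zone k) G x <=
    ((C * Qavg) `^ p)%:E * \int[mu]_(y in band k) (f y `^ p)%:E)%E.
  rewrite (eq_integral (fun x => (`|w_ k x| `^ p)%:E)); last first.
    by move=> x; rewrite inE => /glue_zone; rewrite /G => ->.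
  apply: local_average => //.
  - exact: measurable_zone.
  - exact: measurableD.
  - by move=> y [h _]; apply: deep_sub h; exact: mulr_gt0.
  - by move=> x [].
  move=> x y [_ nDx _ _] dy yx; split => // dy2; apply: nDx; apply: dy2.
  apply/rV_ballP; apply: le_lt_trans yx _; rewrite -mulrA ltr_pMl ?mulr_gt0//.
  by rewrite (ltr_nat R 1 2).
rewrite {1}OmE ge0_integral_setU//; last 2 first.
- by rewrite -OmE.
- by apply/disj_setPS => y [Dy]; rewrite -outside_zones => -[].
rewrite ge0_integral_setU//; last 3 first.
- exact: measurable_limbo.
- by apply: measurable_funS mG.
- by apply/disj_setPS => y [[_ _ h] [k _ [_ _ _ nk]]]; exact: nk (h k.+1).
rewrite (@integral0_eq _ _ _ mu limbo G) ?add0e; last first.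
  by move=> x lx; rewrite /G glue_limbo// normr0 powR0// gt_eqF// (lt_le_trans _ p1).
rewrite ge0_integral_bigcup//; last 3 first.
- exact: measurable_zone.
- by apply: measurable_funS mG => // x h; apply: lzO; right.
- exact: trivIset_zone.
rewrite /glue_const EFinD muleDl//; last first.
  exact: (integrable_fin_num mD Ip).
rewrite mul1e; apply: leeD => //.
apply: lime_le; first by apply: is_cvg_nneseries => k _ _; exact: integral_ge0.
apply: nearW => K.
apply: (@le_trans _ _ (\sum_(0 <= k < K) ((C * Qavg) `^ p)%:E * \int[mu]_(y in band k) (f y `^ p)%:E)%E).
  by apply: lee_sum.
rewrite -ge0_sume_distrr; last first.
  by move=> k _; apply: integral_ge0 => y _; rewrite lee_fin powR_ge0.
rewrite EFinM -muleA; apply: lee_wpmul2l; first by rewrite lee_fin powR_ge0.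
exact: band_sum.
Qed.

Variables (A0 : nat).
Hypothesis HG : forall x, Om x -> `|x| < h0 * A0%:R - h0.

Let fin_Om : (mu Om < +oo)%E.
Proof.
pose L := `|h0 * A0%:R - h0| + 1; have L0 : 0 < L by rewrite ltr_pwDr.
apply: le_lt_trans (le_lt_trans (mu_ccube_le 0 L0) (ltry _)).
apply: le_measure; rewrite ?inE//.
  by apply: measurable_closed; exact: (@closed_ccube R n 0 L).
move=> x /HG h; rewrite /ccube /= subr0; apply: ltW (lt_trans h _).
by rewrite (le_lt_trans (ler_norm _))// ltrDl.
Qed.

Let int_cst (c : R) : mu.-integrable Om (EFin \o cst c).
Proof.
apply/integrableP; split; first exact/measurable_EFinP.
rewrite (_ : (fun x => _) = cst `|c|%:E)// integral_cst//.
by rewrite lte_mul_pinfty ?lee_fin.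
Qed.

Lemma integrable_continuous_bounded (g : V -> R) : continuous g -> mu.-integrable Om (EFin \o g).
Proof.
move=> cg; have [B B0 HB] := bounded_on_ccube 0 `|h0 * A0%:R - h0| cg.
apply: (@rint_le _ _ _ mu Om mOm g (cst B)) => //.
  by apply: measurable_funTS; exact: continuous_measurable_rV.
move=> x /HG h; apply: HB; rewrite /ccube /= subr0.
by apply: ltW (lt_le_trans h _); exact: ler_norm.
Qed.

Let Iw_ k : mu.-integrable Om (EFin \o w_ k).
Proof. exact: integrable_continuous_bounded. Qed.

Let Iw : mu.-integrable D (EFin \o w).
Proof. exact: (rint_le mD mw wf If). Qed.

Let If1 : mu.-integrable D (EFin \o (fun y => f y `^ 1)).
Proof. by apply: eq_rint If => // y _; rewrite powRr1. Qed.

Lemma local_average1 k X W : measurable X -> measurable W -> W `<=` D ->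
  (forall x, X x -> Om x /\ ((k == 0)%N || `[< near D (8 * hh k) x >])) ->
  (forall x y, X x -> deep D (kap * hh k) y -> `|y - x| <= M3 * hh k -> W y) ->
  \int[mu]_(x in X) `|w_ k x| <= C * Qavg * \int[mu]_(y in W) f y.
Proof.
move=> mX mW WD XOm XW; have := local_average (lexx 1) If1 mX mW WD XOm XW.
have XO : X `<=` Om by move=> x /XOm[].
have IX : mu.-integrable X (EFin \o (fun x => `|w_ k x|)).
  by apply: rint_norm => //; exact: (integrableS mOm mX XO (Iw_ k)).
have IW : mu.-integrable W (EFin \o f) by exact: (integrableS mD mW WD If).
rewrite (powRr1 (mulr_ge0 C0 Qavg_ge0)).
rewrite (eq_integral (EFin \o (fun x => `|w_ k x|))) => [|x _]; last by rewrite /= powRr1.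
rewrite [X in (_ <= _ * X)%E](eq_integral (EFin \o f)) => [|x _]; last by rewrite /= powRr1.
rewrite -(fineK (integrable_fin_num mX IX)) -(fineK (integrable_fin_num mW IW)).
by rewrite -EFinM lee_fin.
Qed.

Lemma glue_integrable : mu.-integrable Om (EFin \o glue).
Proof.
have [J HJ] : exists J, 2 * M3 <= kap * 2 ^+ J.
  exists (Num.truncn (2 * M3 / kap)).+1; rewrite -ler_pdivrMl// mulrC.
  have h1 : 2 * M3 / kap <= (Num.truncn (2 * M3 / kap)).+1%:R by apply: ltW; exact: truncnS_gt.
  by apply: le_trans h1 _; rewrite -natrX ler_nat ltnW// ltn_expl.
apply/integrableP; split; first by apply/measurable_EFinP; exact: measurable_glue.
rewrite (eq_integral (fun x => (`|glue x| `^ 1)%:E)) => [|x _]; last by rewrite /= powRr1.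
apply: le_lt_trans (glue_Lp (lexx 1) HJ If1) _.
by rewrite -(fineK (integrable_fin_num mD If1)) -EFinM ltry.
Qed.

Lemma vanishing (E : set V) (g : V -> R) (A : nat -> set V) eps : measurable E ->
  mu.-integrable E (EFin \o g) -> (forall x, 0 <= g x) -> (forall k, measurable (A k)) ->
  (forall x, E x -> g x = 0 \/ exists K, forall k, (K <= k)%N -> ~ A k x) -> 0 < eps ->
  \forall k \near \oo, \int[mu]_(x in E `&` A k) g x < eps.
Proof.
move=> mE Ig g0 mA H e0.
pose F k x := (g x * \1_(A k) x)%:E.
have mg := rint_measurable Ig.
have mF k : measurable_fun E (F k).
  by apply/measurable_EFinP; apply: measurable_funM => //; exact: measurable_indic.
have FA k : \int[mu]_(x in E `&` A k) g x = fine (\int[mu]_(x in E) F k x)%E.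
  rewrite /Rintegral integral_mkcondr; congr fine; apply: eq_integral => x _.
  by rewrite /F patchE indicE; case: (x \in A k); rewrite ?mulr1 ?mulr0.
have cF : \forall x \ae mu, E x -> F k x @[k --> \oo] --> (0 : \bar R)%E.
  apply: aeW => x Ex; apply: cvg_near_cst; have [gx|[K HK]] := H x Ex.
    by apply: nearW => k; rewrite /F gx mul0r.
  by exists K => // k /= Kk; rewrite /F indicE memNset ?mulr0//; exact: HK.
have dF : \forall x \ae mu, forall k, E x -> (`|F k x| <= (EFin \o g) x)%E.
  apply: aeW => x k Ex; rewrite /F /= lee_fin ger0_norm ?mulr_ge0// ler_piMr//.
have [_ _ L] := @dominated_convergence _ _ _ mu E mE F (cst 0%E) (EFin \o g) mF
  (measurable_cst _) cF Ig dF.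
rewrite integral0 in L.
have : fine (\int[mu]_(x in E) F k x)%E @[k --> \oo] --> (0 : R) by exact: (@fine_cvg _ _ _ _ _ 0 L).
move=> /cvgrPdist_lt/(_ _ e0); apply: filterS => k; rewrite sub0r normrN FA.
exact: le_lt_trans (ler_norm _).
Qed.

Lemma deep_exhausts x : D x -> exists2 e, 0 < e & deep D e x.
Proof. by move=> Dx; have /nbhs_ballP[e e0 h] := open_nbhs_nbhs (conj oD Dx); exists e. Qed.

Lemma hh_small e : 0 < e -> exists K, forall k, (K <= k)%N -> hh k <= e.
Proof.
move=> e0; exists (Num.truncn (h0 / e)).+1 => k Kk; apply: le_trans (hh_le h00 Kk) _.
rewrite hhE ler_pdivrMr ?exprn_gt0// -ler_pdivrMl// mulrC.
have h1 : h0 / e <= (Num.truncn (h0 / e)).+1%:R by apply: ltW; exact: truncnS_gt.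
by apply: le_trans h1 _; rewrite -natrX ler_nat ltnW// ltn_expl.
Qed.

Lemma tail_small eps : 0 < eps -> exists2 e, 0 < e & \int[mu]_(y in D `\` deep D e) f y < eps.
Proof.
move=> eps0; have mA k : measurable (~` deep D (hh k)) by exact: measurableC.
have HA x : D x -> f x = 0 \/ exists K, forall k, (K <= k)%N -> ~ (~` deep D (hh k)) x.
  move=> Dx; right; have [e e0 ed] := deep_exhausts Dx.
  have [K HK] := hh_small e0; exists K => k Kk nd; apply: nd; apply: deep_le ed.
  exact: HK.
have [K _ /(_ K (leqnn K)) h] := vanishing mD If f0 mA HA eps0.
by exists (hh K) => //; rewrite setDE.
Qed.

Definition cut_const : R := 1 + 3 ^+ n * kB ^+ n.

Lemma cutoff e psi : 0 < e -> test_function Om psi -> exists chi : V -> R,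
  [/\ csm chi, forall x, Om x -> deep D (e / 2) x -> chi x = 1,
   forall x, `|1 - chi x| <= cut_const & test_function D (fun x => chi x * psi x)].
Proof.
move=> e0 tpsi; have e8 : 0 < e / 8 by rewrite divr_gt0.
have [l /(_ l (leqnn l)) hl] := hh_small e8.
pose S (q : @grid n A0 l) := `[< deep D (2 * hh l) (node h0 q) >].
pose chi x := \sum_(q | S q) phi h0 q x.
have cchi : csm chi by move=> j; apply: ck_sum => q _; exact: csm_phi.
exists chi; split => //.
- move=> x Ox dx; rewrite -(@sum_phi R n h0 A0 h00 l x (ltW (HG Ox))) /chi [RHS](bigID S) /=.
  rewrite [X in _ = _ + X]big1 ?addr0// => q nS; apply/eqP; apply: contraNT nS => /phi_supp xq.
  apply/asboolP; apply: deep_le (deep_shift (y := node h0 q) dx).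
  by have := xq h00; rewrite distrC; move: hl; set p := `|_|; lra.
- move=> x; rewrite (le_trans (ler_normB _ _))// normr1 lerD2l.
  rewrite (le_trans (ler_norm_sum _ _ _))//.
  apply: (@le_trans _ _ (\sum_(q : @grid n A0 l) (`|x - node h0 q| < hh l)%R%:R * kB ^+ n)).
    rewrite [leRHS](bigID S) /= -[leLHS]addr0; apply: lerD; last first.
      by apply: sumr_ge0 => q _; rewrite mulr_ge0// exprn_ge0// ltW// kB_gt0.
    apply: ler_sum => q _; case: ltP => xq /=.
      by rewrite mul1r; apply: prodf_le => i t; exact: kB_tau.
    rewrite mul0r (_ : phi h0 q x = 0) ?normr0//; apply/eqP.
    by apply: contraTT xq => /(phi_supp h00); rewrite -ltNge.
  rewrite -mulr_suml ler_wpM2r ?node_count// exprn_ge0// ltW// kB_gt0//.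
have [_ cK KD] := tpsi.
apply: (@test_functionI _ _ D _ _ _ (@compact_closedI _ _ _ cK (closed_deep (D := D) (e := hh l)))).
- by apply: csmM => //; exact: test_function_csm tpsi.
- by move=> y [_]; apply: deep_sub.
- move=> x; rewrite mulf_eq0 negb_or => /andP[cx px]; split; first exact: subset_closure.
  have [q Sq xq] : exists2 q, S q & phi h0 q x != 0.
    apply: contrapT => no; move: cx; rewrite /chi big1 ?eqxx// => q Sq.
    by apply/eqP/negPn/negP => h; apply: no; exists q.
  have := phi_supp h00 xq => {}xq; move: Sq => /asboolP/(deep_shift (y := x)).
  by apply: deep_le; move: xq; set p := `|_|; lra.
Qed.

Hypothesis w_cvg : forall theta, test_function D theta ->
  (fun k => \int[mu]_(x in D) (w_ k x * theta x)) @ \oo --> \int[mu]_(x in D) (w x * theta x).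

Let mO_D : measurable (Om `\` D). Proof. exact: measurableD. Qed.

Let glue_tail eps : 0 < eps -> \forall k \near \oo,
  \int[mu]_(x in (Om `\` D) `&` near D (8 * hh k.+1)) `|glue x| < eps.
Proof.
move=> eps0; apply: (@vanishing (Om `\` D) (fun x => `|glue x|)) => //.
  apply: rint_norm => //; apply: (integrableS mOm mO_D _ glue_integrable).
  exact: subDsetl.
move=> x [Ox nD].
have [h|/existsNP[k nk]] := pselect (forall k, near D (8 * hh k) x).
  by left; rewrite glue_limbo ?normr0.
by right; exists k => l kl h; apply: nk; apply: nearS h; exact: leqW.
Qed.

(** Off [D] the sequence differs from its limit only within 8 h_(k+1) of [D]. There [w_ k] is
    controlled by the mass of [f] at depth less than [e], and [glue] by its own integral over a
    shrinking set. *)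
Let out_bound k e : 2 * M3 * hh k <= e ->
  \int[mu]_(x in Om `\` D) `|w_ k x - glue x| <=
  C * Qavg * \int[mu]_(y in D `\` deep D e) f y +
  \int[mu]_(x in (Om `\` D) `&` near D (8 * hh k.+1)) `|glue x|.
Proof.
move=> ke; set X := (Om `\` D) `&` _.
have mX : measurable X by apply: measurableI.
have XO : X `<=` Om by move=> x [[]].
have Ig := integrableS mOm mX XO glue_integrable.
have IwX := integrableS mOm mX XO (Iw_ k).
have -> : \int[mu]_(x in Om `\` D) `|w_ k x - glue x| = \int[mu]_(x in X) `|w_ k x - glue x|.
  rewrite [in RHS]Rintegral_mkcondr; apply: eq_Rintegral => x; rewrite inE => -[Ox nD].
  rewrite patchE; case: ifPn => // /negP; rewrite inE => nx.
  by rewrite (glue_far nD nx) subrr normr0.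
apply: (@le_trans _ _ (\int[mu]_(x in X) (`|w_ k x| + `|glue x|))).
  apply: le_Rintegral => //; first by apply: rint_norm => //; exact: rintB.
    by apply: rintD => //; exact: rint_norm.
  by move=> x _; exact: ler_normB.
rewrite RintegralD//; [|exact: rint_norm|exact: rint_norm].
rewrite lerD2r; apply: local_average1 => //; first exact: measurableD.
- move=> x [[Ox _] nx]; split => //; apply/orP; right; apply/asboolP; exact: nearS nx.
move=> x y [[_ nDx] _] dy yx; split; first by apply: deep_sub dy; exact: mulr_gt0.
move=> de; apply: nDx; apply: de; apply/rV_ballP; apply: le_lt_trans yx _.
apply: lt_le_trans ke; rewrite -mulrA ltr_pMl ?mulr_gt0//.
by rewrite (ltr_nat R 1 2).
Qed.

(** The averages reach at most [M3 * hh k] <= e / 2 from [x], so that from depth less than e / 2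
    they only see depth less than [e]. *)
Let in_bound k e : 0 < e -> M3 * hh k <= e / 2 ->
  \int[mu]_(x in D `\` deep D (e / 2)) (`|w_ k x| + `|w x|) <=
  (C * Qavg + 1) * \int[mu]_(y in D `\` deep D e) f y.
Proof.
move=> e0 ke; set X := D `\` deep D (e / 2); set W := D `\` deep D e.
have mX : measurable X by exact: measurableD.
have mW : measurable W by exact: measurableD.
have XD : X `<=` D by exact: subDsetl.
have WD : W `<=` D by exact: subDsetl.
have XW : X `<=` W.
  by move=> x [Dx nx]; split => // dx; apply: nx; apply: deep_le dx; move: e0; lra.
have IwX := integrableS mOm mX (subset_trans XD DOm) (Iw_ k).
have IwX' := integrableS mD mX XD Iw.
have IfW := integrableS mD mW WD If.
have IfX := integrableS mD mX XD If.
rewrite RintegralD//; [|exact: rint_norm|exact: rint_norm].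
rewrite mulrDl mul1r lerD//.
  apply: local_average1 => //.
    move=> x [Dx _]; split; first exact: DOm.
    by apply/orP; right; apply/asboolP; exists x => //; rewrite subrr normr0 mulr_gt0.
  move=> x y [Dx nx] dy yx; split; first by apply: deep_sub dy; exact: mulr_gt0.
  move=> dye; apply: nx; apply: deep_le (deep_shift (y := x) dye).
  by rewrite distrC; move: yx ke; set p := `|_|; lra.
apply: (@le_trans _ _ (\int[mu]_(x in X) f x)).
  by apply: le_Rintegral => //; [exact: rint_norm|move=> x /XD; exact: wf].
rewrite /Rintegral fine_le ?(integrable_fin_num mX IfX) ?(integrable_fin_num mW IfW)//.
apply: ge0_subset_integral => //; last by move=> y _; rewrite lee_fin.
by apply/measurable_EFinP; exact: rint_measurable IfW.
Qed.

(* Inside [D] away from its boundary the convergence is tested against [w_cvg];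
   the rest is controlled by the mass of [f] near the boundary. *)
Lemma glue_weak_limit psi : test_function Om psi ->
  (fun k => \int[mu]_(x in Om) (w_ k x * psi x)) @ \oo -->
  \int[mu]_(x in Om) (glue x * psi x).
Proof.
move=> tpsi; have [B B0 HB] := test_function_bounded [::] tpsi; rewrite /= in HB.
have cpsi : continuous psi by exact: (test_function_continuous (s := [::]) tpsi).
have mpsi : measurable_fun setT psi by exact: continuous_measurable_rV.
have K0 : 0 <= kB ^+ n :> R by rewrite exprn_ge0// ltW// kB_gt0.
have cc0 : 0 < cut_const by rewrite /cut_const ltr_wpDr// mulr_ge0// exprn_ge0.
have Q0 := Qavg_ge0; have CQ0 : 0 <= C * Qavg by rewrite mulr_ge0.
apply/cvgrPdist_le => eps eps0.
(* [T] collects the factors of the tail in the three error terms, so that with [dl] they add up to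
   eps in [glue_arith]. *)
pose T := (cut_const + 2) * B * (C * Qavg + 1).
have T0 : 0 < T.
  apply: mulr_gt0; first by apply: mulr_gt0 => //; apply: addr_gt0.
  exact: ltr_wpDl.
pose dl := eps / 2 / T; have dl0 : 0 < dl by rewrite !divr_gt0.
have [e e0 He] := tail_small dl0.
have [chi [cchi chi1 chib tchi]] := cutoff e0 tpsi.
have eM : 0 < e / (2 * M3) by rewrite divr_gt0// mulr_gt0.
have [K HK] := hh_small eM.
have GT := glue_tail dl0.
have WC : \forall k \near \oo, `|\int[mu]_(x in D) (w x * (chi x * psi x)) -
    \int[mu]_(x in D) (w_ k x * (chi x * psi x))| <= eps / 2.
  have e2 : 0 < eps / 2 by rewrite divr_gt0.
  by have /cvgrPdist_le/(_ _ e2) := w_cvg tchi.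
have mchi : measurable_fun setT chi by apply: continuous_measurable_rV; exact: (ck_continuous (cchi 0%N)).
have chiB x : `|chi x| <= 1 + cut_const.
  by rewrite -(subKr 1 (chi x)) (le_trans (ler_normB _ _))// normr1 lerD2l.
near=> k.
have kK : (K <= k)%N by near: k; exact: nbhs_infty_ge.
have hke : 2 * M3 * hh k <= e.
  by rewrite mulrC -ler_pdivlMr ?mulr_gt0//; exact: HK.
have hke2 : M3 * hh k <= e / 2 by move: hke; rewrite -mulrA; set p := M3 * _; lra.
have gt : \int[mu]_(x in (Om `\` D) `&` near D (8 * hh k.+1)) `|glue x| < dl by near: k.
have wc : `|\int[mu]_(x in D) (w x * (chi x * psi x)) -
    \int[mu]_(x in D) (w_ k x * (chi x * psi x))| <= eps / 2 by near: k.
have Ig := glue_integrable.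
have IMd S (g : V -> R) (b : V -> R) c : measurable S -> mu.-integrable S (EFin \o g) ->
    measurable_fun setT b -> (forall x, `|b x| <= c) ->
    mu.-integrable S (EFin \o (fun x => g x * b x)).
  move=> mS IgS mb bc; apply: (@rintM _ _ _ mu S mS g b c) => //.
  exact: measurable_funTS.
have IwO := Iw_ k.
have IwD : mu.-integrable D (EFin \o w_ k) by exact: (integrableS mOm mD DOm IwO).
have IgD : mu.-integrable D (EFin \o glue) by exact: (integrableS mOm mD DOm Ig).
have IwX : mu.-integrable (Om `\` D) (EFin \o w_ k).
  by apply: (integrableS mOm mO_D _ IwO); exact: subDsetl.
have IgX : mu.-integrable (Om `\` D) (EFin \o glue).
  by apply: (integrableS mOm mO_D _ Ig); exact: subDsetl.
have IdX : mu.-integrable (Om `\` D) (EFin \o (fun x => w_ k x - glue x)) by exact: rintB.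
have Id : mu.-integrable D (EFin \o (fun x => w_ k x - w x)) by exact: rintB.
have IdO : mu.-integrable Om (EFin \o (fun x => w_ k x - glue x)) by exact: rintB.
have mchip : measurable_fun setT (fun x => chi x * psi x) by exact: measurable_funM.
have mchim : measurable_fun setT (fun x => (1 - chi x) * psi x).
  by apply: measurable_funM => //; apply: measurable_funB.
have bchip x : `|chi x * psi x| <= (1 + cut_const) * B by rewrite normrM ler_pM.
have bchim x : `|(1 - chi x) * psi x| <= cut_const * B by rewrite normrM ler_pM.
(* On [D] the test function is split by [chi]: the first part has compact support in [D] and is left
   to [w_cvg], the second lives at depth less than e / 2. *)
have E : \int[mu]_(x in Om) (w_ k x * psi x) - \int[mu]_(x in Om) (glue x * psi x) =
    \int[mu]_(x in D) ((w_ k x - w x) * (chi x * psi x)) +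
    \int[mu]_(x in D) ((w_ k x - w x) * ((1 - chi x) * psi x)) +
    \int[mu]_(x in Om `\` D) ((w_ k x - glue x) * psi x).
  rewrite -RintegralB//; [|exact: IMd HB|exact: IMd HB].
  rewrite -RintegralD//; [|exact: IMd bchip|exact: IMd bchim].
  transitivity (\int[mu]_(x in Om) ((w_ k x - glue x) * psi x)).
    by apply: eq_Rintegral => x _; rewrite mulrBl.
  rewrite -{1}(setDUK DOm) Rintegral_setU//; last 2 first.
  - by rewrite setDUK//; exact: IMd HB.
  - by apply/disj_setPS => x [Dx [_]].
  congr (_ + _); apply: eq_Rintegral => x; rewrite inE => Dx.
  by rewrite glue_in//; ring.
have B1 : `|\int[mu]_(x in D) ((w_ k x - w x) * (chi x * psi x))| <= eps / 2.
  rewrite (_ : \int[mu]_(x in D) _ =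
      \int[mu]_(x in D) (w_ k x * (chi x * psi x) - w x * (chi x * psi x))).
    rewrite RintegralB//; [|exact: IMd bchip|exact: IMd bchip].
    by rewrite distrC.
  by apply: eq_Rintegral => x _; rewrite mulrBl.
have B2 : `|\int[mu]_(x in D) ((w_ k x - w x) * ((1 - chi x) * psi x))| <=
    cut_const * B * ((C * Qavg + 1) * dl).
  set X := D `\` deep D (e / 2).
  have mX : measurable X by exact: measurableD.
  have XD : X `<=` D by exact: subDsetl.
  have IX := integrableS mD mX XD Id.
  rewrite (_ : \int[mu]_(x in D) _ = \int[mu]_(x in X) ((w_ k x - w x) * ((1 - chi x) * psi x))).
    apply: (le_trans (le_normr_Rintegral mX _)); first exact: IMd bchim.
    apply: (@le_trans _ _ (\int[mu]_(x in X) (cut_const * B * (`|w_ k x| + `|w x|)))).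
      have IwX2 := integrableS mD mX XD IwD; have IwX3 := integrableS mD mX XD Iw.
      apply: le_Rintegral => //.
      - by apply: rint_norm => //; exact: IMd bchim.
      - by apply: rintZ => //; apply: rintD => //; exact: rint_norm.
      move=> x _; rewrite normrM mulrC; apply: ler_pM => //; exact: ler_normB.
    rewrite RintegralZl//; last first.
      by apply: rintD => //; apply: rint_norm => //; [exact: integrableS IwD|exact: integrableS Iw].
    rewrite ler_pM2l ?mulr_gt0//; apply: le_trans (in_bound e0 hke2) _.
    by apply: ler_wpM2l; [rewrite addr_ge0|exact: ltW].
  rewrite /X setDE [in RHS]Rintegral_mkcondr; apply: eq_Rintegral => x; rewrite inE => Dx.
  rewrite patchE; case: ifPn => // /negP; rewrite inE => /contrapT dx.
  by rewrite chi1 ?subrr ?mul0r ?mulr0//; exact: DOm.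
have B3 : `|\int[mu]_(x in Om `\` D) ((w_ k x - glue x) * psi x)| <= B * (C * Qavg * dl + dl).
  apply: (le_trans (le_normr_Rintegral mO_D _)); first exact: IMd HB.
  apply: (@le_trans _ _ (\int[mu]_(x in Om `\` D) (B * `|w_ k x - glue x|))).
    apply: le_Rintegral => //.
    - by apply: rint_norm => //; exact: IMd HB.
    - by apply: rintZ => //; exact: rint_norm.
    by move=> x _; rewrite normrM mulrC ler_wpM2r.
  rewrite RintegralZl//; last exact: rint_norm.
  rewrite ler_pM2l//; apply: le_trans (out_bound hke) _; apply: lerD; last exact: ltW.
  by apply: ler_wpM2l => //; exact: ltW.
rewrite distrC E (le_trans (ler_normD _ _))//.
apply: le_trans (lerD (le_trans (ler_normD _ _) (lerD B1 B2)) B3) _.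
have Tdl : T * dl = eps / 2 by rewrite /dl mulrCA mulfV ?mulr1// gt_eqF.
exact: (glue_arith (ltW B0) CQ0 (ltW dl0) Tdl).
Unshelve. all: by end_near.
Qed.

End gluing.

(** * Weak convergence inside the domain *)

Opaque partial kB tau sigma dtau ddtau.

Section bump_integral.
Context {R : realType} {n : nat}.
Local Notation V := 'rV[R]_n.
Local Notation mu := (@lebesgue_rV R n).
Implicit Types (a x : V) (h : R).

Definition hcell a h : set V := [set x | forall i, x 0 i \in `[a 0 i, a 0 i + h[].

Lemma measurable_hcell a h : measurable (hcell a h).
Proof.
rewrite (_ : hcell a h = \big[setI/setT]_(i < n) (rV_coord i @^-1` `[a 0 i, a 0 i + h[%classic)).
  apply: bigsetI_measurable => i _; rewrite -[X in measurable X]setTI.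
  by apply: measurable_rV_coord => //; exact: measurable_itv.
rewrite -bigcap_seq; apply/seteqP; split => [x /= H i _ //=|x H i]; first exact: H.
by apply: (H i); rewrite /= mem_index_enum.
Qed.

Lemma mu_hcell a h : 0 < h -> mu (hcell a h) = (h ^+ n)%:E.
Proof.
move=> h0; rewrite /hcell (@lebesgue_rV_box R n (fun i => [set` `[a 0 i, a 0 i + h[])); last first.
  by move=> i; exact: measurable_itv.
under eq_bigr do rewrite lebesgue_measure_itv /= lte_fin ltrDl h0 -EFinD addrAC subrr add0r.
by rewrite prodEFin prodr_const card_ord.
Qed.

Lemma tau_pair (t : R) : 0 <= t -> t < 1 -> tau t + tau (t - 1) = 1.
Proof.
move=> t0 t1; have E : \sum_(j < 3) tau (t + 1 - j%:R) = tau (t + 1) + tau t + tau (t - 1).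
  have t2 : t + 1 - 2%:R = t - 1 by lra.
  by rewrite big_ord_recr big_ord_recr big_ord_recr big_ord0 /= add0r subr0 addrK t2.
have Z : tau (t + 1) = 0 by apply: supp1_tau; rewrite ger0_norm ?lerDr// addr_ge0.
rewrite Z add0r in E; rewrite -E; apply: sum_tau; first by rewrite lerDr.
by move: t1; lra.
Qed.

Lemma smo_bphi_cont a h : continuous (bphi a h).
Proof. exact: (ck_continuous (csm_bphi a h 0%N)). Qed.

(* The cells around the support of the bump, translated to a single cell, turn
   the integral into that of a partition of unity. *)
Lemma int_bphi a h : 0 < h -> \int[mu]_x bphi a h x = h ^+ n.
Proof.
move=> h0; pose s (b : {ffun 'I_n -> bool}) : V := \row_i (if b i then - h else 0).
have mB := measurable_hcell a h.
have supp x i : bphi a h x != 0 -> - h < x 0 i - a 0 i < h.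
  move=> /prodf_neq0/(_ i) H; rewrite -ltr_norml ltNge; apply: contraNN H => H.
  by rewrite sc_supp//; exact: supp1_tau.
have E1 x : bphi a h x = \sum_b bphi a h x * \1_(hcell a h) (x - s b).
  have [->|/supp sx] := eqVneq (bphi a h x) 0; first by rewrite big1// => b _; rewrite mul0r.
  rewrite -mulr_sumr -[LHS]mulr1; congr (_ * _).
  pose F (i : 'I_n) (c : bool) : R :=
    (x 0 i - (if c then - h else 0) \in `[a 0 i, a 0 i + h[)%:R.
  rewrite (eq_bigr (fun b : {ffun 'I_n -> bool} => \prod_i F i (b i))).
    rewrite -(bigA_distr_bigA F) big1// => i _; rewrite big_bool /F /= !in_itv /= opprK subr0.
    move: (sx i) => /andP[s1 s2]; case: (leP (a 0 i) (x 0 i)) => ax /=.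
      have -> : (x 0 i + h < a 0 i + h) = false by apply/negbTE; rewrite -leNgt lerD2r.
      by rewrite andbF add0r (_ : x 0 i < a 0 i + h = true)//; move: s2; rewrite ltrBlDl.
    have -> : (a 0 i <= x 0 i + h) by move: s1; lra.
    by rewrite ltrD2r ax addr0.
  move=> b _; rewrite indicE; case: (boolP (_ \in _)) => [/set_mem xB|nxB].
    by rewrite big1// => i _; rewrite /F; have := xB i; rewrite !mxE => ->.
  move/negP: nxB; rewrite inE => /existsNP[i ni]; rewrite (bigD1 i)//= /F.
  by move: ni; rewrite !mxE => /negP/negbTE ->; rewrite mul0r.
have cb : continuous (bphi a h) by exact: smo_bphi_cont.
have Ib : mu.-integrable setT (EFin \o bphi a h).
  apply: (@integrable_bsupp _ _ _ (`|a| + h)) => // x xr; apply/eqP/negPn/negP => H.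
  have := supp x ^~ H => {}H; move: xr; rewrite ltNge => /negP; apply.
  rewrite -(subrK a x) (le_trans (ler_normD _ _))// addrC lerD2l.
  by apply: rV_norm_le => [|i]; [exact: ltW|have := H i; rewrite !mxE -ltr_norml; exact: ltW].
have I1 : mu.-integrable setT (EFin \o (\1_(hcell a h) : V -> R)).
  apply/integrableP; split; first by apply/measurable_EFinP; exact: measurable_indic.
  rewrite (eq_integral (EFin \o (\1_(hcell a h) : V -> R))) => [|x _].
    by rewrite /comp integral_indic// setIT [X in (X < _)%E](mu_hcell a h0) ltry.
  by rewrite /= ger0_norm.
have It (t : V) : mu.-integrable setT (EFin \o (fun x => bphi a h (x + t) * \1_(hcell a h) x)).
  apply: (@eq_rint _ _ _ mu setT measurableT (fun x => \1_(hcell a h) x * bphi a h (x + t))).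
    by move=> x _; rewrite mulrC.
  apply: (@rintM _ _ _ mu setT measurableT _ _ (kB ^+ n)) => //.
    have mt := @measurable_shift_rV R n t.
    by apply: (measurableT_comp (continuous_measurable_rV cb) mt).
  by move=> x _; apply: prodf_le => i u; exact: kB_tau.
have Is b : mu.-integrable setT (EFin \o (fun x => bphi a h x * \1_(hcell a h) (x - s b))).
  apply: (@rintM _ _ _ mu setT measurableT _ _ 1) => //.
    have mt := @measurable_shift_rV R n (- s b).
    by apply: (measurableT_comp (measurable_indic _) mt).
  by move=> x _; rewrite indicE; case: (_ \in _); rewrite ?normr1 ?normr0.
transitivity (\int[mu]_x \sum_b bphi a h x * \1_(hcell a h) (x - s b)).
  by apply: eq_Rintegral => x _; exact: E1.
rewrite Rintegral_sum//.
transitivity (\sum_b \int[mu]_x (bphi a h (x + s b) * \1_(hcell a h) x)).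
  apply: eq_bigr => b _; rewrite /Rintegral; congr fine.
  rewrite -(@integral_shift R n (s b) (fun x => (bphi a h x * \1_(hcell a h) (x - s b))%:E))//.
    by apply: eq_integral => x _; rewrite addrK.
  exact: Is.
rewrite -Rintegral_sum//.
transitivity (\int[mu]_x (\1_(hcell a h) x : R)); last first.
  by rewrite /Rintegral integral_indic// setIT [X in fine X](mu_hcell a h0).
apply: eq_Rintegral => x _; rewrite -mulr_suml indicE.
case: (boolP (_ \in _)) => [/set_mem xB|_]; rewrite ?mulr0// mulr1.
pose F (i : 'I_n) (c : bool) : R := sc tau (a 0 i) h (x 0 i + (if c then - h else 0)).
rewrite (eq_bigr (fun b : {ffun 'I_n -> bool} => \prod_i F i (b i))).
  rewrite -(bigA_distr_bigA F) big1// => i _; rewrite big_bool /F /= !scE addr0 addrC.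
  have := xB i; rewrite in_itv /= => /andP[x1 x2].
  rewrite -[in RHS](@tau_pair ((x 0 i - a 0 i) / h)).
  - by congr (_ + tau _); field; rewrite gt_eqF.
  - by rewrite divr_ge0 ?(ltW h0)// subr_ge0.
  - by rewrite ltr_pdivrMr// mul1r ltrBlDl.
by move=> b _; apply: eq_bigr => i _; rewrite !mxE.
Qed.

Lemma krn_bphi a h x : 0 < h -> h ^+ n * krn a h x = bphi a h x.
Proof.
move=> h0; rewrite -[n in h ^+ n]card_ord -prodr_const -big_split; apply: eq_bigr => i _.
by rewrite /krn1 /= mulrA divff ?mul1r// gt_eqF.
Qed.

Lemma int_bphi_le a h (g : V -> R) om : 0 < h -> continuous g -> 0 <= om ->
  (forall x, `|x - a| <= h -> `|g x| <= om) ->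
  `|\int[mu]_x (bphi a h x * g x)| <= h ^+ n * ((4 * kB) ^+ n * om).
Proof.
move=> h0 cg om0 gom; have kB0 : 0 <= kB ^+ n :> R by rewrite exprn_ge0// ltW// kB_gt0.
have mc : measurable (ccube a h).
  by apply: measurable_closed; exact: (@closed_ccube R n a h).
have out x : ~ ccube a h x -> bphi a h x = 0.
  move=> xa; apply/eqP/negPn/negP => /prodf_neq0 H; apply: xa; apply: rV_norm_le; first exact: ltW.
  move=> i; rewrite !mxE leNgt; apply/negP => xi; move: (H i).
  by rewrite sc_supp ?eqxx//; [exact: supp1_tau|exact: ltW].
have -> : \int[mu]_x (bphi a h x * g x) = \int[mu]_(x in ccube a h) (bphi a h x * g x).
  rewrite [in RHS]Rintegral_mkcond; apply: eq_Rintegral => x _; rewrite patchE.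
  by case: ifPn => // /negP; rewrite inE => /out ->; rewrite mul0r.
have cf : (mu (ccube a h) <= ((4 * h) ^+ n)%:E)%E by exact: mu_ccube_le.
have Ic (c : R) : mu.-integrable (ccube a h) (EFin \o cst c).
  apply/integrableP; split; first exact/measurable_EFinP.
  rewrite (_ : (fun x => _) = cst `|c|%:E)// integral_cst//.
  by rewrite lte_mul_pinfty ?lee_fin// (le_lt_trans cf)// ltry.
have Ip : mu.-integrable (ccube a h) (EFin \o (fun x => bphi a h x * g x)).
  apply: (@rint_le _ _ _ mu _ mc _ (cst (kB ^+ n * om))) => //.
    apply: measurable_funTS; apply: measurable_funM; apply: continuous_measurable_rV => //.
    exact: smo_bphi_cont.
  move=> x xa; rewrite normrM ler_pM//; last exact: gom.
  by apply: prodf_le => i t; exact: kB_tau.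
apply: le_trans (le_normr_Rintegral mc Ip) _.
apply: (@le_trans _ _ (\int[mu]_(x in ccube a h) (kB ^+ n * om))).
  apply: le_Rintegral => //; [exact: rint_norm|exact: Ic|].
  move=> x xa; rewrite normrM ler_pM//; last exact: gom.
  by apply: prodf_le => i t; exact: kB_tau.
rewrite Rintegral_cst//.
have fc : fine (mu (ccube a h)) <= (4 * h) ^+ n.
  by rewrite -lee_fin fineK// ge0_fin_numE// (le_lt_trans cf)// ltry.
apply: le_trans (ler_wpM2l _ fc) _; first exact: mulr_ge0.
by apply: eq_le_refl; rewrite !exprMn; ring.
Qed.

End bump_integral.

Opaque partial kB tau sigma dtau ddtau.

(** * Convergence of the approximations to u inside D *)

Section weak_limit.
Context {R : realType} {n : nat}.
Local Notation V := 'rV[R]_n.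
Local Notation mu := (@lebesgue_rV R n).
Variables (D Om : set V) (h0 c kap M M3 : R) (A0 N : nat).
Hypotheses (HC : chained D Om h0 c kap M M3 N) (HG : in_grid Om h0 A0) (DOm : D `<=` Om).
Variables (u : V -> R) (u1 : 'I_n -> V -> R).
Hypothesis W : wk1 D u u1.
Local Notation hh := (hh h0).
Local Notation node k q := (@node R n h0 A0 k q).
Local Notation grid := (@grid n A0).

Let oD : open D. Proof. by case: HC. Qed.
Let h00 : 0 < h0. Proof. by case: HC => _ []. Qed.
Let kap0 : 0 < kap. Proof. by case: HC => _ []. Qed.
Let kap1 : kap <= 1. Proof. by case: HC => _ []. Qed.
Let kapc : 4 * kap <= c. Proof. by case: HC => _ []. Qed.
Let M30 : 2 * M + 5 <= M3. Proof. by case: HC => _ []. Qed.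
Let M0 : 0 < M. Proof. by case: HC. Qed.
Let mD : measurable D. Proof. exact: open_measurable_rV. Qed.
Let hk k : 0 < hh k. Proof. exact: hh_gt0. Qed.
Let Iu : mu.-integrable D (EFin \o u). Proof. by case: W. Qed.
Let Iu1 j : mu.-integrable D (EFin \o u1 j). Proof. by case: W. Qed.

Definition Uq k (q : grid k) : R := \int[mu]_(y in D) (u y * krn (node k q) (hh k) y).

Let f1 y := \sum_j `|u1 j y|.

Let If1 : mu.-integrable D (EFin \o f1).
Proof. by apply: rint_sum => // j _; apply: rint_norm. Qed.

Definition Cweak : R :=
  3 ^+ n * kB ^+ n * ((N + 1)%:R * (3 + 2 * (M3 / kap)) + M3 / kap).

(* The sum is a mollification of [u]. *)
Lemma ext_mollify k x : deep D ((c + 4) * hh k.+1) x ->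
  `|@ext_k R n D h0 c kap M A0 u k.+1 x - \sum_(q : grid k.+1) phi h0 q x * Uq q| <=
  Cweak * (kap * hh k.+1) * (@Kc R n (kap * hh k.+1) *
    \int[mu]_(y in Rset D kap M3 x (hh k.+1)) f1 y).
Proof.
move=> dx; set h := hh k.+1 in dx *; have h_gt0 : 0 < h by exact: hk.
set S := Rset D kap M3 x h; set rho := kap * h; set K := @Kc R n rho.
have rho0 : 0 < rho by exact: mulr_gt0.
have rhoh : rho <= h by rewrite ler_piMl// ltW.
have c0 : 0 < c by apply: lt_le_trans kapc; rewrite mulr_gt0.
have Dx : D x by apply: deep_sub dx; rewrite mulr_gt0// addr_gt0.
have Ox := DOm Dx.
have xA := ltW (HG Ox).
have nx r : 0 < r -> near D (r * h) x by move=> r0; exists x => //; rewrite subrr normr0 mulr_gt0.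
have mS : measurable S by exact: measurable_Rset.
have SD : S `<=` D by move=> y [dy _]; apply: deep_sub dy.
pose mm := M3 / kap.
have mm0 : 0 <= mm by rewrite divr_ge0 ?(ltW kap0)//; move: M30 M0; lra.
have Sx y : S y -> `|y - x| <= mm * rho.
  by move=> [_]; rewrite /ccube /= /mm /rho mulrA divfK// gt_eqF.
have K0 : 0 <= K by exact: Kc_ge0.
pose IS := \sum_j \int[mu]_(y in S) `|u1 j y|.
have IS0 : 0 <= IS by apply: sumr_ge0 => j _; exact: Rintegral_ge0.
have ISE : \int[mu]_(y in S) f1 y = IS.
  by apply: Rintegral_sum => // j _; apply: rint_norm => //; exact: integrableS (Iu1 j).
pose G := ((N + 1)%:R * ((3 + 2 * mm) * rho * K * IS) + mm * rho * K * IS).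
have G0 : 0 <= G.
  have m3 : 0 <= 3 + 2 * mm by move: mm0; lra.
  by rewrite /G; apply: addr_ge0; repeat (apply: mulr_ge0 => //); exact: ltW.
have Gq (q : grid k.+1) : `|x - node k.+1 q| < h -> `|@PP R n D h0 c kap M A0 u _ q x - Uq q| <= G.
  move=> xq; set nu := node k.+1 q in xq *.
  have dnu r : r <= c + 3 -> deep D (r * h) nu.
    move=> rc; apply: deep_le (deep_shift (y := nu) dx).
    have : r * h <= (c + 3) * h by rewrite ler_pM2r.
    by rewrite distrC; move: xq; set p := `|_|; lra.
  have aq : active h0 D q.
    by apply: (active_near (x := x)) => //; exact: nx.
  have [dz zx] := zzP HC Ox xq aq.
  have [_ _ _ _ I2] := HC.
  have kx : (k.+1 == 0)%N || `[< near D (8 * hh k.+1) x >].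
    by apply/orP; right; apply/asboolP; exact: nx.
  have ch := I2 k.+1 x (@zz R n D h0 c M A0 _ q) nu Ox kx dz.
  (* At this depth the node is itself an admissible centre, so that the sample ball is chained to
     the ball of radius rho at the node; one more link enlarges it to radius h. *)
  have {}ch : chain S rho N (@zz R n D h0 c M A0 _ q, rho) (nu, rho).
    apply: ch.
    - by apply: lt_le_trans zx _; rewrite ler_pM2r//; move: M0; lra.
    - by apply: dnu; lra.
    - by rewrite distrC; apply: lt_le_trans xq _; rewrite ler_peMl ?(ltW h_gt0)//; move: M0; lra.
  have bS : ball nu (2 * h) `<=` S.
    move=> y /rV_ballP yn; split.
      apply: (@deep_le _ _ D (3 * h - `|y - nu|)); last by apply: deep_shift; apply: dnu; lra.
      by rewrite distrC; move: yn rhoh; rewrite /rho; set p := `|_|; lra.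
    rewrite /ccube /= -(subrKA nu) (le_trans (ler_normD _ _))//.
    apply: (@le_trans _ _ (3 * h)); last by rewrite ler_pM2r//; move: M30 M0; lra.
    by rewrite distrC [`|nu - x|]distrC; move: yn xq; set p := `|_|; set q' := `|_|; lra.
  have lk : link S (nu, rho) (nu, h).
    exists nu, (2 * h); split => //=; rewrite ?subrr ?normr0 ?add0r; first by move: rhoh h_gt0; lra.
    by move: h_gt0; lra.
  have ch1 := chain_rcons ch (b := (nu, rho)) (c := (nu, h)) rhoh lk.
  have L1 b b' : rho <= b.2 -> rho <= b'.2 -> link S b b' -> _ :=
    @link1 R n D S mm rho x oD mS SD rho0 mm0 Sx u u1 b b' W.
  rewrite -/IS -/K in L1.
  have L0 : 0 <= (3 + 2 * mm) * rho * K * IS.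
    have m3 : 0 <= 3 + 2 * mm by move: mm0; lra.
    by repeat (apply: mulr_ge0 => //); exact: ltW.
  have P1 := @chain_Pd R n D S rho x rho0 u _ N.+1 (@zz R n D h0 c M A0 _ q, rho) (nu, h) L0 L1 (lexx _) ch1.
  have P2 : `|@PP R n D h0 c kap M A0 u _ q x - Ptl D u nu h x| <= (N + 1)%:R * ((3 + 2 * mm) * rho * K * IS).
    rewrite addn1; apply: le_trans P1; rewrite /Pd /= lerDl mulr_ge0 ?(ltW rho0)//.
    exact: sumr_ge0.
  have cD : ccube nu h `<=` D by apply: subset_trans SD; exact: (link_ccube (link_sym lk)).
  (* What remains of the polynomial beyond the mere average is first moments of [u1], of order
     rho. *)
  have P3 : `|Ptl D u nu h x - Uq q| <= mm * rho * K * IS.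
    rewrite (@PtlE1 R n D x oD u u1 nu h W h_gt0 cD) /Uq -/nu -/h addrC addKr normrN.
    rewrite (le_trans (ler_norm_sum _ _ _))// mulr_sumr; apply: ler_sum => j _.
    have sS y : lkrn x nu h j y != 0 -> S y.
      by move=> /(lkrn_supp h_gt0) yn; apply: bS; apply/rV_ballP; rewrite distrC; move: yn h_gt0; set p := `|_|; lra.
    apply: (@le_int_supp R n D S) => //.
      by apply: measurable_funTS; apply: continuous_measurable_rV; exact: (ck_continuous (csm_lkrn x nu h j 0%N)).
    move=> y; have [->|/sS Sy] := eqVneq (lkrn x nu h j y) 0.
      by rewrite normr0; repeat (apply: mulr_ge0 => //); exact: ltW.
    rewrite /lkrn normrM; apply: ler_pM => //; last exact: krn_le.
    by apply: le_trans (Sx _ Sy); have := coord_le_norm (y - x) j; rewrite !mxE.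
  by rewrite -(subrKA (Ptl D u nu h x)) (le_trans (ler_normD _ _))// /G lerD.
have E : @ext_k R n D h0 c kap M A0 u k.+1 x = \sum_(q : grid k.+1) phi h0 q x * @PP R n D h0 c kap M A0 u _ q x.
  have e1 := vE1 h00 (A0 := A0) (D := D) (k := k.+1) xA.
  rewrite /ext_k /= e1 ?subrr ?mul0r ?addr0; last by apply/orP; right; apply/asboolP; exact: nx.
  rewrite /vA [RHS](bigID (active h0 D (k := k.+1))) /= [X in _ = _ + X]big1 ?addr0// => q nq.
  have [->|/(phi_supp h00) xq] := eqVneq (phi h0 q x) 0; first by rewrite mul0r.
  by case/negP: nq; apply: (active_near (x := x)) => //; exact: nx.
rewrite E -sumrB (le_trans (ler_norm_sum _ _ _))//.
have kBn : 0 <= kB ^+ n :> R by rewrite exprn_ge0// ltW// kB_gt0.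
apply: (@le_trans _ _ (\sum_(q : grid k.+1) (`|x - node k.+1 q| < h)%R%:R * (kB ^+ n * G))).
  apply: ler_sum => q _; rewrite -mulrBr normrM.
  have [->|] := eqVneq (phi h0 q x) 0; first by rewrite normr0 mul0r mulr_ge0// mulr_ge0.
  move=> /(phi_supp h00); rewrite -/h => xq; rewrite xq mul1r; apply: ler_pM => //; last exact: Gq.
  by apply: prodf_le => i t; exact: kB_tau.
rewrite -mulr_suml; apply: (@le_trans _ _ (3 ^+ n * (kB ^+ n * G))).
  by apply: ler_wpM2r; [exact: mulr_ge0|exact: node_count].
by rewrite ISE; apply: eq_le_refl; rewrite /Cweak /G -/mm -/K; ring.
Qed.

Lemma compact_deep K : compact K -> K `<=` D -> exists2 e, 0 < e & K `<=` deep D e.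
Proof.
rewrite compact_cover => cK KD; have h00' := h00.
have [||J _ KJ] := cK nat setT (fun k => (deep D (hh k))°).
- by move=> k _; exact: open_interior.
- move=> x /KD Dx; have [e e0 ed] := deep_exhausts oD Dx.
  have e2 : 0 < e / 2 by rewrite divr_gt0.
  have [k /(_ k (leqnn k)) hke] := hh_small h00 e2; exists k => //.
  apply/nbhs_ballP; exists (e / 2) => // y /rV_ballP xy.
  by apply: deep_le (deep_shift (y := y) ed); rewrite distrC; move: xy hke; set p := `|_|; lra.
exists (hh (\max_(k <- finmap.enum_fset J) k)%N); first exact: hk.
move=> x /KJ[k kJ /interior_subset]; apply: deep_le; apply: hh_le => //.
by rewrite (big_rem k)//= leq_max leqnn.
Qed.

Let contB (f g : V -> R) : continuous f -> continuous g -> continuous (fun x => f x - g x).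
Proof.
move=> cf cg; rewrite (_ : (fun x => _) = f \+ (fun x => -1 * g x)); last first.
  by apply/funext => x; rewrite /= mulN1r.
by apply: (ck_continuous (k := 0%N)); apply: (@ckD _ _ 0); [split|apply: ckZ; split].
Qed.

Let kBn0 : 0 <= kB ^+ n :> R. Proof. by rewrite exprn_ge0// ltW// kB_gt0. Qed.

Let phi_bound k (q : grid k) x : `|phi h0 q x| <= (`|x - node k q| < hh k)%R%:R * kB ^+ n.
Proof.
have [->|/(phi_supp h00) xq] := eqVneq (phi h0 q x) 0.
  by rewrite normr0 mulr_ge0.
by rewrite xq mul1r; apply: prodf_le => i t; exact: kB_tau.
Qed.

Let sum_phi_bound k x (b : grid k -> R) om : 0 <= om ->
  (forall q, `|x - node k q| < hh k -> `|b q| <= om) ->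
  `|\sum_(q : grid k) phi h0 q x * b q| <= 3 ^+ n * kB ^+ n * om.
Proof.
move=> om0 H; rewrite (le_trans (ler_norm_sum _ _ _))//.
apply: (@le_trans _ _ (\sum_(q : grid k) (`|x - node k q| < hh k)%R%:R * (kB ^+ n * om))).
  apply: ler_sum => q _; rewrite normrM mulrA.
  have [xq|xq] := ltP `|x - node k q| (hh k).
    by rewrite mul1r; apply: ler_pM => //; [have := phi_bound q x; rewrite xq mul1r|exact: H].
  by have := phi_bound q x; rewrite ltNge xq mul0r normr_le0 => /eqP ->; rewrite normr0 !mul0r.
rewrite -mulr_suml -mulrA; apply: ler_wpM2r; first exact: mulr_ge0.
exact: node_count.
Qed.

(** The coefficients of the adjoint mollification. Bumps and kernels differ by the factor h^n only,
    so that mollifying [u] and testing with theta amounts to testing [u] with [Sk theta]. *)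
Let cq (theta : V -> R) k (q : grid k) : R :=
  (hh k ^+ n)^-1 * \int[mu]_(x in D) (phi h0 q x * theta x).

Let Sk (theta : V -> R) k y : R := \sum_(q : grid k) phi h0 q y * cq theta q.

Let cq_bound theta k (q : grid k) (t om : R) : continuous theta ->
  (forall x, ~ D x -> theta x = 0) -> (exists r : R, forall x, r < `|x| -> theta x = 0) -> 0 <= om ->
  (forall x, `|x - node k q| <= hh k -> `|theta x - t| <= om) ->
  `|cq theta q - t| <= (4 * kB) ^+ n * om.
Proof.
move=> ct tD [r tr] om0 H; have hn : 0 < hh k ^+ n by rewrite exprn_gt0.
have cg : continuous (fun x => theta x - t).
  apply: (@contB theta (cst t)) => //.
  exact: (ck_continuous (k := 0%N) (@ck_cst R n 0 t)).
have cphi : continuous (phi h0 q) by exact: (ck_continuous (csm_phi h0 q 0%N)).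
have B := int_bphi_le (hk k) cg om0 H.
have Ipt : mu.-integrable setT (EFin \o (fun x => phi h0 q x * theta x)).
  apply: (@integrable_bsupp _ _ _ r) => [|x xr]; last by rewrite tr ?mulr0.
  exact: contM.
have Ip : mu.-integrable setT (EFin \o phi h0 q).
  apply: (@integrable_bsupp _ _ _ (`|node k q| + hh k)) => // x xr.
  apply/eqP/negPn/negP => /(phi_supp h00) xq; move: xr; rewrite ltNge => /negP; apply.
  by rewrite -(subrK (node k q) x) (le_trans (ler_normD _ _))// addrC lerD2l ltW.
have E : \int[mu]_x (bphi (node k q) (hh k) x * (theta x - t)) = hh k ^+ n * (cq theta q - t).
  rewrite mulrBr /cq mulrA divff ?gt_eqF// mul1r -(int_bphi (node k q) (hk k)).
  rewrite (_ : \int[mu]_(x in D) _ = \int[mu]_x (phi h0 q x * theta x)); last first.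
    rewrite [in LHS]Rintegral_mkcond; apply: eq_Rintegral => x _; rewrite patchE.
    by case: ifPn => // /negP; rewrite inE => /tD ->; rewrite mulr0.
  rewrite mulrC -RintegralZl// -RintegralB//; last exact: rintZ.
  by apply: eq_Rintegral => x _; rewrite -/(phi h0 q x) mulrBr [t * _]mulrC.
move: B; rewrite E normrM (gtr0_norm hn) ler_pM2l//.
Qed.

Let Sk_bound theta k y B : continuous theta -> (forall x, ~ D x -> theta x = 0) ->
  (exists r : R, forall x, r < `|x| -> theta x = 0) -> 0 <= B -> (forall x, `|theta x| <= B) ->
  `|Sk theta k y| <= 3 ^+ n * kB ^+ n * ((4 * kB) ^+ n * B).
Proof.
move=> ct tD tr B0 HB; apply: sum_phi_bound.
  by apply: mulr_ge0 => //; apply: exprn_ge0; apply: mulr_ge0 => //; apply: ltW; exact: kB_gt0.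
move=> q _; rewrite -(subr0 (cq theta q)); apply: cq_bound => // x _.
by rewrite subr0.
Qed.

Let Sk_cvg theta y : continuous theta -> (forall x, ~ D x -> theta x = 0) ->
  (exists r : R, forall x, r < `|x| -> theta x = 0) -> D y ->
  Sk theta k y @[k --> \oo] --> theta y.
Proof.
move=> ct tD tr Dy; pose c0 : R := 3 ^+ n * kB ^+ n * (4 * kB) ^+ n + 1.
have c4 : 0 <= (4 * kB) ^+ n :> R.
  by apply: exprn_ge0; apply: mulr_ge0 => //; apply: ltW; exact: kB_gt0.
have c00 : 0 < c0 by rewrite ltr_wpDl// mulr_ge0// mulr_ge0// exprn_ge0.
apply/cvgrPdist_le => eps eps0; have e1 : 0 < eps / c0 by rewrite divr_gt0.
have /cvgrPdist_le/(_ _ e1)/nbhs_ballP[d /= d0 Hd] := ct y.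
have d2 : 0 < d / 3 by rewrite divr_gt0.
have [K HK] := hh_small h00 d2; exists K => // k /= /HK hkd.
have S1 := @sum_phi R n h0 A0 h00 k y (ltW (HG (DOm Dy))).
rewrite distrC -[theta y]mulr1 -S1 mulrC mulr_suml -sumrB.
rewrite (eq_bigr (fun q => phi h0 q y * (cq theta q - theta y))); last first.
  by move=> q _; rewrite mulrBr.
apply: (@le_trans _ _ (3 ^+ n * kB ^+ n * ((4 * kB) ^+ n * (eps / c0)))).
  apply: sum_phi_bound; first by rewrite mulr_ge0// ltW.
  move=> q yq; apply: cq_bound => //; first exact: ltW.
  move=> x xq; rewrite distrC; apply: Hd; apply/rV_ballP.
  rewrite -(subrKA (node k q)) (le_lt_trans (ler_normD _ _))//.
  by rewrite [X in _ + X]distrC; move: yq xq hkd; set p := `|_|; set p' := `|_|; move: d0; lra.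
rewrite mulrA -[leRHS](divfK (lt0r_neq0 c00)) [leRHS]mulrC ler_pM2r//.
by rewrite /c0 lerDl.
Qed.

(** On the support of theta the approximation is within O(h_k) in L^1 of a mollification of [u];
    moved onto theta, the mollification converges by mere continuity. *)
Lemma ext_cvg theta : test_function D theta ->
  (fun k => \int[mu]_(x in D) (@ext_k R n D h0 c kap M A0 u k x * theta x)) @ \oo -->
  \int[mu]_(x in D) (u x * theta x).
Proof.
move=> tt; have [B B0 HB] := test_function_bounded [::] tt; rewrite /= in HB.
have ct : continuous theta by exact: (test_function_continuous (s := [::]) tt).
have tD x : ~ D x -> theta x = 0 by move=> nx; exact: (test_function_out [::] tt nx).
have tr : exists r : R, forall x, r < `|x| -> theta x = 0.
  by have [r Hr] := test_function_bsupp tt; exists r => x; exact: (Hr [::]).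
have mt : measurable_fun setT theta by exact: continuous_measurable_rV.
have [_ cK KD] := tt; have [e e0 Ke] := compact_deep cK KD.
have te x : theta x != 0 -> deep D e x by move=> tx; apply: Ke; exact: subset_closure.
have c0 : 0 < c by apply: lt_le_trans kapc; rewrite mulr_gt0.
pose Uk k x := \sum_(q : grid k) phi h0 q x * Uq q.
have cphi k (q : grid k) : continuous (phi h0 q) by exact: (ck_continuous (csm_phi h0 q 0%N)).
have cext k : continuous (@ext_k R n D h0 c kap M A0 u k).
  by apply: (ck_continuous (k := 0%N)); apply: csm_vv => // l q; exact: csm_PP.
have cUk k : continuous (Uk k).
  apply: (ck_continuous (k := 0%N)); apply: ck_sum => q _.
  by apply: (@ckM _ _ 0 (phi h0 q) (cst (Uq q))); [exact: csm_phi|exact: ck_cst].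
(* the mollified part converges by dominated convergence *)
have L1 : (fun k => \int[mu]_(x in D) (u x * Sk theta k x)) @ \oo --> \int[mu]_(x in D) (u x * theta x).
  pose b : R := 3 ^+ n * kB ^+ n * ((4 * kB) ^+ n * B).
  have Sb k y : `|Sk theta k y| <= b by apply: Sk_bound => //; exact: ltW.
  have mS k : measurable_fun setT (Sk theta k).
    apply: continuous_measurable_rV; apply: (ck_continuous (k := 0%N)); apply: ck_sum => q _.
    by apply: (@ckM _ _ 0 (phi h0 q) (cst (cq theta q))); [exact: csm_phi|exact: ck_cst].
  have mu_ := rint_measurable Iu.
  have cS : \forall y \ae mu, D y -> (u y * Sk theta k y)%:E @[k --> \oo] --> (u y * theta y)%:E.
    apply: aeW => y Dy; apply: cvg_EFin; first by apply: nearW.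
    by apply: cvgMr; exact: Sk_cvg.
  have dS : \forall y \ae mu, forall k, D y -> (`|(u y * Sk theta k y)%:E| <= (b * `|u y|)%:E)%E.
    by apply: aeW => y k Dy; rewrite lee_fin normrM mulrC ler_wpM2r.
  have [_ _ L] := @dominated_convergence _ _ _ mu D mD (fun k y => (u y * Sk theta k y)%:E)
    (fun y => (u y * theta y)%:E) (fun y => (b * `|u y|)%:E)
    (fun k => (@measurable_EFinP _ _ _ D _).2 (measurable_funM mu_ (measurable_funTS (mS k))))
    ((@measurable_EFinP _ _ _ D _).2 (measurable_funM mu_ (measurable_funTS mt)))
    cS (rintZ mD b (rint_norm mD Iu)) dS.
  have {}L : fine (\int[mu]_(x in D) (u x * Sk theta k x)%:E)%E @[k --> \oo] -->
      fine (\int[mu]_(x in D) (u x * theta x)%:E)%E.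
    apply: fine_cvg; rewrite fineK; first exact: L.
    by apply: (integrable_fin_num mD); apply: (@rintM _ _ _ mu D mD u theta B) => //; exact: measurable_funTS.
  exact: L.
have E1 k : \int[mu]_(x in D) (Uk k x * theta x) = \int[mu]_(x in D) (u x * Sk theta k x).
  have Ipt (q : grid k) : mu.-integrable D (EFin \o (fun x => phi h0 q x * theta x)).
    have [r Hr] := tr; apply: (integrableS measurableT mD (@subsetT _ _)).
    apply: (@integrable_bsupp _ _ _ r) => [|x xr]; last by rewrite Hr ?mulr0.
    exact: contM.
  have Iup (q : grid k) : mu.-integrable D (EFin \o (fun x => u x * phi h0 q x)).
    apply: (@rintM _ _ _ mu D mD u _ (kB ^+ n)) => //.
      by apply: measurable_funTS; exact: continuous_measurable_rV.
    by move=> x _; apply: prodf_le => i t; exact: kB_tau.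
  transitivity (\sum_(q : grid k) Uq q * \int[mu]_(x in D) (phi h0 q x * theta x)).
    rewrite (_ : \int[mu]_(x in D) _ = \int[mu]_(x in D) (\sum_(q : grid k) Uq q * (phi h0 q x * theta x))).
      by rewrite (Rintegral_sum mD) => [|q _]; [apply: eq_bigr => q _; rewrite RintegralZl|exact: rintZ].
    by apply: eq_Rintegral => x _; rewrite /Uk mulr_suml; apply: eq_bigr => q _; rewrite mulrAC mulrC.
  rewrite (_ : \int[mu]_(x in D) (u x * Sk theta k x) =
      \int[mu]_(x in D) (\sum_(q : grid k) cq theta q * (u x * phi h0 q x))); last first.
    by apply: eq_Rintegral => x _; rewrite /Sk mulr_sumr; apply: eq_bigr => q _; rewrite mulrA mulrC.
  rewrite (Rintegral_sum mD) => [|q _]; last exact: rintZ.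
  apply: eq_bigr => q _; rewrite RintegralZl// /cq /Uq.
  have -> : \int[mu]_(x in D) (u x * phi h0 q x) =
      hh k ^+ n * \int[mu]_(x in D) (u x * krn (node k q) (hh k) x).
    rewrite -RintegralZl//; last first.
      apply: (@rint_krnlike _ _ _ _ _ (node k q) (hh k)) => //; first exact: csm_krn.
      by move=> y; exact: krn_supp.
    by apply: eq_Rintegral => x _; rewrite /phi -(krn_bphi (node k q) x (hk k)) mulrCA.
  have alg (H p q' : R) : H != 0 -> q' * p = H^-1 * p * (H * q') by move=> H0; field.
  by apply: alg; rewrite expf_neq0 ?gt_eqF.
(* the rest is small by the averaging estimate *)
have [Bf Bf0 HBf] : exists2 b : R, 0 < b & \int[mu]_(y in D) f1 y <= b.
  exists (`|\int[mu]_(y in D) f1 y| + 1); first by rewrite ltr_pwDr.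
  by rewrite (le_trans (ler_norm _))// lerDl.
have Iext k : mu.-integrable D (EFin \o (fun x => @ext_k R n D h0 c kap M A0 u k x * theta x)).
  have [r Hr] := tr; apply: (integrableS measurableT mD (@subsetT _ _)).
  apply: (@integrable_bsupp _ _ _ r) => [|x xr]; last by rewrite Hr ?mulr0.
  exact: contM.
have IUk k : mu.-integrable D (EFin \o (fun x => Uk k x * theta x)).
  have [r Hr] := tr; apply: (integrableS measurableT mD (@subsetT _ _)).
  apply: (@integrable_bsupp _ _ _ r) => [|x xr]; last by rewrite Hr ?mulr0.
  exact: contM.
have Cw0 : 0 <= Cweak.
  have mm0 : 0 <= M3 / kap by rewrite divr_ge0 ?(ltW kap0)//; move: M30 M0; lra.
  apply: mulr_ge0; first by apply: mulr_ge0 => //; exact: exprn_ge0.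
  apply: addr_ge0 => //; apply: mulr_ge0 => //; apply: addr_ge0 => //; exact: mulr_ge0.
have M3p : 0 < M3 by move: M30 M0; lra.
pose q0 := @Qavg R n kap M3.
have q00 : 0 <= q0 by exact: Qavg_ge0.
have rest k : (c + 4) * hh k.+1 <= e ->
   `|\int[mu]_(x in D) (@ext_k R n D h0 c kap M A0 u k.+1 x * theta x) -
    \int[mu]_(x in D) (Uk k.+1 x * theta x)| <= B * Cweak * (kap * hh k.+1) * q0 * Bf.
  move=> hke; rewrite -RintegralB//.
  pose wt x := @ext_k R n D h0 c kap M A0 u k.+1 x * theta x - Uk k.+1 x * theta x.
  have cwt : continuous wt.
    by apply: contB; exact: contM.
  apply: (le_trans (le_normr_Rintegral mD _)); first by apply: rintB.
  have If1' := If1.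
  have f10 y : 0 <= f1 y by exact: sumr_ge0.
  pose C := B * Cweak * (kap * hh k.+1).
  have C0 : 0 <= C by rewrite /C; repeat (apply: mulr_ge0 => //); exact: ltW.
  (* The averaging estimate is applied with [D] in the place of [Om] and to a sequence that vanishes
     except at index [k.+1]. *)
  have LA := @local_average1 R n D D h0 kap M3 C (fun l => if l == k.+1 then wt else cst 0) f1
     oD oD h00 kap0 M3p C0 f10 If1'.
  have := LA _ _ A0 _ k.+1 D D mD mD (@subset_refl _ D) _ _.
  rewrite eqxx => H; apply: (@le_trans _ _ (C * q0 * \int[mu]_(y in D) f1 y)); last first.
    by apply: ler_wpM2l => //; exact: mulr_ge0.
  apply: H.
  - by move=> l; case: ifP => // _; exact: (ck_continuous (k := 0%N) (@ck_cst R n 0 0)).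
  - move=> l x Dx _; case: ifPn => [/eqP ->|_]; last first.
      by rewrite normr0; repeat (apply: mulr_ge0 => //); [exact: Kc_ge0 (mulr_gt0 _ _)|exact: Rintegral_ge0].
    rewrite /wt -mulrBl normrM mulrC.
    have [->|tx] := eqVneq (theta x) 0.
      rewrite normr0 mul0r; repeat (apply: mulr_ge0 => //); [exact: Kc_ge0 (mulr_gt0 _ _)|exact: Rintegral_ge0].
    rewrite /C -!(mulrA B); apply: ler_pM => //.
    by apply: ext_mollify; apply: deep_le (te x tx).
  - by move=> x Dx; exact: HG (DOm Dx).
  - move=> x Dx; split => //; apply/orP; right; apply/asboolP.
    by exists x => //; rewrite subrr normr0 mulr_gt0.
  by move=> x y _ dy _; apply: deep_sub dy; exact: mulr_gt0.
apply/cvgrPdist_le => eps eps0; have e2 : 0 < eps / 2 by rewrite divr_gt0.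
have /cvgrPdist_le/(_ _ e2)[K1 _ HK1] := L1.
have ce : 0 < e / (c + 4) by rewrite divr_gt0// addr_gt0.
have [K2 HK2] := hh_small h00 ce.
pose X := B * Cweak * kap * q0 * Bf + 1.
have X0 : 0 < X by rewrite ltr_wpDl//; repeat (apply: mulr_ge0 => //); exact: ltW.
have eX : 0 < eps / 2 / X by rewrite divr_gt0.
have [K3 HK3] := hh_small h00 eX.
exists (maxn K1 (maxn K2 K3)).+1 => // -[//|k] /=; rewrite ltnS !geq_max => /and3P[k1 k2 k3].
have r1 := HK1 k.+1 (leqW k1); have r2 := HK2 k.+1 (leqW k2); have r3 := HK3 k.+1 (leqW k3).
rewrite -E1 in r1.
have r4 : `|\int[mu]_(x in D) (@ext_k R n D h0 c kap M A0 u k.+1 x * theta x) -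
    \int[mu]_(x in D) (Uk k.+1 x * theta x)| <= eps / 2.
  apply: le_trans (rest k _) _; first by rewrite mulrC -ler_pdivlMr// addr_gt0.
  apply: (@le_trans _ _ (X * hh k.+1)); last by rewrite mulrC -ler_pdivlMr.
  rewrite /X mulrDl mul1r -[leLHS]addr0; apply: lerD; last exact: ltW.
  by apply: eq_le_refl; ring.
rewrite [eps]splitr -(subrKA (\int[mu]_(x in D) (Uk k.+1 x * theta x))).
by rewrite (le_trans (ler_normD _ _))// lerD// distrC.
Qed.

End weak_limit.

(** * Uniform cones and chains of balls *)

Opaque partial kB tau sigma dtau ddtau.

Section joined.
Context {R : realType} {n : nat}.
Local Notation V := 'rV[R]_n.
Implicit Types (x y z w : V) (rho e : R) (N : nat).
Variable D : set V.
Hypothesis oD : open D.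

(** The number of links is the same for all small radii: a link only needs a ball in [D] around both
    balls, whatever their size. The radius can therefore be adapted to the scale afterwards. *)
Definition joined rho N z z' := forall r, 0 < r -> r <= rho ->
  chain (deep D r) r N (z, r) (z', r).

Lemma joinedW rho rho' N N' z z' : rho' <= rho -> (N <= N')%N ->
  joined rho N z z' -> joined rho' N' z z'.
Proof.
move=> rr NN H r r0 rr'; apply: (chain_mono NN); apply: H => //; exact: le_trans rr.
Qed.

Lemma joined_sym rho N z z' : joined rho N z z' -> joined rho N z' z.
Proof. by move=> H r r0 rr; apply: chain_rev => //; exact: H. Qed.

Lemma joined_trans rho N N' z w z' : joined rho N z w -> joined rho N' w z' ->
  joined rho (N + N') z z'.
Proof. by move=> H H' r r0 rr; apply: chain_cat (H r r0 rr) (H' r r0 rr). Qed.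

Lemma joined_near rho z z' : deep D (4 * rho) z -> `|z' - z| <= rho -> joined rho 1 z z'.
Proof.
move=> zD zz r r0 rr; right; exists (z', r); split => //=; last by left.
(* This radius exceeds |z' - z| + r, and leaves all points of the ball with depth more than 3/2
   rho. *)
exists z, (5 / 2 * rho); rewrite /= subrr normr0 add0r; split.
- by move: r0 rr; lra.
- by move: zz r0 rr; set p := `|_|; lra.
move=> y /rV_ballP zy; apply: deep_le (deep_shift (y := y) zD).
by rewrite distrC; move: zy r0 rr; set p := `|_|; lra.
Qed.

Lemma deep_nbhs x : D x -> exists2 rho, 0 < rho & deep D (4 * rho) x.
Proof.
move=> Dx; have /nbhs_ballP[e /= e0 h] := open_nbhs_nbhs (conj oD Dx).
exists (e / 4); first by rewrite divr_gt0.
by rewrite mulrC divfK.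
Qed.

Hypothesis cD : connected D.

(** The points joined to [z0] form a relatively open and closed subset of [D]. *)
Lemma joined_all z0 z : D z0 -> D z -> exists2 rho, 0 < rho & exists N, joined rho N z0 z.
Proof.
move=> Dz0 Dz.
pose A := [set x | D x /\ exists2 rho, 0 < rho & exists N, joined rho N z0 x].
have ext x y r : D y -> deep D (4 * r) x -> 0 < r -> `|y - x| <= r ->
    A x -> A y.
  move=> Dy dx r0 yx [Dx [rho rho0 [N J]]]; split => //.
  exists (Num.min r rho); first by rewrite lt_min r0.
  exists (N + 1)%N; apply: (@joined_trans _ N 1 z0 x y).
    by apply: joinedW J => //; rewrite ge_min lexx orbT.
  by apply: joinedW (joined_near dx yx) => //; rewrite ge_min lexx.
have AD : A = D.
  apply: cD.
  - exists z0; split => //; have [r r0 dr] := deep_nbhs Dz0.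
    by exists r => //; exists 0%N => s _ _; left.
  - exists A; last by apply/seteqP; split => [x h|x []//]; split => //; case: h.
    rewrite openE => x Ax; have [r r0 dr] := deep_nbhs (proj1 Ax).
    apply/nbhs_ballP; exists r => // y /rV_ballP xy.
    have Dy : D y by apply: dr; apply/rV_ballP; apply: lt_trans xy _; move: r0; lra.
    by apply: (ext x y r) => //; rewrite distrC; exact: ltW.
  - exists (closure A); first exact: closed_closure.
    apply/seteqP; split => [x Ax|x [Dx cx]]; first by split; [case: Ax|exact: subset_closure].
    have [r r0 dr] := deep_nbhs Dx.
    have r2 : 0 < r / 2 by rewrite divr_gt0.
    have [y [Ay /rV_ballP xy]] := cx _ (nbhsx_ballx x _ r2).
    have Dy := proj1 Ay.
    apply: (ext y x (r / 2)) => //; last exact: ltW.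
    by apply: deep_le (deep_shift (y := y) dr); rewrite distrC; move: xy r0; set p := `|_|; lra.
have : A z by rewrite AD.
by case.
Qed.

Hypothesis bD : exists B, forall x, D x -> `|x| <= B.

Lemma compact_deep_bounded e : 0 < e -> compact (deep D e).
Proof.
move=> e0; have [B HB] := bD.
apply: (@subclosed_compact _ _ (ccube 0 B)) => //; first exact: closed_deep.
  exact: (@compact_ccube R n 0 B).
by move=> x /(deep_sub e0)/HB; rewrite /ccube /= subr0.
Qed.

(** Compactness of [deep D e] makes radius and number of links uniform. In the cover a single index
    bounds both the number of links and the inverse of the radius. *)
Lemma joined_deep e : 0 < e -> exists2 rho, 0 < rho & exists N,
  forall z z', deep D e z -> deep D e z' -> joined rho N z z'.
Proof.
move=> e0.
have [[z0 dz0]|no] := pselect (exists z0, deep D e z0); last first.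
  by exists 1 => //; exists 0%N => z z' dz; exfalso; apply: no; exists z.
have Dz0 := deep_sub e0 dz0.
have := compact_deep_bounded e0; rewrite compact_cover => cK.
pose O k := [set z | joined k.+1%:R^-1 k z0 z]°.
have [||J _ KJ] := cK nat setT O.
- by move=> k _; exact: open_interior.
- move=> z dz; have Dz := deep_sub e0 dz; have [rho rho0 [N JN]] := joined_all Dz0 Dz.
  have [r r0 dr] := deep_nbhs Dz.
  pose s := Num.min r rho; have s0 : 0 < s by rewrite lt_min r0.
  have [k [kN ks]] : exists k, (N.+1 <= k)%N /\ k.+1%:R^-1 <= s.
    exists (maxn N.+1 (Num.truncn s^-1)); split; first exact: leq_maxl.
    rewrite invf_ple ?posrE// ltW// (lt_le_trans (truncnS_gt _))// ler_nat ltnS leq_maxr//.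
  exists k => //; apply/nbhs_ballP; exists r => // y /rV_ballP zy /=.
  apply: (@joinedW s _ (N + 1)) => //; first by rewrite addn1.
  apply: (joined_trans (w := z)); first by apply: joinedW JN; rewrite // /s ge_min lexx orbT.
  apply: (@joinedW r _ 1) => //; first by rewrite /s ge_min lexx.
  by apply: joined_near => //; rewrite distrC ltW.
pose m := (\max_(k <- finmap.enum_fset J) k)%N.
have H z : deep D e z -> joined m.+1%:R^-1 m z0 z.
  move=> /KJ[k kJ /interior_subset /=]; have km : (k <= m)%N.
    by rewrite /m (big_rem k)//= leq_max leqnn.
  by apply: joinedW => //; rewrite lef_pV2 ?posrE// ler_nat ltnS.
exists m.+1%:R^-1; first by rewrite invr_gt0.
exists (m + m)%N => z z' /H/joined_sym h /H; exact: joined_trans.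
Qed.

End joined.

Lemma chain_arith1 {R : realType} (l q q' p t h : R) : q < 3 * p -> q' <= l + t ->
  p <= h / 8 -> 0 < h -> 0 < t -> q + q' <= l + 2 * t + 2 * h.
Proof. by move=> *; lra. Qed.

Lemma chain_arith2 {R : realType} (l q q' p t h : R) : q < 2 * l + 2 * p -> q' <= l + t ->
  p <= h / 8 -> 0 < h -> 2 * l <= t -> q + q' <= l + 2 * t + 2 * h.
Proof. by move=> *; lra. Qed.

(** * Samples and chains from a uniform cone condition *)

Section cone.
Context {R : realType} {n : nat}.
Local Notation V := 'rV[R]_n.
Implicit Types (x y z w e : V).

(** A common direction for all points near [y0] allows two sample balls to be moved in parallel, to
    a height where one ball inside [D] contains both. *)
Definition uniform_cone (D : set V) (r cc : R) := forall y0, D y0 -> exists2 e : V, `|e| <= 1 &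
  forall y t, D y -> `|y - y0| < r -> 0 < t -> t < r -> deep D (cc * t) (y + t *: e).

Variables (D : set V) (r cc h0 : R).
Hypotheses (oD : open D) (cD : connected D) (bD : exists B, forall x, D x -> `|x| <= B).
Hypotheses (r0 : 0 < r) (cc0 : 0 < cc) (cc1 : cc <= 1) (h00 : 0 < h0) (h0r : h0 < r).
Hypothesis UC : uniform_cone D r cc.
Local Notation hh := (hh h0).

Let hk k : 0 < hh k. Proof. exact: hh_gt0. Qed.

Lemma cone_sample k y : D y -> exists z, deep D (cc * hh k) z /\ `|z - y| <= hh k.
Proof.
move=> Dy; have [e e1 H] := UC Dy; exists (y + hh k *: e); split.
  apply: H => //; first by rewrite subrr normr0.
  by apply: le_lt_trans h0r; exact: hh_le0.
by rewrite (addrC y) addrK normrZ gtr0_norm// ler_piMr// ltW.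
Qed.

Variable L : R.
Hypothesis L1 : 1 <= L.

(** [c2 * hh k] is the depth kept on the way: up to height cc h_k / 2 the ball at the start provides
    it, above that the cone. [Cc * hh k] is the height where the depth (2 L + 1) h_k exceeds the
    distance of the two paths by h_k. *)
Let c2 := cc * cc / 2.
Let kap := c2 / 4.
Let Cc := (2 * L + 1) / cc.

Let c20 : 0 < c2. Proof. by rewrite divr_gt0// mulr_gt0. Qed.
Let c21 : c2 <= cc / 2. Proof. by rewrite /c2 ler_pM2r ?invr_gt0// ler_piMr// ltW. Qed.
Let kap0 : 0 < kap. Proof. by rewrite divr_gt0. Qed.

Lemma cone_descent k y z e T : D y -> deep D (cc * hh k) z -> `|z - y| < L * hh k ->
  `|e| <= 1 -> (forall t, 0 < t -> t <= T -> deep D (cc * t) (z + t *: e)) -> 0 <= T ->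
  forall t, 0 <= t -> t <= T -> deep D (c2 * hh k) (z + t *: e).
Proof.
move=> Dy dz zy e1 H T0 t t0 tT; have h := hk k.
have [tc|tc] := leP t (cc * hh k / 2).
  apply: deep_le (deep_shift (y := z + t *: e) dz).
  rewrite (addrC z) addrK normrZ ger0_norm//.
  have : t * `|e| <= t by rewrite ler_piMr.
  have : c2 * hh k <= cc / 2 * hh k by rewrite ler_pM2r.
  have e3 : cc * hh k = 2 * (cc / 2 * hh k) by field.
  move: tc; rewrite e3 [2 * _ / 2]mulrAC divff ?mul1r//.
  by move: (t * `|e|) (cc / 2 * hh k) (c2 * hh k) => p q q'; lra.
have t00 : 0 < t by apply: le_lt_trans tc; rewrite divr_ge0// mulr_ge0// ltW.
apply: deep_le (H t t00 tT); rewrite /c2 -mulrA -mulrA ler_pM2l//.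
by rewrite mulrCA mulrC ltW// mulrC mulrA.
Qed.

(** Up from [z] along the axis of the cone in steps of at most rho, one link across, and down to
    [z']. *)
Let fine_chain kp k y z z' : Cc * hh k < r -> L * hh k < r ->
  D y -> deep D (cc * hh k) z -> `|z - y| < L * hh k ->
  deep D (cc * hh k) z' -> `|z' - y| < L * hh k ->
  0 < kp -> kp <= kap ->
  chain (Rset D kp (L + 2 * Cc + 2) y (hh k)) (kp * hh k) (2 * (Num.truncn (Cc / kp)).+1 + 1)
    (z, kp * hh k) (z', kp * hh k).
Proof.
move=> hC hL Dy dz zy dz' z'y kp0 kpk; have h := hk k.
have [e e1 H] := UC Dy; set T := Cc * hh k in hC.
have Cc0 : 0 < Cc by rewrite /Cc divr_gt0//; move: L1; lra.
have T0 : 0 < T by rewrite mulr_gt0.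
set I := (Num.truncn (Cc / kp)).+1; set S := Rset _ _ _ _ _; set rho := kp * hh k.
have rho0 : 0 < rho by rewrite mulr_gt0.
have kap1 : kp <= 1 / 8 by apply: le_trans kpk _; rewrite /kap; move: c21 cc1; lra.
have rho1 : rho <= hh k / 8 by rewrite /rho mulrC ler_pM2l//; move: kap1; lra.
have rhoc : 4 * rho <= c2 * hh k.
  rewrite /rho mulrA ler_pM2r//; apply: (@le_trans _ _ (4 * kap)); first by rewrite ler_pM2l.
  by rewrite /kap mulrC divfK.
have desc p : deep D (cc * hh k) p -> `|p - y| < L * hh k ->
    chain S rho I (p, rho) (p + T *: e, rho) /\ deep D (cc * T) (p + T *: e).
  move=> dp py.
  have Dp : D p by apply: deep_sub dp; exact: mulr_gt0.
  have Hp t : 0 < t -> t <= T -> deep D (cc * t) (p + t *: e).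
    move=> t0 tT; apply: H => //; [exact: lt_trans hL|exact: le_lt_trans hC].
  split; last exact: Hp.
  have dd := cone_descent Dy dp py e1 Hp (ltW T0).
  pose s := T / I%:R; have s0 : 0 < s by rewrite divr_gt0// ltr0n.
  have sr : s <= rho.
    rewrite /s ler_pdivrMr ?ltr0n// /rho /T [leRHS]mulrAC ler_pM2r// [leRHS]mulrC -ler_pdivrMr//.
    by apply: ltW; exact: truncnS_gt.
  have IsT : I%:R * s = T by rewrite /s mulrC divfK// pnatr_eq0.
  have step j : (j <= I)%N -> chain S rho j (p, rho) (p + (j%:R * s) *: e, rho).
    elim: j => [|j IH] jI; first by left; rewrite mul0r scale0r addr0.
    have tj : j%:R * s <= T by rewrite -IsT ler_pM2r// ler_nat ltnW.
    have tj0 : 0 <= j%:R * s by rewrite mulr_ge0// ltW.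
    apply: (chain_rcons (IH (ltnW jI))) => //.
    exists (p + (j%:R * s) *: e), (3 * rho); rewrite /= subrr normr0 add0r.
    have dj := dd _ tj0 tj; split; first by move: rho0; lra.
      rewrite -natr1 mulrDl mul1r scalerDl addrA [X in `|X|](_ : _ = s *: e); last first.
        by rewrite [p + _ + _]addrC addrK.
      rewrite normrZ gtr0_norm//.
      have : s * `|e| <= s by rewrite ler_piMr// ltW.
      by move: sr rho0; set q := s * _; lra.
    move=> w /rV_ballP pw; split.
      apply: deep_le (deep_shift (y := w) dj); rewrite distrC -/rho.
      by move: pw rhoc; set q := `|_|; set q' := c2 * _; lra.
    rewrite /ccube /= (le_trans (ler_distD (p + (j%:R * s) *: e) w y))//.
    rewrite [`|w - _|]distrC.
    have h2 : `|p + (j%:R * s) *: e - y| <= L * hh k + T.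
      rewrite addrAC (le_trans (ler_normD _ _))// lerD//; first exact: ltW.
      by rewrite normrZ ger0_norm// (le_trans _ tj)// ler_piMr.
    have -> : (L + 2 * Cc + 2) * hh k = L * hh k + 2 * T + 2 * hh k by rewrite /T; ring.
    exact: (chain_arith1 pw h2 rho1 h T0).
  by have := step I (leqnn I); rewrite IsT.
have [c1 d1] := desc z dz zy; have [c1' _] := desc z' dz' z'y.
rewrite (_ : (2 * I + 1 = I + 1 + I)%N); last by rewrite mul2n -addnn addnAC.
suff lk : chain S rho 1 (z + T *: e, rho) (z' + T *: e, rho).
  exact: (chain_cat (chain_cat c1 lk) (chain_rev (lexx rho : rho <= (z', rho).2) c1')).
right; exists (z' + T *: e, rho); split => //=; last by left.
have zz' : `|z' - z| < 2 * L * hh k.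
  rewrite -(subrKA y) (le_lt_trans (ler_normD _ _))// [`|y - z|]distrC.
  by move: zy z'y; rewrite -mulrA; set q := `|_|; set q' := `|_|; set l := L * _; lra.
have ccT : cc * T = (2 * L + 1) * hh k.
  by rewrite /T /Cc mulrA [cc * _]mulrC divfK// gt_eqF.
exists (z + T *: e), (2 * L * hh k + 2 * rho); rewrite /= subrr normr0 add0r.
have Lh : 0 <= L * hh k by rewrite mulr_ge0 ?(ltW h)//; move: L1; lra.
split; first by rewrite -mulrA; move: rho0 Lh; lra.
  rewrite [X in `|X|](_ : _ = z' - z); last by rewrite opprD addrACA subrr addr0.
  by move: zz' rho0; set q := `|_|; lra.
move=> w /rV_ballP zw; split.
  apply: deep_le (deep_shift (y := w) d1); rewrite ccT distrC -/rho mulrDl mul1r.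
  by move: zw rho1 h; set q := `|_|; lra.
rewrite /ccube /= (le_trans (ler_distD (z + T *: e) w y))// [`|w - _|]distrC.
have h2 : `|z + T *: e - y| <= L * hh k + T.
  rewrite addrAC (le_trans (ler_normD _ _))// lerD//; first exact: ltW.
  by rewrite normrZ gtr0_norm// ler_piMr// ltW.
have Cc2 : 2 * (L * hh k) <= T.
  rewrite /T mulrA ler_pM2r// /Cc ler_pdivlMr//.
  have : 2 * L * cc <= 2 * L by rewrite ler_piMr//; move: L1; lra.
  by move: L1; set q := 2 * L * cc; lra.
have -> : (L + 2 * Cc + 2) * hh k = L * hh k + 2 * T + 2 * hh k by rewrite /T; ring.
rewrite -(mulrA 2 L) in zw.
exact: (chain_arith2 zw h2 rho1 h Cc2).
Qed.

(** Up to the scale [eta] the cone yields the chains. At coarser scales all sample points have depth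
    [cc * eta], so that compactness provides chains, and their distance from [y] is bounded by the
    size of [D], that is by a multiple of [eta]. *)
Lemma cone_chains : exists kap' M3 N, [/\ 0 < kap', kap' <= 1 & 4 * kap' <= cc] /\
  forall M3', M3 <= M3' -> forall k y z z', D y ->
  deep D (cc * hh k) z -> `|z - y| < L * hh k ->
  deep D (cc * hh k) z' -> `|z' - y| < L * hh k ->
  chain (Rset D kap' M3' y (hh k)) (kap' * hh k) N (z, kap' * hh k) (z', kap' * hh k).
Proof.
have Cc0 : 0 < Cc by rewrite /Cc divr_gt0//; move: L1; lra.
have L0 : 0 < L by apply: lt_le_trans L1.
have eta0 : 0 < r / (Cc + L) / 2 by rewrite !divr_gt0// addr_gt0.
have [K HK] := hh_small h00 eta0; pose eta := hh K; have etap : 0 < eta by exact: hk.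
have [rho rho0 [N JN]] := joined_deep oD cD bD (mulr_gt0 cc0 etap).
have [B HB] := bD.
(* The second term makes [kap' * hh k] an admissible radius for [joined] at all coarse scales. *)
pose kap' := Num.min kap (rho / h0).
have kap'0 : 0 < kap' by rewrite lt_min kap0 divr_gt0.
have kap'k : kap' <= kap by rewrite ge_min lexx.
have kap1 : kap <= 1 / 8 by rewrite /kap; move: c21 cc1; lra.
exists kap', (Num.max (L + 2 * Cc + 2) (2 * `|B| / eta)), (maxn (2 * (Num.truncn (Cc / kap')).+1 + 1) N).
split; first split => //; first by apply: le_trans kap'k _; move: kap1; lra.
  apply: (@le_trans _ _ (4 * kap)); first by rewrite ler_pM2l.
  by rewrite /kap mulrC divfK//; apply: le_trans c21 _; move: cc0; lra.
move=> M3'; rewrite ge_max => /andP[M3a M3b] k y z z' Dy dz zy dz' z'y.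
have [Kk|kK] := leqP K k.
  have hkk : hh k <= r / (Cc + L) / 2 by exact: HK.
  have hr : (Cc + L) * hh k < r.
    have CL : 0 < Cc + L by rewrite addr_gt0.
    rewrite mulrC -ltr_pdivlMr//; apply: le_lt_trans hkk _.
    by rewrite ltr_pdivrMr// ltr_pMr ?divr_gt0// (ltr_nat R 1 2).
  have hC : Cc * hh k < r.
    by apply: le_lt_trans hr; rewrite ler_pM2r// lerDl ltW.
  have hL : L * hh k < r.
    by apply: le_lt_trans hr; rewrite ler_pM2r// lerDr ltW.
  apply: (chain_mono (leq_maxl _ _)).
  apply: chainS (fine_chain hC hL Dy dz zy dz' z'y kap'0 kap'k) => //.
  move=> w [dw wy]; split => //; apply: le_trans wy _; rewrite ler_pM2r//.
apply: (chain_mono (leq_maxr _ _)).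
have ek : eta <= hh k by apply: hh_le => //; exact: ltnW.
have dd w : deep D (cc * hh k) w -> deep D (cc * eta) w.
  by apply: deep_le; rewrite ler_pM2l.
have krho : kap' * hh k <= rho.
  apply: (@le_trans _ _ (rho / h0 * h0)); last by rewrite divfK// gt_eqF.
  apply: ler_pM; rewrite ?(ltW kap'0) ?(ltW (hk k))//; last exact: hh_le0.
  by rewrite ge_min lexx orbT.
have J := JN _ _ (dd _ dz) (dd _ dz') _ (mulr_gt0 kap'0 (hk k)) krho.
apply: chainS J => // w dw; split => //.
have Dw : D w by apply: deep_sub dw; exact: mulr_gt0.
rewrite /ccube /= (le_trans (ler_normB _ _))//.
apply: (@le_trans _ _ (2 * `|B|)).
  rewrite mulr_natl mulr2n lerD//; [exact: le_trans (HB _ Dw) (ler_norm _)|exact: le_trans (HB _ Dy) (ler_norm _)].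
apply: (@le_trans _ _ (2 * `|B| / eta * hh k)); last by rewrite ler_pM2r.
by rewrite mulrAC -mulrA ler_peMr ?mulr_ge0// ler_pdivlMr// mul1r.
Qed.

End cone.

(** * The extension operator *)

Opaque partial kB tau sigma dtau ddtau.

Section iterated_ibp.
Context {R : realType} {n : nat}.
Local Notation V := 'rV[R]_n.
Local Notation mu := (@lebesgue_rV R n).

Lemma csm_bsupp_int_on (D : set V) (f g : V -> R) : measurable D ->
  (forall x, ~ D x -> g x = 0) ->
  \int[mu]_(x in D) (f x * g x) = \int[mu]_x (f x * g x).
Proof.
move=> mD gD; rewrite [in LHS]Rintegral_mkcond; apply: eq_Rintegral => x _; rewrite patchE.
by case: ifPn => // /negP; rewrite inE => /gD ->; rewrite mulr0.
Qed.

(* The directions are reversed so that no symmetry of second derivatives is needed. *)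
Lemma ibp_partials (D : set V) (s : seq 'I_n) (g psi : V -> R) : measurable D -> csm g ->
  test_function D psi ->
  \int[mu]_(x in D) (g x * partials s psi x) =
  (-1) ^+ size s * \int[mu]_(x in D) (partials (rev s) g x * psi x).
Proof.
move=> mD cg tpsi.
have out t x : ~ D x -> partials t psi x = 0 by move=> nx; exact: (test_function_out t tpsi nx).
have [r Hr] := test_function_bsupp tpsi.
rewrite (csm_bsupp_int_on g mD (out s)) (csm_bsupp_int_on (partials (rev s) g) mD (out [::])).
elim: s g cg => [|i s IH] g cg; first by rewrite expr0 mul1r.
have cpsi := csm_partials s (test_function_csm tpsi).
rewrite rev_cons (_ : partials (rcons (rev s) i) g = partials (rev s) (partial i g)); last first.
  by rewrite /partials foldr_rcons.
rewrite exprS -mulrA -IH; last exact: csm_partial.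
rewrite mulN1r; apply: (ibp (r := r) i (cg 1%N) (cpsi 1%N)) => x; exact: Hr.
Qed.

End iterated_ibp.

Lemma neg_add0 {R : realType} (p q r : R) : r = -1 * q + p -> r = 0 -> p = q.
Proof. by move=> -> h; lra. Qed.

Section extension.
Context {R : realType} {n : nat}.
Local Notation V := 'rV[R]_n.
Local Notation mu := (@lebesgue_rV R n).
Variables (D Om : set V) (h0 c kap M M3 : R) (A0 N : nat).
Hypotheses (HC : chained D Om h0 c kap M M3 N) (HG : in_grid Om h0 A0) (DOm : D `<=` Om).
Hypothesis oOm : open Om.
Local Notation hh := (hh h0).
Local Notation ext_k u := (@ext_k R n D h0 c kap M A0 u).
Local Notation near := (@near R n D).

Let oD : open D. Proof. by case: HC. Qed.
Let h00 : 0 < h0. Proof. by case: HC => _ []. Qed.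
Let kap0 : 0 < kap. Proof. by case: HC => _ []. Qed.
Let M30 : 0 < M3.
Proof. by case: HC => _ [_ _ _ _ h] M0 _ _; move: h M0; lra. Qed.
Let mD : measurable D. Proof. exact: open_measurable_rV. Qed.
Let mOm : measurable Om. Proof. exact: open_measurable_rV. Qed.

Definition ext_op (u : V -> R) : V -> R := glue D h0 (ext_k u) u.

(** The candidate for the weak derivative [s] of the extension: [v] on [D] and limits of classical
    derivatives off [D]. The order of directions is the one of [ibp_partials]. *)
Definition ext_der s (u v : V -> R) : V -> R := glue D h0 (fun k => partials (rev s) (ext_k u k)) v.

Let csm_ext u k : csm (ext_k u k).
Proof. by apply: csm_vv => // l q; exact: csm_PP. Qed.

Let ext_far s u k x : ~ near (8 * hh k.+1) x ->
  partials s (ext_k u k.+1) x = partials s (ext_k u k) x.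
Proof. by move=> nx; apply: near_partials_eq; apply: vv_far. Qed.

Section one_derivative.
Variables (s : seq 'I_n) (u v f : V -> R) (u1 : 'I_n -> V -> R) (C : R).
Hypotheses (W : wk1 D u u1) (C0 : 0 <= C).
Hypothesis uv : forall theta, test_function D theta ->
  \int[mu]_(x in D) (u x * partials s theta x) = (-1) ^+ size s * \int[mu]_(x in D) (v x * theta x).
Hypotheses (mv : measurable_fun D v) (vf : forall y, D y -> `|v y| <= f y).
Hypotheses (f0 : forall y, 0 <= f y) (If : mu.-integrable D (EFin \o f)).
Hypothesis HB : forall k x, Om x -> (k == 0)%N || `[< near (8 * hh k) x >] ->
  `|partials (rev s) (ext_k u k) x| <=
  C * (@Kc R n (kap * hh k) * \int[mu]_(y in Rset D kap M3 x (hh k)) f y).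

Let w_ k := partials (rev s) (ext_k u k).
Let cw_ k : continuous (w_ k).
Proof. exact: (ck_continuous (csm_partials (rev s) (csm_ext u k) 0%N)). Qed.
Let w_far k x : ~ near (8 * hh k.+1) x -> w_ k.+1 x = w_ k x.
Proof. exact: ext_far. Qed.

(** Weak convergence of the functions implies that of their derivatives, which are thrown onto
    theta; the two signs cancel. *)
Let w_cvg theta : test_function D theta ->
  (fun k => \int[mu]_(x in D) (w_ k x * theta x)) @ \oo --> \int[mu]_(x in D) (v x * theta x).
Proof.
move=> tt; have sg : (-1) ^+ size s * (-1) ^+ size s = 1 :> R.
  by rewrite -exprMn mulrNN mulr1 expr1n.
have E k : \int[mu]_(x in D) (w_ k x * theta x) =
    (-1) ^+ size s * \int[mu]_(x in D) (ext_k u k x * partials s theta x).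
  by rewrite (ibp_partials s mD (csm_ext u k) tt) mulrA sg mul1r.
have -> : \int[mu]_(x in D) (v x * theta x) =
    (-1) ^+ size s * \int[mu]_(x in D) (u x * partials s theta x).
  by rewrite uv// mulrA sg mul1r.
rewrite (_ : (fun k => _) = (fun k => (-1) ^+ size s * \int[mu]_(x in D) (ext_k u k x * partials s theta x))).
  apply: cvgMr; apply: (ext_cvg HC HG DOm W).
  exact: test_function_partials.
exact/funext.
Qed.

Lemma ext_der_integrable : mu.-integrable Om (EFin \o ext_der s u v).
Proof.
exact: (glue_integrable oD oOm DOm h00 kap0 M30 C0 f0 If mv vf cw_ HB w_far).
Qed.

Lemma ext_der_Lp J p : 1 <= p -> 2 * M3 <= kap * 2 ^+ J ->
  mu.-integrable D (EFin \o (fun y => f y `^ p)) ->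
  (\int[mu]_(x in Om) (`|ext_der s u v x| `^ p)%:E <=
   (@glue_const R n kap M3 C J p)%:E * \int[mu]_(y in D) (f y `^ p)%:E)%E.
Proof.
move=> p1 HJ Ip.
exact: (glue_Lp oD oOm DOm h00 kap0 M30 C0 f0 If mv vf cw_ HB w_far p1 HJ Ip).
Qed.

Lemma ext_der_limit psi : test_function Om psi ->
  (fun k => \int[mu]_(x in Om) (w_ k x * psi x)) @ \oo -->
  \int[mu]_(x in Om) (ext_der s u v x * psi x).
Proof.
exact: (glue_weak_limit oD oOm DOm h00 kap0 M30 C0 f0 If mv vf cw_ HB w_far HG w_cvg).
Qed.

End one_derivative.

Let abs_int (u : V -> R) : mu.-integrable D (EFin \o u) -> mu.-integrable D (EFin \o (fun y => `|u y|)).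
Proof. by move=> iu; exact: rint_norm. Qed.

Let mm0 : 0 <= M3 / kap. Proof. by rewrite divr_ge0// ltW. Qed.

Let C0e : 0 <= @C0ext R n kap M3.
Proof.
rewrite /C0ext; apply: mulr_ge0; first by apply: addr_ge0 => //; apply: mulr_ge0 => //; exact: Cjet_ge0.
by apply: addr_ge0 => //; apply: mulr_ge0 => //; apply: addr_ge0.
Qed.

Let C1e : 0 <= @C1ext R n kap M3 N.
Proof.
rewrite /C1ext; apply: addr_ge0 => //; apply: mulr_ge0.
  by apply: mulr_ge0 => //; exact: Cjet_ge0.
by apply: addr_ge0 => //; exact: mulr_ge0.
Qed.

Let C2e : 0 <= @C2ext R n kap M3 N.
Proof.
rewrite /C2ext; apply: mulr_ge0; last exact: addr_ge0.
by apply: mulr_ge0 => //; exact: Cjet_ge0.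
Qed.

Let RD x k : Rset D kap M3 x (hh k) `<=` D.
Proof. by move=> y [h _]; apply: deep_sub h; apply: mulr_gt0 => //; exact: hh_gt0. Qed.

Let mR x k : measurable (Rset D kap M3 x (hh k)). Proof. exact: measurable_Rset. Qed.

Let sum1_int (I : finType) (u1 : I -> V -> R) :
  (forall j, mu.-integrable D (EFin \o u1 j)) ->
  forall x k, \int[mu]_(y in Rset D kap M3 x (hh k)) (\sum_j `|u1 j y|) =
  \sum_j \int[mu]_(y in Rset D kap M3 x (hh k)) `|u1 j y|.
Proof.
move=> I1 x k; apply: Rintegral_sum => // j _; apply: rint_norm => //.
exact: (integrableS mD (mR x k) (@RD x k) (I1 j)).
Qed.

Section order0.
Variables (u : V -> R) (u1 : 'I_n -> V -> R).
Hypothesis W : wk1 D u u1.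

Let Iu : mu.-integrable D (EFin \o u). Proof. by case: W. Qed.

Let HB0 k x : Om x -> (k == 0)%N || `[< near (8 * hh k) x >] ->
  `|partials (rev [::]) (ext_k u k) x| <=
  @C0ext R n kap M3 * (@Kc R n (kap * hh k) * \int[mu]_(y in Rset D kap M3 x (hh k)) `|u y|).
Proof. by move=> Ox kx; exact: (ext_bound0 HC HG Iu Ox kx). Qed.

Let uv0 theta : test_function D theta ->
  \int[mu]_(x in D) (u x * partials [::] theta x) = (-1) ^+ size (Nil 'I_n) * \int[mu]_(x in D) (u x * theta x).
Proof. by move=> _; rewrite expr0 mul1r. Qed.

Let mu0 := rint_measurable Iu.

Lemma ext_op_integrable : mu.-integrable Om (EFin \o ext_op u).
Proof.
exact: (ext_der_integrable C0e mu0 (fun y _ => lexx _) (fun y => normr_ge0 _) (abs_int Iu) HB0).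
Qed.

Lemma ext_op_Lp J p : 1 <= p -> 2 * M3 <= kap * 2 ^+ J ->
  mu.-integrable D (EFin \o (fun y => `|u y| `^ p)) ->
  (\int[mu]_(x in Om) (`|ext_op u x| `^ p)%:E <=
   (@glue_const R n kap M3 (@C0ext R n kap M3) J p)%:E * \int[mu]_(y in D) (`|u y| `^ p)%:E)%E.
Proof.
exact: (ext_der_Lp C0e mu0 (fun y _ => lexx _) (fun y => normr_ge0 _) (abs_int Iu) HB0).
Qed.

Lemma ext_op_limit psi : test_function Om psi ->
  (fun k => \int[mu]_(x in Om) (ext_k u k x * psi x)) @ \oo --> \int[mu]_(x in Om) (ext_op u x * psi x).
Proof.
exact: (ext_der_limit W C0e uv0 mu0 (fun y _ => lexx _) (fun y => normr_ge0 _) (abs_int Iu) HB0).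
Qed.

(** Passage to the limit on both sides of the integration by parts for the smooth [ext_k] on all of
    [Om]. Possible jumps across the boundary of [D] are excluded by the weak convergence itself. *)
Lemma ext_weak_derivative s v f C : 0 <= C ->
  (forall theta, test_function D theta ->
    \int[mu]_(x in D) (u x * partials s theta x) = (-1) ^+ size s * \int[mu]_(x in D) (v x * theta x)) ->
  measurable_fun D v -> (forall y, D y -> `|v y| <= f y) ->
  (forall y, 0 <= f y) -> mu.-integrable D (EFin \o f) ->
  (forall k x, Om x -> (k == 0)%N || `[< near (8 * hh k) x >] ->
    `|partials (rev s) (ext_k u k) x| <=
    C * (@Kc R n (kap * hh k) * \int[mu]_(y in Rset D kap M3 x (hh k)) f y)) ->
  is_weak_derivative Om s (ext_op u) (ext_der s u v).
Proof.
move=> C0 uv mv vf f0 If HB.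
have I1 := ext_op_integrable; have I2 := ext_der_integrable C0 mv vf f0 If HB.
have loc g : mu.-integrable Om (EFin \o g) -> locally_integrable_on Om g.
  move=> Ig; split; first exact: rint_measurable Ig.
  move=> K KO cK; exact: (integrableS mOm (measurable_compact cK) KO Ig).
split; [exact: loc|exact: loc|] => psi tpsi.
have L1 := ext_op_limit (test_function_partials s tpsi).
have L2 := ext_der_limit W C0 uv mv vf f0 If HB tpsi.
have {}L2 : (fun k => (-1) ^+ size s * \int[mu]_(x in Om) (partials (rev s) (ext_k u k) x * psi x)) @ \oo -->
    (-1) ^+ size s * \int[mu]_(x in Om) (ext_der s u v x * psi x).
  by apply: cvgMr; exact: L2.
have E : (fun k => \int[mu]_(x in Om) (ext_k u k x * partials s psi x)) =
  (fun k => (-1) ^+ size s * \int[mu]_(x in Om) (partials (rev s) (ext_k u k) x * psi x)).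
  by apply/funext => k; exact: (ibp_partials s mOm (csm_ext u k) tpsi).
rewrite E in L1; exact: (cvg_unique _ L1 L2).
Qed.

Let f1 y := \sum_j `|u1 j y|.

Let Iu1 j : mu.-integrable D (EFin \o u1 j). Proof. by case: W. Qed.

Let If1 : mu.-integrable D (EFin \o f1).
Proof. by apply: rint_sum => // j _; exact: abs_int. Qed.

Let f10 y : 0 <= f1 y. Proof. exact: sumr_ge0. Qed.

Let u1f1 j y : D y -> `|u1 j y| <= f1 y.
Proof. by move=> _; apply: (@ler_sum_term R n (fun j => `|u1 j y|)). Qed.

Let HB1 i k x : Om x -> (k == 0)%N || `[< near (8 * hh k) x >] ->
  `|partials (rev [:: i]) (ext_k u k) x| <=
  @C1ext R n kap M3 N * (@Kc R n (kap * hh k) * \int[mu]_(y in Rset D kap M3 x (hh k)) f1 y).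
Proof. by move=> Ox kx; rewrite sum1_int//; exact: (ext_bound1 HC HG i W Ox kx). Qed.

Lemma ext_weak1 i : is_weak_derivative Om [:: i] (ext_op u) (ext_der [:: i] u (u1 i)).
Proof.
have [_ _ H] := W.
apply: (@ext_weak_derivative [:: i] (u1 i) f1 _ C1e) => //; last exact: HB1.
- by move=> theta tt /=; rewrite H// expr1 mulN1r.
- exact: rint_measurable (Iu1 i).
- exact: u1f1.
Qed.

Lemma ext_Lp1 i J p : 1 <= p -> 2 * M3 <= kap * 2 ^+ J ->
  mu.-integrable D (EFin \o (fun y => (\sum_j `|u1 j y|) `^ p)) ->
  (\int[mu]_(x in Om) (`|ext_der [:: i] u (u1 i) x| `^ p)%:E <=
   (@glue_const R n kap M3 (@C1ext R n kap M3 N) J p)%:E *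
   \int[mu]_(y in D) ((\sum_j `|u1 j y|) `^ p)%:E)%E.
Proof.
exact: (ext_der_Lp C1e (rint_measurable (Iu1 i)) (u1f1 i) f10 If1 (HB1 i)).
Qed.

Variable u2 : 'I_n -> 'I_n -> V -> R.
Hypothesis W2 : forall j, wk1 D (u1 j) (u2 j).

Let f2 y := \sum_j \sum_i `|u2 j i y|.

Let Iu2 j i : mu.-integrable D (EFin \o u2 j i). Proof. by case: (W2 j). Qed.

Let If2 : mu.-integrable D (EFin \o f2).
Proof. by apply: rint_sum => // j _; apply: rint_sum => // i _; exact: abs_int. Qed.

Let f20 y : 0 <= f2 y. Proof. by apply: sumr_ge0 => j _; exact: sumr_ge0. Qed.

Let u2f2 j i y : D y -> `|u2 j i y| <= f2 y.
Proof.
move=> _; apply: le_trans (@ler_sum_term R n (fun j => \sum_i `|u2 j i y|) j _).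
  by apply: (@ler_sum_term R n (fun i => `|u2 j i y|)).
by move=> k; exact: sumr_ge0.
Qed.

Let HB2 i j k x : Om x -> (k == 0)%N || `[< near (8 * hh k) x >] ->
  `|partials (rev [:: i; j]) (ext_k u k) x| <=
  @C2ext R n kap M3 N * (@Kc R n (kap * hh k) * \int[mu]_(y in Rset D kap M3 x (hh k)) f2 y).
Proof.
move=> Ox kx.
have -> : \int[mu]_(y in Rset D kap M3 x (hh k)) f2 y =
    \sum_j \sum_i \int[mu]_(y in Rset D kap M3 x (hh k)) `|u2 j i y|.
  rewrite Rintegral_sum// => [|l _]; last first.
    apply: rint_sum => // i' _; apply: rint_norm => //.
    exact: (integrableS mD (mR x k) (@RD x k) (Iu2 l i')).
  by apply: eq_bigr => l _; exact: sum1_int.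
exact: (ext_bound2 HC HG j i W W2 Ox kx).
Qed.

Lemma ext_weak2 i j : is_weak_derivative Om [:: i; j] (ext_op u) (ext_der [:: i; j] u (u2 i j)).
Proof.
have [_ _ H] := W; have [_ _ H2] := W2 i.
apply: (@ext_weak_derivative [:: i; j] (u2 i j) f2 _ C2e) => //; last exact: HB2.
- move=> theta tt /=; rewrite H; last exact: test_function_partial.
  by rewrite H2// opprK sqrrN expr1n mul1r.
- exact: rint_measurable (Iu2 i j).
- exact: u2f2.
Qed.

Lemma ext_Lp2 i j J p : 1 <= p -> 2 * M3 <= kap * 2 ^+ J ->
  mu.-integrable D (EFin \o (fun y => (\sum_j \sum_i `|u2 j i y|) `^ p)) ->
  (\int[mu]_(x in Om) (`|ext_der [:: i; j] u (u2 i j) x| `^ p)%:E <=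
   (@glue_const R n kap M3 (@C2ext R n kap M3 N) J p)%:E *
   \int[mu]_(y in D) ((\sum_j \sum_i `|u2 j i y|) `^ p)%:E)%E.
Proof.
exact: (ext_der_Lp C2e (rint_measurable (Iu2 i j)) (u2f2 i j) f20 If2 (HB2 i j)).
Qed.

End order0.

Lemma ext_op_in u x : D x -> ext_op u x = u x.
Proof. exact: glue_in. Qed.

Section linearity.
Variables (u v : V -> R).
Hypotheses (Iu : mu.-integrable D (EFin \o u)) (Iv : mu.-integrable D (EFin \o v)).

Let Itest (w psi : V -> R) (z : V) r : mu.-integrable D (EFin \o w) -> csm psi ->
  (forall y, psi y != 0 -> `|y - z| < r) ->
  mu.-integrable D (EFin \o (fun y => w y * psi y)).
Proof. exact: rint_krnlike. Qed.

Let lin_int (a : R) (psi : V -> R) : mu.-integrable D (EFin \o (fun y => u y * psi y)) ->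
  mu.-integrable D (EFin \o (fun y => v y * psi y)) ->
  \int[mu]_(y in D) ((a * u y + v y) * psi y) =
  a * (\int[mu]_(y in D) (u y * psi y)) + \int[mu]_(y in D) (v y * psi y).
Proof.
move=> Iup Ivp; rewrite -RintegralZl// -RintegralD//; last exact: rintZ.
by apply: eq_Rintegral => y _; rewrite mulrDl mulrA.
Qed.

Lemma beta_linear a z r j : 0 < r ->
  beta D (fun x => a * u x + v x) z r j = a * beta D u z r j + beta D v z r j.
Proof.
move=> r0; have I w : mu.-integrable D (EFin \o w) ->
    mu.-integrable D (EFin \o (fun y => w y * partial j (krn z r) y)).
  move=> Iw; apply: (Itest Iw (z := z) (r := r)); first by apply: csm_partial; exact: csm_krn.
  by move=> y; exact: partial_krn_supp.
by rewrite /beta lin_int ?opprD ?mulrN//; exact: I.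
Qed.

Lemma alpha_linear a z r : 0 < r ->
  alpha D (fun x => a * u x + v x) z r = a * alpha D u z r + alpha D v z r.
Proof.
move=> r0; rewrite /alpha.
pose psi y := n.+1%:R * krn z r y + \sum_j y 0 j * partial j (krn z r) y.
have cpsi : csm psi.
  move=> k; apply: (@ckD _ _ k (fun y => n.+1%:R * krn z r y)).
    by apply: ckZ; exact: csm_krn.
  apply: ck_sum => j _; apply: (@ckM _ _ k (fun y : V => y 0 j)).
    by apply: (@ck_coord _ _ k id); exact: smo_id.
  by apply: csm_partial; exact: csm_krn.
have I w : mu.-integrable D (EFin \o w) -> mu.-integrable D (EFin \o (fun y => w y * psi y)).
  move=> Iw; apply: (Itest Iw (z := z) (r := r)) => // y; apply: contraNT => yz.
  rewrite /psi (_ : krn z r y = 0) ?mulr0 ?add0r.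
    apply/eqP; apply: big1 => j _; apply/eqP; rewrite mulf_eq0; apply/orP; right.
    by apply: contraNT yz; exact: partial_krn_supp.
  by apply/eqP; apply: contraNT yz; exact: krn_supp.
by apply: lin_int; exact: I.
Qed.

Let zr (k : nat) (q : @grid n A0 k) : 0 < kap * hh k.
Proof. by rewrite mulr_gt0// hh_gt0. Qed.

Lemma PP_linear a k (q : @grid n A0 k) x :
  @PP R n D h0 c kap M A0 (fun x => a * u x + v x) k q x =
  a * @PP R n D h0 c kap M A0 u k q x + @PP R n D h0 c kap M A0 v k q x.
Proof.
rewrite /PP /Ptl (alpha_linear a _ (zr q)).
rewrite (eq_bigr (fun j => a * (beta D u (@zz R n D h0 c M A0 k q) (kap * hh k) j * x 0 j) +
  beta D v (@zz R n D h0 c M A0 k q) (kap * hh k) j * x 0 j)).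
  by rewrite big_split /= -mulr_sumr mulrDr addrACA.
by move=> j _; rewrite (beta_linear a _ j (zr q)) mulrDl mulrA.
Qed.

Lemma ext_k_linear a k x : ext_k (fun x => a * u x + v x) k x = a * ext_k u k x + ext_k v k x.
Proof.
have A l : vA h0 D (@PP R n D h0 c kap M A0 (fun x => a * u x + v x)) l x =
    a * vA h0 D (@PP R n D h0 c kap M A0 u) l x + vA h0 D (@PP R n D h0 c kap M A0 v) l x.
  rewrite /vA mulr_sumr -big_split; apply: eq_bigr => q _ /=.
  by rewrite PP_linear mulrDr mulrCA.
elim: k => [|k IH]; first exact: A.
have arith (a' p q e s t : R) : a' * p + q + e * (a' * s + t) = a' * (p + e * s) + (q + e * t) by ring.
by rewrite !ext_kS A IH arith.
Qed.

(** Linearity at every point: inside [D] it is trivial, on its boundary all values are 0, and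
    elsewhere the value is that of some level. *)
Lemma ext_op_linear a x :
  ext_op (fun x => a * u x + v x) x = a * ext_op u x + ext_op v x.
Proof.
have [Dx|nD] := pselect (D x); first by rewrite !ext_op_in.
have [h|/existsNP[k nk]] := pselect (forall k, near (8 * hh k) x).
  by rewrite /ext_op /glue !(asboolF nD) !(asboolT h) mulr0 addr0.
have nk1 : ~ near (8 * hh k.+1) x by move=> h; apply: nk; apply: nearS h.
have G w : ext_op w x = ext_k w k x.
  by apply: glue_far => // l y; exact: (@ext_far [::]).
by rewrite !G ext_k_linear.
Qed.

End linearity.

(* By linearity it suffices that the extension of a null function vanishes outside [D]. *)
Lemma ext_op_ae u v : mu.-integrable D (EFin \o u) -> mu.-integrable D (EFin \o v) ->
  u = v %[ae mu in D] -> ext_op u = ext_op v %[ae mu in Om].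
Proof.
move=> Iu Iv uv; pose w x := -1 * v x + u x.
have Iw : mu.-integrable D (EFin \o w) by apply: rintD => //; exact: rintZ.
have w0 : w = cst 0 %[ae mu in D].
  by apply: filterS uv => x H Dx; rewrite /w H// mulN1r addNr.
have Z (psi : V -> R) : measurable_fun D psi -> \int[mu]_(y in D) (w y * psi y) = 0.
  move=> mpsi; rewrite /Rintegral (@ae_eq_integral _ _ _ mu D (cst 0%E) _ mD).
  - by rewrite integral0.
  - by apply/measurable_EFinP; apply: measurable_funM => //; exact: rint_measurable Iw.
  - exact: measurable_cst.
  by apply: filterS w0 => y H Dy /=; rewrite H// mul0r.
have mk (z : V) r s : measurable_fun D (partials s (krn z r)).
  apply: measurable_funTS; apply: continuous_measurable_rV.
  exact: (ck_continuous (csm_partials s (csm_krn z r) 0%N)).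
have P0 k (q : @grid n A0 k) x : @PP R n D h0 c kap M A0 w k q x = 0.
  rewrite /PP /Ptl /alpha Z.
    by rewrite add0r big1// => j _; rewrite /beta Z ?oppr0 ?mul0r//; exact: (mk _ _ [:: j]).
  apply: measurable_funD.
    by apply: measurable_funM; [exact: measurable_cst|exact: (mk _ _ [::])].
  apply: measurable_sum => j; apply: measurable_funM; last exact: (mk _ _ [:: j]).
  by apply: measurable_funTS; exact: (@measurable_rV_coord R n j).
have vA0 l x : vA h0 D (@PP R n D h0 c kap M A0 w) l x = 0.
  by rewrite /vA big1// => q _; rewrite P0 mulr0.
have ext0 k x : ext_k w k x = 0.
  elim: k => [|k IH]; first exact: vA0.
  by rewrite ext_kS vA0 IH mulr0 addr0.
have op0 x : ~ D x -> ext_op w x = 0.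
  move=> nD; have [h|/existsNP[k nk]] := pselect (forall k, near (8 * hh k) x).
    by rewrite /ext_op /glue (asboolF nD) (asboolT h).
  have nk1 : ~ near (8 * hh k.+1) x by move=> h; apply: nk; apply: nearS h.
  rewrite /ext_op (@glue_far _ _ D h0 (ext_k w) w h00 _ k)//.
  by move=> l y; exact: (@ext_far [::]).
apply: filterS w0 => x H _.
have L := ext_op_linear Iv Iu (-1) x; rewrite -/w in L.
have [Dx|nD] := pselect (D x).
  by rewrite !ext_op_in//; apply/eqP; rewrite -subr_eq0 addrC -mulN1r; apply/eqP; exact: H.
exact: neg_add0 L (op0 x nD).
Qed.

End extension.

(** * Lp norms *)

Section lp_norms.
Context {R : realType} {n : nat}.
Local Notation V := 'rV[R]_n.
Local Notation mu := (@lebesgue_rV R n).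
Implicit Types (D : set V) (f g : V -> R) (p : R).

Lemma sum_sqr_le (I : finType) (F : I -> R) : (forall i, 0 <= F i) ->
  \sum_i F i ^+ 2 <= (\sum_i F i) ^+ 2.
Proof.
move=> F0; rewrite expr2 mulr_suml; apply: ler_sum => i _; rewrite expr2.
by apply: ler_wpM2l => //; rewrite (bigD1 i)//= lerDl sumr_ge0.
Qed.

Lemma frobenius_ge0 m q (A : 'M[R]_(m, q)) : 0 <= frobenius_norm A.
Proof. exact: sqrtr_ge0. Qed.

Lemma frobenius_le_sum m q (A : 'M[R]_(m, q)) :
  frobenius_norm A <= \sum_i \sum_j `|A i j|.
Proof.
have S0 : 0 <= \sum_i \sum_j `|A i j| by apply: sumr_ge0 => i _; exact: sumr_ge0.
rewrite -[leRHS]ger0_norm// -sqrtr_sqr ler_sqrt ?sqr_ge0//.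
rewrite pair_bigA /= [X in X ^+ 2](pair_bigA _ (fun i j => `|A i j|)) /=.
apply: le_trans (sum_sqr_le _) => [|i]; last exact: normr_ge0.
by apply: ler_sum => i _; rewrite real_normK// num_real.
Qed.

Lemma entry_le_frobenius m q (A : 'M[R]_(m, q)) i j : `|A i j| <= frobenius_norm A.
Proof.
rewrite -sqrtr_sqr ler_sqrt.
  rewrite (bigD1 i)//= (bigD1 j)//= -addrA lerDl addr_ge0//.
    by apply: sumr_ge0 => k _; exact: sqr_ge0.
  by apply: sumr_ge0 => k _; apply: sumr_ge0 => l _; exact: sqr_ge0.
by apply: sumr_ge0 => k _; apply: sumr_ge0 => l _; exact: sqr_ge0.
Qed.

(** Each term is at most the p-th root of the sum of all p-th powers. *)
Lemma powR_sum_le (I : finType) (F : I -> R) p : 1 <= p -> (forall i, 0 <= F i) ->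
  (\sum_i F i) `^ p <= #|I|%:R `^ p * \sum_i F i `^ p.
Proof.
move=> p1 F0; have p0 : 0 < p by apply: lt_le_trans p1.
set S := \sum_i F i `^ p.
have S0 : 0 <= S by apply: sumr_ge0 => i _; exact: powR_ge0.
have Fi i : F i <= S `^ p^-1.
  rewrite -[leLHS]powRr1// -(divff (lt0r_neq0 p0)) powRrM.
  apply: ge0_ler_powR; rewrite ?nnegrE ?powR_ge0 ?invr_ge0 ?(ltW p0)//.
  by rewrite /S (bigD1 i)//= lerDl sumr_ge0// => j _; exact: powR_ge0.
have -> : #|I|%:R `^ p * S = (#|I|%:R * S `^ p^-1) `^ p.
  by rewrite powRM ?powR_ge0// -powRrM mulVf ?gt_eqF// powRr1.
apply: ge0_ler_powR; rewrite ?nnegrE ?sumr_ge0 ?mulr_ge0 ?powR_ge0 ?(ltW p0)//.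
apply: (@le_trans _ _ (\sum_(i : I) S `^ p^-1)); first by apply: ler_sum.
by rewrite sumr_const mulr_natl.
Qed.

Section one_domain.
Variables (D : set V).
Hypothesis mD : measurable D.

Lemma LpD_normE p f : p != 0 ->
  (LpD_norm D p f `^ p = \int[mu]_(x in D) (`|f x| `^ p)%:E)%E.
Proof.
move=> p0; rewrite /LpD_norm poweR_Lnorm// [RHS]integral_mkcond.
apply: eq_integral => x _; rewrite /= !patchE; case: ifP => _ //.
by rewrite normr0 powR0.
Qed.

Lemma LpD_norm_ge0 p f : (0 <= LpD_norm D p f)%E.
Proof. exact: Lnorm_ge0. Qed.

Lemma LpDP p f : p != 0 -> LpD D p f <->
  measurable_fun D f /\ (\int[mu]_(x in D) (`|f x| `^ p)%:E < +oo)%E.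
Proof.
move=> p0; rewrite -LpD_normE// /LpD /= inE /=; split.
- move=> /andP[]; rewrite !inE /= /finite_norm => mf lf; split.
    exact/(measurable_restrictT _ mD).
  by apply: poweR_lty; exact: lf.
- move=> [mf lf]; apply/andP; rewrite !inE; split => /=.
    exact/(measurable_restrictT _ mD).
  by rewrite /finite_norm; exact: lty_poweRy lf.
Qed.

Lemma measurable_powR_norm p f : measurable_fun D f ->
  measurable_fun D (fun x => `|f x| `^ p).
Proof.
move=> mf; apply: (measurableT_comp (measurable_powR p)).
exact: (measurableT_comp (@normr_measurable R setT)).
Qed.

Lemma LpD_intp p f : p != 0 -> LpD D p f -> mu.-integrable D (EFin \o (fun x => `|f x| `^ p)).
Proof.
move=> p0 /(LpDP _ p0)[mf lf]; apply/integrableP; split.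
  by apply/measurable_EFinP; exact: measurable_powR_norm.
by rewrite (eq_integral (fun x => (`|f x| `^ p)%:E))// => x _; rewrite /= ger0_norm ?powR_ge0.
Qed.

Lemma powR_ge_id (t p : R) : 0 <= t -> 1 <= p -> t <= 1 + t `^ p.
Proof.
move=> t0 p1; have [t1|t1] := leP t 1; first by rewrite (le_trans t1)// lerDl powR_ge0.
apply: (@le_trans _ _ (t `^ p)); last by rewrite lerDr.
by rewrite -{1}(powRr1 t0); apply: ler_powR => //; exact: ltW.
Qed.

Lemma LpD_integrable p f : 1 <= p -> (mu D < +oo)%E -> LpD D p f -> mu.-integrable D (EFin \o f).
Proof.
move=> p1 fD Lf; have p0 : p != 0 by rewrite gt_eqF// (lt_le_trans _ p1).
have [mf _] := (LpDP f p0).1 Lf.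
apply: (@rint_le _ _ _ mu D mD f (fun x => 1 + `|f x| `^ p)) => //.
  by move=> x _; exact: powR_ge_id.
apply: rintD => //; last exact: LpD_intp.
apply/integrableP; split; first exact/measurable_EFinP.
rewrite (_ : (fun x => _) = cst `|1|%:E)// integral_cst//.
by rewrite lte_mul_pinfty ?lee_fin.
Qed.

Lemma LpD_ae p f g : p != 0 -> LpD D p f -> measurable_fun D g -> f = g %[ae mu in D] -> LpD D p g.
Proof.
move=> p0 /(LpDP _ p0)[mf lf] mg fg; apply/(LpDP _ p0); split => //.
rewrite -(@ge0_ae_eq_integral _ _ _ mu D (fun x => (`|f x| `^ p)%:E))//.
- by apply/measurable_EFinP; exact: measurable_powR_norm.
- by apply/measurable_EFinP; exact: measurable_powR_norm.
by apply: filterS fg => x H Dx; rewrite H.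
Qed.

End one_domain.

Lemma LpD_norm_le D D' p f g (K : R) : measurable D -> measurable D' -> 0 < p -> 0 <= K ->
  (\int[mu]_(x in D') (`|g x| `^ p)%:E <= K%:E * \int[mu]_(x in D) (`|f x| `^ p)%:E)%E ->
  (LpD_norm D' p g <= (K `^ p^-1)%:E * LpD_norm D p f)%E.
Proof.
move=> mD mD' p0 K0; have pn0 : p != 0 by rewrite gt_eqF.
rewrite -!LpD_normE// => H.
have g0 := @LpD_norm_ge0 D' p g; have f0 := @LpD_norm_ge0 D p f.
have root (x : \bar R) : (0 <= x)%E -> ((x `^ p) `^ p^-1 = x)%E.
  by move=> x0; rewrite -poweRrM divff// poweRe1.
have ip : 0 <= p^-1 by rewrite invr_ge0 ltW.
have := gt0_ler_poweR ip _ _ H.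
rewrite root// poweRM ?poweR_ge0 ?lee_fin// root// poweR_EFin; apply.
- by rewrite in_itv /= poweR_ge0 leey.
- by rewrite in_itv /= mule_ge0 ?poweR_ge0 ?lee_fin// leey.
Qed.

Lemma measurable_frobenius D m q (A : V -> 'M[R]_(m, q)) : measurable D ->
  (forall i j, measurable_fun D (fun x => A x i j)) ->
  measurable_fun D (fun x => frobenius_norm (A x)).
Proof.
move=> mD mA; rewrite (_ : (fun x => _) = (fun x => (\sum_i \sum_j A x i j ^+ 2) `^ 2^-1)).
  apply: (measurableT_comp (measurable_powR _)).
  apply: measurable_sum => i; apply: measurable_sum => j.
  exact: measurable_funX.
apply/funext => x; rewrite powR12_sqrt//.
by apply: sumr_ge0 => k _; apply: sumr_ge0 => l _; exact: sqr_ge0.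
Qed.

Lemma sume_ord_const N (c : \bar R) : (0 <= c)%E -> (\sum_(i < N) c = (N%:R)%:E * c)%E.
Proof.
move=> c0; elim: N => [|N IH]; first by rewrite big_ord0 mul0e.
by rewrite big_ord_recr /= IH -natr1 EFinD ge0_muleDl ?lee_fin// mul1e.
Qed.

Definition Cfrob (N : nat) (K p : R) : R := N%:R `^ p * (N%:R * (K * N%:R `^ p)).

(** [weak_derivative] selects some representative, whereas the estimates concern the explicit
    [ext_der]. So [A] stands for the former and [B] for the latter, and they agree almost
    everywhere. *)
Lemma frobenius_transfer D D' m q (A Z : V -> 'M[R]_(m, q)) (B : 'I_m -> 'I_q -> V -> R) K p :
  measurable D -> measurable D' -> 1 <= p -> 0 <= K ->
  (forall i j, measurable_fun D' (fun x => A x i j)) ->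
  (forall i j, measurable_fun D' (B i j)) ->
  (forall i j, measurable_fun D (fun x => Z x i j)) ->
  (forall i j, (fun x => A x i j) = B i j %[ae mu in D']) ->
  (forall i j, (\int[mu]_(x in D') (`|B i j x| `^ p)%:E <=
     K%:E * \int[mu]_(x in D) ((\sum_i \sum_j `|Z x i j|) `^ p)%:E)%E) ->
  (LpD_norm D' p (fun x => frobenius_norm (A x)) <=
   (Cfrob (m * q) K p `^ p^-1)%:E * LpD_norm D p (fun x => frobenius_norm (Z x)))%E.
Proof.
move=> mD mD' p1 K0 mA mB mZ AB HB; have p0 : 0 < p by apply: lt_le_trans p1.
have N0 : 0 <= (m * q)%:R `^ p by exact: powR_ge0.
have card : #|{: 'I_m * 'I_q}| = (m * q)%N by rewrite card_prod !card_ord.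
apply: LpD_norm_le => //; first by rewrite /Cfrob !mulr_ge0.
have sum2 (F : 'I_m -> 'I_q -> R) : (forall i j, 0 <= F i j) ->
    (\sum_i \sum_j F i j) `^ p <= (m * q)%:R `^ p * \sum_i \sum_j F i j `^ p.
  move=> F0; rewrite pair_bigA [X in _ <= _ * X]pair_bigA /= -card.
  by apply: powR_sum_le.
have mE S (G : V -> R) : measurable S -> measurable_fun S G ->
    measurable_fun S (fun x => (G x)%:E) by move=> _ mG; apply/measurable_EFinP.
have mAp i j : measurable_fun D' (fun x => (`|A x i j| `^ p)%:E).
  by apply: mE => //; apply: measurable_powR_norm.
have mBp i j : measurable_fun D' (fun x => (`|B i j x| `^ p)%:E).
  by apply: mE => //; apply: measurable_powR_norm.
have S1 : (\int[mu]_(x in D') (`|frobenius_norm (A x)| `^ p)%:E <=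
    \int[mu]_(x in D') (((m * q)%:R `^ p)%:E * \sum_i \sum_j (`|A x i j| `^ p)%:E))%E.
  apply: ge0_le_integral => //.
  - by apply: mE => //; apply: measurable_powR_norm => //; exact: measurable_frobenius.
  - apply: measurable_funeM; apply: emeasurable_sum => i; exact: emeasurable_sum.
  move=> x _; rewrite (eq_bigr (fun i => (\sum_j `|A x i j| `^ p)%:E)) => [|i _]; last first.
    by rewrite sumEFin.
  rewrite sumEFin -EFinM lee_fin ger0_norm ?frobenius_ge0//.
  apply: le_trans (sum2 (fun i j => `|A x i j|) (fun i j => normr_ge0 _)).
  apply: ge0_ler_powR; rewrite ?nnegrE ?frobenius_ge0 ?(ltW p0)//; last exact: frobenius_le_sum.
  by apply: sumr_ge0 => i _; exact: sumr_ge0.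
apply: (le_trans S1).
have nn i j x : (0 <= (`|A x i j| `^ p)%:E)%E by rewrite lee_fin powR_ge0.
rewrite ge0_integralZl_EFin//; last 2 first.
- by move=> x _; apply: sume_ge0 => i _; exact: sume_ge0.
- by apply: emeasurable_sum => i; exact: emeasurable_sum.
rewrite /Cfrob EFinM -muleA; apply: lee_wpmul2l; first by rewrite lee_fin.
rewrite ge0_integral_sum//; last 2 first.
- by move=> i; exact: emeasurable_sum.
- by move=> i x _; exact: sume_ge0.
set F := (\int[mu]_(x in D) (`|frobenius_norm (Z x)| `^ p)%:E)%E.
have F0 : (0 <= F)%E by apply: integral_ge0 => x _; rewrite lee_fin powR_ge0.
have E1 i j : (\int[mu]_(x in D') (`|A x i j| `^ p)%:E <= (K * (m * q)%:R `^ p)%:E * F)%E.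
  rewrite (@ge0_ae_eq_integral _ _ _ mu D' _ (fun x => (`|B i j x| `^ p)%:E))//; last first.
    by apply: filterS (AB i j) => x H Dx; rewrite H.
  apply: le_trans (HB i j) _; rewrite EFinM -muleA; apply: lee_wpmul2l; first by rewrite lee_fin.
  rewrite /F -ge0_integralZl_EFin//; last first.
    by apply: mE => //; apply: measurable_powR_norm => //; exact: measurable_frobenius.
  apply: ge0_le_integral => //.
  - by move=> x _; rewrite lee_fin powR_ge0.
  - apply: mE => //; apply: (measurableT_comp (measurable_powR p)).
    apply: measurable_sum => k; apply: measurable_sum => l.
    exact: (measurableT_comp (@normr_measurable R setT)).
  - by apply: measurable_funeM; apply: mE => //; apply: measurable_powR_norm => //; exact: measurable_frobenius.
  move=> x _; rewrite -EFinM lee_fin ger0_norm ?frobenius_ge0// -powRM ?frobenius_ge0//.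
  apply: ge0_ler_powR; rewrite ?nnegrE ?mulr_ge0 ?frobenius_ge0 ?(ltW p0)//.
    by apply: sumr_ge0 => k _; exact: sumr_ge0.
  rewrite pair_bigA /= -card mulr_natl -sumr_const.
  by apply: ler_sum => kl _; exact: entry_le_frobenius.
apply: (@le_trans _ _ (\sum_(i < m) \sum_(j < q) ((K * (m * q)%:R `^ p)%:E * F))%E).
  apply: lee_sum => i _; rewrite ge0_integral_sum//.
  by apply: lee_sum => j _; exact: E1.
have c0 : (0 <= (K * (m * q)%:R `^ p)%:E * F)%E by rewrite mule_ge0// lee_fin mulr_ge0.
rewrite (eq_bigr (fun=> (q%:R)%:E * ((K * (m * q)%:R `^ p)%:E * F))%E); last first.
  by move=> i _; exact: sume_ord_const.
rewrite sume_ord_const; last by rewrite mule_ge0// lee_fin.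
by rewrite [X in (_ <= X * F)%E]EFinM natrM EFinM !muleA lexx.
Qed.

End lp_norms.

(** * Lipschitz boundaries and uniform cones *)

Lemma mulr_half_inv (R : realType) (q : R) : q != 0 -> q * (1 / (2 * q)) = 1 / 2.
Proof. by move=> q0; field. Qed.

Lemma box_step_up (R : realType) (a b w y y0 t r : R) : a < y -> - t < w - (y + t) -> w - (y + t) < t ->
  y - y0 < r -> y0 < (a + b) / 2 -> a + 1 <= b -> t < r -> r <= 1 / 8 -> a < w < b.
Proof. by move=> *; apply/andP; split; lra. Qed.

Lemma box_step_down (R : realType) (a b w y y0 t r : R) : y < b -> - t < w - (y - t) -> w - (y - t) < t ->
  - r < y - y0 -> (a + b) / 2 <= y0 -> a + 1 <= b -> t < r -> r <= 1 / 8 -> a < w < b.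
Proof. by move=> *; apply/andP; split; lra. Qed.

Section lipschitz_cone.
Context {R : realType} {n : nat}.
Local Notation V := 'rV[R]_n.
Implicit Types (x y z w e : V).

(** Orthogonal maps are no isometries of the sup norm; the factor n comes from the entries being at
    most 1 in absolute value. *)
Lemma rV_mul_norm_le (U : 'M[R]_n) (v : V) : U *m U^T = 1%:M -> `|v *m U| <= n%:R * `|v|.
Proof.
move=> UU; apply: rV_norm_le => [|j]; first by rewrite mulr_ge0.
rewrite !mxE (le_trans (ler_norm_sum _ _ _))// -sumr_ord; apply: ler_sum => i _.
rewrite normrM -[leRHS]mulr1; apply: ler_pM => //; first exact: coord_le_norm.
have : (U *m U^T) i i = 1 by rewrite UU mxE eqxx.
rewrite mxE => E; rewrite -(ler_pXn2r (_ : (0 < 2)%N)) ?nnegrE// expr1n -E.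
rewrite (bigD1 j)//= !mxE real_normK ?num_real// -expr2 lerDl.
by apply: sumr_ge0 => k _; rewrite !mxE -expr2 sqr_ge0.
Qed.

Lemma orthogonal_dir (U : 'M[R]_n) j : U *m U^T = 1%:M ->
  (delta_mx 0 j *m U^T : V) *m U = delta_mx 0 j /\ `|delta_mx 0 j *m U^T : V| <= 1.
Proof.
move=> UU; have UU' : U^T *m U = 1%:M by exact: mulmx1C.
split; first by rewrite -mulmxA UU' mulmx1.
apply: rV_norm_le => // i; rewrite !mxE (bigD1 j)//= big1 ?addr0 => [|k kj]; last first.
  by rewrite !mxE (negbTE kj) andbF mul0r.
rewrite !mxE !eqxx mul1r.
have : (U *m U^T) i i = 1 by rewrite UU mxE eqxx.
rewrite mxE => E; rewrite -(ler_pXn2r (_ : (0 < 2)%N)) ?nnegrE// expr1n -E.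
rewrite (bigD1 j)//= !mxE real_normK ?num_real// -expr2 lerDl.
by apply: sumr_ge0 => k _; rewrite !mxE -expr2 sqr_ge0.
Qed.

Lemma finite_pos_lower (I : finType) (F : I -> R) : (forall i, 0 < F i) ->
  exists2 e, 0 < e & forall i, e <= F i.
Proof.
move=> F0; exists (\big[Num.min/1]_i F i); last by move=> i; exact: bigmin_le_cond.
by apply/lt_bigmin.
Qed.

Lemma open_open_box (a b : 'rV[int]_n) : open (open_box a b : set V).
Proof.
rewrite openE => x xab; have [|e e0 He] := @finite_pos_lower _ (fun i : 'I_n =>
    Num.min (x 0 i - (a 0 i)%:~R) ((b 0 i)%:~R - x 0 i)).
  by move=> i; rewrite lt_min !subr_gt0; exact: xab.
apply: (near_nbhs_ball e0) => y yx i; have := He i; rewrite le_min => /andP[h1 h2].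
have : `|y 0 i - x 0 i| < e by apply: le_lt_trans yx; have := coord_le_norm (y - x) i; rewrite !mxE.
by rewrite ltr_norml => /andP[h3 h4]; apply/andP; split; [move: h1 h3; lra|move: h2 h4; lra].
Qed.

Lemma convex_interval (s p q x y : R) : 0 <= s -> 0 <= 1 - s -> p < x < q -> p < y < q ->
  p < (1 - s) * x + s * y < q.
Proof.
move=> s0 s1 /andP[px xq] /andP[py yq].
have [->|sn] := eqVneq s 0; first by rewrite subr0 mul1r mul0r addr0 px.
have sp : 0 < s by rewrite lt_neqAle eq_sym sn.
have -> : p = (1 - s) * p + s * p by ring.
have -> : q = (1 - s) * q + s * q by ring.
have h1 := ler_wpM2l s1 (ltW px); have h2 := ler_wpM2l s1 (ltW xq).
have h3 : s * p < s * y by rewrite ltr_pM2l.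
have h4 : s * y < s * q by rewrite ltr_pM2l.
by rewrite ler_ltD// ler_ltD.
Qed.

Variables (D Om : set V).
Hypotheses (oD : open D) (DOm : D `<=` Om).

Lemma boundary_open (A : set V) : open A -> boundary A = closure A `\` A.
Proof. by move=> oA; rewrite /boundary (interior_id A).1. Qed.

(** Otherwise the segment would meet the boundary of [D] inside [Om], at a distance from [y0] less
    than [s]. *)
Lemma segment_in s y0 y : open Om -> (forall t : R, 0 <= t <= 1 -> Om (y0 + t *: (y - y0))) ->
  D y0 -> `|y - y0| < s ->
  (forall x, (boundary D `\` boundary Om) x -> s <= `|x - y0|) -> D y.
Proof.
move=> oOm seg Dy0 ys far; pose f (t : R) : V := y0 + t *: (y - y0).
have cf : continuous f.
  move=> t; apply: cvgD; first exact: cvg_cst.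
  exact: (@scalel_continuous R V (y - y0) t).
pose A : set R := `[0, 1] `&` f @^-1` D.
have AE : A = `[0, 1]%classic.
  apply: (@segment_connected R 0 1).
  - exists 0; split; first by rewrite /= in_itv /= lexx ler01.
    by rewrite /f /= scale0r addr0.
  - by exists (f @^-1` D) => //; apply: open_comp => // x _; exact: cf.
  - exists (closure A); first exact: closed_closure.
    apply/seteqP; split => [t At|t [t01 ct]]; first by split; [case: At|exact: subset_closure].
    split => //; apply: contrapT => nD.
    have cD : closure D (f t).
      move=> B /cf/= /ct[u [[_ Du] Bu]]; by exists (f u).
    have tt : 0 <= t <= 1 by move: t01; rewrite /= in_itv.
    have bd : (boundary D `\` boundary Om) (f t).
      split; first by rewrite boundary_open.
      by rewrite boundary_open// => -[_]; apply; exact: seg.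
    have := far _ bd; rewrite /f addrAC subrr add0r normrZ leNgt => /negP; apply.
    case/andP: tt => t0 t1; apply: le_lt_trans ys; rewrite ger0_norm//.
    by rewrite ler_piMl.
have : A 1 by rewrite AE /= in_itv /= lexx ler01.
by case=> _; rewrite /f /= scale1r subrKC.
Qed.

(** Near the Lipschitz part the axis of the cone is the downward vertical of the chart, which
    describes [D] up to the boundary of the box. Away from it [D] coincides locally with the box,
    and in each coordinate the axis points away from the nearer face. *)
Lemma lipschitz_uniform_cone (a b : 'rV[int]_n) : (forall i, (a 0 i < b 0 i)%R) ->
  Om = open_box a b -> lipschitz_boundary D (boundary D `\` boundary Om) ->
  exists r cc : R, [/\ 0 < r, 0 < cc, cc <= 1 & uniform_cone D r cc].
Proof.
move=> ab OmE [rL [L0 [rL0 chart]]].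
pose L := Num.max L0 0; have Lge0 : 0 <= L by rewrite le_max lexx orbT.
(* The edges of the box have length at least 1, its corners being integral, so that 1/8 keeps
   opposite faces apart; rL / 8 keeps all points in one chart. *)
pose r := Num.min (1 / 8) (rL / 8).
have r0 : 0 < r by rewrite lt_min !divr_gt0.
have r1 : r <= 1 / 8 by rewrite ge_min lexx.
have rr : 8 * r <= rL by rewrite mulrC -ler_pdivlMr// ge_min lexx orbT.
(* With cc = 1 / (2 m), a displacement of norm cc t changes height and graph by at most t / 2
   together, less than the descent t. *)
pose m : R := (n%:R + 1) * (1 + L).
have m0 : 1 <= m.
  by rewrite /m -[leLHS]mulr1; apply: ler_pM => //; rewrite ?lerDr// lerDl.
have mgt0 : 0 < m by apply: lt_le_trans m0.
exists r, (1 / (2 * m)); split => //; first by rewrite divr_gt0// mulr_gt0.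
  by rewrite div1r invf_le1 ?mulr_gt0//; move: m0; lra.
set cc := 1 / (2 * m).
have cc0 : 0 < cc by rewrite divr_gt0// mulr_gt0.
have cc1 : cc <= 1 by rewrite /cc div1r invf_le1 ?mulr_gt0//; move: m0; lra.
move=> y0 Dy0.
have [[x [Gx xy]]|no] := pselect (exists x, (boundary D `\` boundary Om) x /\ `|x - y0| < 4 * r).
  have [U [j [g [UU lip ch]]]] := chart x Gx.
  have [dU d1] := orthogonal_dir j UU; set d := delta_mx 0 j *m U^T in dU d1.
  exists (- d); first by rewrite normrN.
  move=> y t Dy yy0 t0 tr w /rV_ballP yw.
  pose v := w - (y + t *: - d).
  have vn : `|v| < cc * t by rewrite /v distrC.
  have cct : cc * t <= t by rewrite ler_piMl// ltW.
  have inx z : `|z - y0| < 4 * r -> ball x rL z.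
    move=> zy; apply/rV_ballP; apply: lt_le_trans rr.
    apply: le_lt_trans (ler_distD y0 x z) _; rewrite [`|y0 - z|]distrC.
    by move: zy xy r0; set p := `|_|; set q := `|_|; lra.
  have By : ball x rL y by apply: inx; move: yy0 r0; set p := `|_|; lra.
  have Bw : ball x rL w.
    apply: inx; apply: le_lt_trans (ler_distD (y + t *: - d) w y0) _.
    have h1 : `|y + t *: - d - y0| <= `|y - y0| + t.
      rewrite addrAC (le_trans (ler_normD _ _))// lerD2l normrZ normrN gtr0_norm//.
      by rewrite ler_piMr// ltW.
    move: h1 vn cct yy0 tr; rewrite /v; set p := `|_|; set q := `|_|; set p' := `|_|.
    by move: (cc * t) => ct; lra.
  apply/(ch w Bw); have := (ch y By).1 Dy.
  have wE : w *m U = y *m U - t *: delta_mx 0 j + v *m U.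
    rewrite (_ : w = y + t *: - d + v); last by rewrite /v subrKC.
    by rewrite !mulmxDl scalerN mulNmx -scalemxAl dU.
  have vU : `|v *m U| <= n%:R * (cc * t).
    by apply: le_trans (rV_mul_norm_le v UU) _; rewrite ler_wpM2l// ltW.
  have wj : (w *m U) 0 j <= (y *m U) 0 j - t + n%:R * (cc * t).
    rewrite wE !mxE !eqxx mulr1 lerD2l; apply: le_trans vU.
    by apply: le_trans (coord_le_norm _ j); rewrite mxE ler_norm.
  have gw : g (col' j (y *m U)) - L * (n%:R * (cc * t)) <= g (col' j (w *m U)).
    have := lip (col' j (y *m U), col' j (w *m U)) (conj I I) => /= lp.
    have cd : `|col' j (y *m U) - col' j (w *m U)| <= n%:R * (cc * t).
      apply: rV_norm_le => [|i]; first by rewrite mulr_ge0// mulr_ge0 ?ltW.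
      rewrite !mxE /= -/(v *m U); apply: le_trans vU.
      have := coord_le_norm (v *m U) (lift j i); apply: le_trans.
      have := congr1 (fun M : 'rV[R]_n => M 0 (lift j i)) wE; rewrite !mxE => ->.
      rewrite eqxx /= [lift j i == j]eq_sym (negbTE (neq_lift j i)) mulr0 subr0 opprD addrA subrr add0r normrN.
      by rewrite lexx.
    have : `|g (col' j (y *m U)) - g (col' j (w *m U))| <= L * (n%:R * (cc * t)).
      apply: le_trans lp _; apply: (@le_trans _ _ (L * `|col' j (y *m U) - col' j (w *m U)|)).
        by rewrite ler_wpM2r// le_max lexx.
      by rewrite ler_wpM2l.
    by rewrite ler_norml => /andP[_]; rewrite lerBlDr lerBlDl addrC.
  have key : n%:R * (cc * t) + L * (n%:R * (cc * t)) <= t / 2.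
    rewrite (_ : _ + _ = (n%:R * (1 + L)) * cc * t); last by ring.
    have mn0 : m != 0 by rewrite (gt_eqF mgt0).
    have ccm : m * cc = 1 / 2.
      by rewrite /cc mulr_half_inv.
    rewrite [leRHS](_ : _ = m * cc * t); last by rewrite ccm; lra.
    apply: ler_wpM2r; first exact: ltW.
    apply: ler_wpM2r; first exact: ltW.
    apply: ler_wpM2r; first by rewrite addr_ge0.
    by rewrite lerDl.
  move=> yg; apply: le_lt_trans wj _; apply: lt_le_trans gw.
  move: key yg t0; move: (n%:R * (cc * t)) (L * _) => p q.
  by move: ((y *m U) 0 j) (g (col' j (y *m U))) => p' q'; lra.
pose e : V := \row_i (if y0 0 i < ((a 0 i)%:~R + (b 0 i)%:~R) / 2 then 1 else -1).
have ei i : e 0 i = 1 \/ e 0 i = -1 by rewrite mxE; case: ifP; [left|right].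
exists e; first by apply: rV_norm_le => // i; case: (ei i) => ->; rewrite ?normrN normr1.
move=> y t Dy yy0 t0 tr w /rV_ballP yw.
have cct : cc * t <= t by rewrite ler_piMl// ltW.
have box z : Om z <-> forall i, (a 0 i)%:~R < z 0 i < (b 0 i)%:~R by rewrite OmE.
have oOm : open Om.
  rewrite OmE; have -> : open_box a b = [set x : V | forall i, (a 0 i)%:~R < x 0 i < (b 0 i)%:~R] by [].
  exact: open_open_box.
have wOm : Om w.
  apply/box => i; have := (box y).1 (DOm Dy) i => /andP[ya yb].
  have ywi : `|w 0 i - (y 0 i + t * e 0 i)| < t.
    apply: lt_le_trans cct; apply: le_lt_trans yw.
    by have := coord_le_norm (y + t *: e - w) i; rewrite !mxE distrC.
  have yi : `|y 0 i - y0 0 i| < r.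
    by apply: le_lt_trans yy0; have := coord_le_norm (y - y0) i; rewrite !mxE.
  have abi : (a 0 i)%:~R + 1 <= (b 0 i)%:~R :> R.
    by rewrite -[1]/(1%:~R) -intrD ler_int lezD1.
  move: ywi yi; rewrite !ltr_norml mxE; case: (ltP (y0 0 i)) => y0m; rewrite ?mulr1 ?mulrN1 => /andP[w1 w2] /andP[w3 w4].
    exact: box_step_up ya w1 w2 w4 y0m abi tr r1.
  exact: box_step_down yb w1 w2 w3 y0m abi tr r1.
apply: (@segment_in (4 * r) y0 w) => //.
- move=> s /andP[s0 s1]; apply/box => i.
  have := (box y0).1 (DOm Dy0) i; have := (box w).1 wOm i; rewrite !mxE => /andP[w1 w2] /andP[v1 v2].
  rewrite (_ : y0 0 i + _ = (1 - s) * y0 0 i + s * w 0 i); last by ring.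
  have s1' : 0 <= 1 - s by rewrite subr_ge0.
  by apply: convex_interval => //; apply/andP.
- apply: le_lt_trans (ler_distD (y + t *: e) w y0) _.
  have h1 : `|y + t *: e - y0| <= `|y - y0| + t.
    rewrite addrAC (le_trans (ler_normD _ _))// lerD2l normrZ gtr0_norm//.
    apply: ler_piMr; first exact: ltW.
    by apply: rV_norm_le => // i; case: (ei i) => ->; rewrite ?normrN normr1.
  move: h1 yw yy0 tr cct; rewrite [`|w - _|]distrC; set p := `|_|; set q := `|_|; set p' := `|_|.
  by move: (cc * t) => ct; lra.
move=> x Gx; rewrite leNgt; apply/negP => xs; apply: no; exists x; split => //.
Qed.

End lipschitz_cone.

(** * Similar domains *)

Lemma similar_scales (R : realType) (s h0 e0 h : R) : 0 < s -> 0 < h -> h <= h0 -> h0 <= e0 ->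
  [/\ s * h <= s * e0, e0 / h0 * (s * h) <= s * e0 & s * e0 = e0 / h0 * (s * h0)].
Proof.
move=> s0 h0' hh he; have hp : 0 < h0 by apply: lt_le_trans hh.
have E : s * e0 = e0 / h0 * (s * h0).
  by rewrite mulrCA mulfVK ?gt_eqF.
split => //; first by rewrite ler_pM2l//; apply: le_trans he.
rewrite E; apply: ler_wpM2l; first by rewrite divr_ge0 ?ltW//; apply: lt_le_trans he.
by rewrite ler_pM2l.
Qed.

Lemma scale_dist0 (R : realType) (a b h q e : R) : 0 < h -> a <= e -> b < h -> e = q * h -> a + b < (8 + q) * h.
Proof. by move=> *; nra. Qed.

Lemma scale_dist1 (R : realType) (a b h q e : R) : 0 < h -> h <= e -> q * h <= e ->
  a < (8 + q) * h -> b < h -> a + b < 24 * e.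
Proof. by move=> *; nra. Qed.

Lemma scale_dist2 (R : realType) (a b h q : R) : 0 < h -> a <= h -> b < (8 + q) * h -> a + b < (9 + q) * h.
Proof. by move=> *; nra. Qed.

Lemma scale_dist3 (R : realType) (a b c h q e : R) : 0 < h -> c <= 1 -> h <= e -> q * h <= e ->
  a < c * h -> b < (2 * (9 + q) + 2) * h -> a + b < 24 * e.
Proof. by move=> h0 c1 *; have : c * h <= h by [rewrite ler_piMl// ltW]; nra. Qed.

Lemma scale_dist4 (R : realType) (a b h M : R) : 0 < h -> a < (2 * M + 2) * h -> b < M * h ->
  a + b < (3 * M + 2) * h.
Proof. by move=> *; nra. Qed.

Section similarity.
Context {R : realType} {n : nat}.
Local Notation V := 'rV[R]_n.
Implicit Types (x y z w v : V).

Definition sim (s : R) v x : V := s *: x + v.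

Lemma sim_dist s v x y : 0 < s -> `|sim s v x - sim s v y| = s * `|x - y|.
Proof.
move=> s0; rewrite /sim opprD addrACA subrr addr0 -scalerBr normrZ.
by rewrite gtr0_norm.
Qed.

Lemma sim_surj s v w : 0 < s -> exists y, w = sim s v y.
Proof.
move=> s0; exists (s^-1 *: (w - v)).
by rewrite /sim scalerA mulfV ?gt_eqF// scale1r subrK.
Qed.

Lemma link_sim s v (S S' : set V) (a b : V * R) : 0 < s -> (forall y, S y -> S' (sim s v y)) ->
  link S a b -> link S' (sim s v a.1, s * a.2) (sim s v b.1, s * b.2).
Proof.
move=> s0 SS' [w [d [aw bw wS]]]; exists (sim s v w), (s * d); rewrite /=.
rewrite !sim_dist// -!mulrDr !ltr_pM2l//; split => //.
move=> y /rV_ballP; have [y' ->] := sim_surj v y s0; rewrite sim_dist// ltr_pM2l// => h.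
by apply: SS'; apply: wS; apply/rV_ballP.
Qed.

Lemma chain_sim s v (S S' : set V) rho N (a b : V * R) : 0 < s ->
  (forall y, S y -> S' (sim s v y)) ->
  chain S rho N a b -> chain S' (s * rho) N (sim s v a.1, s * a.2) (sim s v b.1, s * b.2).
Proof.
move=> s0 SS'; elim: N a => [|N IH] a /= [->|]; [by left|by []|by left|].
move=> [c [rc lac cb]]; right; exists (sim s v c.1, s * c.2); split.
- by rewrite /= ler_pM2l.
- exact: link_sim lac.
- exact: IH.
Qed.

Lemma deep_sim s v (D0 D : set V) e p : 0 < s -> (forall y, D0 y -> D (sim s v y)) ->
  deep D0 e p -> deep D (s * e) (sim s v p).
Proof.
move=> s0 DD dp y /rV_ballP; have [y' ->] := sim_surj v y s0; rewrite sim_dist// ltr_pM2l// => h.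
by apply: DD; apply: dp; apply/rV_ballP.
Qed.

Lemma hh_sim s (h0 : R) k : hh (s * h0) k = s * hh h0 k.
Proof. by rewrite /hh mulrA. Qed.

(* Radius [24 * e] contains all the balls and chains that [chained_similar]
   considers around [x] at the coarsest scale. *)
Definition window s e (D0 D : set V) x v :=
  (forall p, D0 p -> D (sim s v p)) /\
  (forall p, D (sim s v p) -> `|sim s v p - x| < 24 * e -> D0 p).

(** Samples and chains are found in [D0] and carried over by the similarity attached to [x]; since
    it may vary with [x], only local agreement of the domains matters. The constants are fixed
    before [s], [D] and [Om]. *)
Lemma chained_similar (D0 : set V) (r cc h0 e0 : R) : open D0 -> connected D0 ->
  (exists B, forall x, D0 x -> `|x| <= B) -> 0 < r -> 0 < cc -> cc <= 1 -> 0 < h0 -> h0 < r ->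
  h0 <= e0 -> uniform_cone D0 r cc ->
  exists kap M M3 N, forall s (D Om : set V), 0 < s -> open D ->
  (forall x, Om x -> exists2 y, D y & `|y - x| <= s * e0) ->
  (forall x, Om x -> exists v, window s (s * e0) D0 D x v) ->
  chained D Om (s * h0) cc kap M M3 N.
Proof.
move=> oD0 cD0 bD0 r0 cc0 cc1 h00 h0r h0e UC.
(* At level 0 a point of [D] is only known within e0, that is q mesh widths; other levels need 8.
   This gives the distance 8 + q to a point of [D], hence [M] after one more mesh width to the
   sample, and [L] is (2 M + 2) + M. *)
pose q := e0 / h0; have q1 : 1 <= q by rewrite ler_pdivlMr ?mul1r.
pose M : R := 9 + q; pose L : R := 3 * M + 2.
have M10 : 10 <= M by rewrite /M; lra.
have L1 : 1 <= L by rewrite /L; lra.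
have [kap [M3 [N [[kap0 kap1 kapc] CH]]]] := cone_chains oD0 cD0 bD0 r0 cc0 cc1 h00 UC L1.
pose M3' := Num.max M3 (2 * M + 5).
exists kap, M, (M3' + M), N => s D Om s0 oD dens win.
split => //.
- split => //; first exact: mulr_gt0.
  have : 2 * M + 5 <= M3' by rewrite le_max lexx orbT.
  by move: M10; lra.
- by move: M10; lra.
- move=> k nu x Ox; rewrite hh_sim => xnu cond.
  have hk0 : 0 < hh h0 k by exact: hh_gt0.
  have [hle qle hE] := similar_scales s0 hk0 (hh_le0 h00 k) h0e.
  rewrite -/q in qle hE; set h := s * hh h0 k in xnu cond hle qle *.
  have hgt : 0 < h by rewrite mulr_gt0.
  have [y Dy yx] : exists2 y, D y & `|y - nu| < (8 + q) * h.
    case/orP: cond => [/eqP k0|/asboolP [y Dy yn]]; last first.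
      by exists y => //; apply: lt_le_trans yn _; rewrite ler_wpM2r ?(ltW hgt)//; move: q1; lra.
    have [y Dy yx] := dens x Ox; exists y => //.
    apply: le_lt_trans (ler_distD x y nu) _; apply: (scale_dist0 hgt yx xnu).
    by rewrite hE /h k0 /hh expr0 divr1.
  have [v [w1 w2]] := win x Ox; have [p yp] := sim_surj v y s0.
  have D0p : D0 p.
    apply: w2; rewrite -yp//; apply: le_lt_trans (ler_distD nu y x) _.
    by rewrite [`|nu - x|]distrC; apply: (scale_dist1 hgt hle qle).
  have [z [zd zp]] := cone_sample r0 h00 h0r UC k D0p.
  exists (sim s v z); split; first by rewrite /h mulrCA; apply: deep_sim zd.
  apply: le_lt_trans (ler_distD y _ nu) _; apply: scale_dist2 => //.
  by rewrite yp sim_dist// ler_pM2l.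
- move=> k x z z' Ox; rewrite hh_sim => cond zd zx zd' zx'.
  have hk0 : 0 < hh h0 k by exact: hh_gt0.
  have [hle qle hE] := similar_scales s0 hk0 (hh_le0 h00 k) h0e.
  rewrite -/q in qle hE; set h := s * hh h0 k in cond hle qle zd zx zd' zx' *.
  have hgt : 0 < h by rewrite mulr_gt0.
  have [y Dy yx] : exists2 y, D y & `|y - x| < (8 + q) * h.
    case/orP: cond => [/eqP k0|/asboolP [y Dy yn]]; last first.
      by exists y => //; apply: lt_le_trans yn _; rewrite ler_wpM2r ?(ltW hgt)//; move: q1; lra.
    have [y Dy yx] := dens x Ox; exists y => //.
    apply: le_lt_trans yx _; rewrite -[s * e0]addr0.
    by apply: (scale_dist0 hgt (lexx _) hgt); rewrite hE /h k0 /hh expr0 divr1.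
  have yM : `|y - x| < M * h.
    by apply: lt_le_trans yx _; rewrite ler_wpM2r ?(ltW hgt)// /M lerD2r ler_nat.
  have [v [w1 w2]] := win x Ox; have [p yp] := sim_surj v y s0.
  have D0p : D0 p.
    apply: w2; rewrite -yp//; rewrite -[`|_|]addr0.
    exact: (scale_dist1 hgt hle qle).
  have pull t : deep D (cc * h) t -> `|t - x| < (2 * M + 2) * h ->
      exists p', [/\ t = sim s v p', deep D0 (cc * hh h0 k) p' & `|p' - p| < L * hh h0 k].
    move=> td tx; have [p' tp] := sim_surj v t s0; exists p'; split => //; last first.
      rewrite -(ltr_pM2l s0) -(sim_dist v)// -tp -yp mulrCA.
      apply: le_lt_trans (ler_distD x t y) _; rewrite [`|x - y|]distrC.
      exact: scale_dist4.
    move=> w /rV_ballP pw; have tw : `|t - sim s v w| < cc * h.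
      by rewrite tp sim_dist// /h mulrCA ltr_pM2l.
    apply: w2; first by apply: td; apply/rV_ballP.
    apply: le_lt_trans (ler_distD t _ x) _; rewrite [`|_ - t|]distrC.
    exact: (scale_dist3 hgt cc1 hle qle).
  have [p1 [-> d1 n1]] := pull z zd zx; have [p2 [-> d2 n2]] := pull z' zd' zx'.
  have M3le : M3 <= M3' by rewrite le_max lexx.
  have := CH M3' M3le k p p1 p2 D0p d1 n1 d2 n2.
  rewrite /h ![kap * (s * _)]mulrCA; apply: (chain_sim (a := (p1, _)) (b := (p2, _)) s0).
  move=> w [wd wc]; split.
    by rewrite [kap * _]mulrCA; apply: deep_sim wd.
  rewrite /ccube /=; apply: le_trans (ler_distD y _ x) _.
  rewrite mulrDl lerD//; last exact: ltW.
  by rewrite yp sim_dist// mulrCA ler_pM2l.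
Qed.

End similarity.

(** * Perforated domains *)

(** The interval starts 30 cells before k unless an end of [A, B] pushes it back. The 30 exceed the
    radius 24 of a window with some room for rounding. *)
Lemma window_coord (A B l k : int) : (100 <= l -> l <= B - A ->
  exists s, [/\ A <= s, s + l <= B, s = A \/ s + 30 <= k & s + l = B \/ k + 30 <= s + l])%R.
Proof.
move=> l100 lAB; have [kA|kA] := lerP (k - 30) A.
  by exists A; split; lia.
have [kB|kB] := lerP (B - l) (k - 30); first by exists (B - l); split; lia.
by exists (k - 30); split; lia.
Qed.

Lemma window_lower (A k s K : int) : s = A \/ s + 30 <= K -> A <= k -> K - 25 < k -> s <= k.
Proof. by move=> [->//|*]; lia. Qed.

Lemma window_upper (B k s K l : int) : s + l = B \/ K + 30 <= s + l -> k + 1 <= B -> k < K + 25 ->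
  k + 1 <= s + l.
Proof. by move=> [->//|*]; lia. Qed.

Section perforated_geometry.
Context {R : realType} {n : nat}.
Local Notation V := 'rV[R]_n.
Implicit Types (x y z w v : V) (k : 'rV[int]_n).
Variables (a b : 'rV[int]_n) (Ys : set V).
Hypotheses (YsY : Ys `<=` unit_cube).

Definition shift_of k : V := \row_i (k 0 i)%:~R.

(** For eps = 1 / N it becomes an inequality between integers whether a cell lies in the box. *)
Definition tiles (N : nat) : set V := [set x | exists k,
  (forall i, (a 0 i * N%:Z <= k 0 i) && (k 0 i + 1 <= b 0 i * N%:Z)) /\
  closure Ys (N%:R *: x - shift_of k)].

Lemma closure_unit y i : closure Ys y -> 0 <= y 0 i <= 1.
Proof.
have sub : Ys `<=` ccube (const_mx (1 / 2)) (1 / 2 : R).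
  move=> z /YsY zY; apply: rV_norm_le => // j; rewrite !mxE ler_norml.
  by have /andP[] := zY j; move: (z 0 j) => t *; apply/andP; split; lra.
move=> /(closure_subset sub); rewrite -(closure_id _).1; last exact: closed_ccube.
move=> h; have := le_trans (coord_le_norm _ i) h.
rewrite !mxE ler_norml => /andP[]; move: (y 0 i) => t *; apply/andP; split; lra.
Qed.

Lemma perforatedE eps (N : nat) : 0 < eps -> eps^-1 = N%:R -> perforated a b Ys eps = (tiles N)°.
Proof.
move=> e0 eN; have eE : eps = N%:R^-1 by rewrite -eN invrK.
have N0 : 0 < N%:R :> R by rewrite -eN invr_gt0.
rewrite /perforated; congr interior; apply/seteqP; split.
  move=> _ [k /= Kk] [y cy <-]; exists k; split; last first.
    by rewrite scalerA -eN mulVf ?gt_eqF// scale1r addrK.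
  (* The centre of the cell decides: as the cells and the box are aligned, it lies in the box only
     with the whole cell. *)
  move=> i; have : cell eps k unit_cube (eps *: (const_mx (1 / 2) + shift_of k)).
    by exists (const_mx (1 / 2)) => // j; rewrite !mxE; apply/andP; split; lra.
  move=> /Kk /(_ i); rewrite !mxE eE ltr_pdivlMl// ltr_pdivrMl// => /andP[h1 h2].
  have h1' : (a 0 i * N%:Z)%:~R < (k 0 i + 1)%:~R :> R.
    by rewrite intrM intrD /= mulrC; apply: lt_trans h1 _; rewrite addrC ltrD2l; lra.
  have h2' : (k 0 i)%:~R < (b 0 i * N%:Z)%:~R :> R.
    by rewrite intrM /= mulrC; apply: lt_trans h2; rewrite ltrDr; lra.
  by move: h1' h2'; rewrite !ltr_int ltzD1 -lezD1 => -> ->.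
move=> x [k [kN cx]]; exists k => /=; last first.
  by exists (N%:R *: x - shift_of k) => //; rewrite subrK scalerA eE mulVf ?gt_eqF// scale1r.
move=> _ [y yY <-] i; rewrite !mxE eE ltr_pdivlMl// ltr_pdivrMl//.
have /andP[k1 k2] := kN i; have /andP[y0 y1] := yY i.
have k1' : (a 0 i)%:~R * N%:R <= (k 0 i)%:~R :> R.
  by rewrite -[N%:R]/(N%:Z%:~R) -intrM ler_int.
have k2' : (k 0 i)%:~R + 1 <= (b 0 i)%:~R * N%:R :> R.
  by rewrite -[N%:R]/(N%:Z%:~R) -intrM -[1]/(1%:~R) -intrD ler_int.
move: k1' k2' y0 y1; rewrite ![N%:R * _]mulrC.
move: ((a 0 i)%:~R * _) ((b 0 i)%:~R * _) ((k 0 i)%:~R) (y 0 i) => A B K Y *.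
by apply/andP; split; lra.
Qed.

Lemma tiles_closed_box N x i : (0 < N)%N -> tiles N x -> (a 0 i)%:~R <= x 0 i <= (b 0 i)%:~R.
Proof.
move=> N0 [k [kN cx]]; have N0' : 0 < N%:R :> R by rewrite ltr0n.
have /andP[k1 k2] := kN i; have := closure_unit i cx; rewrite !mxE => /andP[y0 y1].
have k1' : (a 0 i)%:~R * N%:R <= (k 0 i)%:~R :> R.
  by rewrite -[N%:R]/(N%:Z%:~R) -intrM ler_int.
have k2' : (k 0 i)%:~R + 1 <= (b 0 i)%:~R * N%:R :> R.
  by rewrite -[N%:R]/(N%:Z%:~R) -intrM -[1]/(1%:~R) -intrD ler_int.
rewrite -(ler_pM2r N0') -[x 0 i <= _](ler_pM2r N0').
move: k1' k2' y0 y1; rewrite [N%:R * _]mulrC.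
move: ((a 0 i)%:~R * _) ((b 0 i)%:~R * _) ((k 0 i)%:~R) (x 0 i * _) => A B K Y *.
by apply/andP; split; lra.
Qed.

(** A point of the interior can be moved both ways in each coordinate without leaving the closed
    box, so that it is strictly inside. *)
Lemma tiles_sub N : (0 < N)%N -> (tiles N)° `<=` open_box a b.
Proof.
move=> N0 x /nbhs_ballP[e /= e0 xe] i.
have pt (t : R) : `|t| < e -> tiles N (x + t *: delta_mx 0 i).
  move=> te; apply: xe; apply/rV_ballP; rewrite opprD addNKr normrN normrZ.
  apply: le_lt_trans te; rewrite -[leRHS]mulr1 ler_wpM2l//.
  by apply: rV_norm_le => // j; rewrite !mxE; case: (_ && _); rewrite ?normr1 ?normr0.
have e2 : `|e / 2| < e by rewrite gtr0_norm ?divr_gt0//; lra.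
have := tiles_closed_box i N0 (pt _ e2).
have := @tiles_closed_box _ _ i N0 (pt (- (e / 2)) _); rewrite normrN => /(_ e2).
rewrite !mxE !eqxx /= !mulr1 => /andP[h1 _] /andP[_ h2].
by apply/andP; split; [move: h1|move: h2]; lra.
Qed.

Lemma tiles_dense N x : (0 < N)%N -> Ys !=set0 -> open Ys -> open_box a b x ->
  exists2 y, (tiles N)° y & `|y - x| <= N%:R^-1.
Proof.
move=> N0 [y0 Yy0] oY xb; have N0' : 0 < N%:R :> R by rewrite ltr0n.
have N0n : N%:R != 0 :> R by rewrite gt_eqF.
pose k : 'rV[int]_n := \row_i Num.floor (N%:R * x 0 i).
exists (N%:R^-1 *: (y0 + shift_of k)); last first.
  rewrite -(ler_pM2l N0') -[N%:R * `|_|](_ : `|N%:R *: (N%:R^-1 *: (y0 + shift_of k) - x)| = _).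
    rewrite scalerBr scalerA !mulfV// scale1r; apply: rV_norm_le => // i.
    rewrite !mxE; have := floor_itv (N%:R * x 0 i); rewrite intrD.
    have /andP[] := YsY Yy0 i; set K := _%:~R; move: (y0 0 i) (N%:R * _) => Y X.
    by move=> ? ? /andP[? ?]; rewrite ler_norml; apply/andP; split; lra.
  by rewrite normrZ gtr0_norm.
have /nbhs_ballP[d /= d0 yd] := open_nbhs_nbhs (conj oY Yy0).
apply/nbhs_ballP; exists (N%:R^-1 * d); first by rewrite /= mulr_gt0// invr_gt0.
move=> w /rV_ballP wd; exists k; split.
  move=> i; rewrite !mxE; have /andP[x1 x2] := xb i.
  have f1 : a 0 i * N%:Z <= Num.floor (N%:R * x 0 i).
    by rewrite floor_ge_int intrM /= mulrC ler_pM2l// ltW.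
  rewrite f1 /= lezD1 -(ltr_int R); apply: le_lt_trans (ge_floor _) _.
  by rewrite intrM /= mulrC ltr_pM2r.
apply: subset_closure; apply: yd; apply/rV_ballP.
rewrite -(ltr_pM2l (_ : 0 < N%:R^-1 :> R)) ?invr_gt0//; apply: le_lt_trans wd.
have -> : N%:R^-1 *: (y0 + shift_of k) - w = N%:R^-1 *: (y0 - (N%:R *: w - shift_of k)).
  by rewrite opprB addrA scalerBr scalerA mulVf// scale1r.
by rewrite normrZ gtr0_norm// invr_gt0.
Qed.

Lemma tiles_sim N0 N k (p : V) : (0 < N)%N ->
  N%:R *: sim (N0%:R / N%:R) (N%:R^-1 *: shift_of k) p = N0%:R *: p + shift_of k.
Proof.
move=> N_gt0; have Nn : N%:R != 0 :> R by rewrite pnatr_eq0 -lt0n.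
by rewrite /sim scalerDr !scalerA [N%:R * _]mulrC mulfVK// mulfV// scale1r.
Qed.

Lemma shift_ofD k l : shift_of (k + l) = shift_of k + shift_of l.
Proof. by apply/rowP => i; rewrite !mxE intrD. Qed.

(* The copy of the reference domain reaches at least 30 cells beyond [x] in each
   direction in which it does not touch the boundary of the box. *)
Lemma tiles_window N0 N x : (100 <= N0)%N -> (N0 <= N)%N -> (forall i, a 0 i < b 0 i) ->
  open_box a b x ->
  exists v, window (N0%:R / N%:R) N%:R^-1 (tiles N0)° (tiles N)° x v.
Proof.
move=> N100 N0N ab xb.
have N0p : (0 < N0)%N by apply: leq_trans N100.
have Np : (0 < N)%N by apply: leq_trans N0N.
have Nr : 0 < N%:R :> R by rewrite ltr0n.
have s0 : 0 < N0%:R / N%:R :> R by rewrite divr_gt0// ltr0n.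
pose kap i := Num.floor (N%:R * x 0 i).
have /choice[s sP] i := @window_coord (a 0 i * N%:Z) (b 0 i * N%:Z) ((b 0 i - a 0 i) * N0%:Z) (kap i)
  ltac:(have := ab i; nia) ltac:(have := ab i; nia).
pose v0 : 'rV[int]_n := \row_i (s i - a 0 i * N0%:Z).
pose T := sim (N0%:R / N%:R) (N%:R^-1 *: shift_of v0).
have TN p k : N%:R *: T p - shift_of (k + v0) = N0%:R *: p - shift_of k.
  by rewrite tiles_sim// shift_ofD opprD addrACA [_ - shift_of v0]subrr addr0.
exists (N%:R^-1 *: shift_of v0); split=> p.
  move=> /nbhs_ballP[d /= d0 pd]; apply/nbhs_ballP; exists (N0%:R / N%:R * d); first exact: mulr_gt0.
  move=> w /rV_ballP; have [q ->] := sim_surj (N%:R^-1 *: shift_of v0) w s0.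
  rewrite sim_dist// ltr_pM2l// => pq; have /pd[k [kN ck]] : ball p d q by apply/rV_ballP.
  exists (k + v0); split; last by rewrite TN.
  move=> i; have [s1 s2 _ _] := sP i; have := kN i; rewrite !mxE.
  move: s1 s2; rewrite mulrBl; move: (a 0 i * N0%:Z) (a 0 i * N%:Z) (b 0 i * N0%:Z) (b 0 i * N%:Z) => A B C D.
  by move: (k 0 i) (s i) => K S; lia.
move=> /nbhs_ballP[d /= d0 pd] px; apply/nbhs_ballP.
(* The neighbourhood is kept within 24 cells of [x], where all cells of the finer domain are
   translates of cells of the reference domain. *)
pose d' := Num.min d (24 * N%:R^-1 - `|T p - x|).
have d'0 : 0 < d' by rewrite lt_min d0 subr_gt0.
exists ((N0%:R / N%:R)^-1 * d'); first by rewrite /= mulr_gt0// invr_gt0.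
move=> q /rV_ballP; rewrite ltr_pdivlMl// -(sim_dist (N%:R^-1 *: shift_of v0) _ _ s0) -/T lt_min.
move=> /andP[qd qx]; have /pd[k [kN ck]] : ball (T p) d (T q) by apply/rV_ballP.
exists (k - v0); split; last by rewrite -TN subrK.
move=> i; have [s1 s2 s3 s4] := sP i; have := kN i; rewrite !mxE => /andP[k1 k2].
have Tqx : `|N%:R * T q 0 i - N%:R * x 0 i| < 24.
  rewrite -mulrBr normrM gtr0_norm// mulrC -ltr_pdivlMr//.
  apply: le_lt_trans (_ : `|T q - x| < _); first by have := coord_le_norm (T q - x) i; rewrite !mxE.
  apply: le_lt_trans (ler_distD (T p) _ _) _; rewrite [`|T q - _|]distrC.
  by move: qx; rewrite ltrBrDr.
have := closure_unit i ck; have := floor_itv (N%:R * x 0 i); rewrite -/(kap i) intrD => /andP[x1 x2].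
rewrite (_ : (N%:R *: T q - shift_of k) 0 i = N%:R * T q 0 i - (k 0 i)%:~R); last by rewrite !mxE.
move=> /andP[c1 c2]; have E25 : (25%:~R = 25 :> R) by [].
have K1 : kap i - 25 < k 0 i.
  rewrite -(ltr_int R) rmorphB /= E25.
  move: Tqx x1 x2 c1 c2; rewrite ltr_norml; move: (N%:R * T q 0 i) (N%:R * x 0 i) => A B /andP[].
  by lra.
have K2 : k 0 i < kap i + 25.
  rewrite -(ltr_int R) rmorphD /= E25.
  move: Tqx x1 x2 c1 c2; rewrite ltr_norml; move: (N%:R * T q 0 i) (N%:R * x 0 i) => A B /andP[].
  by lra.
have L1 := window_lower s3 k1 K1; have L2 := window_upper s4 k2 K2.
move: L1 L2; rewrite mulrBl.
move: (a 0 i * N0%:Z) (b 0 i * N0%:Z) (k 0 i) (s i) => A B K S.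
by clear; lia.
Qed.

End perforated_geometry.

(** What the constants depend on, bundled so that their uniformity becomes an equality of records.
    [cd_theta] is the ratio of the coarsest mesh width to eps. *)
Record chain_data (R : realType) := ChainData
  { cd_theta : R; cd_c : R; cd_kap : R; cd_M : R; cd_M3 : R; cd_N : nat }.

Section perforated_chained.
Context {R : realType} {n : nat}.
Local Notation V := 'rV[R]_n.
Implicit Types (D Om : set V) (P : chain_data R).

Definition chained_with D Om (e : R) P := 0 < cd_theta P /\
  chained D Om (cd_theta P * e) (cd_c P) (cd_kap P) (cd_M P) (cd_M3 P) (cd_N P).

Lemma open_box_bounded (a b : 'rV[int]_n) : exists B : R, forall x : V, open_box a b x -> `|x| <= B.
Proof.
exists (\sum_i (`|(a 0 i)%:~R| + `|(b 0 i)%:~R|)) => x xb.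
apply: rV_norm_le => [|i]; first by apply: sumr_ge0 => i _; rewrite addr_ge0.
rewrite (bigD1 i)//=; apply: le_trans (_ : _ <= `|(a 0 i)%:~R| + `|(b 0 i)%:~R|) _; last first.
  by rewrite lerDl; apply: sumr_ge0 => j _; rewrite addr_ge0.
have /andP[x1 x2] := xb i; rewrite ler_norml; apply/andP; split.
  by have := lerNnormlW (lexx `|(a 0 i)%:~R : R|); have := normr_ge0 ((b 0 i)%:~R : R); move: x1; lra.
by have := ler_norm ((b 0 i)%:~R : R); have := normr_ge0 ((a 0 i)%:~R : R); move: x2; lra.
Qed.

Variables (a b : 'rV[int]_n) (Ys : set V) (eps : nat -> R).
Local Notation Om := (open_box a b : set V).
Local Notation Om_ m := (perforated a b Ys (eps m)).
Hypotheses (ab : forall i, (a 0 i < b 0 i)%R)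
  (epsN : forall m, 0 < eps m /\ exists N : nat, (eps m)^-1 = N%:R)
  (YsY : Ys `<=` unit_cube) (dY : domain Ys)
  (lip : forall m, connected (Om_ m) /\ lipschitz_boundary (Om_ m) (boundary (Om_ m) `\` boundary Om)).

Lemma perforated_sub m : Om_ m `<=` Om.
Proof.
have [e0 [N eN]] := epsN m; rewrite (@perforatedE _ _ a b Ys _ _ e0 eN); apply: tiles_sub => //.
by rewrite -(ltr0n R) -eN invr_gt0.
Qed.

Lemma open_perforated m : open (Om_ m).
Proof. exact: open_interior. Qed.

(** The reference domain serves itself, through the identity, and by [tiles_window] all finer ones
    provided that it has at least 100 cells per unit length. *)
Lemma reference_chained m0 : exists P, chained_with (Om_ m0) Om (eps m0) P /\
  forall m, 100 * eps m0 <= 1 -> eps m <= eps m0 -> chained_with (Om_ m) Om (eps m) P.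
Proof.
have [e0 [N0 eN0]] := epsN m0; have [cD lb] := lip m0.
have [Y0 oY _] := dY.
have [r [cc [r0 cc0 cc1 UC]]] := lipschitz_uniform_cone (@open_perforated m0) (@perforated_sub m0) ab erefl lb.
pose h0 := Num.min (r / 2) (eps m0).
have h00 : 0 < h0 by rewrite lt_min divr_gt0.
have h0e : h0 <= eps m0 by rewrite ge_min lexx orbT.
have h0r : h0 < r by apply: (@le_lt_trans _ _ (r / 2)); [rewrite ge_min lexx|lra].
have bD : exists B : R, forall x, Om_ m0 x -> `|x| <= B.
  by have [B hB] := open_box_bounded a b; exists B => x /perforated_sub; exact: hB.
have [kap [M [M3 [N H]]]] := chained_similar (@open_perforated m0) cD bD r0 cc0 cc1 h00 h0r h0e UC.
have dens m x : Om x -> exists2 y, Om_ m y & `|y - x| <= eps m.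
  have [em0 [Nm eNm]] := epsN m; rewrite (@perforatedE _ _ a b Ys _ _ em0 eNm) -[eps m]invrK eNm.
  by apply: tiles_dense => //; rewrite -(ltr0n R) -eNm invr_gt0.
exists (ChainData (h0 / eps m0) cc kap M M3 N); split.
  split; rewrite /= ?divr_gt0// mulfVK ?gt_eqF// -[h0]mul1r; apply: H => //.
  - exact: open_perforated.
  - by rewrite mul1r; exact: dens.
  move=> x Ox; exists 0; have s1 p : sim 1 0 p = p :> V by rewrite /sim scale1r addr0.
  by split=> p; rewrite s1.
move=> m e100 em; have [em0 [Nm eNm]] := epsN m.
have N0r : 0 < N0%:R :> R by rewrite -eN0 invr_gt0.
have eE0 : eps m0 = N0%:R^-1 by rewrite -eN0 invrK.
have eE : eps m = Nm%:R^-1 by rewrite -eNm invrK.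
have Nr : 0 < Nm%:R :> R by rewrite -eNm invr_gt0.
split; rewrite /= ?divr_gt0// (_ : h0 / eps m0 * eps m = N0%:R / Nm%:R * h0); last first.
  by rewrite eE eE0 invrK -mulrA mulrC.
have sE : N0%:R / Nm%:R * eps m0 = eps m by rewrite eE eE0 mulrAC mulfV ?gt_eqF// mul1r.
apply: H; rewrite ?sE.
- exact: divr_gt0.
- exact: open_perforated.
- exact: dens.
move=> x Ox; rewrite (@perforatedE _ _ a b Ys _ _ e0 eN0) (@perforatedE _ _ a b Ys _ _ em0 eNm) eE.
apply: tiles_window => //.
  by move: e100; rewrite eE0 -ler_pdivlMr ?invr_gt0// invrK mul1r ler_nat.
by move: em; rewrite eE eE0 lef_pV2 ?posrE// ler_nat.
Qed.

Lemma perforated_chained : eps @ \oo --> (0 : R) ->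
  exists (P : nat -> chain_data R) m1, (forall m, chained_with (Om_ m) Om (eps m) (P m)) /\
    forall m, (m1 <= m)%N -> P m = P m1.
Proof.
move=> cvg0; have small e : 0 < e -> exists m0, forall m, (m0 <= m)%N -> eps m <= e.
  move=> epos; have /cvgrPdist_le /(_ e epos) [m0 _ h] := cvg0; exists m0 => m mm.
  by have := h m mm; rewrite sub0r normrN gtr0_norm//; case: (epsN m).
have [|m0 /(_ m0 (leqnn _)) h0] := small (1 / 100); first by rewrite divr_gt0.
have [m1 h1] := small (eps m0) (epsN m0).1.
have [P0 [_ P0h]] := reference_chained m0.
have /choice[P hP] m : exists P, chained_with (Om_ m) Om (eps m) P.
  by have [P []] := reference_chained m; exists P.
exists (fun m => if (m1 <= m)%N then P0 else P m), m1; split => m.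
  case: ifPn => // mm; apply: P0h; last exact: h1.
  by move: h0; lra.
by move=> mm; rewrite mm leqnn.
Qed.

Lemma in_grid_open_box (h : R) : 0 < h -> exists A0, in_grid Om h A0.
Proof.
move=> hp; have [B hB] := open_box_bounded a b.
(* One for rounding up and one for the margin in [in_grid]. *)
exists (Num.truncn (B / h)).+2 => x Ox; apply: le_lt_trans (hB x Ox) _.
rewrite -[(Num.truncn (B / h)).+2]addn1 natrD mulrDr mulr1 addrK mulrC -ltr_pdivrMr//.
exact: truncnS_gt.
Qed.

End perforated_chained.

(** * Sobolev estimates *)

Section sobolev_derivatives.
Context {R : realType} {n : nat}.
Local Notation V := 'rV[R]_n.
Local Notation mu := (@lebesgue_rV R n).
Variables (D : set V).
Hypotheses (oD : open D) (fD : (mu D < +oo)%E).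

Let mD : measurable D. Proof. exact: open_measurable_rV. Qed.

Lemma sobolev_weak_derivative k p u s : 1 <= p -> sobolev k p D u -> (size s <= k)%N ->
  LpD D p (weak_derivative D s u) /\ is_weak_derivative D s u (weak_derivative D s u).
Proof.
move=> p1 [_ H] /H[v Lv wv]; have p0 : p != 0 by rewrite gt_eqF// (lt_le_trans _ p1).
have W : is_weak_derivative D s u (weak_derivative D s u) by apply: (@xgetPex _ (cst 0)); exists v.
split => //; apply: (LpD_ae mD p0 Lv); first by case: W => _ [].
exact: weak_derivative_unique wv W.
Qed.

Lemma sobolev_integrable k p u s : 1 <= p -> sobolev k p D u -> (size s <= k)%N ->
  mu.-integrable D (EFin \o weak_derivative D s u).
Proof.
by move=> p1 Su sk; have [Lv _] := sobolev_weak_derivative p1 Su sk; exact: LpD_integrable Lv.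
Qed.

Lemma sobolev_wk1 k p u : 1 <= p -> (1 <= k)%N -> sobolev k p D u ->
  wk1 D u (fun i => weak_derivative D [:: i] u).
Proof.
move=> p1 k1 Su; split; first by case: Su => Lu _; exact: LpD_integrable Lu.
  by move=> j; exact: (sobolev_integrable p1 Su).
move=> j phi tphi; have [_ [_ _ W]] := @sobolev_weak_derivative k p u [:: j] p1 Su k1.
by rewrite -[LHS]/(\int[mu]_(y in D) (u y * partials [:: j] phi y)) W// expr1 mulN1r.
Qed.

(** The first weak derivative is tested with the derivative [j] of a test function, and the result
    compared with the definition of the second. *)
Lemma sobolev_wk2 p u i : 1 <= p -> sobolev 2 p D u ->
  wk1 D (weak_derivative D [:: i] u) (fun j => weak_derivative D [:: i; j] u).
Proof.
move=> p1 Su; split; first exact: (sobolev_integrable p1 Su).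
  by move=> j; exact: (sobolev_integrable p1 Su).
move=> j phi tphi; have [_ [_ _ W1]] := @sobolev_weak_derivative 2 p u [:: i] p1 Su isT.
have [_ [_ _ W2]] := @sobolev_weak_derivative 2 p u [:: i; j] p1 Su isT.
have := W1 _ (test_function_partial j tphi); rewrite expr1 mulN1r => E.
have := W2 _ tphi; rewrite sqrrN expr1n mul1r => <-.
by rewrite -[X in _ = - X]/(\int[mu]_(x in D) (u x * partials [:: i] (partial j phi) x)) E opprK.
Qed.

Lemma sum_powR_integrable (I : finType) (F : I -> V -> R) p : 1 <= p ->
  (forall i, LpD D p (F i)) ->
  mu.-integrable D (EFin \o (fun y => (\sum_i `|F i y|) `^ p)).
Proof.
move=> p1 LF; have p0 : p != 0 by rewrite gt_eqF// (lt_le_trans _ p1).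
have mF i : measurable_fun D (F i) by have [] := (LpDP mD (F i) p0).1 (LF i).
apply: (@rint_le _ _ _ mu D mD _ (fun y => #|I|%:R `^ p * \sum_i `|F i y| `^ p)).
- apply: (measurableT_comp (measurable_powR p)); apply: measurable_sum => i.
  exact: (measurableT_comp (@normr_measurable R setT)).
- by move=> y _; rewrite ger0_norm ?powR_ge0//; exact: powR_sum_le.
- by apply: rintZ => //; apply: rint_sum => // i _; exact: LpD_intp.
Qed.

Lemma powR_integral_lty (f : V -> R) p : mu.-integrable D (EFin \o (fun y => f y `^ p)) ->
  (\int[mu]_(y in D) (f y `^ p)%:E < +oo)%E.
Proof.
move=> /integrableP[_]; rewrite (eq_integral (fun y => (f y `^ p)%:E))// => y _.
by rewrite /= ger0_norm ?powR_ge0.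
Qed.

Lemma integrable_locally f : mu.-integrable D (EFin \o f) -> locally_integrable_on D f.
Proof.
move=> If; split; first exact: rint_measurable If.
by move=> K KD cK; apply: integrableS If => //; exact: measurable_compact.
Qed.

Lemma LpD_le_sobolev1 p (u : V -> R) : 1 <= p -> (LpD_norm D p u <= sobolev1_norm D p u)%E.
Proof.
move=> p1; have p0 : 0 < p by exact: lt_le_trans p1.
rewrite /sobolev1_norm -[leLHS](_ : ((LpD_norm D p u `^ p) `^ p^-1)%E = _); last first.
  by rewrite -poweRrM divff ?gt_eqF// poweRe1// LpD_norm_ge0.
have ip : 0 <= p^-1 by rewrite invr_ge0 ltW.
apply: gt0_ler_poweR => //; rewrite ?in_itv /= ?leey ?andbT ?adde_ge0 ?poweR_ge0//.
by rewrite leeDl// poweR_ge0.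
Qed.

End sobolev_derivatives.

(** * Sobolev estimates for the extension on one domain *)

Section sobolev_extension.
Context {R : realType} {n : nat}.
Local Notation V := 'rV[R]_n.
Local Notation mu := (@lebesgue_rV R n).
Variables (D Om : set V) (h0 c kap M M3 : R) (A0 N J : nat).
Hypotheses (HC : chained D Om h0 c kap M M3 N) (HG : in_grid Om h0 A0) (DOm : D `<=` Om)
  (oOm : open Om) (fOm : (mu Om < +oo)%E) (HJ : 2 * M3 <= kap * 2 ^+ J).

Let oD : open D. Proof. by case: HC. Qed.
Let mD : measurable D. Proof. exact: open_measurable_rV. Qed.
Let mOm : measurable Om. Proof. exact: open_measurable_rV. Qed.
Let fD : (mu D < +oo)%E.
Proof. by apply: le_lt_trans fOm; apply: le_measure; rewrite ?inE. Qed.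

Local Notation E := (ext_op D h0 c kap M A0).
Local Notation K0 p := (@glue_const R n kap M3 (@C0ext R n kap M3) J p).
Local Notation K1 p := (@glue_const R n kap M3 (@C1ext R n kap M3 N) J p).
Local Notation K2 p := (@glue_const R n kap M3 (@C2ext R n kap M3 N) J p).

Lemma glue_const_ge0 (C p : R) : 0 <= @glue_const R n kap M3 C J p.
Proof. by rewrite /glue_const addr_ge0// mulr_ge0// powR_ge0. Qed.

Section order1.
Variables (k : nat) (p : R) (u : V -> R).
Hypotheses (p1 : 1 <= p) (k1 : (1 <= k)%N) (Su : sobolev k p D u).

Let p0 : 0 < p. Proof. exact: lt_le_trans p1. Qed.
Let pn0 : p != 0. Proof. by rewrite gt_eqF. Qed.
Local Notation u1 := (fun i => weak_derivative D [:: i] u).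
Let W1 : wk1 D u u1. Proof. exact: sobolev_wk1 Su. Qed.
Let L1 i : LpD D p (u1 i). Proof. by have [] := sobolev_weak_derivative (s := [:: i]) oD p1 Su k1. Qed.
Let Iu1 : mu.-integrable D (EFin \o (fun y => (\sum_j `|u1 j y|) `^ p)).
Proof. exact: sum_powR_integrable. Qed.
Let IE : mu.-integrable Om (EFin \o E u). Proof. exact: (ext_op_integrable HC HG DOm oOm W1). Qed.

Let intE := ext_op_Lp HC HG DOm oOm W1 p1 HJ (LpD_intp mD pn0 (proj1 Su)).

Lemma ext_LpD : LpD Om p (E u).
Proof.
apply/(LpDP _ _ pn0) => //; split; first exact: rint_measurable IE.
apply: le_lt_trans intE _; rewrite lte_mul_pinfty ?lee_fin ?glue_const_ge0//.
by have [_] := (LpDP mD u pn0).1 (proj1 Su).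
Qed.

Lemma ext_LpD_norm : (LpD_norm Om p (E u) <= (K0 p `^ p^-1)%:E * LpD_norm D p u)%E.
Proof. by apply: LpD_norm_le => //; exact: glue_const_ge0. Qed.

Let E1 i := ext_der D h0 c kap M A0 [:: i] u (u1 i).

Lemma ext_weak_derivative1 i : is_weak_derivative Om [:: i] (E u) (E1 i).
Proof. exact: (ext_weak1 HC HG DOm oOm W1 i). Qed.

Let intE1 i := ext_Lp1 HC HG DOm oOm W1 i p1 HJ Iu1.

Lemma ext_LpD1 i : LpD Om p (E1 i).
Proof.
apply/(LpDP _ _ pn0) => //; split; first by case: (ext_weak_derivative1 i) => _ [].
apply: le_lt_trans (intE1 i) _; rewrite lte_mul_pinfty ?lee_fin ?glue_const_ge0//.
exact: powR_integral_lty.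
Qed.

Lemma ext_gradient_norm :
  (gradient_norm Om p (E u) <= (Cfrob (1 * n) (K1 p) p `^ p^-1)%:E * gradient_norm D p u)%E.
Proof.
have Wx i : is_weak_derivative Om [:: i] (E u) (weak_derivative Om [:: i] (E u)).
  by apply: (@xgetPex _ (cst 0)); exists (E1 i); exact: ext_weak_derivative1.
apply: (@frobenius_transfer _ _ D Om 1 n (gradient Om (E u)) (gradient D u) (fun _ i => E1 i) (K1 p) p mD mOm p1 (glue_const_ge0 _ _)).
- move=> i j; rewrite (_ : (fun x => _) = weak_derivative Om [:: j] (E u)).
    by case: (Wx j) => _ [].
  by apply/funext => x; rewrite mxE.
- by move=> i j; case: (ext_weak_derivative1 j) => _ [].
- move=> i j; rewrite (_ : (fun x => _) = u1 j).
    by have [] := (LpDP mD (u1 j) pn0).1 (L1 j).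
  by apply/funext => x; rewrite mxE.
- move=> i j; have := weak_derivative_unique oOm (Wx j) (ext_weak_derivative1 j).
  apply: filterS => x H Ox; apply: etrans (H Ox); apply: mxE.
move=> i j; apply: le_trans (intE1 j) _; apply: lee_wpmul2l; first by rewrite lee_fin glue_const_ge0.
rewrite le_eqVlt; apply/orP; left; apply/eqP; apply: eq_integral => y _; rewrite big_ord1.
by congr (_ `^ p)%:E; apply: eq_bigr => l _; rewrite mxE.
Qed.

Lemma ext_sobolev1 : sobolev 1 p Om (E u).
Proof.
split; first exact: ext_LpD.
case=> [_|i [|//] _]; last first.
  by exists (E1 i); [exact: ext_LpD1|exact: ext_weak_derivative1].
exists (E u); first exact: ext_LpD.
have Lo := integrable_locally oOm IE.
by split => // phi tphi; rewrite expr0 mul1r.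
Qed.

End order1.

Section order2.
Variables (p : R) (u : V -> R).
Hypotheses (p1 : 1 <= p) (Su : sobolev 2 p D u).

Let p0 : 0 < p. Proof. exact: lt_le_trans p1. Qed.
Let pn0 : p != 0. Proof. by rewrite gt_eqF. Qed.
Local Notation u1 := (fun i => weak_derivative D [:: i] u).
Local Notation u2 := (fun i j => weak_derivative D [:: i; j] u).
Let W1 : wk1 D u u1. Proof. exact: sobolev_wk1 Su. Qed.
Let W2 i : wk1 D (u1 i) (u2 i). Proof. exact: sobolev_wk2 Su. Qed.
Let L2 i j : LpD D p (u2 i j).
Proof. by have [] := sobolev_weak_derivative (s := [:: i; j]) oD p1 Su isT. Qed.
Let Iu2 : mu.-integrable D (EFin \o (fun y => (\sum_i \sum_j `|u2 i j y|) `^ p)).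
Proof.
have := sum_powR_integrable oD p1 (fun ij : 'I_n * 'I_n => L2 ij.1 ij.2).
by under eq_fun do rewrite -(pair_bigA _ (fun i j => `|u2 i j _|)).
Qed.

Let E2 i j := ext_der D h0 c kap M A0 [:: i; j] u (u2 i j).

Lemma ext_weak_derivative2 i j : is_weak_derivative Om [:: i; j] (E u) (E2 i j).
Proof. exact: (ext_weak2 HC HG DOm oOm W1 W2). Qed.

Let intE2 i j := ext_Lp2 HC HG DOm oOm W1 W2 i j p1 HJ Iu2.

Lemma ext_LpD2 i j : LpD Om p (E2 i j).
Proof.
apply/(LpDP _ _ pn0) => //; split; first by case: (ext_weak_derivative2 i j) => _ [].
apply: le_lt_trans (intE2 i j) _; rewrite lte_mul_pinfty ?lee_fin ?glue_const_ge0//.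
exact: powR_integral_lty.
Qed.

Lemma ext_hessian_norm :
  (hessian_norm Om p (E u) <= (Cfrob (n * n) (K2 p) p `^ p^-1)%:E * hessian_norm D p u)%E.
Proof.
have Wx i j : is_weak_derivative Om [:: i; j] (E u) (weak_derivative Om [:: i; j] (E u)).
  by apply: (@xgetPex _ (cst 0)); exists (E2 i j); exact: ext_weak_derivative2.
apply: (@frobenius_transfer _ _ D Om n n (hessian Om (E u)) (hessian D u) E2 (K2 p) p mD mOm p1 (glue_const_ge0 _ _)).
- move=> i j; rewrite (_ : (fun x => _) = weak_derivative Om [:: i; j] (E u)).
    by case: (Wx i j) => _ [].
  by apply/funext => x; rewrite mxE.
- by move=> i j; case: (ext_weak_derivative2 i j) => _ [].
- move=> i j; rewrite (_ : (fun x => _) = u2 i j).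
    by have [] := (LpDP mD (u2 i j) pn0).1 (L2 i j).
  by apply/funext => x; rewrite mxE.
- move=> i j; have := weak_derivative_unique oOm (Wx i j) (ext_weak_derivative2 i j).
  apply: filterS => x H Ox; apply: etrans (H Ox); apply: mxE.
move=> i j; apply: le_trans (intE2 i j) _; apply: lee_wpmul2l; first by rewrite lee_fin glue_const_ge0.
rewrite le_eqVlt; apply/orP; left; apply/eqP; apply: eq_integral => y _.
by congr (_ `^ p)%:E; apply: eq_bigr => k _; apply: eq_bigr => l _; rewrite mxE.
Qed.

Lemma ext_sobolev2 : sobolev 2 p Om (E u).
Proof.
have [LE S1] := ext_sobolev1 p1 (isT : (1 <= 2)%N) Su.
split => // -[|i [|j [|//]]] sk; [exact: S1|exact: S1|].
by exists (E2 i j); [exact: ext_LpD2|exact: ext_weak_derivative2].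
Qed.

End order2.

Lemma ext_extension_operator k p : 1 <= p -> (k == 1%N) || (k == 2%N) ->
  extension_operator (sobolev k p) D Om E.
Proof.
move=> p1 k12; have k1 : (1 <= k)%N by case/orP: k12 => /eqP->.
have int u : sobolev k p D u -> mu.-integrable D (EFin \o u).
  by move=> [Lu _]; exact: LpD_integrable Lu.
split.
- move=> u; case/orP: k12 => /eqP-> Su; last exact: ext_sobolev2.
  exact: ext_sobolev1 Su.
- by move=> u _; apply: aeW => x Dx; exact: ext_op_in.
- by move=> u v Su Sv; apply: (ext_op_ae _ HC); exact: int.
- by move=> t u v Su Sv; apply: aeW => x _; apply: (ext_op_linear _ HC); exact: int.
Qed.

End sobolev_extension.

(** The finitely many indices below [m1] are absorbed into a maximum. *)
Lemma uniform_bound (R : realType) (Q : R -> nat -> Prop) (m1 : nat) :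
  (forall C C' m, C <= C' -> Q C m -> Q C' m) -> (forall m, exists C, Q C m) ->
  (exists C, forall m, (m1 <= m)%N -> Q C m) -> exists2 C, 0 < C & forall m, Q C m.
Proof.
move=> mono each; elim: m1 => [[C QC]|m IH [C QC]].
  exists (Num.max C 1); first by rewrite lt_max ltr01 orbT.
  by move=> m; apply: mono (QC m _) => //; rewrite le_max lexx.
have [C' QC'] := each m; apply: IH; exists (Num.max C C') => l.
rewrite leq_eqVlt => /predU1P[<-|ml]; first by apply: mono QC'; rewrite le_max lexx orbT.
by apply: mono (QC l ml); rewrite le_max lexx.
Qed.

Lemma level_exists (R : realType) (M kap : R) : 0 < kap -> exists J, 2 * M <= kap * 2 ^+ J.
Proof.
move=> kap0; pose N := (Num.truncn (kap^-1 * (2 * M))).+1; exists N.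
rewrite -ler_pdivrMl//; apply: (@le_trans _ _ N%:R); first by apply: ltW; exact: truncnS_gt.
by rewrite -natrX ler_nat ltnW// ltn_expl.
Qed.

Lemma max3_exists (R : realType) (x y z : R) : exists C, [/\ x <= C, y <= C & z <= C].
Proof. by exists (Num.max x (Num.max y z)); rewrite !le_max !lexx !orbT. Qed.

(** * Constants depending on the chain data only *)

Section uniform_extension.
Context {R : realType} {n : nat}.
Local Notation V := 'rV[R]_n.
Local Notation mu := (@lebesgue_rV R n).
Variables (a b : 'rV[int]_n).
Local Notation Om := (open_box a b : set V).

Lemma open_box_finite : (mu Om < +oo)%E.
Proof.
have [B HB] := @open_box_bounded R n a b; pose r := Num.max B 1.
have r0 : 0 < r by rewrite lt_max ltr01 orbT.
have mOm : measurable Om by apply: open_measurable_rV; exact: open_open_box.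
apply: le_lt_trans (_ : mu Om <= mu (ccube 0 r))%E _.
  apply: le_measure; rewrite ?inE//; first exact: measurable_ccube.
  by move=> x /HB xB; rewrite /ccube /= subr0 le_max xB.
by apply: le_lt_trans (mu_ccube_le _ r0) _; rewrite ltry.
Qed.

Definition bounds1 (D : set V) (E : (V -> R) -> V -> R) (p C : R) := forall u, sobolev 1 p D u ->
  (LpD_norm Om p (E u) <= C%:E * LpD_norm D p u)%E /\
  (gradient_norm Om p (E u) <= C%:E * gradient_norm D p u)%E.

Definition bounds2 (D : set V) (E : (V -> R) -> V -> R) (p C : R) := forall u, sobolev 2 p D u ->
  [/\ (LpD_norm Om p (E u) <= C%:E * LpD_norm D p u)%E,
      (gradient_norm Om p (E u) <= C%:E * gradient_norm D p u)%E &
      (hessian_norm Om p (E u) <= C%:E * hessian_norm D p u)%E].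

Lemma lee_const (x y : \bar R) (C C' : R) : C <= C' -> (0 <= y)%E -> (x <= C%:E * y)%E -> (x <= C'%:E * y)%E.
Proof. by move=> CC y0 xy; apply: le_trans xy _; apply: lee_wpmul2r. Qed.

Lemma bounds1_mono D E p C C' : C <= C' -> bounds1 D E p C -> bounds1 D E p C'.
Proof.
by move=> CC H u /H[h1 h2]; split; apply: (lee_const CC) => //; exact: LpD_norm_ge0.
Qed.

Lemma bounds2_mono D E p C C' : C <= C' -> bounds2 D E p C -> bounds2 D E p C'.
Proof.
by move=> CC H u /H[h1 h2 h3]; split; apply: (lee_const CC) => //; exact: LpD_norm_ge0.
Qed.

Definition chain_ext (D : set V) (e : R) (P : chain_data R) A0 :=
  ext_op D (cd_theta P * e) (cd_c P) (cd_kap P) (cd_M P) A0.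

Lemma chain_ext_bounds (P : chain_data R) p : 1 <= p ->
  exists C : R, forall D e A0, D `<=` Om -> chained_with D Om e P -> in_grid Om (cd_theta P * e) A0 ->
  bounds1 D (chain_ext D e P A0) p C /\ bounds2 D (chain_ext D e P A0) p C.
Proof.
move=> p1; have oOm : open Om by exact: open_open_box.
have fOm := open_box_finite.
(* If [cd_kap P] is not positive no domain is chained with [P], and any constant will do. *)
have [kap0|kap0] := ltrP 0 (cd_kap P); last first.
  by exists 0 => D e A0 _ [_ [_ [_ k0 _ _ _] _ _ _]]; move: (lt_le_trans k0 kap0); rewrite ltxx.
have [J HJ] := level_exists (cd_M3 P) kap0.
have [C [le0 le1 le2]] := max3_exists
  (@glue_const R n (cd_kap P) (cd_M3 P) (@C0ext R n (cd_kap P) (cd_M3 P)) J p `^ p^-1)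
  (Cfrob (1 * n) (@glue_const R n (cd_kap P) (cd_M3 P)
     (@C1ext R n (cd_kap P) (cd_M3 P) (cd_N P)) J p) p `^ p^-1)
  (Cfrob (n * n) (@glue_const R n (cd_kap P) (cd_M3 P)
     (@C2ext R n (cd_kap P) (cd_M3 P) (cd_N P)) J p) p `^ p^-1).
exists C => D e A0 DOm [_ HC] HG.
split=> u Su; split.
- apply: (lee_const le0 (LpD_norm_ge0 _ _ _)); exact: (ext_LpD_norm HC HG DOm oOm fOm HJ p1 _ Su).
- apply: (lee_const le1 (LpD_norm_ge0 _ _ _)); exact: (ext_gradient_norm HC HG DOm oOm fOm HJ p1 _ Su).
- apply: (lee_const le0 (LpD_norm_ge0 _ _ _)); exact: (ext_LpD_norm HC HG DOm oOm fOm HJ p1 _ Su).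
- apply: (lee_const le1 (LpD_norm_ge0 _ _ _)); exact: (ext_gradient_norm HC HG DOm oOm fOm HJ p1 _ Su).
- apply: (lee_const le2 (LpD_norm_ge0 _ _ _)); exact: (ext_hessian_norm HC HG DOm oOm fOm HJ p1 Su).
Qed.

End uniform_extension.

(** * The extension theorem *)

Theorem theorem3p2 (R : realType) (n : nat) (a b : 'rV[int]_n)
    (Ys : set 'rV[R]_n) (eps : nat -> R) :
  let Omega : set 'rV[R]_n := open_box a b in
  let Omega_ (m : nat) : set 'rV[R]_n := perforated a b Ys (eps m) in
  (2 <= n)%N ->
  (forall i, a 0 i < b 0 i) ->
  (forall m, 0 < eps m /\ exists N : nat, (eps m)^-1 = N%:R) ->
  eps @ \oo --> (0 : R) ->
  Ys `<=` unit_cube ->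
  domain Ys ->
  matching_faces Ys ->
  lipschitz_boundary Ys (boundary Ys `\` boundary unit_cube) ->
  (forall m, connected (Omega_ m) /\
    lipschitz_boundary (Omega_ m) (boundary (Omega_ m) `\` boundary Omega)) ->
  forall p : R, 1 <= p ->
  exists E : nat -> ('rV[R]_n -> R) -> ('rV[R]_n -> R),
    (exists2 C : R, 0 < C & forall m,
      extension_operator (sobolev 2 p) (Omega_ m) Omega (E m) /\
      forall u, sobolev 2 p (Omega_ m) u ->
      [/\ (LpD_norm Omega p (E m u) <=
             C%:E * (LpD_norm (Omega_ m) p u +
                     (eps m)%:E * gradient_norm (Omega_ m) p u))%E,
          (gradient_norm Omega p (E m u) <=
             C%:E * gradient_norm (Omega_ m) p u)%E &
          (hessian_norm Omega p (E m u) <=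
             C%:E * hessian_norm (Omega_ m) p u)%E]) /\
    (forall s : R, 1 <= s -> exists2 C : R, 0 < C & forall m,
      extension_operator (sobolev 1 s) (Omega_ m) Omega (E m) /\
      forall v, sobolev 1 s (Omega_ m) v ->
      (LpD_norm Omega s (E m v) <=
         C%:E * sobolev1_norm (Omega_ m) s v)%E /\
      (gradient_norm Omega s (E m v) <=
         C%:E * gradient_norm (Omega_ m) s v)%E).
Proof.
move=> Omega Omega_ _ ab epsN eps0 YsY dY _ _ lip p p1.
have [P [m1 [HP Pm1]]] := perforated_chained ab epsN YsY dY lip eps0.
have oOm : open Omega by exact: open_open_box.
have fOm : (lebesgue_rV n Omega < +oo)%E by exact: open_box_finite.
have sub m : Omega_ m `<=` Omega by exact: perforated_sub.
have oD m : open (Omega_ m) by exact: open_interior.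
(* The extent of the grid in mesh widths grows as eps tends to 0; the constants of
   [chain_ext_bounds] are chosen before it. *)
have /choice[A0 HA0] m : exists A0, in_grid Omega (cd_theta (P m) * eps m) A0.
  by apply: in_grid_open_box; rewrite mulr_gt0//; [case: (HP m)|case: (epsN m)].
pose E m := chain_ext (Omega_ m) (eps m) (P m) (A0 m).
have ext m k s : 1 <= s -> (k == 1%N) || (k == 2%N) ->
    extension_operator (sobolev k s) (Omega_ m) Omega (E m).
  move=> s1 k12; have [_ HC] := HP m; have kap0 : 0 < cd_kap (P m) by case: HC => _ [].
  have [J HJ] := level_exists (cd_M3 (P m)) kap0.
  exact: (ext_extension_operator HC (HA0 m) (sub m) oOm fOm HJ s1 k12).
have unif s : 1 <= s -> exists2 C : R, 0 < C &
    forall m, bounds1 a b (Omega_ m) (E m) s C /\ bounds2 a b (Omega_ m) (E m) s C.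
  move=> s1; apply: (@uniform_bound _ _ m1).
  - move=> C C' m CC [h1 h2]; split; [exact: bounds1_mono h1|exact: bounds2_mono h2].
  - by move=> m; have [C HC] := chain_ext_bounds a b (P m) s1; exists C; exact: (HC _ _ _ (sub m) (HP m) (HA0 m)).
  have [C HC] := chain_ext_bounds a b (P m1) s1; exists C => m mm.
  by move: HC; rewrite -(Pm1 m mm) => HC; exact: (HC _ _ _ (sub m) (HP m) (HA0 m)).
exists E; split.
  have [C C0 HC] := unif p p1; exists C => // m; split; first exact: ext.
  move=> u Su; have [_ /(_ u Su)[h0 h1 h2]] := HC m; split => //.
  apply: le_trans h0 _; apply: lee_wpmul2l; first by rewrite lee_fin ltW.
  rewrite leeDl// mule_ge0 ?lee_fin ?LpD_norm_ge0//; first by rewrite ltW//; case: (epsN m).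
move=> s s1; have [C C0 HC] := unif s s1; exists C => // m; split; first exact: ext.
move=> u Su; have [/(_ u Su)[h0 h1] _] := HC m; split => //.
by apply: le_trans h0 _; apply: lee_wpmul2l; [rewrite lee_fin ltW|exact: LpD_le_sobolev1].
Qed.
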